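(* Let $(\mathcal{B},\mathcal{L},\theta,\mathcal{I}_\alpha)$ be a generalized Boolean dynamical system and $E=(E^1,d,r)$ its topological correspondence. The shift map $\sigma_E:\partial E\setminus E^0_{sg}\to\partial E$ is a local homeomorphism. Moreover, if $\Gamma(\partial E,\sigma_E)$ is the Renault-Deaconu groupoid associated with $\sigma_E$, then $\Gamma(\partial E,\sigma_E)\cong\Gamma(\mathcal{B},\mathcal{L},\theta,\mathcal{I}_\alpha)$ (as topological groupoids) and $C^*(\Gamma(\partial E,\sigma_E))\cong C^*(\mathcal{B},\mathcal{L},\theta,\mathcal{I}_\alpha)$.
   Context: **Generalized Boolean dynamical systems.** A Boolean algebra $\mathcal{B}$ is a (not necessarily unital) relatively complemented distributive lattice with least element $\emptyset$ and operations $\cap,\cup,\setminus$; $A\subseteq B$ means $A\cap B=A$. An ideal is a non-empty subset closed under finite unions and under intersection with arbitrary elements of $\mathcal{B}$. An action is a map $\mathcal{B}\to\mathcal{B}$ preserving $\cap,\cup,\setminus$ and $\emptyset$. A generalized Boolean dynamical system $(\mathcal{B},\mathcal{L},\theta,\mathcal{I}_\alpha)$ consists of a Boolean algebra $\mathcal{B}$, a set $\mathcal{L}$, actions $\{\theta_\alpha\}_{\alpha\in\mathcal{L}}$ and ideals $\{\mathcal{I}_\alpha\}_{\alpha\in\mathcal{L}}$ with $\{A\in\mathcal{B}:A\subseteq\theta_\alpha(B)\text{ for some }B\in\mathcal{B}\}\subseteq\mathcal{I}_\alpha$ for all $\alpha\in\mathcal{L}$. **Its $C^*$-algebra.** For $A\in\mathcal{B}$,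 $\Delta_A=\{\alpha\in\mathcal{L}:\theta_\alpha(A)\ne\emptyset\}$; $A$ is regular ($A\in\mathcal{B}_{reg}$) if $0<|\Delta_B|<\infty$ for all $\emptyset\neq B\subseteq A$. $C^*(\mathcal{B},\mathcal{L},\theta,\mathcal{I}_\alpha)$ is the universal $C^*$-algebra generated by projections $\{p_A:A\in\mathcal{B}\}$ and partial isometries $\{s_{\alpha,B}:\alpha\in\mathcal{L},B\in\mathcal{I}_\alpha\}$ such that (i) $p_\emptyset=0$, $p_{A\cap A'}=p_Ap_{A'}$, $p_{A\cup A'}=p_A+p_{A'}-p_{A\cap A'}$; (ii) $p_As_{\alpha,B}=s_{\alpha,B}p_{\theta_\alpha(A)}$; (iii) $s_{\alpha,B}^*s_{\alpha',B'}=\delta_{\alpha,\alpha'}p_{B\cap B'}$; (iv) $p_A=\sum_{\alpha\in\Delta_A}s_{\alpha,\theta_\alpha(A)}s_{\alpha,\theta_\alpha(A)}^*$ for all $A\in\mathcal{B}_{reg}$. **Words.** $\mathcal{L}^*$: finite words over $\mathcal{L}$ (including the empty word $\emptyset$); $\mathcal{L}^\infty$: infinite words; $|\alpha|$: length; $\alpha_{i,j}=\alpha_i\cdots\alpha_j$ (empty if $j<i$). For $\alpha=\alpha_1\cdots\alpha_n$: $\theta_\alpha=\theta_{\alpha_n}\circ\cdots\circ\theta_{\alpha_1}$, $\theta_\emptyset=\mathrm{Id}$; $\mathcal{I}_\alpha=\{A\in\mathcal{B}:A\subseteq\theta_{\alpha_2\cdots\alpha_n}(B)\text{ for some }B\in\mathcal{I}_{\alpha_1}\}$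 for $n\ge1$, $\mathcal{I}_\emptyset=\mathcal{B}$. $\mathcal{W}^*=\{\alpha\in\mathcal{L}^*:\mathcal{I}_\alpha\neq\{\emptyset\}\}$, $\mathcal{W}^\infty=\{\alpha\in\mathcal{L}^\infty:\alpha_{1,n}\in\mathcal{W}^*\ \forall n\geq1\}$, $\mathcal{W}^{\leq\infty}=\mathcal{W}^*\cup\mathcal{W}^\infty$. **Inverse semigroup.** $S=\{(\alpha,A,\beta):\alpha,\beta\in\mathcal{L}^*,\ \emptyset\neq A\in\mathcal{I}_\alpha\cap\mathcal{I}_\beta\}\cup\{0\}$, with $0$ absorbing and $(\alpha,A,\beta)(\gamma,B,\delta)$ equal to $(\alpha,A\cap B,\delta)$ if $\beta=\gamma$; $(\alpha\gamma',\theta_{\gamma'}(A)\cap B,\delta)$ if $\gamma=\beta\gamma'$; $(\alpha,A\cap\theta_{\beta'}(B),\delta\beta')$ if $\beta=\gamma\beta'$ (interpreted as $0$ when the middle entry is $\emptyset$); $0$ otherwise. Its idempotents form $E(S)=\{(\alpha,A,\alpha):\emptyset\neq A\in\mathcal{I}_\alpha\}\cup\{0\}$, ordered by $e\le f$ iff $ef=e$. **Tight spectrum.** A filter in a poset with least element is a non-empty, upward closed, downward directed subset not containing the least element; an ultrafilter is a maximal filter. Each filter $\xi$ in $E(S)$ has an associated word $\alpha\in\mathcal{W}^{\leq\infty}$ (the longest first entry of elements of $\xi$, or the infinite word of which all first entries of elements of $\xi$ are beginnings if their lengths are unbounded); write $\xi=\xi^\alpha$ and $\xi_n=\{A\in\mathcal{I}_{\alpha_{1,n}}:(\alpha_{1,n},A,\alpha_{1,n})\in\xi\}$;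 $\xi$ is determined by $\alpha$ and $\{\xi_n\}_n$. A finite $Z\subseteq\{y:y\le x\}$ is a cover for $x\in E(S)$ if every $0\neq y\le x$ satisfies $yz\neq0$ for some $z\in Z$; $\xi$ is tight if $Z\cap\xi\neq\emptyset$ for each $x\in\xi$ and each finite cover $Z$ of $x$. $\mathsf{T}$ is the set of tight filters with the topology of pointwise convergence of characteristic functions; a basis is given by $V_{e:e_1,\dots,e_n}=\{\xi\in\mathsf{T}:e\in\xi,e_i\notin\xi\ \forall i\}$, $e,e_i\in E(S)$, $n\ge0$. **The groupoid $\Gamma(\mathcal{B},\mathcal{L},\theta,\mathcal{I}_\alpha)$.** For $\alpha\in\mathcal{L}^*$ non-empty and $\alpha\gamma\in\mathcal{W}^{\le\infty}$, $H_{[\alpha]\gamma}$ sends a tight filter $\xi$ with word $\alpha\gamma$ to the tight filter $\eta$ with word $\gamma$ and $\eta_n=\{B\in\mathcal{I}_{\gamma_{1,n}}:A\subseteq B\text{ for some }A\in\xi_{|\alpha|+n}\}$, $0\le n\le|\gamma|$; $H_{[\emptyset]\gamma}$ is the identity. $\Gamma(\mathcal{B},\mathcal{L},\theta,\mathcal{I}_\alpha)=\{(\eta^{\alpha\gamma},|\alpha|-|\beta|,\xi^{\beta\gamma})\in\mathsf{T}\times\mathbb{Z}\times\mathsf{T}:H_{[\alpha]\gamma}(\eta)=H_{[\beta]\gamma}(\xi)\}$ with $(\eta,m,\xi)(\xi,n,\rho)=(\eta,m+n,\rho)$, $(\eta,m,\xi)^{-1}=(\xi,-m,\eta)$, and topology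 with basis the sets $\{(\eta^{\mu\gamma},|\mu|-|\nu|,\xi^{\nu\gamma})\in\Gamma:\xi\in V_{e:e_1,\dots,e_n},H_{[\mu]\gamma}(\eta)=H_{[\nu]\gamma}(\xi)\}$ for $(\mu,A,\nu)\in S$, $e,e_i\in E(S)$. **Topological correspondence.** For $\alpha\in\mathcal{L}^*$, $X_\alpha$ is the set of ultrafilters in $\mathcal{I}_\alpha$ with basis of open sets $\{\mathcal{F}\in X_\alpha:A\in\mathcal{F}\}$, $A\in\mathcal{I}_\alpha$. $E^0=X_\emptyset$ (ultrafilters of $\mathcal{B}$); $F^0=X_\emptyset\cup\{\emptyset\}$, where $\emptyset$ is an isolated point if $\mathcal{B}$ is unital and $F^0$ is the one-point compactification of $X_\emptyset$ with $\emptyset$ at infinity otherwise. $E^1=\{e^\alpha_\eta:\alpha\in\mathcal{L},\eta\in X_\alpha\}$ with the disjoint union topology of $\bigsqcup_{\alpha\in\mathcal{L}}X_\alpha$. $d:E^1\to E^0$, $d(e^\alpha_\eta)=\{B\in\mathcal{B}:A\subseteq B\text{ for some }A\in\eta\}$; $r:E^1\to F^0$, $r(e^\alpha_\eta)=\{A\in\mathcal{B}:\theta_\alpha(A)\in\eta\}$. **Boundary path space.** $F^0_{sce}=F^0\setminus\overline{r(E^1)}$; $F^0_{fin}$ is the set of $v\in F^0$ having a neighborhood $V$ with $r^{-1}(V)$ compact; $F^0_{rg}=F^0_{fin}\setminus\overline{F^0_{sce}}$; $F^0_{sg}=F^0\setminus F^0_{rg}$; $E^0_{sg}=F^0_{sg}\cap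 E^0$. For $n\ge2$, $E^n=\{(e_1,\dots,e_n)\in(E^1)^n:d(e_i)=r(e_{i+1})\}$ (subspace topology), $E^*=\bigsqcup_{n\ge0}E^n$ (disjoint union topology), $E^\infty=\{(e_i)_{i\ge1}:d(e_i)=r(e_{i+1})\ \forall i\}$. For paths of positive length $r(\mu)=r(\mu_1)$, $d(\mu)=d(\mu_n)$ if finite of length $n$; $r(v)=d(v)=v$ for $v\in E^0$. $\partial E=E^\infty\sqcup\{\mu\in E^*:d(\mu)\in E^0_{sg}\}$. For $Q\subseteq E^*$, $\mathcal{Z}(Q)=\{\mu\in\partial E:r(\mu)\in Q\text{ or }\mu_1\cdots\mu_i\in Q\text{ for some }1\le i\le|\mu|\}$; $\partial E$ has the topology generated by $\mathcal{Z}(U)\cap\mathcal{Z}(K)^c$, $U\subseteq E^*$ open, $K\subseteq E^*$ compact. $\sigma_E$ removes the first edge of paths of length $\geq2$, and $\sigma_E(\mu)=d(\mu)$ if $|\mu|=1$. **Renault-Deaconu groupoid.** For a local homeomorphism $\sigma:\mathrm{dom}(\sigma)\to X$ with $\mathrm{dom}(\sigma)\subseteq X$ open, it is $\{(x,m-n,y):m,n\in\mathbb{N}\cup\{0\},x\in\mathrm{dom}(\sigma^m),y\in\mathrm{dom}(\sigma^n),\sigma^m(x)=\sigma^n(y)\}$ with operations as for $\Gamma$ and basic open sets $\{(x,m-n,y):(x,y)\in U\times V,\sigma^m(x)=\sigma^n(y)\}$, $U\subseteq\mathrm{dom}(\sigma^m)$, $V\subseteq\mathrm{dom}(\sigma^n)$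 open with $\sigma^m|_U,\sigma^n|_V$ injective. $C^*(\cdot)$ of an étale groupoid is its groupoid $C^*$-algebra. *)

(* Defs.v *)
From HB Require Import structures.
From mathcomp Require Import all_boot all_order all_algebra complex.
From mathcomp Require Import all_classical all_reals all_analysis.

Set Implicit Arguments.
Unset Strict Implicit.
Unset Printing Implicit Defensive.

Import Order.Theory GRing.Theory Num.Theory numFieldNormedType.Exports.

Local Open Scope classical_set_scope.
Local Open Scope ring_scope.

Definition mkset {T : Type} {A : set T} (x : T) (Ax : A x) : set_type A :=
  exist (fun y => y \in A) x (mem_set Ax).

Section PosetFilters.
Context {T : Type} (P : set T) (le : T -> T -> Prop) (bot : T).

Definition is_pfilter (F : set T) : Prop :=
  [/\ F `<=` P, F !=set0, ~ F bot,
      forall x y, F x -> P y -> le x y -> F y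
    & forall x y, F x -> F y -> exists z, [/\ F z, le z x & le z y]].

Definition is_ultrafilter (F : set T) : Prop :=
  is_pfilter F /\ forall G, is_pfilter G -> F `<=` G -> G `<=` F.

End PosetFilters.

(* A (not necessarily unital) Boolean algebra, i.e. a relatively complemented
   distributive lattice with a least element, is a [cbDistrLatticeType]. *)

Definition is_action d (B : cbDistrLatticeType d) (f : B -> B) : Prop :=
  [/\ f \bot%O = \bot%O,
      forall x y : B, f (x `&` y)%O = (f x `&` f y)%O,
      forall x y : B, f (x `|` y)%O = (f x `|` f y)%O
    & forall x y : B, f (x `\` y)%O = (f x `\` f y)%O].

Definition is_ideal d (B : cbDistrLatticeType d) (I : set B) : Prop :=
  [/\ I !=set0,
      forall x y : B, I x -> I y -> I (x `|` y)%O
    & forall x y : B, I x -> I (x `&` y)%O].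

Record gbds d (B : cbDistrLatticeType d) (L : choiceType) := Gbds {
  act : L -> B -> B;
  idl : L -> set B;
  act_action : forall a, is_action (act a);
  idl_ideal : forall a, is_ideal (idl a);
  act_idl : forall a (A C : B), (A <= act a C)%O -> idl a A }.

Section Words.
Context {d : Order.disp_t} {B : cbDistrLatticeType d} {L : choiceType}.
Variable S : gbds B L.

Definition wact (w : seq L) (A : B) : B := foldl (fun A a => act S a A) A w.

Definition widl (w : seq L) : set B :=
  match w with
  | [::] => setT
  | a :: w' => [set A | exists2 C, idl S a C & (A <= wact w' C)%O]
  end.

Definition unital : Prop := exists u : B, forall A : B, (A <= u)%O.

Definition Delta (A : B) : set L := [set a | act S a A != \bot%O].

Definition regular_elt (A : B) : Prop :=
  forall C : B, C != \bot%O -> (C <= A)%O ->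
    Delta C !=set0 /\ finite_set (Delta C).

Lemma act0 a : act S a \bot%O = \bot%O.
Proof. by case: (act_action S a). Qed.

Lemma actI a x y : act S a (x `&` y)%O = (act S a x `&` act S a y)%O.
Proof. by case: (act_action S a). Qed.

Lemma actU a x y : act S a (x `|` y)%O = (act S a x `|` act S a y)%O.
Proof. by case: (act_action S a). Qed.

Lemma act_le a x y : (x <= y)%O -> (act S a x <= act S a y)%O.
Proof. by move=> /meet_idPl xy; apply/meet_idPl; rewrite -actI xy. Qed.

Lemma wactI w x y : wact w (x `&` y)%O = (wact w x `&` wact w y)%O.
Proof.
by elim: w x y => [//|a w IH] x y; rewrite /wact /= actI; exact: IH.
Qed.

Lemma wactU w x y : wact w (x `|` y)%O = (wact w x `|` wact w y)%O.
Proof.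
by elim: w x y => [//|a w IH] x y; rewrite /wact /= actU; exact: IH.
Qed.

Lemma widl_le w x y : (x <= y)%O -> widl w y -> widl w x.
Proof.
by case: w => [//|a w] /= xy [C IC yC]; exists C => //; exact: le_trans yC.
Qed.

Lemma widlU w x y : widl w x -> widl w y -> widl w (x `|` y)%O.
Proof.
case: w => [//|a w] /= [C IC xC] [D ID yD]; exists (C `|` D)%O.
  by case: (idl_ideal S a) => _ + _; apply.
by rewrite wactU leU2.
Qed.

Lemma widl1_act a x : widl [:: a] (act S a x).
Proof. by exists (act S a x); first exact: (act_idl (lexx _)). Qed.

End Words.

Section Ultrafilters.
Context {d : Order.disp_t} {B : cbDistrLatticeType d} {L : choiceType}.
Variable S : gbds B L.

Definition ultra (w : seq L) : set (set B) :=
  [set F | is_ultrafilter (widl S w) (fun x y => (x <= y)%O) \bot%O F].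

Lemma ultraI w F x y : ultra w F -> F x -> F y -> F (x `&` y)%O.
Proof.
move=> [[FP _ _ Fup Fdir] _] Fx Fy; have [z [Fz zx zy]] := Fdir _ _ Fx Fy.
apply: (Fup z) => //; last by rewrite lexI zx zy.
by apply: widl_le (FP _ Fx); exact: leIl.
Qed.

Lemma ultra_prime w F x y : ultra w F -> F (x `|` y)%O -> F x \/ F y.
Proof.
move=> uF Fxy; have [[FP Fne F0 Fup Fdir] Fmax] := uF.
have Px : widl S w x by apply: widl_le (FP _ Fxy); exact: leUl.
have Py : widl S w y by apply: widl_le (FP _ Fxy); exact: leUr.
have [|nx] := pselect (F x); first by left.
right; have [[e Fe ex0]|H] := pselect (exists2 e, F e & (e `&` x)%O = \bot%O).
  have := ultraI uF Fe Fxy; rewrite meetUr ex0 join0x => Fey.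
  by apply: Fup Fey _ _ => //; exact: leIr.
exfalso; apply: nx.
pose G := [set z | widl S w z /\ exists2 e, F e & (e `&` x <= z)%O].
have FG : F `<=` G.
  by move=> e Fe; split; [exact: FP|exists e => //; exact: leIl].
apply: (Fmax G) => //; last first.
  by split=> //; exists (x `|` y)%O => //; exact: leIr.
split.
- by move=> z [].
- by case: Fne => e Fe; exists e; exact: FG.
- by move=> [_ [e Fe]]; rewrite lex0 => /eqP ex; apply: H; exists e.
- move=> u v [Pu [e Fe eu]] Pv uv; split=> //.
  by exists e => //; exact: le_trans uv.
- move=> u v [Pu [e Fe eu]] [Pv [f Ff fv]]; exists (u `&` v)%O; split.
  + split; first by apply: widl_le Pu; exact: leIl.
    exists (e `&` f)%O; first exact: ultraI uF Fe Ff.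
    rewrite lexI; apply/andP; split.
      by apply: le_trans eu; rewrite leI2 // leIl.
    by apply: le_trans fv; rewrite leI2 // leIr.
  + exact: leIl.
  + exact: leIr.
Qed.

Definition ultra_up (F : set B) : set B :=
  [set C | exists2 A, F A & (A <= C)%O].

Lemma ultra_upP w F : ultra w F -> ultra [::] (ultra_up F).
Proof.
move=> [[FP Fne F0 Fup Fdir] Fmax]; split.
  split=> //.
  - by case: Fne => e Fe; exists e, e.
  - by move=> [e Fe]; rewrite lex0 => /eqP e0; apply: F0; rewrite -e0.
  - by move=> x y [e Fe ex] _ xy; exists e => //; exact: le_trans xy.
  - move=> x y [e Fe ex] [f Ff fy]; have [z [Fz ze zf]] := Fdir _ _ Fe Ff.
    exists z; split; [by exists z|exact: le_trans ex|exact: le_trans fy].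
move=> G [_ Gne G0 Gup Gdir] FG x Gx; case: (Fne) => a Fa.
have FG' e : F e -> G e by move=> Fe; apply: FG; exists e.
have [z [Gz zx za]] := Gdir _ _ Gx (FG' _ Fa).
exists z => //; apply: (Fmax [set y | widl S w y /\ G y]).
- split.
  + by move=> y [].
  + by exists a; split; [exact: FP|exact: FG'].
  + by move=> [_ /G0].
  + by move=> y y' [Py Gy] Py' yy'; split=> //; exact: Gup yy'.
  + move=> y y' [Py Gy] [Py' Gy']; have [u [Gu uy uy']] := Gdir _ _ Gy Gy'.
    by exists u; split=> //; split=> //; exact: widl_le Py.
- by move=> e Fe; split; [exact: FP|exact: FG'].
- by split=> //; apply: widl_le (FP _ Fa).
Qed.

Definition ultra_pull (a : L) (F : set B) : set B := [set A | F (act S a A)].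

Lemma ultra_pullP a F : ultra [:: a] F -> ultra_pull a F !=set0 ->
  ultra [::] (ultra_pull a F).
Proof.
move=> uF [A0 /= FA0]; have [[FP Fne F0 Fup Fdir] Fmax] := uF; split.
  split=> //.
  - by exists A0.
  - by rewrite /ultra_pull /= act0.
  - move=> x y /= Fx _ xy; apply: Fup Fx _ (act_le _ _ xy).
    exact: widl1_act.
  - move=> x y /= Fx Fy; exists (x `&` y)%O; split; last 2 first.
    + exact: leIl.
    + exact: leIr.
    by rewrite /ultra_pull /= actI; apply: (ultraI uF).
move=> G [_ _ G0 Gup Gdir] FG x Gx /=.
have : F (act S a (A0 `&` x)%O `|` act S a (A0 `\` x)%O)%O.
  by rewrite -actU joinIB.
move=> /(ultra_prime uF)[Fb|Fc].
  apply: Fup Fb _ _; first exact: widl1_act.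
  by apply: act_le; exact: leIr.
have [z [Gz zx zc]] := Gdir _ _ Gx (FG _ Fc).
exfalso; apply: G0; suff -> : \bot%O = z by [].
by apply/esym/eqP; rewrite -lex0 -(diffIK A0 x) lexI zc zx.
Qed.

Definition Xsp (w : seq L) : Type := set_type (ultra w).
HB.instance Definition _ w := Choice.copy (Xsp w) (set_type (ultra w)).
HB.instance Definition _ w := @isSubBaseTopological.Build (Xsp w)
  (set (Xsp w))
  [set U | exists2 A, widl S w A & U = [set F : Xsp w | set_val F A]] id.

Lemma XspP w (F : Xsp w) : ultra w (set_val F).
Proof. exact: set_valP. Qed.

Definition mkX w (F : set B) (uF : ultra w F) : Xsp w :=
  mkset uF.

End Ultrafilters.

Section Correspondence.
Context {d : Order.disp_t} {B : cbDistrLatticeType d} {L : choiceType}.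
Variable S : gbds B L.

Definition E0 : Type := Xsp S [::].
HB.instance Definition _ := Topological.copy E0 (Xsp S [::]).

(* [None] is the extra point (the empty set) of [F0]: isolated if [B] is
   unital, the point at infinity of the one-point compactification otherwise. *)
Definition F0 : Type := option E0.
HB.instance Definition _ := Choice.copy F0 (option E0).

Definition F0_open : set (set F0) :=
  [set U | open (Some @^-1` U : set E0) /\
           (U None -> ~ @unital _ B -> compact (~` (Some @^-1` U : set E0)))].

Lemma F0_openT : F0_open setT.
Proof.
split; first by rewrite preimage_setT; exact: openT.
by move=> _ _; rewrite preimage_setT setCT; exact: compact0.
Qed.

Lemma F0_openI : setI_closed F0_open.
Proof.
move=> U V [oU cU] [oV cV]; split; first by rewrite preimage_setI; exact: openI.
move=> [UN VN] nu; rewrite preimage_setI setCI.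
by apply: compactU; [exact: cU|exact: cV].
Qed.

Lemma F0_open_bigU (I : Type) (f : I -> set F0) :
  (forall i, F0_open (f i)) -> F0_open (\bigcup_i f i).
Proof.
move=> of_; have o : open (Some @^-1` (\bigcup_i f i) : set E0).
  by rewrite preimage_bigcup; apply: bigcup_open => i _; case: (of_ i).
split=> // -[i _ fiN] nu; have [_ /(_ fiN nu) ci] := of_ i.
apply: (subclosed_compact _ ci); first exact: open_closedC.
by apply: subsetC => x fx; exists i.
Qed.

HB.instance Definition _ :=
  isOpenTopological.Build F0 F0_openT F0_openI F0_open_bigU.

Definition E1 : Type := {a : L & Xsp S [:: a]}.
HB.instance Definition _ := Topological.copy E1 {a : L & Xsp S [:: a]}.

Definition dE (e : E1) : E0 := mkX (ultra_upP (XspP (projT2 e))).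

Definition rE (e : E1) : F0 :=
  match pselect (ultra_pull S (projT1 e) (set_val (projT2 e)) !=set0) with
  | left ne => Some (mkX (ultra_pullP (XspP (projT2 e)) ne))
  | right _ => None
  end.

Definition F0sce : set F0 := ~` closure (range rE).
Definition F0fin : set F0 :=
  [set v | exists2 V, nbhs v V & compact (rE @^-1` V)].
Definition F0rg : set F0 := F0fin `\` closure F0sce.
Definition F0sg : set F0 := ~` F0rg.
Definition E0sg : set E0 := [set v | F0sg (Some v)].

(* [Epos n] is the space of paths of length [n.+1]. *)
Definition Epos (n : nat) : set {ptws 'I_n.+1 -> E1} :=
  [set e | forall i j : 'I_n.+1, nat_of_ord j = i.+1 ->
             Some (dE (e i)) = rE (e j)].

Definition Epath (n : nat) : topologicalType :=
  match n with 0%N => E0 | m.+1 => set_type (@Epos m) end.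

Definition Estar : Type := {n : nat & Epath n}.
HB.instance Definition _ := Topological.copy Estar {n : nat & Epath n}.

Definition Einf : set (nat -> E1) :=
  [set e | forall i, Some (dE (e i)) = rE (e i.+1)].

Definition path_d (mu : Estar) : E0 :=
  match mu with
  | existT 0 v => v
  | existT n.+1 e => dE (set_val e ord_max)
  end.

Definition path_r (mu : Estar) : F0 :=
  match mu with
  | existT 0 v => Some v
  | existT n.+1 e => rE (set_val e ord0)
  end.

Definition path_length (mu : Estar) : nat := projT1 mu.

(* The edges of a path are numbered from 0. *)
Definition path_edge (mu : Estar) (i : nat) : option E1 :=
  match mu with
  | existT 0 v => None
  | existT n.+1 e => omap (set_val e) (insub i)
  end.

Definition finbd : set Estar := [set mu | E0sg (path_d mu)].

Definition bpath : Type := (set_type finbd + set_type Einf)%type.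

Definition bpath_r (mu : bpath) : F0 :=
  match mu with inl m => path_r (set_val m) | inr e => rE (set_val e 0%N) end.

Definition bpath_edge (mu : bpath) (i : nat) : option E1 :=
  match mu with
  | inl m => path_edge (set_val m) i
  | inr e => Some (set_val e i)
  end.

(* [q] is either the range of [mu] or an initial segment of [mu]. *)
Definition begins_with (mu : bpath) (q : Estar) : Prop :=
  match q with
  | existT 0 v => bpath_r mu = Some v
  | existT n.+1 e =>
      forall i : 'I_n.+1, bpath_edge mu i = Some (set_val e i)
  end.

Definition cylinder (Q : set Estar) : set bpath :=
  [set mu | exists2 q, Q q & begins_with mu q].

HB.instance Definition _ :=
  Choice.copy bpath (set_type finbd + set_type Einf)%type.
HB.instance Definition _ := @isSubBaseTopological.Build bpath (set bpath)
  [set W | exists U K : set Estar, [/\ open U, compact K &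
             W = cylinder U `&` ~` cylinder K]] id.

Lemma tail_Epos n (e : set_type (@Epos n.+1)) :
  @Epos n (fun i => set_val e (lift ord0 i)).
Proof.
move=> i j ij; have := @set_valP _ _ e (lift ord0 i) (lift ord0 j).
by apply; rewrite /= /bump /= ij.
Qed.

Lemma tail_Einf (e : set_type Einf) : Einf (fun i => set_val e i.+1).
Proof. by move=> i; exact: (@set_valP _ _ e). Qed.

(* The removal of the first edge; the value on paths of length 0, which lie
   outside the domain of the shift map, is irrelevant. *)
Definition path_shift (mu : Estar) : Estar :=
  match mu with
  | existT 0 v => existT Epath 0%N v
  | existT 1 e => existT Epath 0%N (dE (set_val e ord0))
  | existT n.+2 e => existT Epath n.+1 (mkset (tail_Epos e))
  end.

Lemma path_d_shift mu : path_d (path_shift mu) = path_d mu.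
Proof.
case: mu => [[|[|n]]] //= e; first by congr (dE (set_val e _)); apply: val_inj.
rewrite /set_val /=; congr (dE (_ e _)); exact: val_inj.
Qed.

Lemma finbd_shift (mu : set_type finbd) : finbd (path_shift (set_val mu)).
Proof. by rewrite /finbd /= path_d_shift; exact: (@set_valP _ _ mu). Qed.

Definition sigmaE_dom : set bpath :=
  [set mu | match mu with
            | inl m => (0 < path_length (set_val m))%N
            | inr _ => True
            end].

Definition sigmaE (mu : bpath) : bpath :=
  match mu with
  | inl m => inl (mkset (@finbd_shift m))
  | inr e => inr (mkset (tail_Einf e))
  end.

End Correspondence.

Arguments sigmaE_dom {d B L} S _.
Arguments sigmaE {d B L} S mu.

(* [f] stands for the partial map with domain [D]; its values outside [D] are
   irrelevant. *)
Definition local_homeomorphism (X : topologicalType) (D : set X) (f : X -> X) :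
    Prop :=
  open D /\
  forall x, D x -> exists U : set X,
    [/\ open U /\ U x, U `<=` D, set_inj U f, {within U, continuous f}
      & forall V, open V -> V `<=` U -> open (f @` V)].

(* [gmul x y z] means that [x] and [y] are composable and that x y = z. *)
Record topGroupoid := TopGroupoid {
  arrow :> topologicalType;
  gmul : arrow -> arrow -> arrow -> Prop;
  ginv : arrow -> arrow }.

Definition groupoid_iso (G H : topGroupoid) : Prop :=
  exists (phi : G -> H) (psi : H -> G),
    [/\ cancel phi psi /\ cancel psi phi,
        continuous phi /\ continuous psi,
        forall x y z, gmul x y z <-> gmul (phi x) (phi y) (phi z)
      & forall x, phi (ginv x) = ginv (phi x)].

Definition triple_mul (X : Type) (s t u : X * int * X) : Prop :=
  s.2 = t.1.1 /\ u = (s.1.1, s.1.2 + t.1.2, t.2).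
Definition triple_inv (X : Type) (t : X * int * X) : X * int * X :=
  (t.2, - t.1.2, t.1.1).

Section RenaultDeaconu.
Variables (X : topologicalType) (D : set X) (f : X -> X).

Definition iter_dom (n : nat) : set X :=
  [set x | forall k, (k < n)%N -> D (iter k f x)].

Definition RD_set : set (X * int * X) :=
  [set t | exists m n : nat,
     [/\ t.1.2 = m%:Z - n%:Z, iter_dom m t.1.1, iter_dom n t.2
       & iter m f t.1.1 = iter n f t.2]].

Definition RD_basic (m n : nat) (U V : set X) : set (X * int * X) :=
  [set t | [/\ t.1.2 = m%:Z - n%:Z, U t.1.1, V t.2
             & iter m f t.1.1 = iter n f t.2]].

Definition RD_arrow : Type := set_type RD_set.
HB.instance Definition _ := Choice.copy RD_arrow (set_type RD_set).
HB.instance Definition _ := @isSubBaseTopological.Build RD_arrow (set RD_arrow)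
  [set W | exists m n U V,
     [/\ open U /\ open V, U `<=` iter_dom m /\ V `<=` iter_dom n,
         set_inj U (iter m f) /\ set_inj V (iter n f)
       & W = [set t : RD_arrow | RD_basic m n U V (set_val t)]]] id.

Lemma RD_inv_subproof (t : RD_arrow) : RD_set (triple_inv (set_val t)).
Proof.
have [m [n [tmn dm dn e]]] := @set_valP _ _ t.
by exists n, m; split=> //=; rewrite tmn opprB.
Qed.

Definition RD_groupoid : topGroupoid := @TopGroupoid RD_arrow
  (fun s t u => triple_mul (set_val s) (set_val t) (set_val u))
  (fun t => mkset (RD_inv_subproof t)).

End RenaultDeaconu.

Section TightGroupoid.
Context {d : Order.disp_t} {B : cbDistrLatticeType d} {L : choiceType}.
Variable S : gbds B L.

(* [None] is the element 0 of the inverse semigroup. *)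
Definition triple : Type := option (seq L * B * seq L).

Definition invsg : set triple :=
  [set x | match x with
           | None => True
           | Some (al, A, be) =>
               [/\ A != \bot%O, widl S al A & widl S be A]
           end].

Definition mk_triple (al : seq L) (A : B) (be : seq L) : triple :=
  if A == \bot%O then None else Some (al, A, be).

Definition invsg_mul (x y : triple) : triple :=
  match x, y with
  | Some (al, A, be), Some (ga, C, de) =>
      if be == ga then mk_triple al (A `&` C)%O de
      else if prefix be ga then
        let ga' := drop (size be) ga in
        mk_triple (al ++ ga') (wact S ga' A `&` C)%O de
      else if prefix ga be then
        let be' := drop (size ga) be in
        mk_triple al (A `&` wact S be' C)%O (de ++ be')
      else None
  | _, _ => None
  end.

Definition idem : set triple :=
  [set e | match e with
           | None => True
           | Some (al, A, be) => [/\ al = be, A != \bot%O & widl S al A]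
           end].

Definition idem_le (e f : triple) : Prop := invsg_mul e f = e.

Definition finite_cover (x : triple) (Z : set triple) : Prop :=
  [/\ finite_set Z, Z `<=` [set y | idem y /\ idem_le y x]
    & forall y, idem y -> idem_le y x -> y <> None ->
        exists2 z, Z z & invsg_mul y z <> None].

Definition tight : set (set triple) :=
  [set xi | is_pfilter idem idem_le None xi /\
            forall x Z, xi x -> finite_cover x Z -> Z `&` xi !=set0].

Definition tightsp : Type := set_type tight.

Definition Vbasic (e : triple) (es : seq triple) : set tightsp :=
  [set xi | set_val xi e /\ forall e', e' \in es -> ~ set_val xi e'].

HB.instance Definition _ := Choice.copy tightsp (set_type tight).
HB.instance Definition _ := @isSubBaseTopological.Build tightsp (set tightsp)
  [set W | exists e es, [/\ idem e, forall e', e' \in es -> idem e'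
                          & W = Vbasic e es]] id.

Definition word : Type := (seq L + (nat -> L))%type.

(* For infinite [om], [nth] returns its default value past the end of [al]. *)
Definition wcat (al : seq L) (ga : word) : word :=
  match ga with
  | inl be => inl (al ++ be)
  | inr om => inr (fun n => nth (om (n - size al)%N) al n)
  end.

Definition wtake (n : nat) (ga : word) : seq L :=
  match ga with inl be => take n be | inr om => mkseq om n end.

Definition wlen_ge (n : nat) (ga : word) : Prop :=
  match ga with inl be => (n <= size be)%N | inr _ => True end.

Definition has_word (xi : tightsp) (ga : word) : Prop :=
  match ga with
  | inl al =>
      (exists A, set_val xi (Some (al, A, al))) /\
      forall be A, set_val xi (Some (be, A, be)) -> (size be <= size al)%N
  | inr om =>
      (forall n, exists be A,
         set_val xi (Some (be, A, be)) /\ (n < size be)%N) /\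
      forall be A, set_val xi (Some (be, A, be)) -> be = mkseq om (size be)
  end.

Definition level (xi : tightsp) (ga : word) (n : nat) : set B :=
  [set A | widl S (wtake n ga) A /\
           set_val xi (Some (wtake n ga, A, wtake n ga))].

(* [Hmap al ga xi eta] means H_{[al]ga}(xi) = eta. *)
Definition Hmap (al : seq L) (ga : word) (xi eta : tightsp) : Prop :=
  has_word xi (wcat al ga) /\
  match al with
  | [::] => eta = xi
  | _ => has_word eta ga /\
         forall n, wlen_ge n ga ->
           level eta ga n =
           [set C | widl S (wtake n ga) C /\
              exists2 A, level xi (wcat al ga) (size al + n)%N A & (A <= C)%O]
  end.

Definition Hmap_eq (mu nu : seq L) (ga : word) (eta xi : tightsp) : Prop :=
  exists zeta, Hmap mu ga eta zeta /\ Hmap nu ga xi zeta.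

Definition Gamma_set : set (tightsp * int * tightsp) :=
  [set t | exists al be ga,
     t.1.2 = (size al)%:Z - (size be)%:Z /\ Hmap_eq al be ga t.1.1 t.2].

(* The middle entry [A] of (mu, A, nu) does not occur in the basic sets. *)
Definition Gamma_basic (mu nu : seq L) (e : triple) (es : seq triple) :
    set (tightsp * int * tightsp) :=
  [set t | exists ga,
     [/\ t.1.2 = (size mu)%:Z - (size nu)%:Z, Vbasic e es t.2
       & Hmap_eq mu nu ga t.1.1 t.2]].

Definition Gamma_arrow : Type := set_type Gamma_set.
HB.instance Definition _ := Choice.copy Gamma_arrow (set_type Gamma_set).
HB.instance Definition _ := @isSubBaseTopological.Build Gamma_arrow
  (set Gamma_arrow)
  [set W | exists mu A nu e es,
     [/\ invsg (Some (mu, A, nu)), idem e, forall e', e' \in es -> idem e'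
       & W = [set t : Gamma_arrow | Gamma_basic mu nu e es (set_val t)]]] id.

Lemma Gamma_inv_subproof (t : Gamma_arrow) :
  Gamma_set (triple_inv (set_val t)).
Proof.
have [al [be [ga [tk [z [za zb]]]]]] := @set_valP _ _ t.
by exists be, al, ga; split; [rewrite /= tk opprB|exists z].
Qed.

Definition Gamma_groupoid : topGroupoid := @TopGroupoid Gamma_arrow
  (fun s t u => triple_mul (set_val s) (set_val t) (set_val u))
  (fun t => mkset (Gamma_inv_subproof t)).

End TightGroupoid.

(* Not necessarily unital; the norm of a normed module over R[i] takes its
   (nonnegative real) values in R[i]. *)
Record cstarAlg (R : realType) := CStarAlg {
  cs_car :> completeNormedModType R[i];
  cmul : cs_car -> cs_car -> cs_car;
  cstar : cs_car -> cs_car;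
  cmulA : forall x y z, cmul x (cmul y z) = cmul (cmul x y) z;
  cmulDl : forall x y z, cmul (x + y) z = cmul x z + cmul y z;
  cmulDr : forall x y z, cmul x (y + z) = cmul x y + cmul x z;
  cmulZl : forall a x y, cmul (a *: x) y = a *: cmul x y;
  cmulZr : forall a x y, cmul x (a *: y) = a *: cmul x y;
  cnormM : forall x y, `|cmul x y| <= `|x| * `|y|;
  cstarK : forall x, cstar (cstar x) = x;
  cstarD : forall x y, cstar (x + y) = cstar x + cstar y;
  cstarZ : forall (a : R[i]) x, cstar (a *: x) = Num.conj a *: cstar x;
  cstarM : forall x y, cstar (cmul x y) = cmul (cstar y) (cstar x);
  cnorm_star : forall x, `|cmul (cstar x) x| = `|x| ^+ 2 }.

Section CStar.
Context {R : realType}.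
Implicit Types A D : cstarAlg R.

Definition star_hom A D (phi : A -> D) : Prop :=
  [/\ forall x y, phi (x + y) = phi x + phi y,
      forall (a : R[i]) x, phi (a *: x) = a *: phi x,
      forall x y, phi (cmul x y) = cmul (phi x) (phi y)
    & forall x, phi (cstar x) = cstar (phi x)].

Definition cstar_iso A D : Prop :=
  exists phi : A -> D, star_hom phi /\ bijective phi.

Definition is_projection A (x : A) : Prop := cmul x x = x /\ cstar x = x.

Definition is_partial_isometry A (x : A) : Prop :=
  cmul (cmul x (cstar x)) x = x.

Definition is_cstar_subalg A (M : set A) : Prop :=
  [/\ closed M, M 0, forall x y, M x -> M y -> M (x + y),
      forall (a : R[i]) x, M x -> M (a *: x)
    & (forall x y, M x -> M y -> M (cmul x y)) /\
      (forall x, M x -> M (cstar x))].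

Definition cstar_generates A (M : set A) : Prop :=
  forall N : set A, is_cstar_subalg N -> M `<=` N -> N = setT.

Section GbdsAlgebra.
Context {d : Order.disp_t} {B : cbDistrLatticeType d} {L : choiceType}.
Variable S : gbds B L.

(* Only the values [s a C] with [C] in [idl S a] matter. *)
Definition gbds_rep A (p : B -> A) (s : L -> B -> A) : Prop :=
  [/\ (forall C, is_projection (p C)) /\
      (forall a C, idl S a C -> is_partial_isometry (s a C)),
      [/\ p \bot%O = 0,
          forall C C', p (C `&` C')%O = cmul (p C) (p C')
        & forall C C', p (C `|` C')%O = p C + p C' - p (C `&` C')%O],
      forall C a C', idl S a C' ->
        cmul (p C) (s a C') = cmul (s a C') (p (act S a C)),
      forall a a' C C', idl S a C -> idl S a' C' ->
        cmul (cstar (s a C)) (s a' C') =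
          if a == a' then p (C `&` C')%O else 0
    & forall C, regular_elt S C ->
        p C = \sum_(a \in Delta S C)
                cmul (s a (act S a C)) (cstar (s a (act S a C)))].

Definition is_gbds_cstar A : Prop :=
  exists (p : B -> A) (s : L -> B -> A),
    [/\ gbds_rep p s,
        cstar_generates (range p `|`
          [set x | exists a, exists2 C, idl S a C & x = s a C])
      & forall D (q : B -> D) (t : L -> B -> D), gbds_rep q t ->
          exists phi : A -> D,
            [/\ star_hom phi, forall C, phi (p C) = q C
              & forall a C, idl S a C -> phi (s a C) = t a C]].

End GbdsAlgebra.

Section GroupoidAlgebra.
Variable G : topGroupoid.

Definition Cc : set (G -> R[i]) :=
  [set f | continuous (f : G -> R[i]^o) /\
           compact (closure [set x | f x != 0])].

Definition convolution (f g : G -> R[i]) : G -> R[i] :=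
  fun z => \sum_(p \in [set p : G * G | gmul p.1 p.2 z]) f p.1 * g p.2.

Definition involution (f : G -> R[i]) : G -> R[i] :=
  fun x => Num.conj (f (ginv x)).

Definition Cc_rep A (pi : (G -> R[i]) -> A) : Prop :=
  [/\ forall f g, Cc f -> Cc g -> pi (fun x => f x + g x) = pi f + pi g,
      forall (a : R[i]) f, Cc f -> pi (fun x => a * f x) = a *: pi f,
      forall f g, Cc f -> Cc g -> pi (convolution f g) = cmul (pi f) (pi g)
    & forall f, Cc f -> pi (involution f) = cstar (pi f)].

(* [A] is the completion of [Cc] in the full norm
   ||f|| = sup ||pi f||, the supremum over all *-representations [pi]. *)
Definition is_groupoid_cstar A : Prop :=
  exists iota : (G -> R[i]) -> A,
    [/\ Cc_rep iota, closure (iota @` Cc) = setT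
      & forall D (pi : (G -> R[i]) -> D), Cc_rep pi ->
          forall f, Cc f -> `|pi f| <= `|iota f|].

End GroupoidAlgebra.
End CStar.

(* Main.v *)
Require Import Defs.
From HB Require Import structures.
From mathcomp Require Import all_boot all_order all_algebra complex.
From mathcomp Require Import all_classical all_reals all_analysis.
From mathcomp Require Import finmap zify ring lra.

(* A boundary path corresponds to the tight filter of all idempotents
   (al, A, al) such that al labels an initial segment of the path and A belongs
   to the ultrafilter where this segment ends: a finite path is a boundary path
   when its last vertex contains no regular set, which is what tightness
   requires.  Cylinder sets are compact open and form, with their complements,
   a subbase; the shift is injective on the cylinders of words of positive
   length, and both groupoids have as a basis the bisections Z(al, A, be), cut
   down by cylinder conditions on the source.

   For the C*-algebras, a representation (p, s) of the relations sends
   (al, A, be) to s_al p_A s_be^*, and every linear relation between indicator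
   functions of the sets Z(al, A, be) also holds between these elements: on an
   atom of the source idempotents it either reduces to a relation between the
   coefficients, or the atom is empty and relation (iv) kills it.  A function f
   supported in a bisection satisfies |pi(f)| <= sup |f| in every
   *-representation, as f^* f is a function on the units.  Hence the map defined
   on indicators extends to C_c, whose elements are uniform limits of
   combinations of indicators, and the groupoid C*-algebra has the universal
   property of the C*-algebra of the dynamical system. *)

Set Implicit Arguments.
Unset Strict Implicit.
Unset Printing Implicit Defensive.

Import Order.Theory GRing.Theory Num.Theory numFieldNormedType.Exports.
Import Defs.

Local Open Scope classical_set_scope.
Local Open Scope ring_scope.

(** * C*-algebras *)

(** The norm estimates use no spectral theory. That a selfadjoint [b] is contractive is certified by
    a commuting selfadjoint [v] with [b^2 = 2v - v^2]: every *-homomorphism preserves this identity,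
    and it makes sense without a unit. The certificate shows that *-homomorphisms are contractive,
    and it bounds *-representations of functions that are not assumed continuous. A second obstacle
    is the empty word: its ideal is all of [B], yet the range of a path of positive length may be
    the extra point of [F0], where no element of [B] lives. Hence many lemmas ask for a nonempty
    word, and arrows presented by two empty words are treated apart. A third is size: the full norm
    ranges over all representations, which cannot index a product directly; one representation for
    each pair of a function and a bound is enough. Finally, the algebra of the dynamical system is
    not constructed independently: it exists because the groupoid algebra has its universal
    property. *)

Lemma complex_ge0 (R : realType) (z : R[i]) : 0 <= z -> z = (complex.Re z)%:C%C.
Proof. by case: z => a b; rewrite lecE /= => /andP[/eqP -> _]. Qed.

Lemma Re_norm_ge0 (R : realType) (z : R[i]) : 0 <= complex.Re `|z|.
Proof. by have := normr_ge0 z; rewrite {1}(complex_ge0 (normr_ge0 z)) lecR. Qed.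

Section RealNorm.
Context {R : realType} {V : normedModType R[i]}.
Implicit Types x y : V.

(** Norms over [R[i]] are complex numbers; this real version has a total order, and all estimates
    below are made with it. *)
Definition nrm x : R := complex.Re `|x|.

Lemma nrmE x : `|x| = (nrm x)%:C%C.
Proof.
exact: complex_ge0 (normr_ge0 x).
Qed.

Lemma nrm_ge0 x : 0 <= nrm x.
Proof. by have := normr_ge0 x; rewrite nrmE lecR. Qed.

Lemma nrmD x y : nrm (x + y) <= nrm x + nrm y.
Proof. by rewrite -lecR rmorphD /= -!nrmE ler_normD. Qed.

Lemma nrm0 : nrm 0 = 0. Proof. by rewrite /nrm normr0. Qed.

Lemma nrm_eq0 x : nrm x = 0 -> x = 0.
Proof. by move=> h; apply/normr0_eq0; rewrite nrmE h. Qed.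

Lemma nrmN x : nrm (- x) = nrm x. Proof. by rewrite /nrm normrN. Qed.

Lemma nrmBC x y : nrm (x - y) = nrm (y - x).
Proof. by rewrite -nrmN opprB. Qed.

Lemma nrmZ a x : nrm (a *: x) = complex.Re `|a| * nrm x.
Proof.
have ha := complex_ge0 (normr_ge0 a).
by rewrite /nrm normrZ {1}ha nrmE /= mul0r subr0.
Qed.

Lemma normcR (r : R) : `|r%:C%C : R[i]| = `|r|%:C%C.
Proof. by rewrite normc_def /= expr0n addr0 sqrtr_sqr. Qed.

Lemma nrm_tri z x y : nrm (x - y) <= nrm (x - z) + nrm (z - y).
Proof. by rewrite -[x](subrK z) -addrA (subrK z); exact: nrmD. Qed.

Lemma closureP (M : set V) x :
  closure M x <-> forall e : R, 0 < e -> exists2 y, M y & nrm (x - y) < e.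
Proof.
split=> [cx e e0|h U].
  have e0' : 0 < e%:C%C :> R[i] by rewrite ltcR.
  have [y [My]] := cx _ (nbhsx_ballx x _ e0').
  by rewrite -ball_normE /ball_ /= nrmE ltcR => h; exists y.
rewrite -nbhs_ballE => -[e e0 sub].
have er := complex_ge0 (ltW e0).
have [|y My yx] := h (complex.Re e); first by rewrite -ltcR -er.
exists y; split=> //; apply: sub; rewrite -ball_normE /ball_ /= nrmE er ltcR.
exact: yx.
Qed.

End RealNorm.

Lemma complete_seq (R : realType) (V : completeNormedModType R[i]) (u : nat -> V) :
  (forall e : R, 0 < e -> exists N, forall m n, (N <= m)%N -> (N <= n)%N ->
     nrm (u m - u n) < e) ->
  exists l, forall e : R, 0 < e -> exists N, forall n, (N <= n)%N ->
     nrm (u n - l) < e.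
Proof.
move=> cu; have : cvg (u @ \oo).
  apply/cauchy_cvgP/cauchy_ballP => e e0.
  have er := complex_ge0 (ltW e0).
  have [|N hN] := cu (complex.Re e); first by rewrite -ltcR -er.
  exists (u @` [set n | (N <= n)%N], u @` [set n | (N <= n)%N]); last first.
    move=> [_ _] [[m /= Nm <-] [n /= Nn <-]].
    by rewrite /= -ball_normE /ball_ /= nrmE er ltcR; apply: hN.
  by split; exists N => //= n /= Nn; exists n.
move=> /cvg_ex[l ul]; exists l => e e0.
have e0' : 0 < e%:C%C :> R[i] by rewrite ltcR.
have [N _ hN] := ul _ (nbhsx_ballx l _ e0').
exists N => n Nn; have := hN n Nn.
by rewrite /= -ball_normE /ball_ /= nrmE ltcR nrmBC.
Qed.

Reserved Notation "x ** y" (at level 40, left associativity).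
Notation "x ** y" := (cmul x y).

Section CStarBasics.
Context {R : realType} (A : cstarAlg R).
Implicit Types x y z b v : A.

Lemma cmul0l x : 0 ** x = 0.
Proof. by have := cmulZl 0 (0 : A) x; rewrite !scale0r. Qed.

Lemma cmul0r x : x ** 0 = 0.
Proof. by have := cmulZr 0 x (0 : A); rewrite !scale0r. Qed.

Lemma cmulNl x y : (- x) ** y = - (x ** y).
Proof. by rewrite -scaleN1r cmulZl scaleN1r. Qed.

Lemma cmulNr x y : x ** (- y) = - (x ** y).
Proof. by rewrite -(scaleN1r y) cmulZr scaleN1r. Qed.

Lemma cmulBl x y z : (x - y) ** z = x ** z - y ** z.
Proof. by rewrite cmulDl cmulNl. Qed.

Lemma cmulBr x y z : x ** (y - z) = x ** y - x ** z.
Proof. by rewrite cmulDr cmulNr. Qed.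

Lemma cstar0 : cstar 0 = 0 :> A.
Proof. by have := cstarZ 0 (0 : A); rewrite rmorph0 !scale0r. Qed.

Lemma cstarN x : cstar (- x) = - cstar x.
Proof. by rewrite -scaleN1r cstarZ rmorphN1 scaleN1r. Qed.

Lemma cstarB x y : cstar (x - y) = cstar x - cstar y.
Proof. by rewrite cstarD cstarN. Qed.

Lemma nrmM x y : nrm (x ** y) <= nrm x * nrm y.
Proof. by rewrite -lecR rmorphM /= -!nrmE cnormM. Qed.

Lemma nrm_starM x : nrm (cstar x ** x) = nrm x ^+ 2.
Proof.
have := cnorm_star x; rewrite !nrmE -rmorphXn /= => -[->].
by [].
Qed.

Lemma nrm_cstar x : nrm (cstar x) = nrm x.
Proof.
have le y : nrm y <= nrm (cstar y).
  have [y0|] := eqVneq (nrm y) 0; first by rewrite y0 nrm_ge0.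
  move=> yn0; have y0 : 0 < nrm y by rewrite lt_neqAle eq_sym yn0 nrm_ge0.
  rewrite -(ler_pM2r y0) -expr2 -nrm_starM; exact: nrmM.
by apply/eqP; rewrite eq_le le andbT; have := le (cstar x); rewrite cstarK.
Qed.

Lemma starM_eq0 x : cstar x ** x = 0 -> x = 0.
Proof.
move=> h; apply: nrm_eq0; have := nrm_starM x; rewrite h nrm0.
by move=> /esym/eqP; rewrite expf_eq0 /= => /eqP.
Qed.

(* With u = b + i(1 - v) in the unitization, u^* u = 1, so u and u^* are
   isometric and b = (u + u^* )/2 is contractive. *)
Lemma selfadjoint_contractive b v : cstar b = b -> cstar v = v ->
  b ** v = v ** b -> b ** b = v + v - v ** v -> nrm b <= 1.
Proof.
move=> bs vs bv bb.
have iso (e : R[i]) z : Num.conj e * e = 1 -> Num.conj e = - e ->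
    nrm (b ** z + e *: (z - v ** z)) = nrm z.
  move=> ee eN; set y := z - v ** z.
  have sy : cstar y = cstar z - cstar z ** v by rewrite cstarB cstarM vs.
  have cross : (cstar z ** b) ** y = cstar y ** (b ** z).
    by rewrite sy cmulBl cmulBr !cmulA -(cmulA (cstar z) b v) bv !cmulA.
  have sq : cstar (b ** z + e *: y) ** (b ** z + e *: y) = cstar z ** z.
    rewrite cstarD cstarM bs cstarZ cmulDl !cmulDr !cmulZl !cmulZr cross.
    rewrite scalerA ee scale1r eN addrA scaleNr addrK.
    rewrite cmulA -(cmulA (cstar z)) bb sy /y !(cmulDr, cmulDl, cmulNr, cmulNl).
    rewrite !cmulA opprK; set P := cstar z ** z; set Q := _ ** v ** z.
    set T := _ ** v ** v ** z; rewrite -(addrA P).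
    have -> : - Q + (- Q + T) = - (Q + Q - T) by rewrite opprB opprD addrA addrC.
    by rewrite addrCA subrr addr0.
  apply/eqP; rewrite -(eqrXn2 (n := 2)) ?nrm_ge0 //.
  by rewrite -!nrm_starM sq.
have bz z : nrm (b ** z) <= nrm z.
  have i1 : Num.conj ('i : R[i]) * 'i = 1 by rewrite conjCi mulNr -expr2 sqrCi opprK.
  have i2 : Num.conj ('i : R[i]) = - 'i by rewrite conjCi.
  have h1 := iso _ z i1 i2.
  have h2 : nrm (b ** z + (- 'i) *: (z - v ** z)) = nrm z.
    by apply: iso; rewrite rmorphN /= i2 ?opprK // mulrN -expr2 sqrCi opprK.
  have : nrm ((b ** z + 'i *: (z - v ** z)) + (b ** z + (- 'i) *: (z - v ** z)))
      <= nrm z + nrm z by rewrite -{1}h1 -{1}h2 nrmD.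
  rewrite addrACA -scalerDl subrr scale0r addr0 -mulr2n -scaler_nat nrmZ.
  rewrite -(rmorph_nat (real_complex R)). rewrite normcR normr_nat.
  by rewrite -[nrm z + _]mulr2n -(mulr_natl (nrm z)) ler_pM2l.
(* At [z = b] the bound reads [|b|^2 <= |b|], by the C*-identity. *)
have := bz b; rewrite -{1}bs nrm_starM.
have [|b1] := leP (nrm b) 1 => //.
by rewrite expr2 ger_pMl ?leNgt ?b1 // (lt_trans ltr01).
Qed.

End CStarBasics.

Lemma le_eps0 (R : realType) (a C : R) :
  (forall e, 0 < e -> a <= C * e) -> a <= 0.
Proof.
move=> h; rewrite leNgt; apply/negP => a0.
have C0 : 0 < C by have := h _ ltr01; rewrite mulr1; exact: lt_le_trans.
have := h (a / C / 2) (divr_gt0 (divr_gt0 a0 C0) (ltr0n _ 2)).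
have -> : C * (a / C / 2) = a / 2 by field; rewrite gt_eqF.
by lra.
Qed.

Lemma nrm_eps0 (R : realType) (V : normedModType R[i]) (x : V) (C : R) :
  (forall e, 0 < e -> nrm x <= C * e) -> x = 0.
Proof.
by move=> /le_eps0 h; apply: nrm_eq0; apply/eqP; rewrite eq_le h nrm_ge0.
Qed.

(** * Square roots by a contracting iteration *)

Section SquareRoot.
Context {R : realType} (A : cstarAlg R).
Implicit Types x y w : A.

Let half : R[i] := (2^-1)%:C%C.

Let halfD x : half *: (x + x) = x.
Proof.
rewrite -mulr2n -scaler_nat scalerA /half -(rmorph_nat (real_complex R)) -rmorphM.
by rewrite mulVf ?pnatr_eq0 //= scale1r.
Qed.

Let nrm_half x : nrm (half *: x) = 2^-1 * nrm x.
Proof. by rewrite nrmZ normcR /= ger0_norm // invr_ge0 ler0n. Qed.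

(* [w] is 1 - sqrt(1 - x^2), obtained as a fixed point of
   w |-> (x^2 + w^2)/2. *)
Lemma sqrt_exists x : cstar x = x -> nrm x < 1 ->
  exists w, [/\ cstar w = w, x ** w = w ** x & x ** x = w + w - w ** w].
Proof.
move=> xs x1; set h := x ** x; pose r := nrm h.
have r0 : 0 <= r := nrm_ge0 _.
have r1 : r < 1.
  by rewrite (le_lt_trans (nrmM _ _)) // -expr2 exprn_ilt1 ?nrm_ge0.
(* [F] maps the ball of radius [r = |x^2| < 1] into itself and contracts it by the factor [r]: the
   half compensates the two terms of [v^2 - w^2 = v(v - w) + (v - w)w]. *)
pose F w := half *: (h + w ** w); pose u n := iter n F 0.
have ur n : nrm (u n) <= r.
  elim: n => [|n IH]; first by rewrite nrm0.
  rewrite /= /F nrm_half ler_pdivrMl ?ltr0n // mulr_natl mulr2n.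
  rewrite (le_trans (nrmD _ _)) // lerD // (le_trans (nrmM _ _)) //.
  by rewrite (le_trans (ler_pM _ _ IH IH)) ?nrm_ge0 // ler_piMr // ltW.
have FF v w : nrm v <= r -> nrm w <= r -> nrm (F v - F w) <= r * nrm (v - w).
  move=> vr wr; rewrite /F -scalerBr nrm_half ler_pdivrMl ?ltr0n //.
  have -> : h + v ** v - (h + w ** w) = v ** (v - w) + (v - w) ** w.
    by rewrite opprD addrACA subrr add0r cmulBr cmulBl addrA subrK.
  rewrite (le_trans (nrmD _ _)) // mulr_natl mulr2n lerD //.
    by rewrite (le_trans (nrmM _ _)) // ler_wpM2r ?nrm_ge0.
  by rewrite (le_trans (nrmM _ _)) // mulrC ler_wpM2r ?nrm_ge0.
have udist n k : nrm (u (n + k)%N - u n) <= r ^+ n.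
  elim: n => [|n IH]; first by rewrite subr0 expr0 (le_trans (ur _)) // ltW.
  by rewrite addSn exprS (le_trans (FF _ _ (ur _) (ur _))) // ler_wpM2l.
have rn e : 0 < e -> exists N, forall n, (N <= n)%N -> r ^+ n < e.
  move=> e0; have := @cvg_expr R r; rewrite ger0_norm // => /(_ r1).
  move=> /cvgrPdist_lt/(_ _ e0)[N _ hN]; exists N => n Nn; have := hN n Nn.
  by rewrite /= sub0r normrN ger0_norm // exprn_ge0.
have [|w uw] := @complete_seq R A u.
  move=> e e0; have [N hN] := rn _ e0; exists N => m n Nm Nn.
  wlog mn : m n Nm Nn / (n <= m)%N.
    by move=> H; have [/H|/ltnW/H] := leqP n m; [|rewrite nrmBC]; apply.
  by rewrite -(subnKC mn) (le_lt_trans (udist _ _)) // hN.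
have wr : nrm w <= r.
  rewrite -subr_le0; apply: (@le_eps0 _ _ 1) => e /uw[N hN].
  rewrite mul1r lerBlDr -[w](subrK (u N)) (le_trans (nrmD _ _)) //.
  by rewrite lerD // nrmBC ltW // hN.
exists w.
(* Selfadjointness and commutation with [x] are inherited by all iterates, then by the limit. *)
have ind (P : A -> Prop) : P 0 -> (forall v, P v -> P (F v)) -> forall n, P (u n).
  by move=> P0 PF; elim=> [//|n IH]; exact: PF.
split.
- have us : forall n, cstar (u n) = u n.
    apply: (ind (fun v => cstar v = v)); first exact: cstar0.
    move=> v vs; rewrite /F /h cstarZ cstarD !cstarM vs xs conj_Creal //.
    by rewrite ger0_real // lecR invr_ge0 ler0n.
  apply: subr0_eq; apply: (@nrm_eps0 _ _ _ 2) => e /uw[N hN].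
  have -> : cstar w - w = cstar (w - u N) + (u N - w).
    by rewrite cstarB us addrA subrK.
  rewrite (le_trans (nrmD _ _)) // nrm_cstar nrmBC mulr_natl mulr2n.
  by rewrite lerD // ltW // hN.
- have ux : forall n, x ** u n = u n ** x.
    apply: (ind (fun v => x ** v = v ** x)); first by rewrite cmul0l cmul0r.
    move=> v vx; rewrite /F cmulZr cmulZl cmulDr cmulDl /h !cmulA.
    by rewrite -(cmulA v v x) -vx cmulA vx -(cmulA v x v) vx cmulA.
  apply: subr0_eq; apply: (@nrm_eps0 _ _ _ (nrm x + nrm x)) => e /uw[N hN].
  have -> : x ** w - w ** x = (u N - w) ** x - x ** (u N - w).
    by rewrite cmulBr cmulBl -ux opprB [RHS]addrC addrA subrK.
  have eN := ltW (hN N (leqnn _)).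
  rewrite (le_trans (nrmD _ _)) // nrmN mulrDl lerD //.
    by rewrite (le_trans (nrmM _ _)) // mulrC ler_wpM2l ?nrm_ge0.
  by rewrite (le_trans (nrmM _ _)) // ler_wpM2l ?nrm_ge0.
- suff wF : w = F w.
    have -> : w + w = h + w ** w by rewrite {1 2}wF /F -scalerDr halfD.
    by rewrite addrK.
  apply: subr0_eq; apply: (@nrm_eps0 _ _ _ 2) => e /uw[N hN].
  rewrite (le_trans (nrm_tri (u N.+1) _ _)) // mulr_natl mulr2n lerD //.
    by rewrite nrmBC ltW // hN.
  rewrite (le_trans (FF _ _ (ur _) wr)) // (@le_trans _ _ (nrm (u N - w))) //.
    by rewrite ler_piMl ?nrm_ge0 // ltW.
  by rewrite ltW // hN.
Qed.

End SquareRoot.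

(** * Contractivity and rigidity of *-homomorphisms *)

Section StarHom.
Context {R : realType}.
Implicit Types A D : cstarAlg R.

Lemma star_hom0 A D (phi : A -> D) : star_hom phi -> phi 0 = 0.
Proof. by case=> _ hZ _ _; have := hZ 0 0; rewrite !scale0r. Qed.

Lemma star_homB A D (phi : A -> D) x y :
  star_hom phi -> phi (x - y) = phi x - phi y.
Proof.
by case=> hD hZ _ _; rewrite hD -scaleN1r hZ scaleN1r.
Qed.

(** For selfadjoint [y] of norm less than 1, [phi] carries over the identity of [sqrt_exists], which
    certifies that [phi y] is contractive. The general case reduces to [x^* x] by the
    C*-identity. *)
Lemma star_hom_contractive A D (phi : A -> D) x :
  star_hom phi -> nrm (phi x) <= nrm x.
Proof.
move=> h; have [hD hZ hM hS] := h.
have sa (y : A) : cstar y = y -> nrm y < 1 -> nrm (phi y) <= 1.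
  move=> ys /(sqrt_exists ys)[w [ws yw yy]].
  apply: (@selfadjoint_contractive _ _ _ (phi w)); rewrite -?hS -?hM ?ys ?ws ?yw //.
  by rewrite yy star_homB // hD.
apply/ler_addgt0Pr => e e0; set c := nrm x + e.
have c0 : 0 < c by rewrite ltr_wpDl ?nrm_ge0.
have xc : nrm x < c by rewrite ltrDl.
(* With [c] slightly larger than [|x|], the element [k x^* x] has norm less than 1, and its image
   has norm [k |phi x|^2]. *)
set k : R := c ^- 2; have k0 : 0 < k by rewrite invr_gt0 exprn_gt0.
have := sa (k%:C%C *: (cstar x ** x)).
rewrite cstarZ cstarM cstarK conj_Creal ?ger0_real ?lecR ?(ltW k0) // => /(_ erefl).
rewrite nrmZ normcR /= gtr0_norm // nrm_starM hZ hM hS.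
rewrite nrmZ normcR /= gtr0_norm // nrm_starM /k.
have c2 : 0 < c ^+ 2 by rewrite exprn_gt0.
rewrite [_ * nrm x ^+ 2]mulrC [_ * nrm (phi x) ^+ 2]mulrC.
rewrite ltr_pdivrMr // ler_pdivrMr // !mul1r.
rewrite ltr_pXn2r ?nnegrE ?nrm_ge0 ?(ltW c0) // xc => /(_ isT).
by rewrite ler_pXn2r ?nnegrE ?nrm_ge0 ?(ltW c0).
Qed.

Lemma star_hom_comp A D (E : cstarAlg R) (phi : A -> D) (psi : D -> E) :
  star_hom phi -> star_hom psi -> star_hom (psi \o phi).
Proof.
move=> [hD hZ hM hS] [kD kZ kM kS]; split=> /= [x y|a x|x y|x].
- by rewrite hD kD.
- by rewrite hZ kZ.
- by rewrite hM kM.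
- by rewrite hS kS.
Qed.

Lemma star_hom_id A : star_hom (@idfun A).
Proof. by split. Qed.

(** The set where both maps agree is a *-subalgebra, and it is closed because *-homomorphisms are
    contractive. *)
Lemma star_hom_eq A D (M : set A) (phi psi : A -> D) :
  star_hom phi -> star_hom psi -> cstar_generates M ->
  (forall x, M x -> phi x = psi x) -> phi =1 psi.
Proof.
move=> h k gM e x; pose N := [set y | phi y = psi y].
suff NT : N = setT by have : N x by rewrite NT.
apply: gM => //; have [hD hZ hM hS] := h; have [kD kZ kM kS] := k.
split; rewrite /N /=.
- move=> y /closureP cy; apply: subr0_eq; apply: (@nrm_eps0 _ _ _ 2) => d d0.
  have [z /= zN yz] := cy d d0.
  have -> : phi y - psi y = phi (y - z) + psi (z - y).
    by rewrite (star_homB _ _ h) (star_homB _ _ k) zN addrA subrK.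
  rewrite (le_trans (nrmD _ _)) // mulr_natl mulr2n.
  by rewrite lerD // (le_trans (star_hom_contractive _ _)) // ?[nrm (z - y)]nrmBC ltW.
- by rewrite !star_hom0.
- by move=> y z ey ez; rewrite hD kD ey ez.
- by move=> a y ey; rewrite hZ kZ ey.
- by split=> [y z ey ez|y ey]; rewrite ?hM ?kM ?hS ?kS ?ey ?ez.
Qed.

(** The comparison maps given by the two universal properties are inverse to each other on
    generators, hence everywhere. *)
Lemma gbds_cstar_unique d (B : cbDistrLatticeType d) (L : choiceType)
    (S : gbds B L) A D :
  is_gbds_cstar S A -> is_gbds_cstar S D -> cstar_iso D A.
Proof.
move=> [p [s [rep_ps gen_ps uni_ps]]] [q [t [rep_qt gen_qt uni_qt]]].
have [phi [hphi phip phis]] := uni_ps _ _ _ rep_qt.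
have [psi [hpsi psiq psit]] := uni_qt _ _ _ rep_ps.
exists psi; split=> //; exists phi.
  apply: (star_hom_eq (star_hom_comp hpsi hphi) (star_hom_id D) gen_qt).
  move=> x [[C _ <-]|[a [C aC ->]]] /=; first by rewrite psiq phip.
  by rewrite psit // phis.
apply: (star_hom_eq (star_hom_comp hphi hpsi) (star_hom_id A) gen_ps).
move=> x [[C _ <-]|[a [C aC ->]]] /=; first by rewrite phip psiq.
by rewrite phis // psit.
Qed.

End StarHom.

(** * Existence of groupoid C*-algebras *)

Section GroupoidAlgebraExistence.
Context {R : realType} {G : topGroupoid}.
Implicit Types f g : G -> R[i].

Hypothesis Cc0 : Cc (fun _ : G => 0 : R[i]).
Hypothesis CcD : forall f g, Cc f -> Cc g -> Cc (fun x => f x + g x).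
Hypothesis CcZ : forall (a : R[i]) f, Cc f -> Cc (fun x => a * f x).
Hypothesis CcM : forall f g, Cc f -> Cc g -> Cc (convolution f g).
Hypothesis CcV : forall f, Cc f -> Cc (involution f).
Hypothesis Cc_bound : forall f, Cc f -> exists M : R,
  forall (D : cstarAlg R) (pi : (G -> R[i]) -> D), Cc_rep pi -> nrm (pi f) <= M.

(** Representations into arbitrary algebras are too many to index a product. Choosing one for each
    pair [(f, M)] such that some representation exceeds [M] at [f] already realises every supremum
    of norms. *)
Let big (p : (G -> R[i]) * R) := exists D : cstarAlg R,
  exists pi : (G -> R[i]) -> D, Cc_rep pi /\ p.2 < nrm (pi p.1).

Let I := {p | big p}.
Let Dd (i : I) : cstarAlg R := projT1 (cid (projT2 i)).
Let pi (i : I) : (G -> R[i]) -> Dd i :=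
  projT1 (cid (projT2 (cid (projT2 i)))).

Let pi_rep i : Cc_rep (pi i).
Proof. exact: (projT2 (cid (projT2 (cid (projT2 i))))).1. Qed.

Let pi_big (i : I) : (projT1 i).2 < nrm (pi i (projT1 i).1).
Proof. exact: (projT2 (cid (projT2 (cid (projT2 i))))).2. Qed.

(** The completion is realised inside the product of the chosen algebras, as the families that
    single functions of [Cc] approximate uniformly in [i]. *)
Let approx (x : forall i, Dd i) := forall e : R, 0 < e ->
  exists2 f, Cc f & forall i, nrm (x i - pi i f) <= e.

Definition ucl := {x | approx x}.
Local Notation E := ucl.
Let fn (x : E) : forall i, Dd i := projT1 x.

Let ext (x y : E) : (forall i, fn x i = fn y i) -> x = y.
Proof.
case: x y => [x ax] [y ay] h; have e : x = y by exact: functional_extensionality_dep.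
by subst y; congr exist; exact: Prop_irrelevance.
Qed.

Let bounded (x : E) : exists M, forall i, nrm (fn x i) <= M.
Proof.
have [f /Cc_bound[M fM] xf] := projT2 x 1 ltr01; exists (1 + M) => i.
rewrite -[fn x i](subrK (pi i f)) (le_trans (nrmD _ _)) //.
by apply: lerD; [exact: xf|exact: fM].
Qed.

(** The value 0 is adjoined so that the set is nonempty even when there is no index. *)
Let snorm (x : E) : R := sup [set r | r = 0 \/ exists i, r = nrm (fn x i)].

Let snorm_has_sup x : has_sup [set r | r = 0 \/ exists i, r = nrm (fn x i)].
Proof.
split; first by exists 0; left.
have [M xM] := bounded x; exists (Num.max 0 M) => r [->|[i ->]].
  by rewrite le_max lexx.
by rewrite le_max xM orbT.
Qed.

Let snorm_ge x i : nrm (fn x i) <= snorm x.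
Proof. by apply: (sup_upper_bound (snorm_has_sup x)); right; exists i. Qed.

Let snorm_ge0 x : 0 <= snorm x.
Proof. by apply: (sup_upper_bound (snorm_has_sup x)); left. Qed.

Let snorm_le x M : 0 <= M -> (forall i, nrm (fn x i) <= M) -> snorm x <= M.
Proof.
move=> M0 xM; apply: ge_sup; first by exists 0; left.
by move=> r [->//|[i ->]].
Qed.

Let approx0 : approx (fun i => 0).
Proof.
move=> e e0; exists (fun _ => 0) => // i.
have [_ hZ _ _] := pi_rep i; have := hZ 0 _ Cc0; rewrite scale0r mul0r => ->.
by rewrite subr0 nrm0 ltW.
Qed.

Let approxD (x y : E) : approx (fun i => fn x i + fn y i).
Proof.
move=> e e0; have e2 : 0 < e / 2 by rewrite divr_gt0.
have [f cf xf] := projT2 x _ e2; have [g cg yg] := projT2 y _ e2.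
exists (fun z => f z + g z); first exact: CcD.
move=> i; have [hD _ _ _] := pi_rep i; rewrite hD // opprD addrACA.
rewrite (le_trans (nrmD _ _)) // [leRHS]splitr; apply: lerD; [exact: xf|exact: yg].
Qed.

Let approxZ (a : R[i]) (x : E) : approx (fun i => a *: fn x i).
Proof.
move=> e e0; set c := complex.Re `|a|.
have c0 : 0 <= c := Re_norm_ge0 a.
have c1 : 0 < c + 1 by rewrite ltr_wpDl.
have [|f cf xf] := projT2 x (e / (c + 1)); first by rewrite divr_gt0.
exists (fun z => a * f z); first exact: CcZ.
move=> i; have [_ hZ _ _] := pi_rep i; rewrite hZ // -scalerBr nrmZ -/c.
rewrite (le_trans (ler_wpM2l c0 (xf i))) // mulrCA ger_pMr // ler_pdivrMr //.
by rewrite mul1r lerDl ler01.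
Qed.

Let approxN (x : E) : approx (fun i => - fn x i).
Proof.
have := approxZ (- 1) x; congr approx; apply: functional_extensionality_dep => i.
by rewrite scaleN1r.
Qed.

Let approxM (x y : E) : approx (fun i => fn x i ** fn y i).
Proof.
move=> e e0; have [M xM] := bounded x; have [N yN] := bounded y.
(* The error is at most [h N + (M + 1) h <= h K], with [M] and [N] made nonnegative; capping [h] at
   1 is what bounds the approximant of [x] by [M + 1]. *)
pose K := Num.max 0 M + Num.max 0 N + 1.
have M0 : 0 <= Num.max 0 M by rewrite le_max lexx.
have N0 : 0 <= Num.max 0 N by rewrite le_max lexx.
have K0 : 0 < K by rewrite ltr_wpDl // addr_ge0.
pose h := Num.min 1 (e / K).
have h0 : 0 < h by rewrite lt_min ltr01 divr_gt0.
have h1 : h <= 1 by rewrite ge_min lexx.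
have hK : h * K <= e by rewrite -ler_pdivlMr // ge_min lexx orbT.
have [f cf xf] := projT2 x _ h0; have [g cg yg] := projT2 y _ h0.
exists (convolution f g); first exact: CcM.
move=> i; have [_ _ hM _] := pi_rep i; rewrite hM //.
have -> : fn x i ** fn y i - pi i f ** pi i g =
    (fn x i - pi i f) ** (fn y i) + pi i f ** (fn y i - pi i g).
  by rewrite cmulBl cmulBr addrA subrK.
have fb : nrm (pi i f) <= Num.max 0 M + 1.
  have -> : pi i f = fn x i - (fn x i - pi i f) by rewrite subKr.
  rewrite (le_trans (nrmD _ _)) // nrmN lerD //.
    by rewrite le_max xM orbT.
  by rewrite (le_trans (xf i)).
rewrite (le_trans (nrmD _ _)) // (le_trans _ hK) //.
have -> : h * K = h * Num.max 0 N + (Num.max 0 M + 1) * h.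
  by rewrite /K; ring.
apply: lerD; apply: (le_trans (nrmM _ _)); apply: ler_pM; rewrite ?nrm_ge0 //.
by rewrite le_max yN orbT.
Qed.

Let approxS (x : E) : approx (fun i => cstar (fn x i)).
Proof.
move=> e e0; have [f cf xf] := projT2 x _ e0.
exists (involution f); first exact: CcV.
move=> i; have [_ _ _ hS] := pi_rep i; rewrite hS // -cstarB nrm_cstar.
exact: xf.
Qed.

HB.instance Definition _ := gen_eqMixin E.
HB.instance Definition _ := gen_choiceMixin E.

Let zeroE : E := exist _ _ approx0.
Let addE (x y : E) : E := exist _ _ (approxD x y).
Let oppE (x : E) : E := exist _ _ (approxN x).
Let scaleE (a : R[i]) (x : E) : E := exist _ _ (approxZ a x).
Let mulE (x y : E) : E := exist _ _ (approxM x y).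
Let starE (x : E) : E := exist _ _ (approxS x).

Let addEA : associative addE.
Proof. by move=> x y z; apply: ext => i; exact: addrA. Qed.
Let addEC : commutative addE.
Proof. by move=> x y; apply: ext => i; exact: addrC. Qed.
Let add0E : left_id zeroE addE.
Proof. by move=> x; apply: ext => i; exact: add0r. Qed.
Let addNE : left_inverse zeroE oppE addE.
Proof. by move=> x; apply: ext => i; exact: addNr. Qed.

HB.instance Definition _ :=
  GRing.isZmodule.Build E addEA addEC add0E addNE.

Let scaleEA a b x : scaleE a (scaleE b x) = scaleE (a * b) x.
Proof. by apply: ext => i; exact: scalerA. Qed.
Let scale1E : left_id 1 scaleE.
Proof. by move=> x; apply: ext => i; exact: scale1r. Qed.
Let scaleEDr : right_distributive scaleE +%R.
Proof. by move=> a x y; apply: ext => i; exact: scalerDr. Qed.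
Let scaleEDl x : {morph scaleE^~ x : a b / a + b}.
Proof. by move=> a b; apply: ext => i; exact: scalerDl. Qed.

HB.instance Definition _ :=
  GRing.Zmodule_isLmodule.Build R[i] E scaleEA scale1E scaleEDr scaleEDl.

Let normE (x : E) : R[i] := (snorm x)%:C%C.

Let normED x y : normE (x + y) <= normE x + normE y.
Proof.
rewrite -rmorphD lecR snorm_le ?addr_ge0 // => i.
by rewrite (le_trans (nrmD _ _)) // lerD.
Qed.

Let normEZ (a : R[i]) (x : E) : normE (a *: x) = `|a| * normE x.
Proof.
rewrite (complex_ge0 (normr_ge0 a)) -rmorphM; congr (_%:C%C).
set c := complex.Re `|a|.
have c0 : 0 <= c := Re_norm_ge0 a.
have le : snorm (a *: x) <= c * snorm x.
  by apply: snorm_le => [|i]; rewrite ?mulr_ge0 // nrmZ ler_wpM2l.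
apply/eqP; rewrite eq_le le /=.
have [->|cn0] := eqVneq c 0; first by rewrite mul0r.
have cp : 0 < c by rewrite lt_neqAle eq_sym cn0.
rewrite -ler_pdivlMl // snorm_le ?mulr_ge0 ?invr_ge0 // => i.
by rewrite ler_pdivlMl // -nrmZ; exact: (snorm_ge (a *: x)).
Qed.

Let normE0 x : normE x = 0 -> x = 0.
Proof.
move=> [x0]; apply: ext => i; apply: nrm_eq0; apply/eqP.
by rewrite eq_le nrm_ge0 -x0 snorm_ge.
Qed.

HB.instance Definition _ := Lmodule_isNormed.Build R[i] E normED normEZ normE0.

Let nrmEE (x : E) : nrm x = snorm x.
Proof. by []. Qed.

Let fnB x y i : fn (x - y) i = fn x i - fn y i.
Proof. by []. Qed.

(** A Cauchy filter converges in each coordinate, at a rate uniform in [i]; the limit family is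
    uniformly close to an element of [E], hence again approximable. *)
Let ucl_complete (F : set_system E) : ProperFilter F -> cauchy F -> cvg F.
Proof.
move=> FF /cauchyP cF.
have near e : 0 < e -> exists x : E, F [set y | forall i, nrm (fn x i - fn y i) < e].
  move=> e0; have e0' : 0 < e%:C%C :> R[i] by rewrite ltcR.
  have [x Fx] := cF _ e0'; exists x; apply: filterS Fx => y.
  rewrite -ball_normE /ball_ /= nrmE ltcR nrmEE => xy i.
  by rewrite -fnB (le_lt_trans (snorm_ge _ _)).
have lim i : exists l : Dd i, forall e : R, 0 < e -> F [set y | nrm (l - fn y i) < e].
  have : cvg ((fun y => fn y i) @ F).
    apply/cauchy_cvgP; apply: cauchy_exP => e e0; have er := complex_ge0 (ltW e0).
    have [|x Fx] := near (complex.Re e); first by rewrite -ltcR -er.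
    exists (fn x i); rewrite /nbhs /=; apply: filterS Fx => y xy.
    by rewrite /= -ball_normE /ball_ /= nrmE er ltcR.
  move=> /cvg_ex[l Fl]; exists l => e e0.
  have e0' : 0 < e%:C%C :> R[i] by rewrite ltcR.
  have := Fl _ (nbhsx_ballx l _ e0'); rewrite /nbhs /=; apply: filterS => y.
  by rewrite /= -ball_normE /ball_ /= nrmE ltcR.
pose l i := projT1 (cid (lim i)).
have lP i : forall e : R, 0 < e -> F [set y | nrm (l i - fn y i) < e].
  exact: projT2 (cid (lim i)).
have unif e : 0 < e -> exists x : E,
    F [set y | forall i, nrm (fn x i - fn y i) < e] /\
    forall i, nrm (l i - fn x i) <= e.
  move=> e0; have [x Fx] := near _ e0; exists x; split=> // i.
  apply/ler_addgt0Pr => d d0.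
  have [y [/= h1 h2]] := filter_ex (filterI Fx (lP i _ d0)).
  rewrite (le_trans (nrm_tri (fn y i) _ _)) // addrC lerD ?(ltW h2) //.
  by rewrite nrmBC ltW.
have al : approx l.
  move=> e e0; have e2 : 0 < e / 2 by rewrite divr_gt0.
  have [x [_ lx]] := unif _ e2; have [f cf xf] := projT2 x _ e2.
  exists f => // i; rewrite (le_trans (nrm_tri (fn x i) _ _)) // [leRHS]splitr.
  by apply: lerD; [exact: lx|exact: xf].
apply/cvg_ex; exists (exist _ l al : E); apply/cvg_ballP => e e0.
have er := complex_ge0 (ltW e0); set r := complex.Re e in er.
have r4 : 0 < r / 4 by rewrite divr_gt0 // -ltcR -er.
have [x [Fx lx]] := unif _ r4; apply: filterS Fx => y xy.
rewrite -ball_normE /ball_ /= nrmE er ltcR nrmEE.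
apply: (@le_lt_trans _ _ (r / 2)); last by rewrite gtr_pMr ?invf_lt1 ?ltr1n // -ltcR -er.
apply: snorm_le => [|i]; first by rewrite divr_ge0 // -lecR -er ltW.
rewrite fnB (le_trans (nrm_tri (fn x i) _ _)) //.
have -> : r / 2 = r / 4 + r / 4 by field.
by apply: lerD; [exact: lx|rewrite ltW // xy].
Qed.

HB.instance Definition _ := Uniform_isComplete.Build E ucl_complete.

Definition ucl_cstar : cstarAlg R.
Proof.
refine (@CStarAlg R E mulE starE _ _ _ _ _ _ _ _ _ _ _).
- by move=> x y z; apply: ext => i; exact: cmulA.
- by move=> x y z; apply: ext => i; exact: cmulDl.
- by move=> x y z; apply: ext => i; exact: cmulDr.
- by move=> a x y; apply: ext => i; exact: cmulZl.
- by move=> a x y; apply: ext => i; exact: cmulZr.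
- move=> x y; rewrite !nrmE -rmorphM lecR !nrmEE snorm_le ?mulr_ge0 // => i.
  by rewrite (le_trans (nrmM _ _)) // ler_pM ?nrm_ge0.
- by move=> x; apply: ext => i; exact: cstarK.
- by move=> x y; apply: ext => i; exact: cstarD.
- by move=> a x; apply: ext => i; exact: cstarZ.
- by move=> x y; apply: ext => i; exact: cstarM.
- move=> x; rewrite !nrmE -rmorphXn; congr (_%:C%C); rewrite !nrmEE.
  apply/eqP; rewrite eq_le; apply/andP; split.
    apply: snorm_le => [|i]; first by rewrite exprn_ge0.
    by rewrite nrm_starM lerXn2r ?nnegrE ?nrm_ge0.
  set s := snorm (mulE _ _); have s0 : 0 <= s := snorm_ge0 _.
  (* Taking the square root turns [|x|^2 <= |x^* x|] into a bound on the coordinates of [x]. *)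
  have -> : s = Num.sqrt s ^+ 2 by rewrite sqr_sqrtr.
  rewrite lerXn2r ?nnegrE ?sqrtr_ge0 // snorm_le ?sqrtr_ge0 // => i.
  rewrite -(@ler_pXn2r _ 2) ?nnegrE ?nrm_ge0 ?sqrtr_ge0 // sqr_sqrtr //.
  by rewrite -nrm_starM; exact: (snorm_ge (mulE (starE x) x)).
Defined.

Let approx_pi f : Cc f -> approx (fun i => pi i f).
Proof. by move=> cf e e0; exists f => // i; rewrite subrr nrm0 ltW. Qed.

Lemma groupoid_cstar_exists : exists D : cstarAlg R, is_groupoid_cstar G D.
Proof.
exists ucl_cstar.
pose iota f : ucl_cstar := match pselect (Cc f) with
  | left cf => exist _ _ (approx_pi cf) | right _ => zeroE end.
have iotaE f i : Cc f -> fn (iota f) i = pi i f.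
  by move=> cf; rewrite /iota; case: pselect.
exists iota; split.
- split.
  + move=> f g cf cg; apply: ext => i; rewrite iotaE; last exact: CcD.
    by have [hD _ _ _] := pi_rep i; rewrite hD // -!iotaE.
  + move=> a f cf; apply: ext => i; rewrite iotaE; last exact: CcZ.
    by have [_ hZ _ _] := pi_rep i; rewrite hZ // -iotaE.
  + move=> f g cf cg; apply: ext => i; rewrite iotaE; last exact: CcM.
    by have [_ _ hM _] := pi_rep i; rewrite hM // -!iotaE.
  + move=> f cf; apply: ext => i; rewrite iotaE; last exact: CcV.
    by have [_ _ _ hS] := pi_rep i; rewrite hS // -iotaE.
- apply/seteqP; split=> // x _; apply/closureP => e e0.
  have [f cf xf] := projT2 (x : E) _ (divr_gt0 e0 (ltr0n _ 2)).
  exists (iota f); first by exists f.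
  apply: (@le_lt_trans _ _ (e / 2)); last by rewrite gtr_pMr // invf_lt1 ?ltr1n.
  apply: snorm_le => [|i]; first by rewrite divr_ge0 // ltW.
  rewrite fnB iotaE //; exact: xf.
(* If [rho f] were larger than [iota f], the pair [(f, nrm (iota f))] would be an index, and the
   coordinate of [iota f] there would exceed its own supremum. *)
- move=> D rho rep f cf; rewrite !nrmE lecR; rewrite leNgt; apply/negP => lt.
  have b : big (f, nrm (iota f)) by exists D, rho.
  have := pi_big (exist _ _ b); rewrite /= -iotaE // ltNge.
  by rewrite (snorm_ge (iota f)).
Qed.

End GroupoidAlgebraExistence.

(** * Ultrafilters by Zorn's lemma *)

Lemma ultrafilter_exists (T : Type) (P : set T) (le : T -> T -> Prop) (bot x : T) :
  (forall y, P y -> le y y) ->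
  (forall y z t, P y -> P z -> P t -> le y z -> le z t -> le y t) -> P x -> ~ le x bot ->
  exists F, is_ultrafilter P le bot F /\ F x.
Proof.
move=> lxx ltr Px xb.
pose Q : set (set T) := [set F | F = set0 \/ is_pfilter P le bot F /\ F x].
have Qx : Q [set y | P y /\ le x y].
  right; split; last by split=> //; exact: lxx.
  split.
  - by move=> y [].
  - by exists x; split=> //; exact: lxx.
  - by move=> [].
  - by move=> y z [Py xy] Pz yz; split=> //; apply: ltr xy yz.
  - by move=> y z [Py xy] [Pz xz]; exists x; split=> //; split=> //; exact: lxx.
have [|F [QF Fmax]] := @Zorn_bigcup _ Q.
  move=> C CQ Ctot; have [[F CF Fx]|nF] := pselect (exists2 F, C F & F x).
    have pf G : C G -> G !=set0 -> is_pfilter P le bot G.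
      by move=> /CQ[->[y []]|[]].
    right; split; last by exists F.
    split.
    - by move=> y [G CG Gy]; have [GP _ _ _ _] := pf G CG (ex_intro _ _ Gy); exact: GP.
    - by exists x, F.
    - by move=> [G CG Gb]; have [_ _ + _ _] := pf G CG (ex_intro _ _ Gb); exact.
    - move=> y z [G CG Gy] Pz yz; have [_ _ _ up _] := pf G CG (ex_intro _ _ Gy).
      by exists G => //; exact: up yz.
    - have D G H y z : C H -> G `<=` H -> G y -> H z ->
          exists t, [/\ (\bigcup_(X in C) X) t, le t y & le t z].
        move=> CH GH /GH Hy Hz; have [_ _ _ _ dir] := pf H CH (ex_intro _ _ Hz).
        by have [t [Ht ty tz]] := dir _ _ Hy Hz; exists t; split=> //; exists H.
      move=> y z [G CG Gy] [H CH Hz]; have [GH|HG] := Ctot _ _ CG CH.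
        exact: (D G H).
      by have [t [? ? ?]] := D H G z y CG HG Hz Gy; exists t.
  left; apply/seteqP; split=> // y [G CG Gy]; case: (CQ _ CG) => [G0|[_ Gx]].
    by rewrite G0 in Gy.
  by case: nF; exists G.
exists F; case: QF => [F0|[pF Fx]].
  exfalso; apply: (Fmax _ _ Qx); rewrite F0; split=> // /(_ x); apply; split=> //.
  exact: lxx.
split=> //; split=> // G pG FG y Gy; apply: contrapT => nFy.
by apply: (Fmax G); [split=> // /(_ y Gy)|right; split=> //; exact: FG].
Qed.

(** * Words and paths *)

Section WordLemmas.
Context {d : Order.disp_t} {B : cbDistrLatticeType d} {L : choiceType}.
Variable S : gbds B L.
Implicit Types (u v w : seq L) (A C D : B) (F G : set B).

Local Notation wact := (Defs.wact S).
Local Notation widl := (Defs.widl S).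
Local Notation ultra := (Defs.ultra S).

Lemma wact_cat u v A : wact (u ++ v) A = wact v (wact u A).
Proof. exact: foldl_cat. Qed.

Lemma wact_le w A C : (A <= C)%O -> (wact w A <= wact w C)%O.
Proof. by move=> /meet_idPl sAC; apply/meet_idPl; rewrite -wactI sAC. Qed.

Lemma wact0 w : wact w \bot%O = \bot%O.
Proof. by elim: w => [//|a w IH]; rewrite /Defs.wact /= act0. Qed.

Lemma widl0 w : widl w \bot%O.
Proof.
case: w => [//|a w]; have [[C IC] _ _] := idl_ideal S a.
by exists C => //; exact: le0x.
Qed.

Lemma idl_le a A C : (A <= C)%O -> idl S a C -> idl S a A.
Proof. by move=> /meet_idPr <- IC; have [_ _] := idl_ideal S a; apply. Qed.

Lemma widl1 a A : widl [:: a] A <-> idl S a A.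
Proof.
by split=> [[C IC sAC]|IA]; [exact: idl_le IC|exists A].
Qed.

Lemma widl_act u v A D : widl u D -> (A <= wact v D)%O -> widl (u ++ v) A.
Proof.
case: u => [_|a u [E IE DE] AD].
  case: v => [//|a v AD]; exists (act S a D) => //.
  by apply: (act_idl (C := D)).
exists E => //; rewrite wact_cat; exact: le_trans AD (wact_le _ DE).
Qed.

(** This fails for the empty prefix, since [idl S a] may be larger than the ideal generated by the
    values of [act S a]. *)
Lemma widl_prefix u v A : u <> [::] -> widl (u ++ v) A ->
  exists2 D, widl u D & (A <= wact v D)%O.
Proof.
case: u => [//|a u] _ [E IE]; rewrite wact_cat => AE.
by exists (wact u E) => //; exists E.
Qed.

Lemma widl_suffix u v A : widl (u ++ v) A -> widl v A.
Proof.
case: u => [//|a u] /widl_prefix[//|D _ AD].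
by have := @widl_act [::] v A D; apply.
Qed.

Lemma ultra_widl w F A : ultra w F -> F A -> widl w A.
Proof. by move=> [[FP _ _ _ _] _] /FP. Qed.

Lemma ultra_bot w F : ultra w F -> ~ F \bot%O.
Proof. by case=> -[]. Qed.

Lemma ultra_ne w F : ultra w F -> F !=set0.
Proof. by case=> -[]. Qed.

Lemma ultra_upward w F A C : ultra w F -> widl w C -> F A -> (A <= C)%O -> F C.
Proof. by move=> [[_ _ _ up _] _] Cw FA sAC; exact: up FA Cw sAC. Qed.

Lemma ultra_cut w F A C : ultra w F -> F A ->
  F (A `&` C)%O \/ F (A `\` C)%O.
Proof. by move=> uF FA; apply: (ultra_prime uF); rewrite joinIB. Qed.

Lemma ultra_max w F G : ultra w F -> ultra w G -> F `<=` G -> F = G.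
Proof.
by move=> [pF mF] [pG _] FG; apply/seteqP; split=> //; exact: mF.
Qed.

Lemma ultra_exists w A : widl w A -> A != \bot%O ->
  exists F, ultra w F /\ F A.
Proof.
move=> wA A0; apply: (@ultrafilter_exists _ _ (fun x y => (x <= y)%O)) => //.
- by move=> y z t _ _ _; exact: le_trans.
- by rewrite lex0; exact/negP.
Qed.

(** A filter that decides every element of the ideal is maximal: a larger filter containing [x]
    cannot also contain [a] minus [x]. *)
Lemma ultra_intro w F : F `<=` widl w -> F !=set0 -> ~ F \bot%O ->
  (forall A C, F A -> widl w C -> (A <= C)%O -> F C) ->
  (forall A C, F A -> F C -> F (A `&` C)%O) ->
  (forall A C, F A -> widl w C -> F (A `&` C)%O \/ F (A `\` C)%O) ->
  ultra w F.
Proof.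
move=> Fw Fne F0 Fup FI Fcut; split.
  split=> // x y Fx Fy; exists (x `&` y)%O; split; [exact: FI|exact: leIl|exact: leIr].
move=> G [Gw _ G0 Gup Gdir] FG x Gx; have [a Fa] := Fne.
have [Fax|Fax] := Fcut _ _ Fa (Gw _ Gx).
  by apply: Fup Fax (Gw _ Gx) _; exact: leIr.
have [z [Gz zx zax]] := Gdir _ _ Gx (FG _ Fax).
case: G0; suff -> : \bot%O = z by [].
by apply/esym/eqP; rewrite -lex0 -(diffIK a x) lexI zax zx.
Qed.

(** With [ultra_upP], this identifies the ultrafilters of [widl w] with those ultrafilters of [B]
    that meet [widl w], so that all vertices can be compared inside [B]. *)
Lemma ultra_restrict w F : ultra [::] F -> F `&` widl w !=set0 ->
  ultra w (F `&` widl w).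
Proof.
move=> uF [a [Fa wa]]; apply: ultra_intro.
- by move=> x [].
- by exists a.
- by move=> [/(ultra_bot uF)].
- by move=> A C [FA wA] wC sAC; split=> //; exact: ultra_upward uF _ FA sAC.
- move=> A C [FA wA] [FC wC]; split; first exact: ultraI uF FA FC.
  exact: widl_le (leIl _ _) wA.
- move=> A C [FA wA] wC; have [FAC|FAC] := ultra_cut C uF FA; [left|right].
    by split=> //; exact: widl_le (leIl _ _) wA.
  by split=> //; exact: widl_le (leBx _ _) wA.
Qed.

Lemma ultra_up_restrict w F : ultra [::] F -> F `&` widl w !=set0 ->
  ultra_up (F `&` widl w) = F.
Proof.
move=> uF ne; have uR := ultra_upP (ultra_restrict uF ne).
apply: (ultra_max uR uF) => C [A [FA _] sAC]; exact: ultra_upward uF _ FA sAC.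
Qed.

Lemma ultra_restrict_up w F : ultra w F -> ultra_up F `&` widl w = F.
Proof.
move=> uF; apply/seteqP; split=> [x [[A FA Ax] wx]|x Fx].
  exact: ultra_upward uF wx FA Ax.
by split; [exists x|exact: ultra_widl Fx].
Qed.

Lemma regular_le A C : (C <= A)%O -> regular_elt S A -> regular_elt S C.
Proof. by move=> CA rA D D0 DC; apply: rA => //; exact: le_trans CA. Qed.

Lemma ultra_meet_seq w F (T : eqType) (l : seq T) (Q : T -> B -> Prop) A :
  ultra w F -> F A ->
  (forall i C D, Q i C -> (D <= C)%O -> Q i D) ->
  (forall i, i \in l -> exists2 C, F C & Q i C) ->
  exists C, [/\ F C, (C <= A)%O & forall i, i \in l -> Q i C].
Proof.
move=> uF FA Qle; elim: l => [|i l IH] h; first by exists A.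
have [|C [FC CA lC]] := IH; first by move=> j jl; apply: h; rewrite inE jl orbT.
have [D FD iD] := h i (mem_head _ _).
exists (C `&` D)%O; split.
- exact: ultraI uF FC FD.
- by apply: le_trans CA; exact: leIl.
- move=> j; rewrite inE => /orP[/eqP ->|jl]; first by apply: Qle iD _; exact: leIr.
  by apply: Qle (lC _ jl) _; exact: leIl.
Qed.

End WordLemmas.

(** * Paths as a range and a partial sequence of edges *)

Section RawPaths.
Context {d : Order.disp_t} {B : cbDistrLatticeType d} {L : choiceType}.
Variable S : gbds B L.
Implicit Types (al be u v w : seq L) (A C D : B).

Local Notation wact := (Defs.wact S).
Local Notation widl := (Defs.widl S).
Local Notation ultra := (Defs.ultra S).
Local Notation E1 := (Defs.E1 S).
Local Notation F0 := (Defs.F0 S).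

(** The extra point becomes the empty family, as the formula for [r(e)] suggests; equality in [F0]
    is then equality of families. *)
Definition oset (r : F0) : set B := if r is Some v then set_val v else set0.

Definition tagE (e : E1) : L := projT1 e.

Lemma oset_rE (e : E1) A : oset (rE e) A <-> set_val (dE e) (act S (tagE e) A).
Proof.
have uF := XspP (projT2 e).
have dEE : set_val (dE e) = ultra_up (set_val (projT2 e)) by [].
have aI : widl [:: projT1 e] (act S (tagE e) A) by exact: widl1_act.
have -> : set_val (dE e) (act S (tagE e) A) <->
    set_val (projT2 e) (act S (tagE e) A).
  rewrite dEE; split=> [[C FC CA]|h]; last by exists (act S (tagE e) A).
  exact: ultra_upward uF aI FC CA.
rewrite /rE; case: pselect => [ne|nne] //=.
by split=> // h; apply: nne; exists A.
Qed.

Lemma E0_ext (v w : Defs.E0 S) : set_val v = set_val w -> v = w.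
Proof. exact: val_inj. Qed.

Lemma F0_ext (r s : F0) : oset r = oset s -> r = s.
Proof.
case: r s => [v|] [w|] //= e; first by congr Some; exact: E0_ext.
  by have [A vA] := ultra_ne (XspP v); move: vA; rewrite e.
by have [A wA] := ultra_ne (XspP w); move: wA; rewrite -e.
Qed.

Lemma E1_ext (e f : E1) : tagE e = tagE f -> set_val (dE e) = set_val (dE f) -> e = f.
Proof.
case: e f => [a eta] [b zeta]; rewrite /tagE /= => ab; subst b => h.
congr existT; apply: val_inj => /=; rewrite -[LHS](ultra_restrict_up (XspP eta)).
by rewrite -[RHS](ultra_restrict_up (XspP zeta)); congr (_ `&` _).
Qed.

Lemma dE_idl (e : E1) : exists2 A, set_val (dE e) A & idl S (tagE e) A.
Proof.
have uF := XspP (projT2 e); have [A FA] := ultra_ne uF.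
by exists A; [exists A|apply/widl1; exact: ultra_widl FA].
Qed.

Lemma E1_exists a (F : set B) A : ultra [::] F -> F A -> idl S a A ->
  exists e : E1, tagE e = a /\ set_val (dE e) = F.
Proof.
move=> uF FA IA; have ne : F `&` widl [:: a] !=set0.
  by exists A; split=> //; exact/widl1.
exists (existT _ a (mkX (ultra_restrict uF ne))); split=> //.
by rewrite -[RHS](ultra_up_restrict uF ne).
Qed.

Variables (r : F0) (ed : nat -> option E1).

(** One format for finite and infinite paths. The range is kept separately because a path of length
    0 has no other data; by [wf_0] such a path sits at a true vertex, whereas a longer path may
    start at the extra point. *)
Record wf_path := WfPath {
  wf_step : forall n, ed n = None -> ed n.+1 = None;
  wf_r : forall e, ed 0%N = Some e -> r = rE e;
  wf_d : forall n e f, ed n = Some e -> ed n.+1 = Some f -> Some (dE e) = rE f;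
  wf_0 : ed 0%N = None -> r <> None }.

(** The ultrafilter of [B] at the [n]-th vertex; it is empty past the end of the path, and also at 0
    when the range is the extra point. *)
Definition lev (n : nat) : set B :=
  if n is m.+1 then (if ed m is Some e then set_val (dE e) else set0)
  else oset r.

End RawPaths.

Arguments tagE {d B L S} e.
Arguments oset {d B L S} r.

Section RawPrefix.
Context {d : Order.disp_t} {B : cbDistrLatticeType d} {L : choiceType}.
Variable S : gbds B L.
Implicit Types (al be u v w : seq L) (A C D : B) (r : Defs.F0 S)
  (ed : nat -> option (Defs.E1 S)).

Local Notation wact := (Defs.wact S).
Local Notation widl := (Defs.widl S).
Local Notation ultra := (Defs.ultra S).

Fixpoint pre ed al : Prop :=
  if al is a :: al' then omap tagE (ed 0%N) = Some a /\ pre (fun n => ed n.+1) al'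
  else True.

Lemma pre_cat ed u v :
  pre ed (u ++ v) <-> pre ed u /\ pre (fun n => ed (size u + n)%N) v.
Proof.
elim: u ed => [|a u IH] ed /=; first by split=> // -[].
by rewrite IH; split=> [[? [? ?]]|[[? ?] ?]].
Qed.

Lemma pre_fun ed u v : pre ed u -> pre ed v -> size u = size v -> u = v.
Proof.
elim: u v ed => [|a u IH] [|b v] //= ed [ea pu] [eb pv] [suv].
by congr cons; [move: ea; rewrite eb => -[]|exact: IH pu pv suv].
Qed.

Lemma pre_comparable ed u v : pre ed u -> pre ed v ->
  (exists w, v = u ++ w) \/ (exists w, u = v ++ w).
Proof.
move=> pu pv; have [le|/ltnW le] := leqP (size u) (size v).
  left; exists (drop (size u) v); rewrite -[LHS](cat_take_drop (size u)).
  congr (_ ++ _); move: pv; rewrite -{1}(cat_take_drop (size u) v) => /pre_cat[pv _].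
  by apply: pre_fun pv pu _; rewrite size_takel.
right; exists (drop (size v) u); rewrite -[LHS](cat_take_drop (size v)).
congr (_ ++ _); move: pu; rewrite -{1}(cat_take_drop (size v) u) => /pre_cat[pu _].
by apply: pre_fun pu pv _; rewrite size_takel.
Qed.

Lemma pre_exists ed n : (forall n, ed n = None -> ed n.+1 = None) ->
  (if n is m.+1 then ed m <> None else True) -> exists2 u, pre ed u & size u = n.
Proof.
elim: n ed => [|n IH] ed step h; first by exists [::].
case e0 : (ed 0%N) => [e|]; last first.
  by exfalso; apply: h; elim: {IH} n => // n IH; apply: step.
have [|u pu su] := IH (fun n => ed n.+1) (fun n => step n.+1); first by case: (n) h.
by exists (tagE e :: u); rewrite /= ?su // e0.
Qed.

Lemma pre_last ed u a : pre ed (rcons u a) <->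
  pre ed u /\ omap tagE (ed (size u)) = Some a.
Proof. by rewrite -cats1 pre_cat /= addn0; split=> [[? []]|[? ?]]. Qed.

Variables (r : Defs.F0 S) (ed : nat -> option (Defs.E1 S)).
Hypothesis wf : wf_path r ed.

Lemma lev_step n e A : ed n = Some e ->
  lev r ed n A <-> lev r ed n.+1 (act S (tagE e) A).
Proof.
move=> en; rewrite /= en -oset_rE; case: n en => [|n] en.
  by rewrite /= (wf_r wf en).
rewrite /=; case en' : (ed n) => [f|]; last by have := wf_step wf en'; rewrite en.
by rewrite -(wf_d wf en' en).
Qed.

Lemma lev_ultra n A : lev r ed n A -> ultra [::] (lev r ed n).
Proof.
case: n => [|n] /=; first by case: (r) => [v|//] _; exact: XspP.
by case: (ed n) => [e|//] _; exact: XspP.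
Qed.

(** Each vertex is the pullback of any later one along the labels in between, so the last vertex of
    a segment determines all the earlier ones. *)
Lemma lev_cat n be A : pre (fun k => ed (n + k)%N) be ->
  lev r ed n A <-> lev r ed (n + size be)%N (wact be A).
Proof.
elim: be n A => [|a be IH] n A /=; first by rewrite addn0.
rewrite addn0; case en : (ed n) => [e|] [] //= [ea] pbe.
rewrite (lev_step A en) ea IH ?addnS //.
by move: pbe; congr pre; apply/funext => k; rewrite addnS.
Qed.

(** An element of the ideal at the source of the first edge is pushed along the other labels. The
    empty word is excluded because level 0 may be empty. *)
Lemma lev_widl al : al <> [::] -> pre ed al ->
  exists2 A, lev r ed (size al) A & widl al A.
Proof.
case: al => [//|a al] _ /= [ea pal].
case en : (ed 0%N) ea => [e|] //= [ea]; have [A FA IA] := dE_idl e.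
exists (wact al A); last by exists A; rewrite // -ea.
by have := lev_cat (n := 1) A pal; rewrite [lev _ _ 1]/= en => -[+ _]; apply.
Qed.

Definition rcyl al A := [/\ pre ed al, lev r ed (size al) A & widl al A].

Lemma rcyl_up al A C : widl al C -> (A <= C)%O -> rcyl al A -> rcyl al C.
Proof.
move=> wC sAC [p l w]; split=> //; exact: ultra_upward (lev_ultra l) _ l sAC.
Qed.

Lemma rcylI al A C : rcyl al A -> rcyl al C -> rcyl al (A `&` C)%O.
Proof.
move=> [p lA wA] [_ lC _]; split=> //; first exact: ultraI (lev_ultra lA) lA lC.
exact: widl_le (leIl _ _) wA.
Qed.

Lemma rcyl_cut al A C : rcyl al A -> rcyl al (A `&` C)%O \/ rcyl al (A `\` C)%O.
Proof.
move=> [p l w]; have [h|h] := ultra_cut C (lev_ultra l) l; [left|right].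
  by split=> //; exact: widl_le (leIl _ _) w.
by split=> //; exact: widl_le (leBx _ _) w.
Qed.

Lemma rcyl0 al : ~ rcyl al \bot%O.
Proof. by move=> [_ l _]; exact: ultra_bot (lev_ultra l) l. Qed.

(** A condition at a prefix can be imposed at any longer prefix, so that several conditions on a
    path can be tested at one vertex. *)
Lemma rcyl_cat al be A C : rcyl (al ++ be) A ->
  (rcyl al C <-> rcyl (al ++ be) (A `&` wact be C)%O /\ widl al C).
Proof.
move=> [/pre_cat[pal pbe] lA wA]; have uA := lev_ultra lA.
have e := lev_cat C pbe; rewrite -size_cat in e.
split=> [[_ lC wC]|[[_ lAC _] wC]]; last first.
  split=> //; apply/e; exact: ultra_upward uA _ lAC (leIr _ _).
split=> //; split; first exact/pre_cat.
  by apply: ultraI uA lA _; apply/e.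
exact: widl_le (leIl _ _) wA.
Qed.

Lemma rcyl_shorten al be A C : rcyl (al ++ be) A -> widl al C ->
  (A <= wact be C)%O -> rcyl al C.
Proof.
move=> h wC /meet_idPl e; apply/(rcyl_cat C h); rewrite e; split=> //.
Qed.

End RawPrefix.

(** * Subbases, neighbourhood bases and compactness *)

Definition is_subbase (T : topologicalType) (D : set (set T)) : Prop :=
  (forall U, D U -> open U) /\
  forall (x : T) (F : set_system T), Filter F ->
    (forall U, D U -> U x -> F U) -> F --> x.

(** The sets of [P] generate a filter that contains every subbasic neighbourhood of [x], hence
    converges to [x]. All neighbourhood bases below are obtained this way. *)
Lemma subbase_nbhs (T : topologicalType) (D : set (set T)) (P : set (set T)) (x : T) :
  is_subbase D -> P !=set0 ->
  (forall U, P U -> open U /\ U x) ->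
  (forall U V, P U -> P V -> exists W, [/\ P W, W `<=` U & W `<=` V]) ->
  (forall U, D U -> U x -> exists2 W, P W & W `<=` U) ->
  forall W, nbhs x W -> exists2 U, P U & U `<=` W.
Proof.
move=> [_ sD] Pne Pop PI PD W.
have FF : Filter (filter_from P id).
  apply: filter_from_filter => // U V PU PV.
  by have [Z [PZ ZU ZV]] := PI _ _ PU PV; exists Z => // y Zy; split; [exact: ZU|exact: ZV].
move=> xW; have := sD x (filter_from P id) FF; apply; last exact: xW.
by move=> U DU Ux; have [Z PZ ZU] := PD _ DU Ux; exists Z.
Qed.

Ltac prove_subbase_open :=
  let U := fresh in let DU := fresh in
  move=> U DU; exists [set U]; last (by rewrite bigcup_set1);
  move=> _ ->; exists [fset U]%fset; last (by rewrite set_fset1 bigcap_set1);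
  move=> ?; rewrite in_fset1 => /eqP ->; exact: mem_set.

Ltac prove_subbase_cvg :=
  let F := fresh in let DF := fresh in let W := fresh in let C := fresh in
  let V := fresh in let sC := fresh in let CV := fresh in let Vx := fresh in
  let sub := fresh in let E := fresh in let sE := fresh in let IE := fresh in
  let Z := fresh in let EZ := fresh in
  move=> ? F ? DF W;
  rewrite nbhsE => -[_ [[C sC <-] [V CV Vx] sub]];
  rewrite nbhs_filterE; apply: filterS sub _; apply: (@filterS _ _ _ V);
  [ by move=> ? ?; exists V | ];
  have [E sE IE] := sC _ CV; rewrite -IE; apply: filter_bigI => Z EZ;
  apply: DF; [ exact: set_mem (sE _ EZ) | by move: Vx; rewrite -IE; apply ].

Ltac prove_subbase := split; [ prove_subbase_open | prove_subbase_cvg ].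

(** Without a finite subcover, the complements in [K] of finite unions generate a proper filter, and
    its cluster point would lie in no [f i]. *)
Lemma compact_subcover (T : topologicalType) (K : set T) (I : eqType) (f : I -> set T) :
  compact K -> (forall i, open (f i)) -> (forall x, K x -> exists i, f i x) ->
  exists s : seq I, forall x, K x -> exists2 i, i \in s & f i x.
Proof.
move=> cK fo fK; apply: contrapT => nfin.
pose F := filter_from [set: seq I]
  (fun s => K `&` [set x | forall i, i \in s -> ~ f i x]).
have PF : ProperFilter F.
  apply: filter_from_proper.
    apply: filter_from_filter; first by exists [::].
    move=> s t _ _; exists (s ++ t) => // x [Kx nx]; split; split=> // i si; apply: nx.
      by rewrite mem_cat si.
    by rewrite mem_cat si orbT.
  move=> s _; apply: contrapT => ne; apply: nfin; exists s => x Kx.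
  apply: contrapT => nx; apply: ne; exists x; split=> // i si fix_.
  by apply: nx; exists i.
have [|x [Kx clx]] := cK F PF; first by exists [::] => // x [].
have [i fi] := fK x Kx.
have [||y [[_ ny] fy]] := clx (K `&` [set x | forall j, j \in [:: i] -> ~ f j x]) (f i).
- by exists [:: i].
- by apply: open_nbhs_nbhs; split.
by apply: (ny i) => //; rewrite inE.
Qed.

(** * Topology of path spaces *)

Section Subbases.
Context {d : Order.disp_t} {B : cbDistrLatticeType d} {L : choiceType}.
Variable S : gbds B L.

Lemma Xsp_subbase w : @is_subbase (Xsp S w)
  [set U | exists2 A, widl S w A & U = [set F : Xsp S w | set_val F A]].
Proof. prove_subbase. Qed.

Lemma bpath_subbase : @is_subbase (bpath S)
  [set W | exists U K : set (Estar S), [/\ open U, compact K &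
             W = cylinder U `&` ~` cylinder K]].
Proof. prove_subbase. Qed.

Lemma RD_subbase (X : topologicalType) (D : set X) (f : X -> X) :
  @is_subbase (RD_arrow D f)
  [set W | exists m n U V,
     [/\ open U /\ open V, U `<=` iter_dom D f m /\ V `<=` iter_dom D f n,
         set_inj U (iter m f) /\ set_inj V (iter n f)
       & W = [set t : RD_arrow D f | RD_basic f m n U V (set_val t)]]].
Proof. prove_subbase. Qed.

Lemma Gamma_subbase : @is_subbase (Gamma_arrow S)
  [set W | exists mu A nu e es,
     [/\ invsg S (Some (mu, A, nu)), idem S e, forall e', e' \in es -> idem S e'
       & W = [set t : Gamma_arrow S | Gamma_basic mu nu e es (set_val t)]]].
Proof. prove_subbase. Qed.

Definition Zsp w A : set (Xsp S w) := [set F | set_val F A].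

Lemma Zsp_open w A : widl S w A -> open (Zsp (w := w) A).
Proof. by move=> wA; apply: (Xsp_subbase w).1; exists A. Qed.

Lemma Xsp_nbhs w (F : Xsp S w) W : nbhs F W ->
  exists A, [/\ set_val F A, widl S w A & Zsp A `<=` W].
Proof.
have uF := XspP F.
move=> /(subbase_nbhs (P := [set U | exists A, set_val F A /\ U = Zsp A])
  (Xsp_subbase w))[].
- by have [A FA] := ultra_ne uF; exists (Zsp A), A.
- move=> _ [A [FA ->]]; split=> //; apply: Zsp_open; exact: ultra_widl FA.
- move=> _ _ [A [FA ->]] [C [FC ->]]; exists (Zsp (A `&` C)%O); split.
  + by exists (A `&` C)%O; split=> //; exact: ultraI uF FA FC.
  + move=> G /= GAC; apply: (ultra_upward (XspP G) _ GAC); last exact: leIl.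
    exact: ultra_widl FA.
  + move=> G /= GAC; apply: (ultra_upward (XspP G) _ GAC); last exact: leIr.
    exact: ultra_widl FC.
- by move=> _ [A wA ->] /= FA; exists (Zsp A) => //; exists A.
by move=> _ [A [FA ->]] sub; exists A; split=> //; exact: ultra_widl FA.
Qed.

Lemma ultrafilter_compact (T : topologicalType) (K : set T) :
  (forall F : set_system T, UltraFilter F -> F K -> exists2 x, K x & F --> x) ->
  compact K.
Proof.
rewrite compact_ultra => h F UF FK; have [x Kx Fx] := h F UF FK.
by exists x; split.
Qed.

(** An ultrafilter [F] of sets of points yields the family [G] of those [C] whose basic set belongs
    to [F]; [G] is an ultrafilter of the ideal, and [F] converges to it. *)
Lemma Zsp_compact w A : widl S w A -> compact (Zsp (w := w) A).
Proof.
move=> wA; apply: ultrafilter_compact => F UF FA.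
pose G := [set C | widl S w C /\ F (Zsp (w := w) C)].
have uG : ultra S w G.
  apply: ultra_intro.
  - by move=> C [].
  - by exists A.
  - move=> [_ F0]; have [x] := filter_ex F0; exact: ultra_bot (XspP x).
  - move=> C D [wC FC] wD CD; split=> //; apply: filterS FC => x xC.
    exact: ultra_upward (XspP x) wD xC CD.
  - move=> C D [wC FC] [wD FD]; split; first exact: widl_le (leIl _ _) wC.
    by apply: filterS (filterI FC FD) => x [xC xD]; exact: ultraI (XspP x) xC xD.
  - move=> C D [wC FC] wD.
    have w1 : widl S w (C `&` D)%O by exact: widl_le (leIl _ _) wC.
    have w2 : widl S w (C `\` D)%O by exact: widl_le (leBx _ _) wC.
    have [FD|FD] := in_ultra_setVsetC (Zsp (w := w) (C `&` D)%O) UF; [by left|right].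
    split=> //; apply: filterS (filterI FC FD) => x [xC /= xD].
    by have [//|] := ultra_cut D (XspP x) xC.
exists (mkX uG); first by split.
apply: (Xsp_subbase w).2 => _ [C wC ->] /= []; exact.
Qed.

End Subbases.

(** * The edge space and regular vertices *)

Section Edges.
Context {d : Order.disp_t} {B : cbDistrLatticeType d} {L : choiceType}.
Variable S : gbds B L.

Local Notation E0 := (Defs.E0 S).
Local Notation E1 := (Defs.E1 S).
Local Notation F0 := (Defs.F0 S).
Implicit Types (e f : E1) (v w : E0) (A C : B).

Lemma dE_mem e A : idl S (tagE e) A ->
  set_val (dE e) A <-> set_val (projT2 e) A.
Proof.
move=> IA; split=> [[C FC CA]|h]; last by exists A.
by apply: (ultra_upward (XspP (projT2 e)) _ FC CA); exact/widl1.
Qed.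

Definition Z1 a A : set E1 := [set e | tagE e = a /\ set_val (dE e) A].

Lemma Z1E a A : idl S a A -> Z1 a A = existT _ a @` Zsp (S := S) (w := [:: a]) A.
Proof.
move=> IA; apply/seteqP; split=> [e [ea eA]|_ [eta etaA <-]].
  case: e ea eA => b eta; rewrite /tagE /= => ba; subst b => /(dE_mem (e := existT _ a eta) IA) h.
  by exists eta.
by split=> //; apply/dE_mem.
Qed.

Lemma Z1_open a A : idl S a A -> open (Z1 a A).
Proof.
move=> IA; rewrite Z1E //; apply: existT_open_map.
by apply: Zsp_open; exact/widl1.
Qed.

Lemma Z1_compact a A : idl S a A -> compact (Z1 a A).
Proof.
move=> IA; rewrite Z1E //; apply: continuous_compact.
  by apply: continuous_subspaceT => x U.
by apply: Zsp_compact; exact/widl1.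
Qed.

Lemma E1_nbhs e W : nbhs e W ->
  exists A, [/\ idl S (tagE e) A, set_val (dE e) A & Z1 (tagE e) A `<=` W].
Proof.
case: e => a eta; rewrite /nbhs /= => /Xsp_nbhs[A [etaA wA sub]].
have IA : idl S a A by apply/widl1.
exists A; split=> //; first exact/(dE_mem (e := existT _ a eta)).
by rewrite /tagE /= Z1E // => _ [z zA <-]; exact: sub.
Qed.

Definition ZF A : set F0 := [set r | oset r A].

Lemma ZF_open A : open (ZF A).
Proof.
split=> //=; rewrite (_ : Some @^-1` _ = Zsp (S := S) (w := [::]) A) //.
exact: Zsp_open.
Qed.

Lemma F0_nbhs v W : nbhs (Some v : F0) W ->
  exists2 A, set_val v A & ZF A `<=` W.
Proof.
rewrite nbhsE => -[U [[oU _] Uv] UW].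
have : nbhs v (Some @^-1` U) by exact: open_nbhs_nbhs.
by move=> /Xsp_nbhs[A [vA _ sub]]; exists A => // -[w|//] wA; apply: UW; exact: sub.
Qed.

Lemma rE_ZF A : @rE _ _ _ S @^-1` ZF A = [set e | set_val (dE e) (act S (tagE e) A)].
Proof. by apply/seteqP; split=> e /oset_rE. Qed.

Lemma edge_exists a A : act S a A != \bot%O -> exists2 e : E1, tagE e = a & oset (rE e) A.
Proof.
move=> /(ultra_exists (widl1_act S a A))[eta [ueta etaA]].
exists (existT _ a (mkX ueta)) => //; apply/oset_rE/dE_mem => //.
exact: (act_idl (lexx _)).
Qed.

Lemma rE_ZF_act A e : oset (rE e) A -> act S (tagE e) A != \bot%O.
Proof.
move=> /oset_rE h; apply/eqP => h0; rewrite h0 in h.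
exact: ultra_bot (XspP (dE e)) h.
Qed.

(** If a regular [A] lies in [v], the edges with range in [ZF A] form finitely many compact sheets,
    and every point of [ZF A] is a limit of ranges. Conversely, near a vertex in [F0rg] all points
    are limits of ranges, which gives each nonempty [C] a letter, and compactness of the preimage
    leaves finitely many letters. *)
Lemma E0sgP v : E0sg v <-> forall A, set_val v A -> ~ regular_elt S A.
Proof.
split=> [sg A vA rA|nreg [[V vV cV] ncl]].
  have nbA : nbhs (Some v : F0) (ZF A).
    by apply: open_nbhs_nbhs; split=> //; exact: ZF_open.
  apply: sg; split.
    exists (ZF A) => //.
    have [A0|An0] := eqVneq A \bot%O.
      by rewrite A0 in vA; case: (ultra_bot (XspP v) vA).
    have [_ /finite_setP fin] := rA A An0 (lexx _).
    have -> : @rE _ _ _ S @^-1` ZF A = \bigcup_(a in Delta S A) Z1 a (act S a A).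
      rewrite rE_ZF; apply/seteqP; split=> [e eA|e [a _ [<-]]] //.
      exists (tagE e) => //; apply: rE_ZF_act; exact/oset_rE.
    have /finite_setP := fin; move=> /finite_setP finD.
    rewrite -bigsetU_fset_set //; apply: bigsetU_compact => a _.
    by apply: Z1_compact; exact: (act_idl (lexx _)).
  move=> cl; have [[w|] [nw //= wA]] := cl _ nbA.
  apply: nw => U /F0_nbhs[C wC CU].
  have wAC := ultraI (XspP w) wA wC.
  have AC0 : (A `&` C)%O != \bot%O.
    by apply/eqP => h; rewrite h in wAC; exact: ultra_bot (XspP w) wAC.
  have [[a /edge_exists[e ea eAC]] _] := rA _ AC0 (leIl _ _).
  exists (rE e); split; first by exists e.
  apply: CU; apply/oset_rE; move/oset_rE: eAC => eAC.
  by apply: (ultra_upward (XspP (dE e)) _ eAC) => //; apply: act_le; exact: leIr.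
have [U vU Usce] : exists2 U, nbhs (Some v : F0) U & U `&` F0sce (S := S) `<=` set0.
  apply: contrapT => h; apply: ncl => U vU; apply: contrapT => h'; apply: h.
  by exists U => // w [Uw sw]; apply: h'; exists w.
have [A vA AUV] := F0_nbhs (filterI vU vV).
apply: (nreg A vA) => C C0 CA.
have [G [uw wC]] : exists G, ultra S [::] G /\ G C by exact: ultra_exists.
have wA : G A by exact: ultra_upward uw _ wC CA.
have cw : closure (range (@rE _ _ _ S)) (Some (mkX uw) : F0).
  apply: contrapT => ncw; apply: (Usce (Some (mkX uw))); split=> //.
  by have [] := AUV (Some (mkX uw)) wA.
split.
  have [|r [[e _ <-] eC]] := cw (ZF C).
    by apply: open_nbhs_nbhs; split=> //; exact: ZF_open.
  by exists (tagE e); exact: rE_ZF_act.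
(* The preimage of [ZF A] is closed: an edge outside it with label [a] has the neighbourhood [Z1] of
   [D] minus [act S a A], which misses it. *)
have cK : compact (@rE _ _ _ S @^-1` ZF A).
  apply: subclosed_compact cV _; last by move=> e /AUV[].
  rewrite rE_ZF => e ce.
  apply: contrapT => /= neA; have [D eD ID] := dE_idl e.
  have [eDA|eDA] := ultra_cut (act S (tagE e) A) (XspP (dE e)) eD.
    by apply: neA; exact: (ultra_upward (XspP (dE e)) (I : widl S [::] _) eDA (leIr _ _)).
  have [|g [/= gA [ge gD]]] := ce (Z1 (tagE e) (D `\` act S (tagE e) A)%O).
    apply: open_nbhs_nbhs; split=> //; apply: Z1_open.
    by apply: idl_le ID; exact: leBx.
  rewrite ge in gA; apply: (ultra_bot (XspP (dE g))).
  by rewrite -(diffIK D (act S (tagE e) A)) meetC; exact: ultraI (XspP (dE g)) gA gD.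
have [||D sD] := compact_subcover (f := fun a => [set e | tagE e = a]) cK.
- move=> a; rewrite openE => e /= ea; have [D eD ID] := dE_idl e.
  apply: (@filterS _ _ _ (Z1 (tagE e) D)); first by rewrite ea => f [].
  by apply: open_nbhs_nbhs; split=> //; exact: Z1_open.
- by move=> e _; exists (tagE e).
apply: (sub_finite_set _ (finite_seq D)) => a /= aC.
have [e ea eC] := edge_exists aC.
have [|b bD eb] := sD e; last by rewrite -ea eb.
apply/oset_rE; move/oset_rE : eC => eC.
by apply: (ultra_upward (XspP (dE e)) _ eC) => //; exact: act_le.
Qed.

End Edges.

(** * Boundary paths in raw form *)

Section Paths.
Context {d : Order.disp_t} {B : cbDistrLatticeType d} {L : choiceType}.
Variable S : gbds B L.

Local Notation E1 := (Defs.E1 S).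
Local Notation F0 := (Defs.F0 S).
Local Notation Estar := (Defs.Estar S).
Local Notation bpath := (Defs.bpath S).
Implicit Types (q : Estar) (x y : bpath) (A C : B).

Lemma path_edge_lt q i : (i < path_length q)%N <-> path_edge q i <> None.
Proof.
case: q => [[|n] e] /=; first by split.
by case: insubP => [j -> _|/negbTE ->]; split.
Qed.

Lemma path_edge_ord n (e : Epath S n.+1) (i : 'I_n.+1) :
  path_edge (existT _ n.+1 e) i = Some (set_val e i).
Proof. by rewrite /= valK. Qed.

Lemma path_wf q : wf_path (path_r q) (path_edge q).
Proof.
case: q => [[|n] e]; split => //=.
- move=> i; case: insubP => //= ni _; rewrite insubF //.
  by apply/negbTE; apply: contra ni; exact: ltnW.
- move=> f; rewrite (_ : insub 0%N = Some ord0) => [[<-]//|].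
  by rewrite -[0%N]/(nat_of_ord (@ord0 n)) valK.
- move=> i f g; case: insubP => //= j _ ji [<-]; case: insubP => //= k _ ki [<-].
  by apply: (@set_valP _ _ e); rewrite ji ki.
- by rewrite -[0%N]/(nat_of_ord (@ord0 n)) valK.
Qed.

Lemma path_lev_end q : lev (path_r q) (path_edge q) (path_length q) = set_val (path_d q).
Proof.
case: q => [[|n] e] //=.
by rewrite -[n]/(nat_of_ord (@ord_max n)) valK.
Qed.

Lemma path_ext q q' : path_length q = path_length q' -> path_r q = path_r q' ->
  (forall i, path_edge q i = path_edge q' i) -> q = q'.
Proof.
case: q q' => [n e] [m f] /= nm; subst m; case: n e f => [|n] e f rr ed.
  by congr existT; case: rr.
congr existT; apply: val_inj; apply/funext => i.
by have /= := ed i; rewrite !valK /= => -[].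
Qed.

Lemma path_exists (r : F0) ed n : wf_path r ed -> ed n = None ->
  (forall m, (m < n)%N -> ed m <> None) ->
  exists q, [/\ path_length q = n, path_r q = r & path_edge q = ed].
Proof.
move=> wf edn lt; have ge m : (n <= m)%N -> ed m = None.
  elim: m => [|m IH]; first by rewrite leqn0 => /eqP <-.
  rewrite leq_eqVlt => /orP[/eqP <- //|nm]; exact: (wf_step wf (IH nm)).
case: n edn lt ge => [|n] edn lt ge.
  case: r wf => [v|] wf; last by have := wf_0 wf edn.
  exists (existT _ 0%N v); split=> //=; apply/funext => i; by rewrite ge.
case e0 : (ed 0%N) => [e|]; last by have := lt 0%N isT.
pose g (i : 'I_n.+1) : E1 := odflt e (ed i).
have gE i : ed (nat_of_ord i) = Some (g i).
  by rewrite /g; case ei : (ed i) => [f|] //; have := lt i (ltn_ord i).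
have gP : @Epos _ _ _ S n g.
  by move=> i j ij; apply: (wf_d wf (gE i)); rewrite -ij.
exists (existT _ n.+1 (mkset gP)); split=> //=.
  by symmetry; exact: (wf_r wf (gE ord0)).
apply/funext => i /=; have [ni|ni] := ltnP i n.+1; last first.
  by rewrite insubN ?ge // -leqNgt.
by rewrite (insubT (fun k => k < n.+1)%N ni) /= [RHS](gE (Ordinal ni)).
Qed.

Lemma bpath_wf x : wf_path (bpath_r x) (bpath_edge x).
Proof.
case: x => [m|e]; first exact: path_wf.
split=> //=; first by move=> f [<-].
by move=> n f g [<-] [<-]; exact: (@set_valP _ _ e).
Qed.

(** The boundary condition in raw form, through [E0sgP]; [bpath_exists] is the converse
    construction. *)
Lemma bpath_singular x n A : bpath_edge x n = None ->
  lev (bpath_r x) (bpath_edge x) n A -> ~ regular_elt S A.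
Proof.
case: x => [m|e] //= en lA.
have : E0sg (path_d (set_val m)) by exact: (@set_valP _ _ m).
move=> /E0sgP; apply; rewrite -path_lev_end.
set q := set_val m in en lA *.
suff -> : path_length q = n by [].
apply/eqP; rewrite eqn_leq; apply/andP; split.
  by rewrite leqNgt; apply/negP => /path_edge_lt; rewrite en.
case: n en lA => // n en /=; case en' : (path_edge q n) => [f|] // _.
by apply/path_edge_lt; rewrite en'.
Qed.

Lemma bpath_ext x y : bpath_r x = bpath_r y ->
  (forall i, bpath_edge x i = bpath_edge y i) -> x = y.
Proof.
have no (m : set_type (@finbd _ _ _ S)) (e : set_type (@Einf _ _ _ S)) :
    ~ (forall i, bpath_edge (inl m) i = bpath_edge (inr e) i).
  move=> /(_ (path_length (set_val m))) /= h.
  have : ~ (path_length (set_val m) < path_length (set_val m))%N by rewrite ltnn.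
  by move=> /path_edge_lt; rewrite h; apply.
case: x y => [m|e] [m'|e'] rr h.
- congr inl; apply: val_inj; apply: path_ext => //.
  apply/eqP; rewrite eqn_leq; apply/andP; split; rewrite leqNgt; apply/negP.
    by move=> /path_edge_lt; rewrite [path_edge _ _]h => /path_edge_lt; rewrite ltnn.
  by move=> /path_edge_lt; rewrite -[path_edge _ _]h => /path_edge_lt; rewrite ltnn.
- by case: (no _ _ h).
- by case: (@no m' e) => i.
- by congr inr; apply: val_inj; apply/funext => i; have [] := h i.
Qed.

Lemma bpath_exists (r : F0) ed : wf_path r ed ->
  (forall n A, ed n = None -> lev r ed n A -> ~ regular_elt S A) ->
  exists x, bpath_r x = r /\ bpath_edge x = ed.
Proof.
move=> wf sg; have [[n edn]|inf] := pselect (exists n, ed n = None).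
  have ex : exists n, ~~ ed n by exists n; rewrite edn.
  case: (ex_minnP ex) => {}n {}edn nmin.
  have edN : ed n = None by case: (ed n) edn.
  have [m mn e0|q [ql qr qe]] := path_exists wf edN.
    by have := nmin m; rewrite e0 => /(_ isT); rewrite leqNgt mn.
  have qd : finbd q.
    apply/E0sgP => A; rewrite -path_lev_end ql qr qe; exact: sg.
  by exists (inl (mkset qd)).
have {}inf n : {e | ed n = Some e}.
  by case e : (ed n) => [f|]; [exists f|case: inf; exists n].
pose g n := projT1 (inf n).
have gE n : ed n = Some (g n) by exact: (projT2 (inf n)).
have gP : @Einf _ _ _ S g by move=> i; exact: (wf_d wf (gE i) (gE i.+1)).
exists (inr (mkset gP)); split=> /=; first by rewrite (wf_r wf (gE 0%N)).
by apply/funext => i; rewrite gE.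
Qed.

Lemma path_edge_shift q i : (0 < path_length q)%N ->
  path_edge (path_shift q) i = path_edge q i.+1.
Proof.
case: q => [[|[|n]] e] //= _; first by rewrite insubF.
case: insubP => [j ji <-|ni] /=; last by rewrite insubF //; exact: negbTE.
rewrite (_ : (nat_of_ord j).+1 = nat_of_ord (lift ord0 j)) //.
by rewrite valK.
Qed.

Lemma sigmaE_edge x i : sigmaE_dom S x ->
  bpath_edge (sigmaE S x) i = bpath_edge x i.+1.
Proof. by case: x => [m|e] //= /path_edge_shift. Qed.

Lemma sigmaE_domP x : sigmaE_dom S x <-> bpath_edge x 0%N <> None.
Proof. by case: x => [m|e] //=; exact: path_edge_lt. Qed.

Lemma path_r_shift q e : path_edge q 0%N = Some e ->
  path_r (path_shift q) = Some (dE e).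
Proof.
case: q => [[|[|n]] p] //=.
  by rewrite -[0%N]/(nat_of_ord (@ord0 0)) valK /= => -[<-].
rewrite -[0%N]/(nat_of_ord (@ord0 n.+1)) valK /= => -[<-].
by symmetry; exact: (@set_valP _ _ p ord0).
Qed.

Lemma sigmaE_r x e : bpath_edge x 0%N = Some e -> bpath_r (sigmaE S x) = Some (dE e).
Proof.
case: x => [m|f] /=; first exact: path_r_shift.
by move=> [<-]; symmetry; exact: (@set_valP _ _ f 0%N).
Qed.

Lemma begins_withP x q : begins_with x q <->
  (forall i, (i < path_length q)%N -> bpath_edge x i = path_edge q i) /\
  (path_length q = 0%N -> bpath_r x = path_r q).
Proof.
case: q => [[|n] e] /=; first by split=> [->|[_ ->]].
split=> [h|[h _] i]; last by rewrite h // valK.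
split=> // i ni; have := h (Ordinal ni) => /= ->.
by rewrite (insubT (fun k => k < n.+1)%N ni).
Qed.

End Paths.

(** * Recovering a path from its labels and its last vertex *)

Section WordOfPath.
Context {d : Order.disp_t} {B : cbDistrLatticeType d} {L : choiceType}.
Variable S : gbds B L.
Implicit Types (al be u v w : seq L) (A C D : B) (F G : set B).

Lemma wactB w A C : wact S w (A `\` C)%O = (wact S w A `\` wact S w C)%O.
Proof.
elim: w A C => [//|a w IH] A C; rewrite /wact /=.
by have [_ _ _ ->] := act_action S a; exact: IH.
Qed.

Lemma ultra_pull_word w G A : ultra S [::] G -> G (wact S w A) ->
  ultra S [::] [set C | G (wact S w C)].
Proof.
move=> uG GA; apply: ultra_intro => //=.
- by exists A.
- by rewrite wact0; exact: ultra_bot uG.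
- by move=> C D GC _ CD; apply: (ultra_upward uG _ GC) => //; exact: wact_le.
- by move=> C D GC GD; rewrite wactI; exact: ultraI uG GC GD.
- by move=> C D GC _; rewrite wactI wactB; exact: ultra_cut uG GC.
Qed.

Lemma pre_onth (ed : nat -> option (E1 S)) al :
  pre ed al <-> forall i, (i < size al)%N -> omap tagE (ed i) = onth al i.
Proof.
elim: al ed => [|a al IH] ed /=; first by split.
rewrite IH; split=> [[e0 h] [|i] //|h]; first exact: h.
by split=> [|i ni]; [exact: (h 0%N)|exact: (h i.+1)].
Qed.

Lemma onth_Some (T : Type) (s : seq T) i : (i < size s)%N -> exists a, onth s i = Some a.
Proof. by rewrite -onthTE; case: onth => // a _; exists a. Qed.

Lemma drop_onth (T : Type) (s : seq T) i a : onth s i = Some a ->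
  drop i s = a :: drop i.+1 s.
Proof.
elim: s i => [//|b s IH] [|i] //=; first by move=> [->]; rewrite drop0.
exact: IH.
Qed.

Lemma pre_drop (ed : nat -> option (E1 S)) al i : (i <= size al)%N -> pre ed al ->
  pre (fun k => ed (i + k)%N) (drop i al).
Proof.
move=> ile; rewrite -{1}(cat_take_drop i al) => /pre_cat[_].
by rewrite size_takel.
Qed.

Lemma lev_drop r (ed : nat -> option (E1 S)) al i A : wf_path r ed ->
  (i <= size al)%N -> pre ed al ->
  lev r ed i A <-> lev r ed (size al) (wact S (drop i al) A).
Proof.
move=> wf ile p; rewrite (lev_cat wf A (pre_drop ile p)) size_drop subnKC //.
Qed.

(** All vertices are pulled back from the common last one, and an edge is determined by its label
    and its source. *)
Lemma raw_ext r r' (ed ed' : nat -> option (E1 S)) al :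
  wf_path r ed -> wf_path r' ed' -> pre ed al -> pre ed' al ->
  lev r ed (size al) = lev r' ed' (size al) ->
  r = r' /\ forall i, (i < size al)%N -> ed i = ed' i.
Proof.
move=> wf wf' p p' e.
have le i : (i <= size al)%N -> lev r ed i = lev r' ed' i.
  by move=> ile; apply/seteqP; split=> A; rewrite !(lev_drop A _ ile) // e.
split; first by apply: F0_ext; exact: le 0%N isT.
move=> i ilt; have := le i.+1 ilt.
move/pre_onth: p => /(_ i ilt); move/pre_onth: p' => /(_ i ilt).
have [a ->] := onth_Some ilt => /=.
case: (ed i) (ed' i) => [f|//] [g|//] [gt] [ft] h; congr Some.
by apply: E1_ext; rewrite ?ft.
Qed.

(** The path is traced backwards from [G]: its [i]-th vertex has to be the pullback [Fn i] along the
    remaining letters. That [A] lies in [widl al] ensures that each source meets the ideal of its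
    letter. *)
Lemma word_path al G A : ultra S [::] G -> G A -> widl S al A ->
  exists r (ed : nat -> option (E1 S)), [/\ wf_path r ed,
    forall i, (size al <= i)%N -> ed i = None, pre ed al & lev r ed (size al) = G].
Proof.
move=> uG GA wA; pose Fn i := [set C | G (wact S (drop i al) C)].
have main i : exists oe : option (E1 S), if onth al i is Some a then
    exists e, [/\ oe = Some e, tagE e = a & set_val (dE e) = Fn i.+1] else oe = None.
  case ai : (onth al i) => [a|]; last by exists None.
  have : widl S (a :: drop i.+1 al) A.
    rewrite -(drop_onth ai); apply: (@widl_suffix _ _ _ _ (take i al)).
    by rewrite cat_take_drop.
  move=> [C IC AC']; have GC : Fn i.+1 C by exact: ultra_upward uG _ GA AC'.
  have [e [te de]] := E1_exists (ultra_pull_word uG GC) GC IC.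
  by exists (Some e), e.
have [ed edP] := choice main.
have edge i : (i < size al)%N -> exists e, [/\ ed i = Some e, onth al i = Some (tagE e)
    & set_val (dE e) = Fn i.+1].
  move=> /onth_Some[a ai]; have := edP i; rewrite ai => -[e [ei ea ed']].
  by exists e; rewrite ea.
have edN i : (size al <= i)%N -> ed i = None.
  by move=> /onth_default ai; have := edP i; rewrite ai.
have osF (e : E1 S) i : onth al i = Some (tagE e) -> set_val (dE e) = Fn i.+1 ->
    oset (rE e) = Fn i.
  move=> ai de; have E C : oset (rE e) C <-> Fn i C.
    by rewrite oset_rE de /Fn /= (drop_onth ai); split.
  by apply/seteqP; split=> C /E.
(* For the empty word the path is the vertex [G]; otherwise the first edge dictates the range, which
   may be the extra point. *)
pose r : F0 S := if ed 0%N is Some e then rE e else Some (mkX uG).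
have rP e : ed 0%N = Some e -> r = rE e by rewrite /r => ->.
exists r, ed; split=> //.
- split.
  + move=> i; have [|ge _] := ltnP i (size al); first by move=> /edge[e [->]].
    by apply: edN; exact: leqW.
  + exact: rP.
  + move=> i e f ei fi; have [ni|ge] := ltnP i (size al); last by rewrite edN in ei.
    have [ni'|ge] := ltnP i.+1 (size al); last by rewrite edN in fi.
    have [e' [ei' _ de]] := edge _ ni; have [f' [fi' af df]] := edge _ ni'.
    rewrite ei in ei'; case: ei' => ee; subst e'.
    rewrite fi in fi'; case: fi' => ff; subst f'.
    by apply: F0_ext; rewrite (osF _ _ af df) /= de.
  + by rewrite /r => ->.
- apply/pre_onth => i ni; have [e [-> -> _]] := edge _ ni; by [].
- case e : (size al) => [|n] /=.
    by rewrite /r edN ?e.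
  have [|f [-> _ ->]] := edge n; first by rewrite e.
  by rewrite /Fn -e drop_size; apply/seteqP; split.
Qed.

End WordOfPath.

(** * Compact open sets of finite paths *)

Section PathNeighbourhoods.
Context {d : Order.disp_t} {B : cbDistrLatticeType d} {L : choiceType}.
Variable S : gbds B L.
Local Notation E1 := (Defs.E1 S).
Local Notation F0 := (Defs.F0 S).
Local Notation Estar := (Defs.Estar S).
Local Notation bpath := (Defs.bpath S).
Implicit Types (q : Estar) (x y : bpath) (A C : B) (al : seq L).

(** Testing only the last vertex loses nothing, as the earlier ones are its pullbacks; these sets
    are a base of compact open sets of finite paths. *)
Definition Q al A : set Estar :=
  [set q | path_length q = size al /\ rcyl (path_r q) (path_edge q) al A].

Lemma Q_word q : exists al A, Q al A q.
Proof.
have wf := path_wf q.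
have [||al p sa] := @pre_exists _ _ _ S (path_edge q) (path_length q).
- exact: wf_step wf.
- case e : (path_length q) => [//|n].
  by apply/path_edge_lt; rewrite e.
have [A lA wA] : exists2 A, lev (path_r q) (path_edge q) (size al) A & widl S al A.
  have [a0|an] := eqVneq al [::]; last by apply: lev_widl => //; exact/eqP.
  rewrite a0 in sa *; case: q sa {wf p} => [[|n] e] //= _.
  by have [A vA] := ultra_ne (XspP e); exists A.
by exists al, A; split.
Qed.

Lemma coord_continuous n (i : 'I_n.+1) :
  continuous (fun e : set_type (@Epos _ _ _ S n) => set_val e i).
Proof.
move=> e; apply: (@continuous_comp _ _ _
  (set_val : set_type (@Epos _ _ _ S n) -> {ptws 'I_n.+1 -> E1})
  (fun f : {ptws 'I_n.+1 -> E1} => f i)).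
  exact: initial_continuous.
exact: (@proj_continuous 'I_n.+1 (fun=> E1) i).
Qed.

Lemma Q_open al A : open (Q al A).
Proof.
rewrite openE => -[n e] [/= ne]; case: n e ne => [|n] e ne [p l wA].
  have a0 : al = [::] by case: (al) ne.
  subst al; rewrite /interior /nbhs /=.
  apply: (@filterS _ _ _ (Zsp (S := S) (w := [::]) A)).
    by move=> v vA; split.
  by apply: open_nbhs_nbhs; split=> //; exact: Zsp_open.
rewrite /interior /nbhs /=.
pose e0 : set_type (@Epos _ _ _ S n) := e.
have FF : Filter (nbhs e0) by exact: nbhs_filter.
(* Labels are locally constant because [E1] is a disjoint union over the letters; a condition on the
   last edge is then enough. *)
have h1 : \forall e' \near nbhs e0, forall i : 'I_n.+1, tagE (set_val e' i) = tagE (set_val e i).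
  apply: (@filter_forall _ _ (fun i (e' : set_type (@Epos _ _ _ S n)) => tagE (set_val e' i) = tagE (set_val e i)) _ FF) => i.
  have [D eD ID] := dE_idl (set_val e i).
  have nZ : nbhs (set_val e0 i) (Z1 (S := S) (tagE (set_val e i)) D).
    by apply: open_nbhs_nbhs; split=> //; exact: Z1_open.
  by apply: (@filterS _ _ FF _ _ _ (@coord_continuous n i e0 _ nZ)) => e' [].
have [a [u alE]] : exists a u, al = rcons u a.
  by case/lastP: (al) ne => // u a _; exists a, u.
have IA : idl S a A.
  by apply/widl1; apply: (@widl_suffix _ _ _ _ u); rewrite cats1 -alE.
have su : size u = n by move: ne; rewrite alE size_rcons => -[].
have h2 : \forall e' \near nbhs e0, set_val (dE (set_val e' ord_max)) A.
  have nZ : nbhs (set_val e0 ord_max) (Z1 (S := S) a A).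
    apply: open_nbhs_nbhs; split=> //; first exact: Z1_open.
    move: p; rewrite alE pre_last => -[_]; rewrite su.
    rewrite -[n]/(nat_of_ord (@ord_max n)) path_edge_ord => -[ta].
    split=> //; move: l; rewrite alE size_rcons su /=.
    by rewrite -[n]/(nat_of_ord (@ord_max n)) valK.
  by apply: (@filterS _ _ FF _ _ _ (@coord_continuous n ord_max e0 _ nZ)) => e' [].
apply: (@filterS2 _ _ FF _ _ _ _ h1 h2) => e' t' A'; split=> //; split=> //.
  apply/pre_onth => i ni; move/pre_onth: p => /(_ i ni) <-.
  have ni' : (i < n.+1)%N by rewrite [n.+1]ne.
  by have := t' (Ordinal ni'); rewrite /= (insubT (fun k => k < n.+1)%N ni') /= => ->.
rewrite alE size_rcons su /=.
by rewrite -[n]/(nat_of_ord (@ord_max n)) valK.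
Qed.

End PathNeighbourhoods.

Section PathCylinders.
Context {d : Order.disp_t} {B : cbDistrLatticeType d} {L : choiceType}.
Variable S : gbds B L.
Local Notation E1 := (Defs.E1 S).
Local Notation F0 := (Defs.F0 S).
Local Notation Estar := (Defs.Estar S).
Local Notation bpath := (Defs.bpath S).
Implicit Types (q : Estar) (x y : bpath) (A C : B) (al : seq L).
Local Notation Q := (@Q _ _ _ S).

Lemma Q_le al A C : (A <= C)%O -> widl S al C -> Q al A `<=` Q al C.
Proof.
move=> AC' wC q [sq h]; split=> //; exact: rcyl_up wC AC' h.
Qed.

Lemma Q_nbhs q al A0 W : Q al A0 q -> nbhs q W ->
  exists2 A, Q al A q & Q al A `<=` W.
Proof.
move=> Qq; pose F := filter_from [set A | Q al A q] (Q al).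
have wA0 : widl S al A0 by case: Qq => _ [].
have FF : Filter F.
  apply: filter_from_filter; first by exists A0.
  move=> A C [sq hA] [_ hC].
  have wA : widl S al A by case: hA.
  have wC : widl S al C by case: hC.
  exists (A `&` C)%O; first by split=> //; exact: rcylI hA hC.
  by move=> q' hq; split; apply: Q_le hq => //; [exact: leIl|exact: leIr].
suff : F --> q by move=> h /h.
move=> {}W; case: q Qq @F FF => n e Qq F FF hW.
have {}hW : nbhs e (existT (Epath S) n @^-1` W) := hW.
case: n e Qq @F FF hW => [|n] e Qq F FF hW.
  have a0 : al = [::] by case: Qq; case: (al).
  subst al; have [A [eA _ sub]] := Xsp_nbhs hW; exists A; first by split.
  by move=> [m f]; case: m f => [|m] f [/= sm [_ fA _]] //; exact: sub.
have {}hW : nbhs (e : set_type (@Epos _ _ _ S n)) (existT (Epath S) n.+1 @^-1` W) := hW.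
move: hW; rewrite nbhsE => -[_ [[V oV <-] Ve] sub].
have /filterS : (fun q => exists2 f, q = existT _ n.+1 f & V (set_val f)) `<=` W.
  by move=> _ [f -> Vf]; exact: sub.
apply; case: Qq => /= nal [p l wA].
have FF' : Filter (filter_from [set A | Q al A (existT _ n.+1 e)]
    (fun A => [set g : {ptws 'I_n.+1 -> E1} | exists2 f : set_type (@Epos _ _ _ S n), g = set_val f & Q al A (existT _ n.+1 f)])).
  apply: filter_from_filter; first by exists A0; split.
  move=> A C [sq hA] [_ hC].
  have wA' : widl S al A by case: hA.
  have wC : widl S al C by case: hC.
  exists (A `&` C)%O; first by split=> //; exact: rcylI hA hC.
  move=> g [f -> hq]; split; exists f => //; apply: Q_le hq => //; [exact: leIl|exact: leIr].
suff cv : (filter_from [set A | Q al A (existT _ n.+1 e)]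
    (fun A => [set g : {ptws 'I_n.+1 -> E1} | exists2 f : set_type (@Epos _ _ _ S n), g = set_val f & Q al A (existT _ n.+1 f)]))
    --> (set_val e : {ptws 'I_n.+1 -> E1}).
  have [A QA sA] := cv V (open_nbhs_nbhs (conj oV Ve)).
  exists A => // -[m f] [/= mal hf].
  have mn : m = n.+1 by rewrite mal -nal.
  clear mal; subst m; exists f => //; apply: sA; exists f => //; by split.
apply/cvg_sup => i U [_ [[C oC <-] Ce] CU].
have /E1_nbhs[D [ID eD DC]] : nbhs (set_val e i) C by apply: open_nbhs_nbhs.
have ial : (i < size al)%N by rewrite -nal.
have ei := path_edge_ord e i.
have lD : lev (path_r (existT _ n.+1 e)) (path_edge (existT _ n.+1 e)) i.+1 D.
  by rewrite [lev _ _ _]/= valK.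
have wf := path_wf (existT _ n.+1 e).
(* A condition [D] at the source of edge [i] becomes a condition at the end of the path by applying
   the remaining letters. *)
exists (A0 `&` wact S (drop i.+1 al) D)%O.
  split=> //; split=> //; last exact: widl_le (leIl _ _) wA.
  apply: ultraI (lev_ultra l) l _; exact/(lev_drop D wf ial p).
move=> _ [f -> [_ [pf lf wf']]]; apply: CU; apply: DC.
have wff := path_wf (existT (Epath S) n.+1 f).
split.
  move/pre_onth: pf => /(_ i ial); move/pre_onth: p => /(_ i ial) <-.
  by rewrite !path_edge_ord /= => -[].
have : lev (path_r (existT _ n.+1 f)) (path_edge (existT _ n.+1 f)) i.+1 D.
  apply/(lev_drop D wff ial pf); apply: ultra_upward (lev_ultra lf) _ lf _ => //.
  exact: leIr.
by rewrite /= valK.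
Qed.

(** For an ultrafilter of sets of paths, the elements that hold at almost all last vertices form an
    ultrafilter [G] of [B]; the path traced back from [G] by [word_path] is the limit. *)
Lemma Q_compact al A : widl S al A -> compact (Q al A).
Proof.
move=> wA; apply: ultrafilter_compact => F UF FA.
pose lv q := lev (path_r q) (path_edge q) (size al).
pose G := [set C | F [set q | lv q C]].
have GA : G A by apply: filterS FA => q [_ []].
have lu q : lv q !=set0 -> ultra S [::] (lv q) by move=> [C]; exact: lev_ultra.
have uG : ultra S [::] G.
  apply: ultra_intro => //.
  - by exists A.
  - by move=> F0'; have [q qb] := filter_ex F0'; apply: (ultra_bot (lu q _) qb); exists \bot%O.
  - move=> C D FC _ CD; apply: filterS FC => q qC.
    by apply: (ultra_upward (lu q _) _ qC CD) => //; exists C.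
  - move=> C D FC FD; apply: filterS2 FC FD => q qC qD.
    by apply: (ultraI (lu q _) qC qD); exists C.
  - move=> C D FC _.
    have [FD|FD] := in_ultra_setVsetC [set q | lv q (C `&` D)%O] UF; [by left|right].
    apply: filterS2 FC FD => q qC /= qD.
    by have [qCD|//] := ultra_cut D (lu q (ex_intro _ C qC)) qC; case: qD.
have [r [ed [wf edN p lG]]] := word_path uG GA wA.
have edlt m : (m < size al)%N -> ed m <> None.
  move=> ml; move/pre_onth: p => /(_ m ml); have [a ->] := onth_Some ml.
  by case: (ed m).
have [q0 [lq rq eq]] := path_exists wf (edN _ (leqnn _)) edlt.
have Qq0 : Q al A q0 by split=> //; split; rewrite ?rq ?eq ?lG.
exists q0 => // W /(Q_nbhs Qq0)[C [_ [_ lC wC]] sub].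
rewrite rq eq lG in lC; apply: filterS2 FA lC => q [sq [pq _ _]] qC.
by apply: sub; split.
Qed.

Lemma Q_separate q q' : q <> q' -> exists al A al' A',
  [/\ Q al A q, Q al' A' q' & forall z, Q al A z -> Q al' A' z -> False].
Proof.
move=> qq; have [al [A qA]] := Q_word q; have [al' [A' qA']] := Q_word q'.
have [aa|aa] := eqVneq al al'; last first.
  exists al, A, al', A'; split=> // z [s1 [p1 _ _]] [s2 [p2 _ _]].
  by move/eqP: aa; apply; apply: pre_fun p1 p2 _; rewrite -s1 -s2.
subst al'.
have [C lC nC] : exists2 C, lev (path_r q) (path_edge q) (size al) C
    & ~ lev (path_r q') (path_edge q') (size al) C.
  apply: contrapT => h; apply: qq; case: qA => sq [p l w]; case: qA' => sq' [p' l' w'].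
  have e : lev (path_r q) (path_edge q) (size al) = lev (path_r q') (path_edge q') (size al).
    apply: (ultra_max (lev_ultra l) (lev_ultra l')) => C lC.
    by apply: contrapT => nC; apply: h; exists C.
  have [er ee] := raw_ext (path_wf q) (path_wf q') p p' e.
  apply: path_ext => //; first by rewrite sq sq'.
  move=> i; have [il|il] := ltnP i (size al); first exact: ee.
  case e1 : (path_edge q i) => [f|].
    have /path_edge_lt : path_edge q i <> None by rewrite e1.
    by rewrite sq ltnNge il.
  case e2 : (path_edge q' i) => [f|] //.
  have /path_edge_lt : path_edge q' i <> None by rewrite e2.
  by rewrite sq' ltnNge il.
case: (qA) => sq hq; case: (qA') => sq' hq'.
have [hC|hC] := rcyl_cut C hq'.
  case: nC; case: hC => _ l _.
  by apply: (ultra_upward (lev_ultra l) _ l) => //; exact: leIr.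
exists al, (A `&` C)%O, al, (A' `\` C)%O; split=> //.
  split=> //; case: hq => p l w; split=> //; first exact: ultraI (lev_ultra l) l lC.
  exact: widl_le (leIl _ _) w.
move=> z [_ [_ l1 _]] [_ [_ l2 _]]; apply: (ultra_bot (lev_ultra l1)).
have := ultraI (lev_ultra l1) l1 l2.
by rewrite -meetA [X in (_ `&` X)%O]meetC diffIK meetx0.
Qed.

(** By [Q_separate], each point of [K] lies in some [Q] that a neighbourhood of [q] avoids. Only
    such sets, marked [good], enter the cover; a finite subcover gives finitely many neighbourhoods
    to intersect. *)
Lemma Q_compact_avoid (K : set Estar) q : compact K -> ~ K q ->
  exists al A, Q al A q /\ forall z, Q al A z -> ~ K z.
Proof.
move=> cK nKq; have [al [A0 qA0]] := Q_word q.
pose good (p : seq L * B) := exists A, Q al A q /\ forall z, Q al A z -> ~ Q p.1 p.2 z.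
pose f (p : seq L * B) : set Estar := [set z | good p /\ Q p.1 p.2 z].
have of_ p : open (f p).
  have [gp|ngp] := pselect (good p).
    rewrite (_ : f p = Q p.1 p.2); first exact: Q_open.
    by apply/seteqP; split=> [z []|].
  rewrite (_ : f p = set0); first exact: open0.
  by apply/seteqP; split=> [z []|].
have fK z : K z -> exists p, f p z.
  move=> Kz; have [be [A [be' [A' [qA zA' dis]]]]] : exists al A al' A',
      [/\ Q al A q, Q al' A' z & forall t, Q al A t -> Q al' A' t -> False].
    by apply: Q_separate => qz; rewrite qz in nKq.
  have ba : be = al.
    case: qA => s1 [p1 _ _]; case: qA0 => s2 [p2 _ _].
    by apply: pre_fun p1 p2 _; rewrite -s1 -s2.
  by subst be; exists (be', A'); split=> //; exists A; split=> // t h1 h2; exact: dis h1 h2.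
have [s sK] := compact_subcover cK of_ fK.
have [A [qA As]] : exists A, Q al A q /\
    forall p, p \in s -> good p -> forall z, Q al A z -> ~ Q p.1 p.2 z.
  elim: s {sK} => [|p s [A [qA IH]]]; first by exists A0.
  have [[C [qC Cp]]|ng] := pselect (good p); last first.
    exists A; split=> // p'; rewrite inE => /orP[/eqP ->//|]; exact: IH.
  case: (qA) => sq hA; case: (qC) => _ hC.
  have wA : widl S al A by case: hA.
  have wC : widl S al C by case: hC.
  exists (A `&` C)%O; split.
    split=> //; exact: rcylI hA hC.
  move=> p'; rewrite inE => /orP[/eqP -> _|ps gp'] z hz.
    by apply: Cp; apply: Q_le hz => //; exact: leIr.
  by apply: (IH _ ps gp'); apply: Q_le hz => //; exact: leIl.
exists al, A; split=> // z zA Kz; have [p ps [gp zp]] := sK z Kz.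
exact: As zp.
Qed.

End PathCylinders.

(** * Cylinder sets of boundary paths *)

Section Cylinders.
Context {d : Order.disp_t} {B : cbDistrLatticeType d} {L : choiceType}.
Variable S : gbds B L.
Local Notation E1 := (Defs.E1 S).
Local Notation F0 := (Defs.F0 S).
Local Notation Estar := (Defs.Estar S).
Local Notation bpath := (Defs.bpath S).
Implicit Types (q : Estar) (x y : bpath) (A C : B) (al be ga : seq L).
Local Notation Q := (@Q _ _ _ S).

Definition blev x := lev (bpath_r x) (bpath_edge x).

Definition cyl al A : set bpath :=
  [set x | rcyl (bpath_r x) (bpath_edge x) al A].

Lemma wf_none r (ed : nat -> option E1) m n : wf_path r ed -> (m <= n)%N ->
  ed m = None -> ed n = None.
Proof.
move=> wf mn em; elim: n mn => [|n IH]; first by rewrite leqn0 => /eqP <-.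
by rewrite leq_eqVlt => /orP[/eqP <- //|/IH]; exact: (wf_step wf).
Qed.

Lemma lev_eq r r' (ed ed' : nat -> option E1) n :
  (forall i, (i < n)%N -> ed i = ed' i) -> (n = 0%N -> r = r') ->
  lev r ed n = lev r' ed' n.
Proof. by case: n => [|n] h r0 /=; [rewrite r0|rewrite h]. Qed.

Lemma pre_eq (ed ed' : nat -> option E1) al :
  (forall i, (i < size al)%N -> ed i = ed' i) -> pre ed al -> pre ed' al.
Proof.
by move=> h /pre_onth p; apply/pre_onth => i ni; rewrite -h // p.
Qed.

Lemma rcyl_eq r r' (ed ed' : nat -> option E1) al A :
  (forall i, (i < size al)%N -> ed i = ed' i) -> (size al = 0%N -> r = r') ->
  rcyl r ed al A -> rcyl r' ed' al A.
Proof.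
by move=> h hr [p l w]; split=> //; [exact: pre_eq p|rewrite -(lev_eq h hr)].
Qed.

Lemma begins_trunc x n : (if n is m.+1 then bpath_edge x m <> None else bpath_r x <> None) ->
  exists q, path_length q = n /\ begins_with x q.
Proof.
move=> hn; have wf := bpath_wf x.
have lt m : (m < n)%N -> bpath_edge x m <> None.
  case: n hn => [//|n] hn; rewrite ltnS => mn em; apply: hn.
  exact: wf_none wf mn em.
pose ed i := if (i < n)%N then bpath_edge x i else None.
have [||m mn|q [ql qr qe]] := @path_exists _ _ _ S (bpath_r x) ed n.
- split.
  + move=> i; rewrite /ed; case: ifP => [_ /(wf_step wf) ->|ni _]; first by case: ifP.
    by rewrite ltnNge leqW // leqNgt ni.
  + by move=> e; rewrite /ed; case: ifP => // _; exact: (wf_r wf).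
  + by move=> i e f; rewrite /ed; case: ifP => // _ ei; case: ifP => // _; exact: (wf_d wf ei).
  + rewrite /ed; case: ifP => [_|n0 _]; first exact: (wf_0 wf).
    by case: (n) n0 hn.
- by rewrite /ed ltnn.
- by rewrite /ed mn; exact: lt.
exists q; split=> //; apply/begins_withP; rewrite ql qe qr; split=> // i ni.
by rewrite /ed ni.
Qed.

Lemma begins_rcyl x q al A : path_length q = size al -> begins_with x q ->
  cyl al A x <-> Q al A q.
Proof.
move=> ql /begins_withP[h hr]; rewrite ql in h hr; split=> [|[_]].
  by move=> hx; split=> //; apply: rcyl_eq hx => //.
by apply: rcyl_eq => [i ni|s0]; [rewrite h|rewrite hr].
Qed.

Lemma cylE al A : cyl al A = cylinder (Q al A).
Proof.
apply/seteqP; split=> [x hx|x [q Qq /begins_rcyl]].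
  have [|q [ql bq]] := @begins_trunc x (size al).
    case: (hx) => p l _; case: (al) p l => [|a u] p l.
      by move=> r0; rewrite /lev r0 in l.
    move=> e0; move: l; rewrite /lev /= ; move: e0 => /=.
    by move=> ->.
  by exists q => //; exact/(begins_rcyl _ ql bq).
by move=> /(_ al A); case: (Qq) => ql _ /(_ ql)[_]; apply.
Qed.

Lemma cylinder0 : cylinder (set0 : set Estar) = set0.
Proof. by apply/seteqP; split=> // x []. Qed.

Lemma cylinderT : cylinder (setT : set Estar) = setT.
Proof.
apply/seteqP; split=> // x _; case e0 : (bpath_edge x 0%N) => [e|].
  by have [|q [_ bq]] := @begins_trunc x 1; [rewrite e0|exists q].
have [|q [_ bq]] := @begins_trunc x 0; last by exists q.
exact: (wf_0 (bpath_wf x) e0).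
Qed.

Lemma cyl_open al A : open (cyl al A).
Proof.
rewrite cylE; apply: (bpath_subbase S).1; exists (Q al A), set0.
by split; [exact: Q_open|exact: compact0|rewrite cylinder0 setC0 setIT].
Qed.

Lemma cyl_closed al A : closed (cyl al A).
Proof.
have [wA|nwA] := pselect (widl S al A); last first.
  rewrite (_ : cyl al A = set0); first exact: closed0.
  by apply/seteqP; split=> // x [].
(* The complement is a subbasic set: all boundary paths, minus the cylinder over the compact set
   [Q al A]. *)
rewrite -[cyl al A]setCK; apply: open_closedC.
rewrite -[X in open X]setTI cylE -cylinderT.
apply: (bpath_subbase S).1; exists setT, (Q al A).
by split=> //; [exact: openT|exact: Q_compact].
Qed.

Definition cbox (P N : seq (seq L * B)) : set bpath :=
  [set x | (forall p, p \in P -> cyl p.1 p.2 x) /\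
           (forall p, p \in N -> ~ cyl p.1 p.2 x)].

Lemma cbox_cat P N P' N' : cbox (P ++ P') (N ++ N') = cbox P N `&` cbox P' N'.
Proof.
apply/seteqP; split=> [x [h1 h2]|x [[h1 h2] [h3 h4]]].
  by split; split=> p hp; ((by apply: h1; rewrite mem_cat hp ?orbT) || (by apply: h2; rewrite mem_cat hp ?orbT)).
by split=> p; rewrite mem_cat => /orP[]; [exact: h1|exact: h3|exact: h2|exact: h4].
Qed.

Lemma cbox_open P N : open (cbox P N).
Proof.
elim: P => [|p P IH].
  elim: N => [|p N IH].
    by rewrite (_ : cbox [::] [::] = setT); [exact: openT|apply/seteqP; split].
  rewrite -cat1s -[[::]]/([::] ++ [::]) cbox_cat; apply: openI => //.
  rewrite (_ : cbox _ _ = ~` cyl p.1 p.2); first exact/closed_openC/cyl_closed.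
  apply/seteqP; split=> [x [_ h]|x h]; first exact: h (mem_head _ _).
  by split=> // p'; rewrite inE => /eqP ->.
rewrite -cat1s -[N]/([::] ++ N) cbox_cat; apply: openI => //.
rewrite (_ : cbox _ _ = cyl p.1 p.2); first exact: cyl_open.
apply/seteqP; split=> [x [h _]|x h]; first exact: h (mem_head _ _).
by split=> // p'; rewrite inE => /eqP ->.
Qed.

Lemma cbox1 al A x : cyl al A x <-> cbox [:: (al, A)] [::] x.
Proof.
split=> [h|[h _]]; last exact: h (mem_head _ _).
by split=> // p; rewrite inE => /eqP ->.
Qed.

Lemma bpath_nbhs x W : nbhs x W -> exists P N, cbox P N x /\ cbox P N `<=` W.
Proof.
move=> /(subbase_nbhs (P := [set U | exists P N, cbox P N x /\ U = cbox P N])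
  (bpath_subbase S))[].
- by exists (cbox [::] [::]), [::], [::].
- by move=> _ [P [N [xPN ->]]]; split=> //; exact: cbox_open.
- move=> _ _ [P [N [xPN ->]]] [P' [N' [xPN' ->]]].
  exists (cbox (P ++ P') (N ++ N')); rewrite cbox_cat.
  split=> [|y []|y []] //.
  by exists (P ++ P'), (N ++ N'); rewrite cbox_cat.
- move=> _ [U [K [oU cK ->]]] [[q Uq xq] nK].
  have [al [A qA]] := Q_word q.
  have [C qC CU] := Q_nbhs qA (open_nbhs_nbhs (conj oU Uq)).
  have [||s sK] := compact_subcover (f := fun p : seq L * B => Q p.1 p.2) cK.
  - by move=> p; exact: Q_open.
  - by move=> z _; have [be [D zD]] := Q_word z; exists (be, D).
  (* A piece of the cover of [K] that [x] does not enter is excluded by a negative condition. If [x]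
     enters it, the segment [z] of [x] lies outside [K], and a positive condition keeps the segments
     of that length in a neighbourhood of [z] that avoids [K]. *)
  have [P [N [xPN PNs]]] : exists P N, cbox P N x /\ forall p, p \in s ->
      forall y, cbox P N y -> forall z, K z -> Q p.1 p.2 z -> ~ begins_with y z.
    elim: s {sK} => [|p s [P [N [xPN IH]]]]; first by exists [::], [::].
    have [xp|nxp] := pselect (cyl p.1 p.2 x); last first.
      exists P, (p :: N); split.
        split=> p'; first by case: xPN => h _; exact: h.
        by rewrite inE => /orP[/eqP -> //|]; case: xPN => _ h; exact: h.
      move=> p'; rewrite inE => /orP[/eqP ->|ps] y [yP yN] z Kz zp yz.
        have [zl _] := zp; apply: (yN p (mem_head _ _)).
        exact/(begins_rcyl _ zl yz).
      apply: (IH _ ps y _ z Kz zp yz); split=> // p'' hp''.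
      by apply: yN; rewrite inE hp'' orbT.
    have [z [zp xz]] : exists z, Q p.1 p.2 z /\ begins_with x z.
      by move: xp; rewrite cylE => -[z ? ?]; exists z.
    have nKz : ~ K z by move=> Kz; apply: nK; exists z.
    have [be [D [zD Dav]]] := Q_compact_avoid cK nKz.
    have [zl _] := zD; have xD : cyl be D x by exact/(begins_rcyl _ zl xz).
    exists ((be, D) :: P), N; split.
      split=> p'; last by case: xPN => _ h; exact: h.
      by rewrite inE => /orP[/eqP -> //|]; case: xPN => h _; exact: h.
    move=> p'; rewrite inE => /orP[/eqP ->|ps] y [yP yN] t Kt tp yt.
      apply: (Dav t) => //; have yD := yP (be, D) (mem_head _ _).
      have tl : path_length t = size be.
        by case: (zp) (tp) zl => -> _ [-> _].
      exact/(begins_rcyl D tl yt).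
    apply: (IH _ ps y _ t Kt tp yt); split=> // p'' hp''.
    by apply: yP; rewrite inE hp'' orbT.
  exists (cbox ([:: (al, C)] ++ P) ([::] ++ N)).
    exists ([:: (al, C)] ++ P), ([::] ++ N); split=> //.
    rewrite cbox_cat; split=> //; apply/cbox1.
    have [ql _] := qC; exact/(begins_rcyl _ ql xq).
  rewrite cbox_cat => y [/cbox1 yC yPN]; split.
    by move: yC; rewrite cylE => -[z zC yz]; exists z => //; exact: CU.
  by move=> [z Kz yz]; have [p ps zp] := sK z Kz; exact: (PNs p ps y yPN z Kz zp).
by move=> _ [P [N [xPN ->]]] sub; exists P, N.
Qed.

End Cylinders.

(** * Boundary paths and tight filters *)

Section Idempotents.
Context {d : Order.disp_t} {B : cbDistrLatticeType d} {L : choiceType}.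
Variable S : gbds B L.
Implicit Types (A C D E : B) (al be ga w : seq L).

Local Notation idm al A := (Some (al, A, al) : triple (B := B) (L := L)).

Lemma prefix_size_nil be w : prefix (be ++ w) be -> w = [::].
Proof.
move=> /prefixP[t e]; apply/eqP; rewrite -size_eq0.
by have := congr1 size e; rewrite !size_cat => h; lia.
Qed.

Lemma mul_idr be w A C :
  invsg_mul S (idm be A) (idm (be ++ w) C) = mk_triple (be ++ w) (wact S w A `&` C)%O (be ++ w).
Proof.
rewrite /invsg_mul; case: eqP => [e|_].
  by have w0 : w = [::]; [apply: (@prefix_size_nil be); rewrite -e prefix_refl|rewrite w0 cats0].
by rewrite prefix_prefix drop_size_cat.
Qed.

Lemma mul_idl be w A C :
  invsg_mul S (idm (be ++ w) A) (idm be C) = mk_triple (be ++ w) (A `&` wact S w C)%O (be ++ w).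
Proof.
rewrite /invsg_mul; case: eqP => [e|ne].
  by have w0 : w = [::]; [apply: (@prefix_size_nil be); rewrite e prefix_refl|rewrite w0 cats0].
case: ifP => [/prefix_size_nil w0|_]; first by case: ne; rewrite w0 cats0.
by rewrite prefix_prefix drop_size_cat.
Qed.

Lemma mul_id_cases be ga A C :
  [\/ exists w, ga = be ++ w, exists w, be = ga ++ w |
      invsg_mul S (idm be A) (idm ga C) = None].
Proof.
have [/prefixP[w ->]|n1] := boolP (prefix be ga); first by constructor 1; exists w.
have [/prefixP[w ->]|n2] := boolP (prefix ga be); first by constructor 2; exists w.
constructor 3; rewrite /invsg_mul (negbTE n1) (negbTE n2); case: eqP => // e.
by rewrite e prefix_refl in n1.
Qed.

Lemma mk_triple_Some al A be : A != \bot%O -> mk_triple al A be = Some (al, A, be).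
Proof. by rewrite /mk_triple => /negbTE ->. Qed.

Lemma mk_triple_neq0 al A be : mk_triple al A be <> None <-> A != \bot%O.
Proof. by rewrite /mk_triple; case: eqP. Qed.

Lemma idem_leP be ga A C : A != \bot%O ->
  idem_le S (idm be A) (idm ga C) <-> exists2 w, be = ga ++ w & (A <= wact S w C)%O.
Proof.
move=> A0; rewrite /idem_le; split=> [h|[w -> /meet_idPl e]]; last first.
  by rewrite mul_idl e mk_triple_Some.
have aux w : be = ga ++ w -> exists2 w, be = ga ++ w & (A <= wact S w C)%O.
  move=> e; exists w => //; subst be; move: h; rewrite mul_idl /mk_triple.
  by case: eqP => // _ [e]; rewrite -{1}e leIr.
have [[w e]|[w e]|n] := mul_id_cases be ga A C; last by rewrite n in h.
  subst ga; move: h; rewrite mul_idr /mk_triple; case: eqP => // _ [e _] _.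
  by apply: (aux [::]); rewrite cats0.
exact: aux e.
Qed.

Lemma idem_lexx e : idem S e -> idem_le S e e.
Proof.
case: e => [[[al A] be]|//] [<- A0 _]; apply/idem_leP => //.
by exists [::]; rewrite ?cats0.
Qed.

End Idempotents.
Notation idm al A := (Some (al, A, al)).

Lemma seq_size_bound (T L : eqType) (f : T -> seq L) (l : seq T) z :
  z \in l -> (size (f z) <= sumn [seq size (f z) | z <- l])%N.
Proof.
elim: l => [//|y l IH]; rewrite inE => /orP[/eqP ->|/IH] /=; lia.
Qed.

(** * From boundary paths to tight filters *)

Section TightCode.
Context {d : Order.disp_t} {B : cbDistrLatticeType d} {L : choiceType}.
Variable S : gbds B L.
Implicit Types (A C D E : B) (al be ga w : seq L) (x : bpath S).
Local Notation triple := (triple (B := B) (L := L)).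

Definition code x : set triple :=
  [set e | if e is Some (al, A, be) then al = be /\ cyl al A x else False].

Lemma cyl_neq0 al A x : cyl al A x -> A != \bot%O.
Proof. by move=> h; apply/eqP => e; subst A; exact: rcyl0 h. Qed.

Lemma cyl_widl al A x : cyl al A x -> widl S al A.
Proof. by case. Qed.

Lemma cyl_exists x : exists al A, cyl al A x.
Proof.
have : cylinder (setT : set (Estar S)) x by rewrite cylinderT.
move=> [q _ xq]; have [al [A qA]] := Q_word q.
by exists al, A; have [ql _] := qA; exact/(begins_rcyl _ ql xq).
Qed.

Lemma cyl_comparable al be A C x : cyl al A x -> cyl be C x ->
  (exists w, be = al ++ w) \/ (exists w, al = be ++ w).
Proof. by move=> [p _ _] [p' _ _]; exact: pre_comparable p p'. Qed.

Lemma cyl_cat al w A C x : cyl (al ++ w) A x ->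
  (cyl al C x <-> cyl (al ++ w) (A `&` wact S w C)%O x /\ widl S al C).
Proof. exact: (rcyl_cat (bpath_wf x)). Qed.

Lemma cyl_shorten al w A C x : cyl (al ++ w) A x -> widl S al C ->
  (A <= wact S w C)%O -> cyl al C x.
Proof. exact: (rcyl_shorten (bpath_wf x)). Qed.

Lemma cyl_pre_exists x n : (if n is m.+1 then bpath_edge x m <> None else True) ->
  exists2 u, pre (bpath_edge x) u & size u = n.
Proof. by apply: pre_exists => k; exact: (wf_step (bpath_wf x)). Qed.

Lemma code_filter x : is_pfilter (idem S) (idem_le S) None (code x).
Proof.
split.
- move=> [[[al A] be]|//] [<- h]; split=> //; [exact: cyl_neq0 h|exact: cyl_widl h].
- by have [al [A h]] := cyl_exists x; exists (idm al A).
- by [].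
- move=> [[[al A] be]|//] [[[ga C] de]|] [<- h] //= [<- C0 wC].
  move=> /(idem_leP S _ _ _ (cyl_neq0 h))[w e AC']; subst al; split=> //.
  exact: cyl_shorten h wC AC'.
move=> [[[al A] be]|//] [[[ga C] de]|//] [<- h] [<- k].
have aux al' w A' C' : cyl (al' ++ w) A' x -> cyl al' C' x -> exists z, [/\ code x z,
    idem_le S z (idm (al' ++ w) A') & idem_le S z (idm al' C')].
  move=> h' k'; have [hk _] := (cyl_cat C' h').1 k'.
  exists (idm (al' ++ w) (A' `&` wact S w C')%O); split=> //.
    apply/idem_leP; first exact: cyl_neq0 hk.
    by exists [::]; rewrite ?cats0 // leIl.
  apply/idem_leP; first exact: cyl_neq0 hk.
  by exists w => //; rewrite leIr.
have [[w e]|[w e]] := cyl_comparable h k; subst.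
  by have [z [? ? ?]] := aux _ _ _ _ k h; exists z.
exact: aux h k.
Qed.

(** A finite cover that misses [code x] can meet small idempotents along [x] only through words
    longer than any chosen prefix [mu]. This is absurd if [mu] is long; if [mu] exhausts [x], it
    makes an element of the last vertex regular. *)
Lemma code_tight x : tight S (code x).
Proof.
split; first exact: code_filter.
move=> x0 Z cx0 [finZ subZ cov]; apply: contrapT => disj.
have nZ z : Z z -> ~ code x z by move=> Zz cz; apply: disj; exists z.
case: x0 cx0 subZ cov => [[[be A] be']|//] [<- hA] subZ cov.
have /finite_seqP[l Zl] := finZ.
have lZ z : z \in l -> Z z by rewrite Zl.
pose wd (z : triple) := if z is Some (al, _, _) then al else [::].
(* [mu] extends [be] and is either at least as long as all words of the cover, or the whole word of
   a finite [x]. *)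
have [mu [pmu muN [v muE]]] : exists mu, [/\ pre (bpath_edge x) mu,
    (forall z, z \in l -> (size (wd z) <= size mu)%N) \/ bpath_edge x (size mu) = None
    & exists v, mu = be ++ v].
  have ext u : pre (bpath_edge x) u -> (size be <= size u)%N -> exists v, u = be ++ v.
    move=> pu su; have [pb _ _] := hA; have [[w ->]|[w e]] := pre_comparable pb pu.
      by exists w.
    exists [::]; rewrite cats0; move: su; rewrite e size_cat => su.
    have /eqP : size w = 0%N by lia.
    by rewrite size_eq0 => /eqP ->; rewrite cats0.
  pose N := (sumn [seq size (wd z) | z <- l] + size be)%N.
  have [eN|eN] := pselect (bpath_edge x N = None); last first.
    have [u pu su] := @cyl_pre_exists x N.+1 eN.
    exists u; split=> //; last by apply: ext => //; rewrite su /N; lia.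
    left=> z zl; rewrite su /N.
    by apply: leq_trans (seq_size_bound wd zl) _; rewrite -addnS leq_addr.
  have ex : exists n, ~~ bpath_edge x n by exists N; rewrite eN.
  case: (ex_minnP ex) => n en nmin.
  have enN : bpath_edge x n = None by case: bpath_edge en.
  have [|u pu su] := @cyl_pre_exists x n.
    case: (n) nmin => [//|m] nmin em; have := nmin m; rewrite em => /(_ isT).
    by rewrite ltnn.
  exists u; split=> //; first by right; rewrite su.
  apply: ext => //; rewrite su leqNgt; apply/negP => nb.
  have [pb _ _] := hA; move/pre_onth: pb => /(_ n nb); rewrite enN /=.
  by have [a ->] := onth_Some nb.
have [_ lA wA] := hA; have lu := lev_ultra lA.
have pv : pre (fun k => bpath_edge x (size be + k)%N) v.
  by move: pmu; rewrite muE => /pre_cat[].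
set F := lev (bpath_r x) (bpath_edge x) (size mu).
have FA : F (wact S v A).
  by move: lA; rewrite (lev_cat (bpath_wf x) A pv) /F muE size_cat.
have uF : ultra S [::] F := lev_ultra FA.
have wmu : widl S mu (wact S v A) by rewrite muE; exact: widl_act wA (lexx _).
pose Qz (z : triple) D := forall w E, (E <= wact S w D)%O ->
  invsg_mul S (idm (mu ++ w) E) z = None.
have idZ z : z \in l -> z = None \/ exists ze C, z = idm ze C /\ widl S ze C.
  move=> /lZ /subZ[]; case: z => [[[ze C] ze']|] /=; last by left.
  by move=> [<- _ w] _; right; exists ze, C.
(* [D] is shrunk, still inside the vertex at [mu], until no idempotent below [(mu, D, mu)] meets a
   member of the cover whose word is at most as long as [mu]. *)
have [D [FD DA DQ]] : exists D, [/\ F D, (D <= wact S v A)%O &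
    forall z, z \in [seq z <- l | (size (wd z) <= size mu)%N] -> Qz z D].
  apply: (ultra_meet_seq uF FA).
    move=> z C D Q1 DC w E ED; apply: Q1; apply: le_trans ED _; exact: wact_le.
  move=> z; rewrite mem_filter => /andP[sz zl].
  have [->|[ze [C [zE wC]]]] := idZ z zl; first by exists (wact S v A).
  rewrite zE /= in sz.
  have [/prefixP[u ue]|npre] := boolP (prefix ze mu).
    have nC : ~ F (wact S u C).
      move=> FC; apply: (nZ z (lZ z zl)); rewrite zE; split=> //.
      have h : cyl mu (wact S v A `&` wact S u C)%O x.
        split=> //; first exact: ultraI uF FA FC.
        exact: widl_le (leIl _ _) wmu.
      rewrite ue in h; apply: cyl_shorten h wC (leIr _ _).
    have [//|FD] := ultra_cut (wact S u C) uF FA.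
      by move=> h; case: nC; apply: (ultra_upward uF _ h) => //; exact: leIr.
    exists (wact S v A `\` wact S u C)%O => // w E ED.
    rewrite zE ue -catA mul_idl wact_cat /mk_triple.
    suff -> : (E `&` wact S w (wact S u C))%O = \bot%O by rewrite eqxx.
    apply/eqP; rewrite -lex0; apply: le_trans (leI2 ED (lexx _)) _.
    by rewrite -wactI diffIK wact0.
  exists (wact S v A) => // w E _; rewrite zE.
  have [[u ue]|[u ue]|//] := mul_id_cases S (mu ++ w) ze E C.
    move: npre sz; rewrite ue -catA => npre; rewrite !size_cat => sz.
    have /eqP : size (w ++ u) = 0%N by rewrite size_cat; lia.
    by rewrite size_eq0 => /eqP e; rewrite e cats0 prefix_refl in npre.
  case/negP: npre; apply/prefixP; exists (drop (size ze) mu).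
  rewrite -{1}(cat_take_drop (size ze) mu); congr (_ ++ _).
  have := congr1 (take (size ze)) ue; rewrite takel_cat // => ->.
  by rewrite take_size_cat.
have D0 : D != \bot%O by apply/eqP => e; rewrite e in FD; exact: ultra_bot uF FD.
have below w E : E != \bot%O -> (E <= wact S w D)%O -> exists ze C, [/\ idm ze C \in l,
    (size mu < size ze)%N & invsg_mul S (idm (mu ++ w) E) (idm ze C) <> None].
  move=> E0 ED; have wE : widl S (mu ++ w) E.
    by apply: widl_act ED; exact: widl_le DA wmu.
  have [|||z Zz zm] := cov (idm (mu ++ w) E) => //.
    apply/idem_leP => //; exists (v ++ w); first by rewrite muE catA.
    by rewrite wact_cat; apply: le_trans ED _; exact: wact_le.
  have zl : z \in l by move: Zz; rewrite Zl.
  have [z0|[ze [C [zE _]]]] := idZ z zl; first by rewrite z0 in zm.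
  exists ze, C; rewrite -zE; split=> //.
  rewrite ltnNge; apply/negP => sz; apply: zm; apply: DQ => //.
  by rewrite mem_filter zE /= sz -zE.
case: muN => [short|eN].
  have [|ze [C [zl lt _]]] := below [::] D D0; first exact: lexx.
  by have := short _ zl; rewrite /= leqNgt lt.
(* The path stops at [mu], so regularity of [D] is the contradiction. The letters available to a
   nonempty [C] below [D] are letters at position [size mu] of words of the cover, hence finitely
   many, and there is at least one. *)
apply: (bpath_singular eN FD) => C C0 CD; split.
  have [ze [C' [zl lt]]] := below [::] C C0 CD; rewrite cats0.
  have [[u ue]|[u ue]|//] := mul_id_cases S mu ze C C'; last first.
    by move: lt; rewrite ue size_cat ltnNge leq_addr.
  subst ze; rewrite mul_idr mk_triple_neq0; case: u lt {zl} => [|a u] lt.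
    by move: lt; rewrite cats0 ltnn.
  move=> h; exists a; apply/eqP => e; move: h.
  by rewrite -cat1s wact_cat {2}/wact /= e wact0 meet0x eqxx.
apply: (sub_finite_set _ (finite_seq (pmap (fun z => onth (wd z) (size mu)) l))).
move=> a /= aC; have [|ze [C' [zl lt]]] := below [:: a] (act S a C) aC.
  exact: act_le.
rewrite mem_pmap => h; apply/mapP; exists (idm ze C') => //=.
have [[u ue]|[u ue]|//] := mul_id_cases S (mu ++ [:: a]) ze (act S a C) C'.
  by rewrite ue -catA onth_cat ltnn subnn.
have su : (size u = 0)%N.
  have := congr1 size ue; rewrite !size_cat /= => hs; apply/eqP.
  by rewrite -leqn0 -(leq_add2l (size ze)) addn0 -hs addn1.
move: ue; case: u su => // _; rewrite cats0 => <-.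
by rewrite onth_cat ltnn subnn.
Qed.

End TightCode.

Lemma cat_cases (T : eqType) (be u ga v : seq T) : be ++ u = ga ++ v ->
  (exists w, ga = be ++ w /\ u = w ++ v) \/ (exists w, be = ga ++ w /\ v = w ++ u).
Proof.
elim: be ga => [|a be IH] [|b ga] /=.
- by left; exists [::].
- by move=> ->; left; exists (b :: ga).
- by move=> <-; right; exists (a :: be).
move=> [<-] /IH[[w [-> ->]]|[w [-> ->]]]; first by left; exists w.
by right; exists w.
Qed.

Lemma cat_injl (T : Type) (u v w : seq T) : u ++ v = u ++ w -> v = w.
Proof. by elim: u => [//|a u IH] /= [/IH]. Qed.

(** * From tight filters to boundary paths *)

Section TightToPath.
Context {d : Order.disp_t} {B : cbDistrLatticeType d} {L : choiceType}.
Variable S : gbds B L.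
Implicit Types (A C D E : B) (al be ga w : seq L).
Local Notation triple := (triple (B := B) (L := L)).
Local Notation widl := (Defs.widl S).
Local Notation wact := (Defs.wact S).

Variable xi : set triple.
Hypothesis tight_xi : tight S xi.

Let X be A := xi (idm be A).

Let xi_elt e : xi e -> exists be A, [/\ e = idm be A, A != \bot%O & widl be A].
Proof.
have [[fI _ f0 _ _] _] := tight_xi.
move=> xe; have := fI _ xe; case: e xe => [[[al A] be]|//] xe [<- A0 wA].
by exists al, A.
Qed.

Let X_idem be A : X be A -> A != \bot%O /\ widl be A.
Proof.
by move=> /xi_elt[be' [A' [[-> -> _] A0 wA]]].
Qed.

Let X_up ga w A C : X (ga ++ w) A -> widl ga C -> (A <= wact w C)%O -> X ga C.
Proof.
have [[fI _ f0 fup _] _] := tight_xi; move=> xA wC sAC.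
have [A0 wA] := X_idem xA.
have C0 : C != \bot%O.
  apply/eqP => e; rewrite e wact0 lex0 in sAC; by rewrite sAC in A0.
by apply: (fup _ _ xA); [split|apply/idem_leP => //; exists w].
Qed.

Let X_cmp be A ga C : X be A -> X ga C ->
  (exists w, ga = be ++ w /\ X ga (wact w A `&` C)%O) \/
  (exists w, be = ga ++ w /\ X be (A `&` wact w C)%O).
Proof.
move=> xA xC; have [[_ _ _ _ fdir] _] := tight_xi.
have [z [xz zA zC]] := fdir _ _ xA xC; have [ze [E [zE E0 wE]]] := xi_elt xz.
subst z; have [_ wA] := X_idem xA; have [_ wC] := X_idem xC.
move: zA zC => /(idem_leP S _ _ _ E0)[u eu EA] /(idem_leP S _ _ _ E0)[v ev EC].
have [[w [ew uv]]|[w [ew vu]]] : (exists w, ga = be ++ w /\ u = w ++ v) \/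
    (exists w, be = ga ++ w /\ v = w ++ u) by apply: cat_cases; rewrite -eu -ev.
  left; exists w; split=> //; rewrite ev in xz; apply: X_up xz _ _.
    exact: widl_le (leIr _ _) wC.
  by rewrite wactI lexI EC andbT -wact_cat -uv.
right; exists w; split=> //; rewrite eu in xz; apply: X_up xz _ _.
  exact: widl_le (leIl _ _) wA.
by rewrite wactI lexI EA /= -wact_cat -vu.
Qed.

Let X_meet be A C : X be A -> X be C -> X be (A `&` C)%O.
Proof.
have aux w D : be = be ++ w -> w = [::].
  by move=> e; apply/eqP; rewrite -size_eq0 -(eqn_add2l (size be)) -size_cat -e addn0.
by move=> xA xC; have [[w [/aux -> //]]|[w [/aux -> //]]] := X_cmp xA xC.
Qed.

(** The two pieces form a finite cover of [(be, A, be)]. This is where tightness makes every level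
    an ultrafilter. *)
Let X_cut be A C : X be A -> X be (A `&` C)%O \/ X be (A `\` C)%O.
Proof.
move=> xA; have [A0 wA] := X_idem xA; have [_ tg] := tight_xi.
pose Z : set triple := [set z | exists D, [/\ z = idm be D, D != \bot%O
   & D = (A `&` C)%O \/ D = (A `\` C)%O]].
have [|z [[D [-> _ [->|->]]] xz]] := tg _ Z xA; [|by left|by right].
split.
- apply: (sub_finite_set _ (finite_set2 (idm be (A `&` C)%O) (idm be (A `\` C)%O))).
  by move=> z [D [-> _ [->|->]]]; [left|right].
- move=> z [D [-> D0 hD]].
  have DA : (D <= A)%O by case: hD => ->; [exact: leIl|exact: leBx].
  split; first by split=> //; exact: widl_le DA wA.
  by apply/idem_leP => //; exists [::]; rewrite ?cats0.
- move=> [[[ze E] ze']|//] [<- E0 wE] /(idem_leP S _ _ _ E0)[w we EA] _.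
  subst ze; have : (E `&` wact w (A `&` C) `|` E `&` wact w (A `\` C))%O != \bot%O.
    by rewrite -meetUr -wactU joinIB (meet_idPl EA).
  rewrite join_eq0 negb_and => /orP[h|h].
    exists (idm be (A `&` C)%O); last by rewrite mul_idl mk_triple_neq0.
    exists (A `&` C)%O; split=> //; last by left.
    by apply/eqP => e; rewrite e wact0 meetx0 eqxx in h.
  exists (idm be (A `\` C)%O); last by rewrite mul_idl mk_triple_neq0.
  exists (A `\` C)%O; split=> //; last by right.
  by apply/eqP => e; rewrite e wact0 meetx0 eqxx in h.
Qed.

Let Pw be := exists A, X be A.
Let Fw be : set B := ultra_up [set A | X be A].

Let Pw_ultra be : Pw be -> ultra S be [set A | X be A].
Proof.
move=> [A xA]; apply: ultra_intro.
- by move=> C /X_idem[].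
- by exists A.
- by move=> /X_idem[]; rewrite eqxx.
- move=> C D xC wD CD; apply: (@X_up be [::] C D) => //; by rewrite cats0.
- by move=> C D xC xD; exact: X_meet.
- by move=> C D xC _; exact: X_cut.
Qed.

Let Fw_ultra be : Pw be -> ultra S [::] (Fw be).
Proof. by move=> /Pw_ultra; exact: ultra_upP. Qed.

Let Pw_prefix be w : be <> [::] -> Pw (be ++ w) -> Pw be.
Proof.
move=> bn [A xA]; have [_ wA] := X_idem xA.
by have [D wD AD] := widl_prefix bn wA; exists D; exact: X_up xA wD AD.
Qed.

Let Pw_uniq be ga : Pw be -> Pw ga -> size be = size ga -> be = ga.
Proof.
move=> [A xA] [C xC] s.
have aux u w v : u = v ++ w -> size v = size u -> v = u.
  move=> -> /eqP; rewrite size_cat -{1}[size v]addn0 eqn_add2l eq_sym size_eq0.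
  by move=> /eqP ->; rewrite cats0.
have [[w [e _]]|[w [e _]]] := X_cmp xA xC; first exact: aux e s.
by symmetry; apply: aux e _.
Qed.

(** This is what makes consecutive edges read off from [xi] fit together. For empty [be] the element
    [C] lies in the ideal anyway; otherwise it is first cut by an element of the level. *)
Let Fw_step be a C : Pw (rcons be a) ->
  Fw be C <-> Fw (rcons be a) (act S a C).
Proof.
move=> Pba; have [E xE] := Pba; rewrite -cats1 in xE *.
split=> [[A xA AC']|[E' xE' EC]].
  have xEA : X (be ++ [:: a]) (wact [:: a] A `&` E)%O.
    have aux w : be = (be ++ [:: a]) ++ w -> False.
      move=> /(congr1 size)/eqP; rewrite -catA size_cat -{1}[size be]addn0.
      by rewrite eqn_add2l.
    have [[w [e h]]|[w [e _]]] := X_cmp xA xE; last by case: (aux w).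
    have ew := cat_injl e.
    by rewrite -ew in h.
  exists (wact [:: a] A `&` E)%O => //.
  apply: le_trans (leIl _ _) _; exact: act_le.
have [b0|/eqP bn] := eqVneq be [::].
  exists C => //; subst be; exact: (@X_up [::] [:: a] E' C xE').
have [D xD] : Pw be by apply: (@Pw_prefix be [:: a]) => //; exists E.
have [_ wD] := X_idem xD.
exists (D `&` C)%O; last exact: leIr.
have xDE : X (be ++ [:: a]) (wact [:: a] D `&` E')%O.
  have aux w : be = (be ++ [:: a]) ++ w -> False.
    move=> /(congr1 size)/eqP; rewrite -catA size_cat -{1}[size be]addn0.
    by rewrite eqn_add2l.
  have [[w [e h]]|[w [e _]]] := X_cmp xD xE'; last by case: (aux w).
  have ew := cat_injl e.
  by rewrite -ew in h.
apply: X_up xDE _ _; first exact: widl_le (leIl _ _) wD.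
by rewrite wactI leI2.
Qed.

Let edge_ex n : exists oe : option (E1 S),
  (exists be a e, [/\ size be = n, Pw (rcons be a), oe = Some e, tagE e = a
     & set_val (dE e) = Fw (rcons be a)]) \/
  (oe = None /\ ~ exists be a, size be = n /\ Pw (rcons be a)).
Proof.
have [[be [a [sb Pba]]]|h] := pselect (exists be a, size be = n /\ Pw (rcons be a)).
  have [A xA] := Pba; have [_ wA] := X_idem xA.
  have IA : idl S a A.
    by apply/widl1; apply: (@widl_suffix _ _ _ _ be); rewrite cats1.
  have FA : Fw (rcons be a) A by exists A.
  have [e [te de]] := E1_exists (Fw_ultra Pba) FA IA.
  by exists (Some e); left; exists be, a, e.
by exists None; right.
Qed.

(** The words in [xi] are comparable, and the level over each of them is an ultrafilter, so they
    spell a raw path. Covers of regular elements then show that the path stops only where a boundary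
    path may. *)
Lemma tight_code : exists x : bpath S, code x = xi.
Proof.
have [ed edP] := choice edge_ex.
have edge_some be a : Pw (rcons be a) -> exists e,
    [/\ ed (size be) = Some e, tagE e = a & set_val (dE e) = Fw (rcons be a)].
  move=> Pba; case: (edP (size be)) => [[be' [a' [e [sb Pba' ee te de]]]]|[_ n]].
    have := Pw_uniq Pba' Pba; rewrite !size_rcons sb => /(_ erefl)/rcons_inj[eb ea].
    by subst; exists e.
  by case: n; exists be, a.
have edge_inv n e : ed n = Some e -> exists be a,
    [/\ size be = n, Pw (rcons be a), tagE e = a & set_val (dE e) = Fw (rcons be a)].
  move=> en; case: (edP n) => [[be [a [e' [sb P ee te de]]]]|[en' _]].
    by rewrite en in ee; case: ee => ->; exists be, a.
  by rewrite en in en'.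
have [r rE'] : exists r : F0 S, oset r = Fw [::].
  have [P0|n0] := pselect (Pw [::]); first by exists (Some (mkX (Fw_ultra P0))).
  exists None; apply/seteqP; split=> // C [A xA _]; case: n0; by exists A.
have rEF (e : E1 S) n be a : size be = n -> Pw (rcons be a) -> tagE e = a ->
    set_val (dE e) = Fw (rcons be a) -> oset (rE e) = Fw be.
  move=> _ P te de; apply/seteqP; split=> C.
    by move=> /oset_rE; rewrite te de => h; exact: (Fw_step C P).2.
  by move=> h; apply/oset_rE; rewrite te de; exact: (Fw_step C P).1.
have wf : wf_path r ed.
  split.
  - move=> n en; case en1 : (ed n.+1) => [f|//].
    have [be [b [sb P _ _]]] := edge_inv _ _ en1.
    case/lastP: be sb P => [//|be a]; rewrite size_rcons => -[sb] P.
    have Pba : Pw (rcons be a).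
      by apply: (@Pw_prefix _ [:: b]); rewrite ?cats1 //; case: (be).
    by have [e [ee _ _]] := edge_some _ _ Pba; rewrite -sb ee in en.
  - move=> e e0; have [be [a [/size0nil b0 P te de]]] := edge_inv _ _ e0; subst be.
    by apply: F0_ext; rewrite rE' (rEF e _ _ _ erefl P te de).
  - move=> n e f en fn; have [be [a [sb P te de]]] := edge_inv _ _ en.
    have [be' [b [sb' P' tf df]]] := edge_inv _ _ fn.
    apply: F0_ext; rewrite (rEF f _ _ _ erefl P' tf df) /= de; congr Fw.
    apply: Pw_uniq => //; last by rewrite size_rcons sb sb'.
    apply: (@Pw_prefix _ [:: b]); rewrite ?cats1 //.
    by move=> b0; rewrite b0 in sb'.
  (* [xi] is nonempty: an element over the empty word forces a true vertex as range, and one over a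
     longer word would provide a first edge. *)
  - move=> e0 rN; have [[_ [e xe] _ _ _] _] := tight_xi.
    have [be [A [eE _ _]]] := xi_elt xe; subst e.
    case: be xe => [|a be] xe.
      have : oset r A by rewrite rE'; exists A.
      by rewrite rN.
    have Pa : Pw (rcons [::] a) by apply: (@Pw_prefix [:: a] be) => //; exists A.
    by have [f [ff _ _]] := edge_some _ _ Pa; rewrite /= e0 in ff.
have preP al : Pw al -> pre ed al.
  move=> Pal; apply/pre_onth => i ni; have [a ai] := onth_Some ni.
  have tk : take i.+1 al = rcons (take i al) a.
    rewrite (take_nth a ni); congr rcons; exact: onth_nth ai.
  have Pt : Pw (rcons (take i al) a).
    rewrite -tk; apply: (@Pw_prefix _ (drop i.+1 al)); last by rewrite cat_take_drop.
    by rewrite tk; case: (take i al).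
  have [e [ee te _]] := edge_some _ _ Pt; rewrite size_takel 1?ltnW // in ee.
  by rewrite ee ai /= te.
have levP n A : lev r ed n A -> exists be, [/\ size be = n, Pw be & Fw be A].
  case: n => [|n] /=.
    by rewrite rE' => FA; exists [::]; split=> //; have [C xC _] := FA; exists C.
  case en : (ed n) => [e|//] eA; have [be [a [sb P te de]]] := edge_inv _ _ en.
  by exists (rcons be a); rewrite size_rcons sb -de.
have [x [xr xe]] : exists x, bpath_r x = r /\ bpath_edge x = ed.
  apply: bpath_exists wf _ => n A en /levP[be [sb _ [C xC CA]]] regA.
  have regC := regular_le CA regA; have [C0 wC] := X_idem xC.
  have [_ finC] := regC C C0 (lexx _).
  have [_ tg] := tight_xi.
  (* For regular [C] the finitely many one-letter extensions cover [(be, C, be)], so one of them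
     belongs to [xi] and the path goes on after [be]. *)
  have [|z [[a aC <-] xz]] := tg _ [set idm (be ++ [:: a]) (act S a C) | a in Delta S C] xC.
    split.
    - exact: finite_image.
    - move=> _ [a aC <-]; split.
        by split=> //; apply: widl_act wC _; exact: lexx.
      by apply/idem_leP => //; exists [:: a].
    - move=> [[[ze E] ze']|//] [<- E0 wE] /(idem_leP S _ _ _ E0)[w we EC] _.
      subst ze; case: w EC wE => [|a w] EC wE.
        have [[a aE] _] := regC E E0 EC.
        have aEC : (act S a E <= act S a C)%O by exact: act_le.
        exists (idm (be ++ [:: a]) (act S a C)).
          exists a => //=; apply/eqP => e0; move/eqP: aE; apply.
          by apply/eqP; rewrite -lex0 -e0.
        by rewrite cats0 mul_idr mk_triple_neq0 [wact _ _]/(act S a E) (meet_idPl aEC).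
      exists (idm (be ++ [:: a]) (act S a C)).
        exists a => //=; apply/eqP => e0; move: EC.
        by rewrite /Defs.wact /= e0 -/(Defs.wact S w _) wact0 lex0 (negbTE E0).
      rewrite -cat1s catA mul_idl mk_triple_neq0.
      by rewrite (meet_idPl (_ : (E <= wact w (act S a C))%O)).
  have [e [ee _ _]] : exists e, [/\ ed (size be) = Some e, tagE e = a
     & set_val (dE e) = Fw (rcons be a)].
    by apply: edge_some; rewrite -cats1; exists (act S a C).
  by rewrite sb en in ee.
exists x; apply/seteqP; split=> e.
  case: e => [[[al A] be]|//] [<- [p l wA]].
  rewrite xe in p; rewrite xr xe in l.
  have [be' [sb [D xD] [C xC CA]]] := levP _ _ l.
  have ab : be' = al by apply: (pre_fun _ p sb); apply: preP; exists D.
  subst be'; apply: (@X_up al [::] C A) => //; by rewrite cats0.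
move=> xe'; have [be [A [eE A0 wA]]] := xi_elt xe'; subst e; split=> //.
have Pb : Pw be by exists A.
split=> //; first by rewrite xe; exact: preP.
rewrite xr xe; case/lastP: be xe' Pb {wA} => [|be a] xe' Pb /=.
  by rewrite rE'; exists A.
rewrite size_rcons /=; have [e [-> _ ->]] := edge_some _ _ Pb.
by exists A.
Qed.

End TightToPath.

(** * Ultrafilters of idempotents are tight *)

Section CylinderSpace.
Context {d : Order.disp_t} {B : cbDistrLatticeType d} {L : choiceType}.
Variable S : gbds B L.
Implicit Types (A C D E : B) (al be ga w : seq L).
Local Notation triple := (triple (B := B) (L := L)).
Implicit Types (e f g : triple).

Lemma idem_elt e : idem S e -> e <> None ->
  exists be A, [/\ e = idm be A, A != \bot%O & widl S be A].
Proof. by case: e => [[[be A] be']|//] [<- A0 wA] _; exists be, A. Qed.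

Lemma idem_le_trans e f g : idem S e -> idem S f -> idem S g ->
  idem_le S e f -> idem_le S f g -> idem_le S e g.
Proof.
case: e => [[[al A] al']|//] [<- A0 wA].
case: f => [[[be C] be']|] //= [<- C0 wC].
case: g => [[[ga D] ga']|] //= [<- D0 wD].
move=> /(idem_leP S _ _ _ A0)[u -> AC'] /(idem_leP S _ _ _ C0)[v -> CD].
apply/idem_leP => //; exists (v ++ u); first by rewrite catA.
by rewrite wact_cat; apply: le_trans AC' _; exact: wact_le.
Qed.

Lemma idem_mul e f : idem S e -> idem S f -> idem S (invsg_mul S e f).
Proof.
case: e => [[[be A] be']|//] [<- A0 wA].
case: f => [[[ga C] ga']|] // [<- C0 wC].
have [[w e]|[w e]|->//] := mul_id_cases S be ga A C; subst.
  rewrite mul_idr /mk_triple; case: eqP => // /eqP h; split=> //.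
  exact: widl_le (leIr _ _) wC.
rewrite mul_idl /mk_triple; case: eqP => // /eqP h; split=> //.
exact: widl_le (leIl _ _) wA.
Qed.

Lemma idem_mul_le e f : idem S e -> idem S f ->
  idem_le S (invsg_mul S e f) e /\ idem_le S (invsg_mul S e f) f.
Proof.
case: e => [[[be A] be']|//] [<- A0 wA].
case: f => [[[ga C] ga']|] // [<- C0 wC].
have [[w e]|[w e]|->//] := mul_id_cases S be ga A C; subst.
  rewrite mul_idr /mk_triple; case: eqP => // /eqP h.
  split; apply/idem_leP => //; first by exists w => //; exact: leIl.
  by exists [::]; rewrite ?cats0 //; exact: leIr.
rewrite mul_idl /mk_triple; case: eqP => // /eqP h.
split; apply/idem_leP => //; last by exists w => //; exact: leIr.
by exists [::]; rewrite ?cats0 //; exact: leIl.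
Qed.

Lemma idem_le_mul e f g : idem S e -> idem S f -> idem S g -> e <> None ->
  idem_le S e f -> idem_le S e g -> idem_le S e (invsg_mul S f g).
Proof.
case: e => [[[al A] al']|//] [<- A0 wA].
case: f => [[[be C] be']|] // [<- C0 wC].
case: g => [[[ga D] ga']|] // [<- D0 wD] _.
move=> /(idem_leP S _ _ _ A0)[u eu AC'] /(idem_leP S _ _ _ A0)[v ev AD].
have nz w E : (A <= wact S w E)%O -> E != \bot%O.
  by move=> AE; apply/eqP => E0; rewrite E0 wact0 lex0 (negbTE A0) in AE.
have [[w [ew uv]]|[w [ew vu]]] : (exists w, ga = be ++ w /\ u = w ++ v) \/
    (exists w, be = ga ++ w /\ v = w ++ u) by apply: cat_cases; rewrite -eu -ev.
  have h : (A <= wact S v (wact S w C `&` D))%O.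
    by rewrite wactI lexI AD andbT -wact_cat -uv.
  by subst ga; rewrite mul_idr mk_triple_Some; [apply/idem_leP => //; exists v|exact: nz h].
have h : (A <= wact S u (C `&` wact S w D))%O by rewrite wactI lexI AC' /= -wact_cat -vu.
by subst be; rewrite mul_idl mk_triple_Some; [apply/idem_leP => //; exists u|exact: nz h].
Qed.

Lemma idem_le_None e : idem_le S e None -> e = None.
Proof. by case: e => [[[be A] be']|]. Qed.

(** By maximality, an idempotent outside an ultrafilter has product 0 with some member. If all of a
    finite cover were outside, a common lower bound of these members would have product 0 with the
    whole cover. *)
Lemma ultra_tight (xi : set triple) :
  is_ultrafilter (idem S) (idem_le S) None xi -> tight S xi.
Proof.
move=> [pf mx]; split=> // x Z xx [finZ subZ cov]; apply: contrapT => dis.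
have [fI _ f0 fup fdir] := pf.
have sep z : Z z -> exists2 y, xi y & invsg_mul S y z = None.
  move=> Zz; apply: contrapT => h; apply: dis; exists z; split=> //.
  have [iz lz] := subZ z Zz.
  have nz y : xi y -> invsg_mul S y z <> None by move=> xy e; apply: h; exists y.
  pose G := [set t | idem S t /\ exists2 y, xi y & idem_le S (invsg_mul S y z) t].
  apply: (mx G); last first.
  - by split=> //; exists x => //; exact: (idem_mul_le (fI _ xx) iz).2.
  - move=> y xy; split; first exact: fI.
    by exists y => //; exact: (idem_mul_le (fI _ xy) iz).1.
  split.
  - by move=> t [].
  - by exists z; split=> //; exists x => //; exact: (idem_mul_le (fI _ xx) iz).2.
  - by move=> [_ [y xy /idem_le_None]]; exact: nz.
  - move=> s t [is_ [y xy ys]] it st; split=> //; exists y => //.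
    apply: idem_le_trans ys st => //; apply: idem_mul => //; exact: fI.
  - move=> s t [is_ [y xy ys]] [it [y' xy' yt]].
    have [u [xu uy uy']] := fdir _ _ xy xy'.
    have iu := fI _ xu; exists (invsg_mul S u z).
    have [m1 m2] := idem_mul_le iu iz; have im := idem_mul iu iz.
    have le (w : triple) : xi w -> idem_le S u w -> idem_le S (invsg_mul S u z) (invsg_mul S w z).
      move=> xw uw; apply: idem_le_mul => //; [exact: fI|exact: nz|].
      by apply: idem_le_trans m1 uw => //; exact: fI.
    have tr (w s' : triple) : xi w -> idem_le S u w -> idem S s' -> idem_le S (invsg_mul S w z) s' ->
        idem_le S (invsg_mul S u z) s'.
      move=> xw uw is' h'; apply: idem_le_trans (le w xw uw) h' => //.
      by apply: idem_mul => //; exact: fI.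
    split; [split=> //; exists u => //; exact: idem_lexx|exact: tr ys|exact: tr yt].
have /finite_seqP[l Zl] := finZ.
have [y [xy yx yl]] : exists y, [/\ xi y, idem_le S y x &
    forall z, z \in l -> invsg_mul S y z = None].
  have : forall z, z \in l -> Z z by rewrite Zl.
  elim: (l) => [_|z l' IH lZ]; first by exists x; split=> //; apply: idem_lexx; exact: fI.
  have [|y [xy yx yl]] := IH; first by move=> z' z'l; apply: lZ; rewrite inE z'l orbT.
  have Zz := lZ z (mem_head _ _); have [y' xy' y'z] := sep z Zz.
  have [iz _] := subZ z Zz.
  have [u [xu uy uy']] := fdir _ _ xy xy'; have iu := fI _ xu.
  have none (w z' : triple) : idem S z' -> xi w -> idem_le S u w -> invsg_mul S w z' = None ->
      invsg_mul S u z' = None.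
    move=> iz' xw uw wz; apply: contrapT => uz.
    have [m1 m2] := idem_mul_le iu iz'; have im := idem_mul iu iz'.
    apply: (uz); apply: idem_le_None; rewrite -wz.
    apply: (idem_le_mul im (fI _ xw) iz' uz _ m2).
    exact: idem_le_trans im iu (fI _ xw) m1 uw.
  exists u; split=> //; first by apply: idem_le_trans uy yx; exact: fI.
  move=> z'; rewrite inE => /orP[/eqP ->|z'l]; first exact: none y'z.
  have [iz' _] := subZ z' (lZ z' (mem_behead (s := z :: l') z'l)).
  by apply: none (yl _ z'l).
have [|z Zz] := cov y (fI _ xy) yx; first by move=> y0; rewrite y0 in xy.
by apply; apply: yl; move: Zz; rewrite Zl.
Qed.

(** It turns emptiness of a set of paths into a statement about idempotents; this is how an empty
    atom is later recognised as a cover. *)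
Lemma cyl_nonempty al A : widl S al A -> A != \bot%O -> exists x : bpath S, cyl al A x.
Proof.
move=> wA A0; have ie : idem S (idm al A) by [].
have [xi [/ultra_tight/tight_code[x <-] [_ h]]] : exists xi,
    is_ultrafilter (idem S) (idem_le S) None xi /\ xi (idm al A).
  apply: ultrafilter_exists => //; first by move=> e; exact: idem_lexx.
  by move=> e f g; exact: idem_le_trans.
by exists x.
Qed.

End CylinderSpace.

(** * The shift map *)

Section Shift.
Context {d : Order.disp_t} {B : cbDistrLatticeType d} {L : choiceType}.
Variable S : gbds B L.
Implicit Types (A C D E : B) (al be ga u v w : seq L) (x y z : bpath S).
Local Notation widl := (Defs.widl S).
Local Notation wact := (Defs.wact S).
Local Notation dom n := (iter_dom (sigmaE_dom S) (sigmaE S) n).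
Local Notation sh n := (iter n (sigmaE S)).

Definition prex x u := pre (bpath_edge x) u.

Lemma iter_edge n x i : dom n x -> bpath_edge (sh n x) i = bpath_edge x (n + i)%N.
Proof.
elim: n i => [//|n IH] i dn.
have dn' : dom n x by move=> k kn; apply: dn; exact: leqW.
rewrite iterS sigmaE_edge; last exact: dn (ltnSn n).
by rewrite IH // addnS.
Qed.

Lemma iter_blev n x i : dom n x -> blev (sh n x) i = blev x (n + i)%N.
Proof.
case: i => [|i] dn; last first.
  by rewrite /blev addnS /= iter_edge.
rewrite addn0; case: n dn => [//|n] dn.
have dn' : dom n x by move=> k kn; apply: dn; exact: leqW.
have := dn n (ltnSn n) => /sigmaE_domP; rewrite iter_edge // addn0.
case en : (bpath_edge x n) => [e|//] _; rewrite /blev /= en.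
by rewrite (@sigmaE_r _ _ _ _ _ e) // iter_edge // addn0.
Qed.

Lemma prex_dom u x : prex x u -> dom (size u) x.
Proof.
move=> p; have : (size u <= size u)%N by []; move: {-2}(size u) => n.
elim: n => [//|n IH] nu; have dn := IH (ltnW nu).
move=> k; rewrite ltnS leq_eqVlt => /orP[/eqP ->|]; last exact: dn.
apply/sigmaE_domP; rewrite iter_edge // addn0.
by move/pre_onth: p => /(_ n nu); have [a ->] := onth_Some nu; case: bpath_edge.
Qed.

Lemma dom_prex n x : dom n x -> exists2 u, prex x u & size u = n.
Proof.
move=> dn; apply: cyl_pre_exists; case: n dn => [//|n] dn.
have dn' : dom n x by move=> k kn; apply: dn; exact: leqW.
by have := dn n (ltnSn n) => /sigmaE_domP; rewrite iter_edge // addn0.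
Qed.

Lemma prex_shift u v x : prex x u -> prex x (u ++ v) <-> prex (sh (size u) x) v.
Proof.
move=> p; rewrite /prex pre_cat (_ : bpath_edge (sh (size u) x) = fun n => bpath_edge x (size u + n)%N).
  by split=> [[]|].
by apply/funext => i; rewrite iter_edge //; exact: prex_dom.
Qed.

Lemma cyl_shift u v A x : prex x u ->
  cyl (u ++ v) A x <-> cyl v A (sh (size u) x) /\ widl (u ++ v) A.
Proof.
move=> p; have e : blev (sh (size u) x) (size v) = blev x (size (u ++ v)).
  by rewrite iter_blev ?size_cat //; exact: prex_dom.
split=> [[p' l w]|[[p' l w'] w]].
  split=> //; split; first exact/prex_shift.
    by rewrite -/(blev _ _) e.
  exact: widl_suffix w.
split=> //; first exact/prex_shift.
by rewrite -/(blev _ _) -e.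
Qed.

Lemma cyl_prex u A x : cyl u A x -> prex x u.
Proof. by case. Qed.

Lemma cyl_lev u A x : cyl u A x -> blev x (size u) A.
Proof. by case. Qed.

Lemma prex_cyl u x : u <> [::] -> prex x u -> exists A, cyl u A x.
Proof.
by move=> un p; have [A lA wA] := lev_widl (bpath_wf x) un p; exists A.
Qed.

Lemma cyl_shift_ex u v A x : prex x u -> cyl v A (sh (size u) x) -> u ++ v <> [::] ->
  exists C, cyl (u ++ v) (C `&` A)%O x.
Proof.
move=> p cv un; have [C cC] : exists C, cyl (u ++ v) C x.
  apply: prex_cyl => //; apply/prex_shift => //; exact: cyl_prex cv.
exists C; apply/cyl_shift => //; have [cC' wC] := (cyl_shift _ _ p).1 cC.
split; first exact: rcylI cC' cv.
exact: widl_le (leIl _ _) wC.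
Qed.

Lemma cyl_ext x y : (forall u A, cyl u A x <-> cyl u A y) -> x = y.
Proof.
move=> h; have aux x' y' : (forall u A, cyl u A x' <-> cyl u A y') -> forall n e,
    bpath_edge x' n = Some e -> bpath_edge y' n = Some e.
  move=> {}h n e en.
  have [u pu su] : exists2 u, prex x' u & size u = n.+1.
    by apply: cyl_pre_exists; rewrite en.
  have [A cA] : exists A, cyl u A x' by apply: prex_cyl => // u0; rewrite u0 in su.
  have cA' := (h _ _).1 cA.
  have l1 := cyl_lev cA; have l2 := cyl_lev cA'.
  have e1 : blev x' (size u) = blev y' (size u).
    apply: (ultra_max (lev_ultra l1) (lev_ultra l2)) => C lC.
    have cAC : cyl u (A `&` C)%O x'.
      case: cA => p l w; split=> //; first exact: ultraI (lev_ultra l) l lC.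
      exact: widl_le (leIl _ _) w.
    have := cyl_lev ((h _ _).1 cAC) => l3.
    by apply: (ultra_upward (lev_ultra l3) _ l3) => //; exact: leIr.
  have [_ /(_ n)] := raw_ext (bpath_wf x') (bpath_wf y') pu (cyl_prex cA') e1.
  by rewrite su => /(_ (ltnSn n)) <-.
apply: bpath_ext; last first.
  move=> i; case ex : (bpath_edge x i) => [e|]; first by rewrite (aux _ _ h _ _ ex).
  case ey : (bpath_edge y i) => [e|//].
  by rewrite (aux _ _ (fun u A => iff_sym (h u A)) _ _ ey) in ex.
case ex : (bpath_edge x 0%N) => [e|].
  by rewrite (wf_r (bpath_wf x) ex) (wf_r (bpath_wf y) (aux _ _ h _ _ ex)).
apply: F0_ext; apply/seteqP; split=> A rA.
  by have [_ l _] := (h [::] A).1 (And3 I rA I).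
by have [_ l _] := (h [::] A).2 (And3 I rA I).
Qed.

(** Conditions beyond [u] are visible after the shift, and those at prefixes of [u] are decided by
    the vertex at the end of [u], which is the range of the shifted path. *)
Lemma shift_inj u x y : prex x u -> prex y u -> sh (size u) x = sh (size u) y -> x = y.
Proof.
move=> px py e; have [u0|un] := eqVneq u [::]; first by rewrite u0 in e.
have aux x' y' : prex x' u -> prex y' u -> sh (size u) x' = sh (size u) y' ->
    forall w A, cyl w A x' -> cyl w A y'.
  move=> {}px {}py {}e w A cw.
  have [[v ev]|[v ev]] := pre_comparable px (cyl_prex cw).
    subst w; have [cv wv] := (cyl_shift v A px).1 cw.
    by apply/(cyl_shift v A py); rewrite -e.
  have wA := cyl_widl cw; subst u.
  have lw : blev x' (size (w ++ v)) (wact v A).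
    have [_ l _] := cw; have [_ pv] := (pre_cat _ _ _).1 px.
    by have := (lev_cat (bpath_wf x') A pv).1 l; rewrite /blev size_cat.
  have : blev y' (size (w ++ v)) (wact v A).
    move: lw; rewrite -[size (w ++ v)]addn0 -iter_blev; last exact: prex_dom.
    by rewrite e iter_blev //; exact: prex_dom.
  have [pw pv] := (pre_cat _ _ _).1 py.
  rewrite size_cat => l; split=> //.
  exact: (lev_cat (bpath_wf y') A pv).2.
apply: cyl_ext => w A; split; exact: aux.
Qed.

Lemma cyl_of_shift u C v A x : widl v A -> cyl u C x ->
  cyl v A (sh (size u) x) <-> cyl (u ++ v) (A `&` wact v C)%O x.
Proof.
move=> wA cC; have p := cyl_prex cC; have wC := cyl_widl cC.
have w' : widl (u ++ v) (A `&` wact v C)%O by apply: widl_act wC (leIr _ _).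
have lC : blev (sh (size u) x) 0 C by rewrite iter_blev ?addn0; [exact: cyl_lev|exact: prex_dom].
rewrite cyl_shift //; split=> [cA|[cA _]]; last exact: rcyl_up wA (leIl _ _) cA.
split=> //; have [pv l w] := cA; split=> //.
  apply: ultraI (lev_ultra l) l _.
  by have := (lev_cat (n := 0) (bpath_wf (sh (size u) x)) C pv).1 lC; rewrite add0n.
exact: widl_le (leIl _ _) w.
Qed.

(** A word extending [u] loses this prefix, a condition inside [u] moves to the range of the shifted
    path, and an incomparable word is never met: the empty word with the bottom element encodes the
    empty set. *)
Lemma cyl_to_shift u w A : exists w' A', forall C x, cyl u C x ->
  cyl w A x <-> cyl w' A' (sh (size u) x).
Proof.
have none : (forall C x, cyl u C x -> ~ cyl w A x) -> exists w' A', forall C x, cyl u C x ->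
    cyl w A x <-> cyl w' A' (sh (size u) x).
  move=> h; exists [::], \bot%O => C x cC; split=> [/(h _ _ cC)//|cA].
  by case: (rcyl0 cA).
have [wA|nwA] := pselect (widl w A); last first.
  by apply: none => C x _ cA; apply: nwA; exact: cyl_widl cA.
have [/prefixP[v ev]|n1] := boolP (prefix u w).
  subst w; exists v, A => C x cC; rewrite cyl_shift; last exact: cyl_prex cC.
  by split=> [[]|].
have [/prefixP[v ev]|n2] := boolP (prefix w u); last first.
  apply: none => C x cC cA; have [[v e]|[v e]] := cyl_comparable cC cA.
    by move: n1; rewrite e prefix_prefix.
  by move: n2; rewrite e prefix_prefix.
subst u; exists [::], (wact v A) => C x cC; have p := cyl_prex cC.
have [pw pv] := (pre_cat _ _ _).1 p.
have e := lev_cat (bpath_wf x) A pv.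
have e' : blev (sh (size (w ++ v)) x) 0 = blev x (size w + size v)%N.
  by rewrite iter_blev ?addn0; [rewrite size_cat|exact: prex_dom].
split=> [[_ l _]|[_ l _]].
  by split=> //; rewrite -/(blev _ _) e'; exact: e.1.
by split=> //; apply: e.2; rewrite -/(blev x _) -e'.
Qed.

(** Letters are prepended one at a time. The new edge has as source the range of the path built so
    far, which meets the ideal of the letter since [A] lies in [widl (u ++ v)]; the boundary
    condition is untouched. *)
Lemma shift_exists u v A y : cyl v A y -> widl (u ++ v) A ->
  exists x, prex x u /\ sh (size u) x = y.
Proof.
move=> cA wA; elim: u wA => [|a u IH] wA; first by exists y.
have [x' [p' e']] := IH (widl_suffix (u := [:: a]) wA).
have cx' : cyl (u ++ v) A x'.
  by apply/cyl_shift => //; rewrite e'; split=> //; exact: (widl_suffix (u := [:: a]) wA).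
have [C IC AC'] := wA; have [puv luv _] := cx'.
have l0 : blev x' 0 C.
  have := (lev_cat (n := 0) (bpath_wf x') C puv).2; rewrite add0n; apply.
  exact: ultra_upward (lev_ultra luv) _ luv AC'.
have [e [te de]] := E1_exists (lev_ultra l0) l0 IC.
pose ed n := if n is m.+1 then bpath_edge x' m else Some e.
have wf' := bpath_wf x'.
have rx : bpath_r x' = Some (dE e).
  by apply: F0_ext; rewrite /= de.
have wf : wf_path (rE e) ed.
  split=> //=.
  - by move=> [|n] //=; exact: (wf_step wf').
  - by move=> f [->].
  - move=> [|n] f g /=; last exact: (wf_d wf').
    by move=> [<-] g0; rewrite -rx; exact: (wf_r wf' g0).
have levE n : lev (rE e) ed n.+1 = blev x' n.
  by case: n => [|n] //=; rewrite de.
have [x [xr xe]] : exists x, bpath_r x = rE e /\ bpath_edge x = ed.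
  apply: bpath_exists => // -[|n] D //= en.
  by rewrite -/(lev (rE e) ed n.+1) levE; exact: bpath_singular.
have dx : sigmaE_dom S x by apply/sigmaE_domP; rewrite xe.
have sx : sigmaE S x = x'.
  apply: bpath_ext; first by rewrite (@sigmaE_r _ _ _ _ _ e) ?xe ?rx.
  by move=> i; rewrite sigmaE_edge // xe.
exists x; split; last by rewrite [size _]/= iterSr sx.
by rewrite /prex xe /= te; split=> //; move: p'; rewrite /prex.
Qed.

Lemma shift_image u C y : cyl [::] C y -> widl u C ->
  exists x, cyl u C x /\ sh (size u) x = y.
Proof.
move=> cC wC; have [|x [p e]] := shift_exists (u := u) cC; first by rewrite cats0.
exists x; split=> //; rewrite -[u]cats0; apply/cyl_shift => //.
by rewrite e cats0.
Qed.

Lemma shift_cyl u C x : cyl u C x -> cyl [::] C (sh (size u) x).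
Proof.
by move=> cC; have [] := (cyl_shift [::] C (cyl_prex cC)).1; rewrite cats0.
Qed.

Lemma cbox_to_shift u P N : exists P' N', forall C x, cyl u C x ->
  cbox P N x <-> cbox P' N' (sh (size u) x).
Proof.
have lst (l : seq (seq L * B)) : exists l' : seq (seq L * B), forall C x, cyl u C x ->
    ((forall p, p \in l -> cyl p.1 p.2 x) <-> (forall p, p \in l' -> cyl p.1 p.2 (sh (size u) x)))
    /\ ((forall p, p \in l -> ~ cyl p.1 p.2 x) <-> (forall p, p \in l' -> ~ cyl p.1 p.2 (sh (size u) x))).
  elim: l => [|p l [l' IH]]; first by exists [::].
  have [w' [A' h]] := cyl_to_shift u p.1 p.2; exists ((w', A') :: l') => C x cC.
  have [IH1 IH2] := IH C x cC; have hp := h C x cC.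
  split; split=> H q; rewrite inE => /orP[/eqP ->|ql].
  - by apply/hp; apply: H; rewrite mem_head.
  - by apply: IH1.1 ql => p' p'l; apply: H; rewrite inE p'l orbT.
  - by apply/hp; exact: (H (w', A') (mem_head _ _)).
  - by apply: IH1.2 ql => p' p'l; apply: H; rewrite inE p'l orbT.
  - by move=> /hp; apply: H; rewrite mem_head.
  - by apply: IH2.1 ql => p' p'l; apply: H; rewrite inE p'l orbT.
  - by move=> /hp; exact: (H (w', A') (mem_head _ _)).
  - by apply: IH2.2 ql => p' p'l; apply: H; rewrite inE p'l orbT.
have [P' hP] := lst P; have [N' hN] := lst N; exists P', N' => C x cC.
by have [h1 _] := hP C x cC; have [_ h2] := hN C x cC; split=> -[/h1 ? /h2 ?]; split.
Qed.

Lemma cbox_of_shift u C P N : widl u C -> exists P' N', forall x, cyl u C x ->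
  cbox P N (sh (size u) x) <-> cbox P' N' x.
Proof.
move=> wC.
have one (p : seq L * B) : exists p' : seq L * B, forall x, cyl u C x ->
    cyl p.1 p.2 (sh (size u) x) <-> cyl p'.1 p'.2 x.
  have [wp|nwp] := pselect (widl p.1 p.2).
    by exists (u ++ p.1, (p.2 `&` wact p.1 C)%O) => x cC; exact: cyl_of_shift.
  exists ([::], \bot%O) => x cC; split=> [/cyl_widl//|h]; by case: (rcyl0 h).
have lst (l : seq (seq L * B)) : exists l' : seq (seq L * B), forall x, cyl u C x ->
    ((forall p, p \in l -> cyl p.1 p.2 (sh (size u) x)) <-> (forall p, p \in l' -> cyl p.1 p.2 x))
    /\ ((forall p, p \in l -> ~ cyl p.1 p.2 (sh (size u) x)) <-> (forall p, p \in l' -> ~ cyl p.1 p.2 x)).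
  elim: l => [|p l [l' IH]]; first by exists [::].
  have [p1 h] := one p; exists (p1 :: l') => x cC.
  have [IH1 IH2] := IH x cC; have hp := h x cC.
  split; split=> H q; rewrite inE => /orP[/eqP ->|ql].
  - by apply/hp; apply: H; rewrite mem_head.
  - by apply: IH1.1 ql => p' p'l; apply: H; rewrite inE p'l orbT.
  - by apply/hp; exact: (H p1 (mem_head _ _)).
  - by apply: IH1.2 ql => p' p'l; apply: H; rewrite inE p'l orbT.
  - by move=> /hp; apply: H; rewrite mem_head.
  - by apply: IH2.1 ql => p' p'l; apply: H; rewrite inE p'l orbT.
  - by move=> /hp; exact: (H p1 (mem_head _ _)).
  - by apply: IH2.2 ql => p' p'l; apply: H; rewrite inE p'l orbT.
have [P' hP] := lst P; have [N' hN] := lst N; exists P', N' => x cC.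
by have [h1 _] := hP x cC; have [_ h2] := hN x cC; split=> -[/h1 ? /h2 ?]; split.
Qed.

(** The idempotents whose cylinders belong to an ultrafilter [F] of sets form a tight filter: a
    finite cover of an idempotent splits its cylinder into finitely many, one of which is in [F].
    The path coded by this filter is the limit. *)
Lemma cyl_compact al A : compact (cyl (S := S) al A).
Proof.
apply: ultrafilter_compact => F UF FA.
pose xi : set (triple (B := B) (L := L)) :=
  [set e | if e is Some (be, C, be') then be = be' /\ F (cyl (S := S) be C) else False].
have elt e : xi e -> exists be C, [/\ e = idm be C, C != \bot%O, widl be C & F (cyl (S := S) be C)].
  case: e => [[[be C] be']|//] [<- FC]; exists be, C; have [x xC] := filter_ex FC.
  by split=> //; [exact: cyl_neq0 xC|exact: cyl_widl xC].
have cx x e : code x e -> exists be C, e = idm be C /\ cyl be C x.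
  by case: e => [[[be C] be']|//] [<- h]; exists be, C.
have xiT : tight S xi.
  split.
    split.
    - by move=> e /elt[be [C [-> C0 wC _]]].
    - by exists (idm al A).
    - by [].
    - move=> e f /elt[be [C [-> C0 wC FC]]] iF ef.
      case: f iF ef => [[[ga D] ga']|] // [<- D0 wD] ef; split=> //.
      apply: filterS FC => x xC; have [_ _ _ up _] := code_filter x.
      by have [] := up (idm be C) (idm ga D) (conj erefl xC) (And3 erefl D0 wD) ef.
    - move=> e f /elt[be [C [-> C0 wC FC]]] /elt[ga [D [-> D0 wD FD]]].
      have ie : idem S (idm be C) by [].
      have ig : idem S (idm ga D) by [].
      have [m1 m2] := idem_mul_le ie ig.
      exists (invsg_mul S (idm be C) (idm ga D)); split=> //.
      have FCD : F (cyl (S := S) be C `&` cyl (S := S) ga D) by exact: filterI.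
      have [x [xC xD]] := filter_ex FCD.
      have key y : cyl be C y -> cyl ga D y -> code y (invsg_mul S (idm be C) (idm ga D)).
        move=> yC yD; have [_ _ _ up dir] := code_filter y.
        have [z [yz zC zD]] := dir (idm be C) (idm ga D) (conj erefl yC) (conj erefl yD).
        apply: (up _ _ yz); first exact: idem_mul.
        have [cI _ c0 _ _] := code_filter y.
        apply: (idem_le_mul (cI _ yz) ie ig _ zC zD).
        by move=> z0; rewrite z0 in yz.
      have [ze [E [eE _]]] := cx _ _ (key x xC xD); rewrite eE; split=> //.
      apply: filterS FCD => y [yC yD]; have := key y yC yD.
      by rewrite eE => -[].
  move=> e Z /elt[be [C [-> C0 wC FC]]] [finZ subZ cov].
  have /finite_seqP[l Zl] := finZ.
  have cvr x : cyl be C x -> exists2 z, z \in l & code x z.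
    move=> xC; have [_ tg] := code_tight x.
    have [z [Zz xz]] := tg (idm be C) Z (conj erefl xC) (And3 finZ subZ cov).
    by exists z => //; move: Zz; rewrite Zl.
  have : F [set x | exists2 z, z \in l & code x z] by apply: filterS FC.
  have lZ (z : triple (B := B) (L := L)) : z \in l -> Z z by rewrite Zl.
  elim: (l) lZ => [|z l' IH] lZ Fl.
    by have [x [z]] := filter_ex Fl; rewrite in_nil.
  have [Fz|Fz] := in_ultra_setVsetC [set x | code x z] UF.
    exists z; split; first by apply: lZ; rewrite mem_head.
    have [x xz] := filter_ex Fz; have [ze [E [eE _]]] := cx _ _ xz; subst z; split=> //.
    by apply: filterS Fz => y [].
  apply: IH; first by move=> z' z'l; apply: lZ; rewrite inE z'l orbT.
  apply: filterS2 Fl Fz => x [z' z'l xz'] /= nxz; exists z' => //.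
  by move: z'l; rewrite inE => /orP[/eqP ez|//]; rewrite ez in xz'.
have [x cxx] := tight_code xiT.
have xiP be C : cyl be C x <-> F (cyl (S := S) be C).
  have -> : cyl be C x <-> code x (idm be C) by split=> [|[]].
  by rewrite cxx; split=> [[]|].
exists x; first exact/xiP.
move=> W /bpath_nbhs[P [N [[xP xN] sub]]]; apply: filterS sub _.
have FP : F [set y | forall p, p \in P -> cyl p.1 p.2 y].
  elim: P xP => [|p P IH] xP; first by apply: filterS filterT.
  have Fp : F (cyl (S := S) p.1 p.2) by apply/xiP; apply: xP; rewrite mem_head.
  have {}IH : F [set y | forall p, p \in P -> cyl p.1 p.2 y].
    by apply: IH => p' p'P; apply: xP; rewrite inE p'P orbT.
  apply: filterS2 Fp IH => y yp yP p'; rewrite inE => /orP[/eqP -> //|]; exact: yP.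
have FN : F [set y | forall p, p \in N -> ~ cyl p.1 p.2 y].
  elim: N xN => [|p N IH] xN; first by apply: filterS filterT.
  have Fp : F (~` cyl (S := S) p.1 p.2).
    have [/xiP xp|//] := in_ultra_setVsetC (cyl (S := S) p.1 p.2) UF.
    by case: (xN p (mem_head _ _)).
  have {}IH : F [set y | forall p, p \in N -> ~ cyl p.1 p.2 y].
    by apply: IH => p' p'P; apply: xN; rewrite inE p'P orbT.
  apply: filterS2 Fp IH => y yp yP p'; rewrite inE => /orP[/eqP -> //|]; exact: yP.
by apply: filterS2 FP FN => y yP yN; split.
Qed.

Lemma sigmaE_local_homeo : local_homeomorphism (sigmaE_dom S) (sigmaE S).
Proof.
have nb x : sigmaE_dom S x -> exists a A, cyl [:: a] A x.
  move=> dx; have [|u pu su] := @dom_prex 1 x; first by case.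
  have [A cA] : exists A, cyl u A x by apply: prex_cyl => // u0; rewrite u0 in su.
  by case: u su pu cA => [|a [|]] // _ _ cA; exists a, A.
have cd a A : cyl (S := S) [:: a] A `<=` sigmaE_dom S.
  by move=> x cA; exact: (prex_dom (cyl_prex cA) (ltn0Sn 0)).
split.
  rewrite openE => x /nb[a [A cA]]; apply: (filterS (@cd a A)).
  by apply: open_nbhs_nbhs; split=> //; exact: cyl_open.
move=> x /nb[a [A cA]]; exists (cyl (S := S) [:: a] A); split.
- by split=> //; exact: cyl_open.
- exact: cd.
- move=> y z /set_mem yA /set_mem zA e.
  exact: (@shift_inj [:: a] y z (cyl_prex yA) (cyl_prex zA) e).
- have wA := cyl_widl cA; apply/subspace_continuousP => y yA W.
  move=> /bpath_nbhs[P [N [yPN sub]]].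
  have [P' [N' h]] := cbox_of_shift P N wA.
  have yPN' : cbox P' N' y by exact/(h y yA).
  rewrite /nbhs /= /within; have : nbhs y (cbox P' N').
    by apply: open_nbhs_nbhs; split=> //; exact: cbox_open.
  by apply: filterS => z zPN zA; apply: sub; exact/(h z zA).
- move=> V oV VU; have wA := cyl_widl cA.
  rewrite openE => _ [y Vy <-].
  have [P [N [yPN sub]]] := bpath_nbhs (open_nbhs_nbhs (conj oV Vy)).
  have [P' [N' h]] := cbox_to_shift [:: a] P N.
  have yA := VU y Vy; have yPN' := (h A y yA).1 yPN.
  (* Every path whose range contains [A] is the shift of one in [cyl [:: a] A], so a whole
     neighbourhood is attained. *)
  apply: (@filterS _ _ _ (cyl [::] A `&` cbox P' N')); last first.
    apply: open_nbhs_nbhs; split; first by apply: openI; [exact: cyl_open|exact: cbox_open].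
    by split=> //; exact: shift_cyl yA.
  move=> z [zA zPN]; have [x' [x'A ez]] := shift_image zA wA.
  exists x'; last exact: ez.
  by apply: sub; apply/(h A x' x'A); rewrite ez.
Qed.

End Shift.

(** * The Renault-Deaconu groupoid *)

Section Bisections.
Context {d : Order.disp_t} {B : cbDistrLatticeType d} {L : choiceType}.
Variable S : gbds B L.
Implicit Types (A C D E : B) (al be ga u v w : seq L) (x y z : bpath S).
Local Notation widl := (Defs.widl S).
Local Notation wact := (Defs.wact S).
Local Notation dom n := (iter_dom (sigmaE_dom S) (sigmaE S) n).
Local Notation sh n := (iter n (sigmaE S)).
Local Notation G := (RD_groupoid (sigmaE_dom S) (sigmaE S)).
Implicit Types (g h k : G).

Definition src g : bpath S := (set_val g).2.
Definition tgt g : bpath S := (set_val g).1.1.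
Definition deg g : int := (set_val g).1.2.

Lemma arrow_ext g h : tgt g = tgt h -> deg g = deg h -> src g = src h -> g = h.
Proof.
move=> e1 e2 e3; apply: val_inj; move: e1 e2 e3; rewrite /tgt /deg /src /set_val /=.
by case: (val g) => [[? ?] ?]; case: (val h) => [[? ?] ?] /= -> -> ->.
Qed.

(* The compact open bisection given by the inverse semigroup element
   (al, A, be): its arrows are (al z, |al| - |be|, be z). *)
Definition zset al A be : set G := [set g |
  [/\ deg g = (size al)%:Z - (size be)%:Z, cyl al A (tgt g), cyl be A (src g)
    & sh (size al) (tgt g) = sh (size be) (src g)]].

Lemma arrow_exists al A be x y : cyl al A x -> cyl be A y ->
  sh (size al) x = sh (size be) y ->
  exists g, [/\ zset al A be g, tgt g = x & src g = y].
Proof.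
move=> cx cy e.
have h : RD_set (sigmaE_dom S) (sigmaE S) (x, (size al)%:Z - (size be)%:Z, y).
  exists (size al), (size be); split=> //; apply: prex_dom; [exact: cyl_prex cx|exact: cyl_prex cy].
by exists (mkset h); split.
Qed.

Lemma zset_tgt_cyl al A be C g : zset al A be g ->
  widl al C -> widl be C -> cyl al C (tgt g) <-> cyl be C (src g).
Proof.
move=> [_ ca cb e] wa wb.
have ea := cyl_shift [::] C (cyl_prex ca); have eb := cyl_shift [::] C (cyl_prex cb).
rewrite !cats0 in ea eb; rewrite ea eb e.
by split=> -[? _]; split.
Qed.

Lemma zset_src_exists al A be y : widl al A -> cyl be A y ->
  exists g, zset al A be g /\ src g = y.
Proof.
move=> wA cy; have c0 := shift_cyl cy.
have [x [cx ex]] := shift_image c0 wA.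
by have [g [zg _ sg]] := arrow_exists cx cy ex; exists g.
Qed.

Lemma zset_src_inj al A be g h : zset al A be g -> zset al A be h ->
  src g = src h -> g = h.
Proof.
move=> [d1 a1 b1 e1] [d2 a2 b2 e2] es; apply: arrow_ext => //; last by rewrite d1 d2.
apply: (shift_inj (cyl_prex a1) (cyl_prex a2)); by rewrite e1 e2 es.
Qed.

Lemma zset_tgt_inj al A be g h : zset al A be g -> zset al A be h ->
  tgt g = tgt h -> g = h.
Proof.
move=> [d1 a1 b1 e1] [d2 a2 b2 e2] es; apply: arrow_ext => //; first by rewrite d1 d2.
apply: (shift_inj (cyl_prex b1) (cyl_prex b2)); by rewrite -e1 -e2 es.
Qed.

(** An element [A] can be found at the common vertex as soon as one of the two words is nonempty.
    With [m = n = 0] that vertex may be the extra point, and no [A] exists. *)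
Lemma arrow_words g m n : dom m (tgt g) -> dom n (src g) ->
  sh m (tgt g) = sh n (src g) -> deg g = m%:Z - n%:Z -> (m != 0)%N || (n != 0)%N ->
  exists al A be, [/\ size al = m, size be = n & zset al A be g].
Proof.
move=> dm dn e dg mn; have [al pa sa] := dom_prex dm; have [be pb sb] := dom_prex dn.
subst m n.
have [A [wa wb lA]] : exists A, [/\ widl al A, widl be A & blev (sh (size al) (tgt g)) 0 A].
  have lev0 u y A : prex y u -> cyl u A y -> blev (sh (size u) y) 0 A.
    by move=> p [_ l _]; rewrite iter_blev ?addn0 //; exact: prex_dom.
  have [a0|an] := eqVneq al [::].
    have bn : be <> [::] by move=> b0; rewrite a0 b0 in mn.
    have [A cA] := prex_cyl bn pb.
    by exists A; split; [rewrite a0|exact: cyl_widl cA|rewrite e; exact: lev0 cA].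
  have [A cA] := prex_cyl (elimN eqP an) pa.
  have [b0|bn] := eqVneq be [::].
    by exists A; split; [exact: cyl_widl cA|rewrite b0|exact: lev0 cA].
  have [C cC] := prex_cyl (elimN eqP bn) pb.
  exists (A `&` C)%O; split.
  - by apply: widl_le (cyl_widl cA); exact: leIl.
  - by apply: widl_le (cyl_widl cC); exact: leIr.
  - have l1 := lev0 _ _ _ pa cA; have l2 := lev0 _ _ _ pb cC; rewrite -e in l2.
    exact: ultraI (lev_ultra l1) l1 l2.
have c0 : cyl [::] A (sh (size al) (tgt g)) by [].
exists al, A, be; split=> //; split=> //.
  by rewrite -[al]cats0; apply/cyl_shift; rewrite ?cats0.
by rewrite -[be]cats0; apply/cyl_shift; rewrite ?cats0 // -e.
Qed.

Lemma arrow_zset g : exists al A be, zset al A be g.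
Proof.
have [m [n [dg dm dn e]]] := @set_valP _ _ g.
have [mn|] := boolP ((m != 0)%N || (n != 0)%N).
  by have [al [A [be [_ _ z]]]] := arrow_words dm dn e dg mn; exists al, A, be.
rewrite negb_or !negbK => /andP[/eqP m0 /eqP n0]; subst m n.
have exy : tgt g = src g := e.
have [al [A cA]] := cyl_exists (tgt g); exists al, A, al; split=> //.
- by rewrite /deg dg !subrr.
- by rewrite -exy.
- by rewrite exy.
Qed.

Lemma zset_RD_basic al A be (V : set (bpath S)) :
  zset al A be `&` src @^-1` V = [set t : RD_arrow (sigmaE_dom S) (sigmaE S) |
    RD_basic (sigmaE S) (size al) (size be) (cyl al A) (cyl be A `&` V) (set_val t)].
Proof.
apply/seteqP; split=> [g [[dg ca cb e] Vg]|g [dg ca [cb Vg] e]]; first by split.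
by split.
Qed.

Lemma zset_src_open al A be (V : set (bpath S)) : open V ->
  open (zset al A be `&` src @^-1` V).
Proof.
move=> oV; rewrite zset_RD_basic; apply: (RD_subbase _ _).1.
exists (size al), (size be), (cyl al A), (cyl be A `&` V); split=> //.
- by split; [exact: cyl_open|apply: openI => //; exact: cyl_open].
- by split=> [x cx|x [cx _]]; apply: prex_dom; exact: cyl_prex cx.
- split=> [x y /set_mem cx /set_mem cy e|x y /set_mem[cx _] /set_mem[cy _] e].
    exact: shift_inj (cyl_prex cx) (cyl_prex cy) e.
  exact: shift_inj (cyl_prex cx) (cyl_prex cy) e.
Qed.

Lemma zset_open al A be : open (zset al A be).
Proof. by rewrite -[zset _ _ _]setIT -(preimage_setT src); apply: zset_src_open; exact: openT. Qed.

(* Two bisections with a common arrow have words extending each other by the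
   same word, so they agree where both are defined. *)
Lemma zset_compat al A be al' A' be' g : zset al A be g -> zset al' A' be' g ->
  (exists w, al' = al ++ w /\ be' = be ++ w) \/ (exists w, al = al' ++ w /\ be = be' ++ w).
Proof.
have aux al1 A1 be1 al2 A2 be2 : zset al1 A1 be1 g -> zset al2 A2 be2 g ->
    (size al1 <= size al2)%N -> exists w, al2 = al1 ++ w /\ be2 = be1 ++ w.
  move=> [d1 a1 b1 e1] [d2 a2 b2 e2] le.
  have le' : (size be1 <= size be2)%N by move: d2; rewrite d1; lia.
  have ext u1 u2 y : prex y u1 -> prex y u2 -> (size u1 <= size u2)%N ->
      exists w, u2 = u1 ++ w.
    move=> p1 p2 s; have [[w ->]|[w ew]] := pre_comparable p1 p2; first by exists w.
    exists [::]; rewrite cats0; move: s; rewrite ew size_cat -{2}[size u2]addn0 leq_add2l.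
    by rewrite leqn0 size_eq0 => /eqP ->; rewrite cats0.
  have [w ew] := ext _ _ _ (cyl_prex a1) (cyl_prex a2) le.
  have [w' ew'] := ext _ _ _ (cyl_prex b1) (cyl_prex b2) le'.
  exists w; split=> //; rewrite ew'; congr (_ ++ _); subst al2 be2.
  have p1 := (prex_shift w (cyl_prex a1)).1 (cyl_prex a2).
  have p2 := (prex_shift w' (cyl_prex b1)).1 (cyl_prex b2).
  rewrite -e1 in p2; apply: pre_fun p2 p1 _.
  by move: d2; rewrite d1 !size_cat; lia.
move=> z z'; have [le|/ltnW le] := leqP (size al) (size al').
  by left; exact: aux z z' le.
by right; exact: aux z' z le.
Qed.

(** By [zset_compat], bisections sharing an arrow differ by a common suffix of both words, so
    membership in one of them depends, on the other, only on the source. *)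
Lemma zset_restrict al A be al' A' be' g h : zset al A be g -> zset al' A' be' g ->
  zset al' A' be' h -> cyl be A (src h) -> zset al A be h.
Proof.
move=> zg zg' zh cb; have [wa wb] : widl al A /\ widl be A.
  by case: zg => _ ca cb' _; split; [exact: cyl_widl ca|exact: cyl_widl cb'].
have key : prex (tgt h) al /\ deg h = (size al)%:Z - (size be)%:Z /\
    sh (size al) (tgt h) = sh (size be) (src h).
  have [[w [ea eb]]|[w [ea eb]]] := zset_compat zg zg'; subst.
    have [dh ca' cb' e] := zh.
    have [pa pw] := (pre_cat _ _ _).1 (cyl_prex ca').
    have pa' := (prex_shift w pa).1 (cyl_prex ca').
    have [pb _] := (pre_cat _ _ _).1 (cyl_prex cb').
    have pb' := (prex_shift w pb).1 (cyl_prex cb').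
    split=> //; split; first by rewrite dh !size_cat; lia.
    by apply: (shift_inj pa' pb'); rewrite -!iterD [(_ + size al)%N]addnC [(_ + size be)%N]addnC -!size_cat.
  have [dh ca' cb' e] := zh.
  have pw := (prex_shift w (cyl_prex cb')).1 (cyl_prex cb).
  rewrite -e in pw; split; first exact/(prex_shift w (cyl_prex ca')).
  split; first by rewrite dh !size_cat; lia.
  by rewrite !size_cat ![(size _ + size w)%N]addnC !iterD e.
have [p [dh e]] := key; split=> //.
have := (cyl_shift [::] A (cyl_prex cb)).1; rewrite cats0 => /(_ cb)[c0 _].
by rewrite -[al]cats0; apply/(cyl_shift [::] A p); rewrite cats0 e.
Qed.

(** An arrow outside lies in another bisection. If the two are disjoint, that one separates; if they
    meet, they agree over common sources, and a condition on the source separates. *)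
Lemma zset_closed al A be : closed (zset al A be).
Proof.
rewrite -[zset _ _ _]setCK; apply: open_closedC; rewrite openE => g ng.
have [al' [A' [be' zg]]] := arrow_zset g.
have [[h [zh zh']]|dis] := pselect (exists h, zset al A be h /\ zset al' A' be' h); last first.
  apply: (@filterS _ _ _ (zset al' A' be')); first by move=> h zh' zh; apply: dis; exists h.
  by apply: open_nbhs_nbhs; split=> //; exact: zset_open.
apply: (@filterS _ _ _ (zset al' A' be' `&` src @^-1` (~` cyl be A))).
  by move=> k [_ nk] [_ _ ck _]; exact: nk.
apply: open_nbhs_nbhs; split.
  by apply: zset_src_open; apply: closed_openC; exact: cyl_closed.
by split=> // cg; apply: ng; exact: zset_restrict zh zh' zg cg.
Qed.

(** Inside one bisection an arrow is a function of its source, so every open condition on arrows has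
    to be rewritten as a cylinder condition on the source. *)
Lemma arrow_nbhs al A be g W : zset al A be g -> nbhs g W -> exists P N,
  cbox P N (src g) /\ zset al A be `&` src @^-1` cbox P N `<=` W.
Proof.
move=> zg /(subbase_nbhs (P := [set U | exists P N, cbox P N (src g) /\
  U = zset al A be `&` src @^-1` cbox P N]) (RD_subbase _ _))[].
- by exists (zset al A be `&` src @^-1` cbox [::] [::]), [::], [::].
- move=> _ [P [N [gPN ->]]]; split=> //; apply: zset_src_open; exact: cbox_open.
- move=> _ _ [P [N [gPN ->]]] [P' [N' [gPN' ->]]].
  exists (zset al A be `&` src @^-1` cbox (P ++ P') (N ++ N')); split.
  + by exists (P ++ P'), (N ++ N'); rewrite cbox_cat.
  + by move=> h [zh]; rewrite /= cbox_cat => -[].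
  + by move=> h [zh]; rewrite /= cbox_cat => -[].
- move=> _ [m [n [U [V [[oU oV] [dU dV] _ ->]]]]] [dg Ug Vg eg].
  have [dg' ca cb e] := zg.
  have [P1 [N1 [g1 s1]]] := bpath_nbhs (open_nbhs_nbhs (conj oU Ug)).
  have [P2 [N2 [g2 s2]]] := bpath_nbhs (open_nbhs_nbhs (conj oV Vg)).
  (* The condition on the target is carried to the source through the common shifted path. *)
  have [P3 [N3 h3]] := cbox_to_shift S al P1 N1.
  have [P4 [N4 h4]] := cbox_of_shift P3 N3 (cyl_widl cb).
  have g4 : cbox P4 N4 (src g).
    by apply/(h4 _ cb); rewrite -e; apply/(h3 _ _ ca).
  have [P5 [g5 h5]] : exists P, cbox P [::] (src g) /\ forall h, zset al A be h ->
      cbox P [::] (src h) -> deg h = m%:Z - n%:Z /\ sh m (tgt h) = sh n (src h).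
    have dm : dom m (tgt g) := dU _ Ug.
    have dn : dom n (src g) := dV _ Vg.
    have dmn : (size al)%:Z - (size be)%:Z = m%:Z - n%:Z by rewrite -dg' -dg.
    have [mn|] := boolP ((m != 0)%N || (n != 0)%N).
      have [mu [D [nu [smu snu zD]]]] := arrow_words dm dn eg dg mn.
      exists [:: (nu, D)]; split; first by apply/cbox1; case: zD.
      move=> h zh /cbox1 hD; have [dh _ _ eh] := zset_restrict zD zg zh hD.
      by rewrite dh -smu -snu.
    (* Here the arrow is a unit, so both words agree, and injectivity of the shift makes every arrow
       of the bisection a unit. *)
    rewrite negb_or !negbK => /andP[/eqP m0 /eqP n0]; subst m n.
    exists [::]; split=> // h [dh ch1 ch2 eh] _; split; first by rewrite dh.
    have sab : size al = size be by lia.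
    have ab : al = be.
      apply: pre_fun (cyl_prex ca) _ sab; rewrite /= in eg.
      by rewrite [tgt g]eg; exact: cyl_prex cb.
    by subst be; exact: shift_inj (cyl_prex ch1) (cyl_prex ch2) eh.
  exists (zset al A be `&` src @^-1` cbox (P5 ++ (P4 ++ P2)) ([::] ++ (N4 ++ N2))).
    by exists (P5 ++ (P4 ++ P2)), ([::] ++ (N4 ++ N2)); rewrite !cbox_cat.
  move=> h [zh hc].
  have : cbox (P5 ++ (P4 ++ P2)) ([::] ++ (N4 ++ N2)) (src h) := hc.
  rewrite !cbox_cat => -[h5' [h4' h2']].
  have [dh eh] := h5 h zh h5'; have [_ cha chb e'] := zh; split=> //.
    by apply: s1; apply/(h3 _ _ cha); rewrite e'; apply/(h4 _ chb).
  exact: s2.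
by move=> _ [P [N [gPN ->]]] sub; exists P, N.
Qed.

(** [src] is injective on the bisection and maps it onto the compact set [cyl be A]; surjectivity
    needs [widl al A], which any of its arrows supplies. *)
Lemma zset_compact al A be : compact (zset al A be).
Proof.
apply: ultrafilter_compact => F UF FA.
have wA : widl al A.
  by have [g [_ ca _ _]] := filter_ex FA; exact: cyl_widl ca.
have PF : ProperFilter (src @ F) by exact: fmap_proper_filter.
have [|y [cy Fy]] := @cyl_compact _ _ _ S be A (src @ F) PF.
  by rewrite nbhs_simpl /=; apply: filterS FA => g [].
have [g [zg sg]] := zset_src_exists wA cy.
exists g => // W /(arrow_nbhs zg)[P [N [gPN sub]]].
apply: filterS sub _; apply: filterI => //.
have [//|nF] := in_ultra_setVsetC (src @^-1` cbox P N) UF.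
have [||z [/= nz zz]] := Fy (~` cbox P N) (cbox P N); [exact: nF| |by []].
by rewrite -sg; apply: open_nbhs_nbhs; split=> //; exact: cbox_open.
Qed.

End Bisections.

Lemma subbase_continuous (T U : topologicalType) (D : set (set U)) (f : T -> U) :
  is_subbase D -> (forall V, D V -> open (f @^-1` V)) -> continuous f.
Proof.
move=> [_ sD] h x; apply: sD => V DV Vx.
by apply: open_nbhs_nbhs; split; [exact: h|].
Qed.

Lemma near_seq (T : topologicalType) (x : T) (I : eqType) (l : seq I) (Q : I -> set T) :
  (forall i, i \in l -> nbhs x (Q i)) -> nbhs x [set y | forall i, i \in l -> Q i y].
Proof.
elim: l => [|i l IH] h; first by apply: filterS filterT.
have h1 := h i (mem_head _ _).
have h2 : nbhs x [set y | forall i, i \in l -> Q i y].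
  by apply: IH => j jl; apply: h; rewrite inE jl orbT.
apply: filterS2 h1 h2 => y yi yl j; rewrite inE => /orP[/eqP -> //|]; exact: yl.
Qed.

(** * Isomorphism with the tight groupoid *)

Section GammaIso.
Context {d : Order.disp_t} {B : cbDistrLatticeType d} {L : choiceType}.
Variable S : gbds B L.
Implicit Types (A C D E : B) (al be u v w mu nu : seq L) (x y z : bpath S) (ga : word (L := L)).
Local Notation widl := (Defs.widl S).
Local Notation dom n := (iter_dom (sigmaE_dom S) (sigmaE S) n).
Local Notation sh n := (iter n (sigmaE S)).
Local Notation G := (RD_groupoid (sigmaE_dom S) (sigmaE S)).

Definition wnth ga i : option L :=
  match ga with inl al => onth al i | inr om => Some (om i) end.

Definition WX x ga := forall i, omap tagE (bpath_edge x i) = wnth ga i.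

Lemma WX_exists x : exists ga, WX x ga.
Proof.
have [[n en]|inf] := pselect (exists n, bpath_edge x n = None).
  have ex : exists n, ~~ bpath_edge x n by exists n; rewrite en.
  case: (ex_minnP ex) => {en}n en nmin.
  have enN : bpath_edge x n = None by case: bpath_edge en.
  have [|u pu su] := @cyl_pre_exists _ _ _ _ x n.
    case: (n) nmin => [//|m] nmin em; have := nmin m; rewrite em => /(_ isT).
    by rewrite ltnn.
  exists (inl u) => i /=; have [iu|iu] := ltnP i (size u).
    by move/pre_onth: pu; apply.
  by rewrite onth_default // (wf_none (bpath_wf x) _ enN) // -su.
have {}inf n : {a | omap tagE (bpath_edge x n) = Some a}.
  by case e : (bpath_edge x n) => [f|]; [exists (tagE f)|case: inf; exists n].
by exists (inr (fun n => projT1 (inf n))) => i; exact: (projT2 (inf i)).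
Qed.

Lemma size_wtake n ga : wlen_ge n ga -> size (wtake n ga) = n.
Proof. by case: ga => [al|om] /=; [exact: size_takel|rewrite size_mkseq]. Qed.

Lemma size_wtake_le n ga : (size (wtake n ga) <= n)%N.
Proof. by case: ga => [al|om] /=; rewrite ?size_mkseq // size_take_min geq_minl. Qed.

Lemma onth_wtake n ga i : (i < n)%N -> onth (wtake n ga) i = wnth ga i.
Proof.
case: ga => [al|om] ni /=; last first.
  by rewrite onthE (nth_map (om 0%N)) ?size_mkseq // nth_mkseq.
have [il|il] := ltnP i (size al); last by rewrite !onth_default // size_take_min geq_min il orbT.
by rewrite -[in RHS](cat_take_drop n al) onth_cat size_take_min leq_min ni il.
Qed.

Lemma WX_prex x ga u : WX x ga -> prex x u <-> wlen_ge (size u) ga /\ wtake (size u) ga = u.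
Proof.
move=> h; split=> [/pre_onth p|[_ <-]]; last first.
  apply/pre_onth => i; rewrite h => il; rewrite onth_wtake //.
  by apply: leq_trans il _; exact: size_wtake_le.
have hl : wlen_ge (size u) ga.
  case: ga h => [al|om] //= h; rewrite leqNgt; apply/negP => lt.
  have := p (size al) lt; rewrite h /= onth_default //.
  by have [a ->] := onth_Some lt.
split=> //; apply: eq_from_onth => i; have [iu|iu] := ltnP i (size u).
  by rewrite onth_wtake // -h p.
by rewrite !onth_default // size_wtake.
Qed.

Definition Phi x : tightsp S := mkset (code_tight x).

Lemma PhiE x al A be : set_val (Phi x) (Some (al, A, be)) <-> al = be /\ cyl al A x.
Proof. by []. Qed.

Lemma Phi_inj : injective Phi.
Proof.
move=> x y /(congr1 (fun xi => set_val xi)) e; apply: cyl_ext => u A.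
have h z : cyl u A z <-> set_val (Phi z) (idm u A) by rewrite PhiE; split=> [|[]].
by rewrite !h e.
Qed.

Lemma Phi_surj (xi : tightsp S) : exists x, Phi x = xi.
Proof.
have [x cx] := tight_code (set_valP xi : tight S (set_val xi)).
by exists x; apply: val_inj.
Qed.

Lemma has_wordP x ga : has_word (Phi x) ga <-> WX x ga.
Proof.
have ex n : bpath_edge x n <> None -> exists u A, size u = n.+1 /\ cyl u A x.
  move=> en; have [u pu su] := @cyl_pre_exists _ _ _ _ x n.+1 en.
  have [A cA] : exists A, cyl u A x by apply: prex_cyl => // u0; rewrite u0 in su.
  by exists u, A.
case: ga => [al|om]; split.
- move=> [[A [_ cA]] mx] i /=; have [ia|ia] := ltnP i (size al).
    by have [/pre_onth p _ _] := cA; exact: p.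
  rewrite onth_default //; case e : (bpath_edge x i) => [f|//].
  have [|u [C [su cC]]] := ex i; first by rewrite e.
  by have := mx u C (conj erefl cC); rewrite su ltnNge ia.
- move=> h; have pa : prex x al by apply/(WX_prex _ h); rewrite /= take_size.
  have eN : bpath_edge x (size al) = None.
    by have := h (size al); rewrite /= onth_default //; case: bpath_edge.
  split; last first.
    move=> be A [_ cA]; have := (WX_prex be h).1 (cyl_prex cA) => -[]; by [].
  have [a0|an] := eqVneq al [::]; last first.
    by have [A cA] := prex_cyl (elimN eqP an) pa; exists A.
  subst al; case er : (bpath_r x) => [v|]; last by case: (wf_0 (bpath_wf x) eN er).
  have [A vA] := ultra_ne (XspP v); exists A; split=> //; split=> //.
  by rewrite /= er.
- move=> [inf h] i /=; have [be [A [[_ cA] lt]]] := inf i.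
  have [/pre_onth p _ _] := cA; rewrite p // (h be A (conj erefl cA)).
  by rewrite onthE (nth_map (om 0%N)) ?size_mkseq // nth_mkseq.
- move=> h; split=> [n|be A [_ cA]].
    have [|u [C [su cC]]] := ex n; first by have := h n; case: bpath_edge.
    by exists u, C; rewrite su.
  by have [_ <-] := (WX_prex be h).1 (cyl_prex cA); rewrite /= size_mkseq.
Qed.

Lemma wnth_wcat al ga i :
  wnth (wcat al ga) i = if (i < size al)%N then onth al i else wnth ga (i - size al)%N.
Proof.
case: ga => [be|om] /=; first by rewrite onth_cat.
case: ltnP => il; last by rewrite nth_default.
by have [a ai] := onth_Some il; rewrite ai; congr Some; exact: onth_nth ai.
Qed.

Lemma WX_wcat x al ga : WX x (wcat al ga) <-> prex x al /\ WX (sh (size al) x) ga.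
Proof.
split=> [h|[p h] i].
  have p : prex x al by apply/pre_onth => i il; rewrite h wnth_wcat il.
  split=> // i; rewrite iter_edge; last exact: prex_dom.
  by rewrite h wnth_wcat ltnNge leq_addr /= addKn.
rewrite wnth_wcat; case: ltnP => il; first by move/pre_onth: p; apply.
by rewrite -h iter_edge ?subnKC //; exact: prex_dom.
Qed.

Lemma wtake_wcat al ga n : wtake (size al + n) (wcat al ga) = al ++ wtake n ga.
Proof.
apply: eq_from_onth => i; case: (ltnP i (size al + n)) => il; last first.
  rewrite !onth_default //.
    rewrite size_cat; apply: leq_trans il; rewrite leq_add2l.
    exact: size_wtake_le.
  by apply: leq_trans il; exact: size_wtake_le.
rewrite onth_wtake // wnth_wcat onth_cat; case: ltnP => // ia.
by rewrite onth_wtake // ltn_subLR.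
Qed.

(** The upward closure in the definition of [Hmap] is harmless, since cylinders grow with their
    element; what remains is [cyl_shift]. *)
Lemma HmapP al ga x z : Hmap al ga (Phi x) (Phi z) <->
  WX x (wcat al ga) /\ z = sh (size al) x.
Proof.
rewrite /Hmap has_wordP; case: al => [|a al].
  by split=> -[h e]; split=> //; [exact: Phi_inj e|rewrite e].
set al' := a :: al; have an : al' <> [::] by [].
have lv y ga' n A : level (Phi y) ga' n A <-> cyl (wtake n ga') A y.
  by split=> [[_ [_ h]]|h] //; split; [exact: cyl_widl h|split].
split=> [[hx [/has_wordP hz hl]]|[hx ->]].
  split=> //; have [px hx'] := (WX_wcat x al' ga).1 hx.
  apply: cyl_ext => v C.
  have key : wlen_ge (size v) ga -> wtake (size v) ga = v ->
      cyl v C z <-> cyl v C (sh (size al') x).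
    move=> vl ve; have E : level (Phi z) ga (size v) C <-> widl (wtake (size v) ga) C /\
        exists2 A, level (Phi x) (wcat al' ga) (size al' + size v) A & (A <= C)%O.
      by rewrite (hl _ vl).
    have e1 : cyl v C z <-> level (Phi z) ga (size v) C by rewrite lv ve.
    rewrite e1 E ve; split.
      move=> [wC [A /lv]]; rewrite wtake_wcat ve => /(cyl_shift v A px)[cA _] AC'.
      exact: rcyl_up wC AC' cA.
    move=> cC; split; first exact: cyl_widl cC.
    have [|D cD] := cyl_shift_ex px cC; first by case: (al') an.
    by exists (D `&` C)%O; [apply/lv; rewrite wtake_wcat ve|exact: leIr].
  split=> cC; have := cyl_prex cC.
    by move=> /(WX_prex v hz)[vl ve]; exact/key.
  by move=> /(WX_prex v hx')[vl ve]; exact/key.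
split=> //; have [px hx'] := (WX_wcat x al' ga).1 hx.
split; first exact/has_wordP.
move=> n nl; apply/seteqP; split=> C.
  move=> /lv cC; split; first exact: cyl_widl cC.
  have [|D cD] := cyl_shift_ex px cC; first by case: (al') an.
  by exists (D `&` C)%O; [apply/lv; rewrite wtake_wcat|exact: leIr].
move=> [wC [A /lv]]; rewrite wtake_wcat => /(cyl_shift _ A px)[cA _] AC'.
apply/lv; exact: rcyl_up wC AC' cA.
Qed.

Lemma Hmap_eqP mu nu ga x y : Hmap_eq mu nu ga (Phi x) (Phi y) <->
  [/\ WX x (wcat mu ga), WX y (wcat nu ga) & sh (size mu) x = sh (size nu) y].
Proof.
split=> [[zeta [h1 h2]]|[h1 h2 e]].
  have [z ez] := Phi_surj zeta; subst zeta.
  by move/HmapP: h1 => [? e1]; move/HmapP: h2 => [? e2]; split=> //; rewrite -e1 -e2.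
by exists (Phi (sh (size mu) x)); split; apply/HmapP.
Qed.

(** The tail [ga] has to be the label word of the common shifted path, so it can be eliminated. *)
Lemma Hmap_ex mu nu x y : (exists ga, Hmap_eq mu nu ga (Phi x) (Phi y)) <->
  [/\ prex x mu, prex y nu & sh (size mu) x = sh (size nu) y].
Proof.
split=> [[ga /Hmap_eqP[h1 h2 e]]|[p1 p2 e]].
  by split=> //; [case/WX_wcat: h1|case/WX_wcat: h2].
have [ga h] := WX_exists (sh (size mu) x); exists ga; apply/Hmap_eqP; split=> //.
  exact/WX_wcat.
by apply/WX_wcat; rewrite -e.
Qed.

Lemma Gamma_setP x k y : Gamma_set (Phi x, k, Phi y) <->
  RD_set (sigmaE_dom S) (sigmaE S) (x, k, y).
Proof.
split.
  move=> [al [be [ga [/= ek h]]]].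
  have [p1 p2 e] := (Hmap_ex al be x y).1 (ex_intro _ ga h).
  by exists (size al), (size be); split=> //; exact: prex_dom.
move=> [m [n [/= ek d1 d2 e]]]; have [al pa sa] := dom_prex d1.
have [be pb sb] := dom_prex d2; subst m n.
have [ga h] := (Hmap_ex al be x y).2 (And3 pa pb e).
by exists al, be, ga.
Qed.

Let PhiV (xi : tightsp S) : bpath S := projT1 (cid (Phi_surj xi)).

Let PhiVK : cancel PhiV Phi.
Proof. by move=> xi; exact: (projT2 (cid (Phi_surj xi))). Qed.

Let PhiK : cancel Phi PhiV.
Proof. by move=> x; apply: Phi_inj; exact: PhiVK. Qed.

Lemma to_Gamma_subproof (g : G) : Gamma_set (Phi (tgt g), deg g, Phi (src g)).
Proof.
apply/Gamma_setP; exact: (@set_valP _ _ g).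
Qed.

Definition to_Gamma (g : G) : Gamma_groupoid S := mkset (to_Gamma_subproof g).

Let of_Gamma_subproof (t : Gamma_groupoid S) : RD_set (sigmaE_dom S) (sigmaE S)
  (PhiV (set_val t).1.1, (set_val t).1.2, PhiV (set_val t).2).
Proof.
apply/Gamma_setP; rewrite !PhiVK; exact: (@set_valP _ _ t).
Qed.

Let of_Gamma (t : Gamma_groupoid S) : G := mkset (of_Gamma_subproof t).

Lemma Vbasic_cbox e es : idem S e -> exists P N, forall x, Vbasic e es (Phi x) <-> cbox P N x.
Proof.
move=> ie; have [->|en] := eqVneq e None.
  exists [:: ([::], \bot%O)], [::] => x; split=> [[]//|[h _]].
  by case: (rcyl0 (h _ (mem_head _ _))).
have [be [A [eE A0 wA]]] := idem_elt ie (elimN eqP en); subst e.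
exists [:: (be, A)], (pmap (fun e' : triple (B := B) (L := L) =>
  if e' is Some (al, C, al') then if al == al' then Some (al, C) else None else None) es) => x.
split=> -[h1 h2].
  split=> p; first by rewrite inE => /eqP ->; case: h1.
  rewrite mem_pmap => /mapP[[[[al C] al']|//] ees]; case: eqP => // ea [->] /= cC.
  by apply: (h2 _ ees); split.
split; first by split=> //; exact: (h1 (be, A) (mem_head _ _)).
move=> e'; case: e' => [[[al C] al']|] ees; last by case. 
move=> [ea cC]; apply: (h2 (al, C)) => //.
by rewrite mem_pmap; apply/mapP; exists (Some (al, C, al')) => //; rewrite ea eqxx.
Qed.

Lemma to_Gamma_continuous : continuous to_Gamma.
Proof.
apply: subbase_continuous (Gamma_subbase S) _ => _ [mu [A [nu [e [es [_ ie _ ->]]]]]].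
have [P [N hPN]] := Vbasic_cbox es ie.
have -> : to_Gamma @^-1` [set t : Gamma_arrow S | Gamma_basic mu nu e es (set_val t)] =
   [set g | [/\ deg g = (size mu)%:Z - (size nu)%:Z, cbox P N (src g) &
      [/\ prex (tgt g) mu, prex (src g) nu & sh (size mu) (tgt g) = sh (size nu) (src g)]]].
  apply/seteqP; split=> [g [ga [dg /hPN Vg h]]|g [dg /hPN Vg /Hmap_ex[ga h]]].
    by split=> //; apply/Hmap_ex; exists ga.
  by exists ga.
rewrite openE => g [dg gPN [p1 p2 eg]].
(* A bisection around [g] all of whose arrows have the required words. If both words are empty, [g]
   is a unit, and any bisection containing it consists of units. *)
have [al [C [be [zg sub]]]] : exists al C be, zset al C be g /\ forall h, zset al C be h ->
    [/\ deg h = (size mu)%:Z - (size nu)%:Z, prex (tgt h) mu, prex (src h) nu &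
       sh (size mu) (tgt h) = sh (size nu) (src h)].
  have [mn|] := boolP ((size mu != 0)%N || (size nu != 0)%N).
    have [al [C [be [sa sb zg]]]] := arrow_words (prex_dom p1) (prex_dom p2) eg dg mn.
    have [_ ca cb _] := zg.
    have ea : al = mu := pre_fun (cyl_prex ca) p1 sa.
    have eb : be = nu := pre_fun (cyl_prex cb) p2 sb.
    subst; exists mu, C, nu; split=> // h [dh ch1 ch2 eh].
    by split=> //; [exact: cyl_prex ch1|exact: cyl_prex ch2].
  rewrite negb_or !negbK !size_eq0 => /andP[/eqP m0 /eqP n0]; subst mu nu.
  have [al [C [be zg]]] := arrow_zset g; have [dg' ca cb _] := zg.
  have sab : size al = size be by rewrite dg /= in dg'; lia.
  have ab : al = be.
    apply: pre_fun (cyl_prex ca) _ sab; rewrite /= in eg.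
    by rewrite [tgt g]eg; exact: cyl_prex cb.
  subst be; exists al, C, al; split=> // h [dh ch1 ch2 eh]; split=> //; first by rewrite dh subrr.
  exact: shift_inj (cyl_prex ch1) (cyl_prex ch2) eh.
have nZ : nbhs g (zset al C be `&` @src _ _ _ S @^-1` cbox P N).
  by apply: open_nbhs_nbhs; split=> //; apply: zset_src_open; exact: cbox_open.
rewrite /interior /=; move: nZ; apply: filterS => h [/sub[dh h1 h2 h3] hPN'].
by split.
Qed.

Let of_Gamma_continuous : continuous of_Gamma.
Proof.
move=> t W nW; have [al [A [be zg]]] := arrow_zset (of_Gamma t).
have [P [N [gPN sub]]] := arrow_nbhs zg nW.
have [dg ca cb eg] := zg.
have A0 : A != \bot%O := cyl_neq0 cb.
have inv : invsg S (Some (al, A, be)).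
  by split=> //; [exact: cyl_widl ca|exact: cyl_widl cb].
have tE1 : (set_val t).1.1 = Phi (tgt (of_Gamma t)) by rewrite [RHS]PhiVK.
have tE2 : (set_val t).2 = Phi (src (of_Gamma t)) by rewrite [RHS]PhiVK.
have Hex := (Hmap_ex al be (tgt (of_Gamma t)) (src (of_Gamma t))).2
  (And3 (cyl_prex ca) (cyl_prex cb) eg).
have basic e es : idem S e -> (forall e', e' \in es -> idem S e') ->
    Vbasic e es (Phi (src (of_Gamma t))) ->
    nbhs t [set s : Gamma_arrow S | Gamma_basic al be e es (set_val s)].
  move=> ie ies V; apply: open_nbhs_nbhs; split.
    by apply: (Gamma_subbase S).1; exists al, A, be, e, es.
  by have [ga h] := Hex; exists ga; rewrite tE1 tE2; split.
have iA : idem S (idm be A) by split=> //; exact: cyl_widl cb.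
have VA : Vbasic (idm be A) [::] (Phi (src (of_Gamma t))) by split.
have nA := basic (idm be A) [::] iA (fun _ h => match notF h with end) VA.
(* Each cylinder condition on the source is a single [Vbasic] condition, and there are finitely many
   of them. *)
have nP : nbhs t [set s : Gamma_arrow S | forall p, p \in P -> cyl p.1 p.2 (src (of_Gamma s))].
  apply: near_seq => p pP; have cp := gPN.1 p pP.
  have ip : idem S (idm p.1 p.2) by split=> //; [exact: cyl_neq0 cp|exact: cyl_widl cp].
  have Vp : Vbasic (idm p.1 p.2) [::] (Phi (src (of_Gamma t))) by split.
  apply: filterS (basic _ [::] ip (fun _ h => match notF h with end) Vp).
  by move=> s [ga [_ [h _] _]]; move: h; rewrite -(PhiVK (set_val s).2) => -[].
have nN : nbhs t [set s : Gamma_arrow S | forall p, p \in N -> ~ cyl p.1 p.2 (src (of_Gamma s))].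
  apply: near_seq => p pN; have cp := gPN.2 p pN.
  (* A pair that gives no idempotent has an empty cylinder, so excluding it costs nothing. *)
  have [ip|nip] := pselect (idem S (idm p.1 p.2)); last first.
    apply: filterS filterT => s _ cs; apply: nip; split=> //; [exact: cyl_neq0 cs|exact: cyl_widl cs].
  have Vp : Vbasic (idm be A) [:: idm p.1 p.2] (Phi (src (of_Gamma t))).
    by split=> // e'; rewrite inE => /eqP -> [].
  have ies e' : e' \in [:: idm p.1 p.2] -> idem S e' by rewrite inE => /eqP ->.
  apply: filterS (basic _ _ iA ies Vp) => s [ga [_ [_ h] _]] cs.
  by apply: (h (idm p.1 p.2)); rewrite ?mem_head // -(PhiVK (set_val s).2).
apply: filterS3 nA nP nN => s [ga [ds [cA _] h]] sP sN.
apply: sub; split; last by split.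
have cs : cyl be A (src (of_Gamma s)) by move: cA; rewrite -(PhiVK (set_val s).2) => -[].
have := Hmap_ex al be (tgt (of_Gamma s)) (src (of_Gamma s)) => -[+ _].
rewrite [Phi (tgt _)]PhiVK [Phi (src _)]PhiVK => /(_ (ex_intro _ ga h))[p1 p2 e].
split=> //; rewrite -[al]cats0; apply/(cyl_shift [::] A p1); rewrite cats0 e; split; last by case: inv.
exact: shift_cyl cs.
Qed.

Lemma RD_Gamma_iso : groupoid_iso G (Gamma_groupoid S).
Proof.
exists to_Gamma, of_Gamma; split.
- split.
    by move=> g; apply: arrow_ext; rewrite /tgt /src /=; [exact: PhiK| |exact: PhiK].
  move=> t; apply: val_inj.
  transitivity (Phi (PhiV (set_val t).1.1), (set_val t).1.2, Phi (PhiV (set_val t).2)).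
    by [].
  by rewrite !PhiVK /set_val /=; case: (val t) => [[? ?] ?].
- by split; [exact: to_Gamma_continuous|exact: of_Gamma_continuous].
- move=> g h k; rewrite /= /triple_mul /=; split=> -[e1 e2].
    split; first by congr Phi.
    transitivity (Phi (tgt k), deg k, Phi (src k)); first by [].
    by rewrite /tgt /deg /src e2.
  split; first exact: Phi_inj e1.
  have e : (Phi (tgt k), deg k, Phi (src k)) =
    (Phi (tgt g), deg g + deg h, Phi (src h)) := e2.
  have := Phi_inj (congr1 snd e : Phi (src k) = Phi (src h)).
  have := Phi_inj (congr1 (fun t => t.1.1) e : Phi (tgt k) = Phi (tgt g)).
  have : deg k = deg g + deg h := congr1 (fun t => t.1.2) e.
  rewrite /tgt /deg /src; by case: (set_val k) => [[? ?] ?] /= -> -> ->.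
- by move=> g; apply: val_inj.
Qed.

End GammaIso.

(** * Representations of the relations *)

Section Representation.
Context {R : realType} {d : Order.disp_t} {B : cbDistrLatticeType d} {L : choiceType}.
Variable S : gbds B L.
Implicit Types (C D E F : B) (al be ga u v w : seq L).
Local Notation widl := (Defs.widl S).
Local Notation wact := (Defs.wact S).

Variables (A : cstarAlg R) (p : B -> A) (s : L -> B -> A).
Hypothesis rep : gbds_rep S p s.

Lemma rep_pI C D : p C ** p D = p (C `&` D)%O.
Proof. by have [_ [_ -> _] _ _ _] := rep. Qed.

Lemma rep_p0 : p \bot%O = 0.
Proof. by have [_ [-> _ _] _ _ _] := rep. Qed.

Lemma rep_pS C : cstar (p C) = p C.
Proof. by have [[/(_ C)[]]] := rep. Qed.

Lemma rep_pU C D : p (C `|` D)%O = p C + p D - p (C `&` D)%O.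
Proof. by have [_ [_ _ ->] _ _ _] := rep. Qed.

Lemma rep_ps C a D : idl S a D -> p C ** s a D = s a D ** p (act S a C).
Proof. by have [_ _ h _ _] := rep; exact: h. Qed.

Lemma rep_ss a C D : idl S a C -> idl S a D -> cstar (s a C) ** s a D = p (C `&` D)%O.
Proof. by have [_ _ _ h _] := rep => IC ID; rewrite h // eqxx. Qed.

Lemma rep_ss0 a b C D : idl S a C -> idl S b D -> a <> b -> cstar (s a C) ** s b D = 0.
Proof. by have [_ _ _ h _] := rep => IC ID /eqP/negbTE ab; rewrite h // ab. Qed.

Lemma rep_pB C D : p (C `\` D)%O = p C - p (C `&` D)%O.
Proof.
have h : ((C `&` D) `&` (C `\` D) = \bot)%O.
  apply/eqP; rewrite -lex0 -(diffIK C D) [X in (_ <= X)%O]meetC.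
  by apply: leI2 => //; exact: leIr.
have := rep_pU (C `&` D)%O (C `\` D)%O; rewrite h rep_p0 subr0 joinIB => ->.
by rewrite addrAC subrr add0r.
Qed.

(** This is not among the relations: by (iii), the difference [t] of the two sides satisfies
    [t^* t = 0]. *)
Lemma rep_sp a C D : idl S a C -> s a C ** p D = s a (C `&` D)%O.
Proof.
move=> IC; have ID : idl S a (C `&` D)%O by apply: idl_le IC; exact: leIl.
apply: subr0_eq; apply: starM_eq0.
have mD : (C `&` (C `&` D) = C `&` D)%O by rewrite meetA meetxx.
have e1 : p D ** cstar (s a C) ** (s a C ** p D) = p (C `&` D)%O.
  by rewrite cmulA -(cmulA (p D)) rep_ss // !rep_pI meetxx meetAC meetxx meetC.
have e2 : p D ** cstar (s a C) ** s a (C `&` D)%O = p (C `&` D)%O.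
  by rewrite -cmulA rep_ss // rep_pI mD meetCA meetxx.
have e3 : cstar (s a (C `&` D)%O) ** (s a C ** p D) = p (C `&` D)%O.
  by rewrite cmulA rep_ss // rep_pI [(_ `&` C)%O]meetC mD -meetA meetxx.
rewrite cstarB cstarM rep_pS cmulBl !cmulBr e1 e2 e3 rep_ss // meetxx.
by rewrite !subrr.
Qed.

(** The relations only concern [s a D] with [D] in the ideal of [a], while [widl] merely asserts
    that such a [D] exists above [C]; one is chosen. *)
Definition widl_wit a al C : B :=
  if pselect (widl (a :: al) C) is left h then projT1 (cid (let: ex_intro2 D ID CD := h in
    ex_intro (fun D => idl S a D /\ (C <= wact al D)%O) D (conj ID CD))) else \bot%O.

Lemma widl_witP a al C : widl (a :: al) C ->
  idl S a (widl_wit a al C) /\ (C <= wact al (widl_wit a al C))%O.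
Proof.
move=> h; rewrite /widl_wit; case: pselect => [h'|//].
by case: cid.
Qed.

(* The partial isometry attached to a word; the value does not depend on the
   chosen witness of [widl]. *)
Fixpoint sw al C : A :=
  if al is a :: al' then s a (widl_wit a al' C) ** sw al' C else p C.

(** [L1] and [L2] go through one induction, since exchanging the chosen witness for another, in
    [sw_cons0], uses [L2] for the shorter word. *)
Let L1 al := forall C D, widl al C -> sw al C ** p D = sw al (C `&` D)%O.
Let L2 al := forall C D, widl al C -> p D ** sw al C = sw al (C `&` wact al D)%O.

Let sw_cons0 a al C D : L2 al -> widl (a :: al) C -> idl S a D ->
  (C <= wact al D)%O -> sw (a :: al) C = s a D ** sw al C.
Proof.
move=> l2 wC ID CD /=; have [IE CE] := widl_witP wC; set E := widl_wit a al C in IE CE *.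
have wC' : widl al C by exact: (widl_suffix (u := [:: a]) wC).
have eD : p D ** sw al C = sw al C by rewrite l2 // (meet_idPl CD).
have eE : p E ** sw al C = sw al C by rewrite l2 // (meet_idPl CE).
by rewrite -{1}eD -{2}eE !cmulA !rep_sp // meetC.
Qed.

Let L12 al : L1 al /\ L2 al.
Proof.
elim: al => [|a al [l1 l2]].
  split=> C D _ /=; first exact: rep_pI.
  by rewrite rep_pI meetC.
have aux C D : widl (a :: al) C -> widl (a :: al) (C `&` D)%O.
  by apply: widl_le; exact: leIl.
split=> C D wC; have [E IE CE] := wC; have wC' := widl_suffix (u := [:: a]) wC.
  rewrite (sw_cons0 l2 wC IE CE) -cmulA l1 // (sw_cons0 l2 (aux _ _ wC) IE) //.
  exact: le_trans (leIl _ _) CE.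
rewrite (sw_cons0 l2 wC IE CE) cmulA rep_ps // -cmulA l2 //.
rewrite (sw_cons0 l2 (aux _ _ wC) IE) //; exact: le_trans (leIl _ _) CE.
Qed.

Lemma sw_p al C D : widl al C -> sw al C ** p D = sw al (C `&` D)%O.
Proof. exact: (L12 al).1. Qed.

Lemma p_sw al C D : widl al C -> p D ** sw al C = sw al (C `&` wact al D)%O.
Proof. exact: (L12 al).2. Qed.

Lemma sw_cons a al C D : widl (a :: al) C -> idl S a D -> (C <= wact al D)%O ->
  sw (a :: al) C = s a D ** sw al C.
Proof. exact: sw_cons0 (L12 al).2. Qed.

Lemma sw1 a C : idl S a C -> sw [:: a] C = s a C.
Proof.
by move=> IC; rewrite (sw_cons (D := C)) //= ?rep_sp ?meetxx //; exact/widl1.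
Qed.

Lemma sw0 al : sw al \bot%O = 0.
Proof.
have := @p_sw al \bot%O \bot%O (widl0 S al); rewrite rep_p0 cmul0l.
by rewrite (meet_idPl (le0x _)) => <-.
Qed.

Lemma sw_cat u v C D : widl u D -> (C <= wact v D)%O -> sw (u ++ v) C = sw u D ** sw v C.
Proof.
elim: u D => [|a u IH] D wD CD.
  rewrite /= p_sw ?(meet_idPl CD) //.
  exact: (@widl_act _ _ _ _ [::] v C D).
have wC : widl (a :: (u ++ v)) C by exact: (@widl_act _ _ _ _ (a :: u) v C D).
have [E IE DE] := wD; have wD' := widl_suffix (u := [:: a]) wD.
rewrite cat_cons (sw_cons wC IE); last first.
  rewrite wact_cat; apply: le_trans CD _; exact: wact_le.
by rewrite (sw_cons wD IE DE) -cmulA -(IH D).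
Qed.

Let sw_common a u w C D : widl (a :: u) C -> widl (a :: w) D ->
  cstar (sw (a :: u) C) ** sw (a :: w) D = cstar (sw u C) ** sw w D.
Proof.
move=> wC wD; have [E IE CE] := wC; have [F IF DF] := wD.
(* With the join of both witnesses the two words have the same first factor [s a], and (iii) turns
   the inner product of these factors into a projection that is absorbed. *)
have IU : idl S a (E `|` F)%O by have [_ h _] := idl_ideal S a; exact: h.
have wC' := widl_suffix (u := [:: a]) wC; have wD' := widl_suffix (u := [:: a]) wD.
rewrite (sw_cons wC IU); last by apply: le_trans CE _; apply: wact_le; exact: leUl.
have DU : (D <= wact w (E `|` F))%O by apply: le_trans DF _; apply: wact_le; exact: leUr.
rewrite (sw_cons wD IU) //.
rewrite cstarM cmulA -(cmulA (cstar (sw u C))) rep_ss // meetxx -cmulA p_sw //.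
by rewrite (meet_idPl DU).
Qed.

Lemma swS_sw u v C D : widl u C -> widl (u ++ v) D ->
  cstar (sw u C) ** sw (u ++ v) D = sw v (D `&` wact v C)%O.
Proof.
elim: u => [|a u IH] wC wD; first by rewrite /= rep_pS p_sw.
rewrite cat_cons sw_common // IH //; first exact: (widl_suffix (u := [:: a]) wC).
exact: (widl_suffix (u := [:: a]) wD).
Qed.

Lemma swS_sw0 u w C D : ~~ prefix u w -> ~~ prefix w u -> widl u C -> widl w D ->
  cstar (sw u C) ** sw w D = 0.
Proof.
elim: u w => [|a u IH] [|b w] //; rewrite /= => n1 n2 wC wD.
have [ab|ab] := eqVneq a b; last first.
  have [E IE CE] := wC; have [F IF DF] := wD.
  rewrite -/(sw (a :: u) C) -/(sw (b :: w) D) (sw_cons wC IE CE) (sw_cons wD IF DF).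
  rewrite cstarM cmulA -(cmulA (cstar (sw u C))) rep_ss0 ?cmul0r ?cmul0l //.
  exact/eqP.
subst b; rewrite -/(sw (a :: u) C) -/(sw (a :: w) D) sw_common //.
rewrite eqxx /= in n1 n2; apply: IH => //.
  exact: (widl_suffix (u := [:: a]) wC).
exact: (widl_suffix (u := [:: a]) wD).
Qed.

Definition tr al C be : A := sw al C ** cstar (sw be C).

Lemma trS al C be : cstar (tr al C be) = tr be C al.
Proof. by rewrite /tr cstarM cstarK. Qed.

Lemma tr0 al be : tr al \bot%O be = 0.
Proof. by rewrite /tr sw0 cmul0l. Qed.

(** The product rule of the inverse semigroup when the inner word on the right is the longer one;
    [trM'] is the adjoint case and [trM0] that of incomparable words. *)
Lemma trM al C be w D de : widl al C -> widl be C -> widl (be ++ w) D -> widl de D ->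
  tr al C be ** tr (be ++ w) D de = tr (al ++ w) (D `&` wact w C)%O de.
Proof.
move=> w1 w2 w3 w4; rewrite /tr cmulA -(cmulA (sw al C)) swS_sw //.
set X := (D `&` wact w C)%O; have wX : widl w X.
  by apply: widl_le (leIl _ _) _; exact: widl_suffix w3.
rewrite -(sw_cat w1 (leIr _ _)).
have wX' : widl (al ++ w) X by apply: widl_act w1 (leIr _ _).
have h : sw (al ++ w) X = sw (al ++ w) X ** p X by rewrite sw_p // meetxx.
rewrite {1}h -cmulA; congr (_ ** _).
rewrite -(rep_pS X) -cstarM sw_p //; congr (cstar (sw _ _)).
exact/meet_idPr/leIl.
Qed.

Lemma trM' al C be w D de : widl al C -> widl (be ++ w) C -> widl be D -> widl de D ->
  tr al C (be ++ w) ** tr be D de = tr al (C `&` wact w D)%O (de ++ w).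
Proof.
move=> w1 w2 w3 w4; rewrite -[LHS]cstarK cstarM !trS trM // trS //.
Qed.

Lemma trM0 al C be ga D de : ~~ prefix be ga -> ~~ prefix ga be -> widl be C ->
  widl ga D -> tr al C be ** tr ga D de = 0.
Proof.
move=> n1 n2 wC wD; rewrite /tr cmulA -(cmulA (sw al C)) swS_sw0 //.
by rewrite cmul0r cmul0l.
Qed.

Definition pq (e : seq L * B) : A := tr e.1 e.2 e.1.

Lemma pq_meet be w C D : widl be C -> widl (be ++ w) D ->
  pq (be, C) ** pq (be ++ w, D) = pq (be ++ w, D `&` wact w C)%O.
Proof. by move=> w1 w2; rewrite /pq trM. Qed.

Lemma pq_meet' be w C D : widl be C -> widl (be ++ w) D ->
  pq (be ++ w, D) ** pq (be, C) = pq (be ++ w, D `&` wact w C)%O.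
Proof. by move=> w1 w2; rewrite /pq trM'. Qed.

Lemma pq_comm e f : widl e.1 e.2 -> widl f.1 f.2 -> pq e ** pq f = pq f ** pq e.
Proof.
case: e f => [be C] [ga D] /= wC wD.
have [/prefixP[w ew]|n1] := boolP (prefix be ga).
  by subst ga; rewrite pq_meet // pq_meet'.
have [/prefixP[w ew]|n2] := boolP (prefix ga be).
  by subst be; rewrite pq_meet // pq_meet'.
by rewrite /pq /= !trM0.
Qed.

Lemma pq_idem e : widl e.1 e.2 -> pq e ** pq e = pq e.
Proof.
case: e => [be C] /= wC; have := @pq_meet be [::] C C; rewrite cats0 => -> //.
by rewrite meetxx.
Qed.

Lemma tr_pq al C be : widl al C -> widl be C -> tr al C be ** pq (be, C) = tr al C be.
Proof.
move=> w1 w2; have := @trM al C be [::] C be; rewrite !cats0 /pq /= => -> //.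
by rewrite meetxx.
Qed.

(** The product of [z] with all [1 - pq e] for [e] in [N], written without a unit. *)
Definition kill (z : A) (N : seq (seq L * B)) : A := foldl (fun z e => z - z ** pq e) z N.

Lemma kill_mull y z N : kill (y ** z) N = y ** kill z N.
Proof.
elim: N z => [//|e N IH] z; rewrite /kill /= -/(kill _ N) -/(kill _ N).
by rewrite -cmulA -cmulBr IH.
Qed.

Lemma killD y z N : kill (y + z) N = kill y N + kill z N.
Proof.
elim: N y z => [//|e N IH] y z; rewrite /kill /= -!/(kill _ N) -IH.
by rewrite cmulDl opprD addrACA.
Qed.

Lemma kill0 N : kill 0 N = 0.
Proof. by elim: N => [//|e N IH]; rewrite /kill /= cmul0l subr0. Qed.

Lemma killN z N : kill (- z) N = - kill z N.
Proof. by apply/eqP; rewrite -addr_eq0 -killD addNr kill0. Qed.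

Lemma killZ (a : R[i]) z N : kill (a *: z) N = a *: kill z N.
Proof.
by elim: N z => [//|e N IH] z; rewrite /kill /= -!/(kill _ N) -IH scalerBr cmulZl.
Qed.

Lemma kill_sum (I : Type) (r : seq I) (F : I -> A) N :
  kill (\sum_(i <- r) F i) N = \sum_(i <- r) kill (F i) N.
Proof.
by elim: r => [|i r IH]; rewrite ?big_nil ?kill0 // !big_cons killD IH.
Qed.

Lemma kill_pq z e N : widl e.1 e.2 -> (forall f, f \in N -> widl f.1 f.2) ->
  kill (z ** pq e) N = kill z N ** pq e.
Proof.
move=> we; elim: N z => [//|f N IH] z wN; rewrite /kill /= -!/(kill _ N).
have wf : widl f.1 f.2 by apply: wN; rewrite mem_head.
rewrite -cmulA (pq_comm we wf) cmulA -cmulBl IH // => g gN.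
by apply: wN; rewrite inE gN orbT.
Qed.

Lemma kill_mem z e N : e \in N -> (forall f, f \in N -> widl f.1 f.2) ->
  kill (z ** pq e) N = 0.
Proof.
elim: N z => [//|f N IH] z; rewrite inE => /orP[/eqP ->|eN] wN.
  rewrite /kill /= -cmulA pq_idem ?subrr; last by apply: wN; rewrite mem_head.
  exact: kill0.
have we : widl e.1 e.2 by apply: wN; rewrite inE eN orbT.
have wf : widl f.1 f.2 by apply: wN; rewrite mem_head.
rewrite /kill /= -/(kill _ N) -cmulA (pq_comm we wf) cmulA -cmulBl IH // => g gN.
by apply: wN; rewrite inE gN orbT.
Qed.

(** Unlike in [finite_cover], the elements of [N] need not lie below [e]; sources of arbitrary
    bisections can thus be used as they are. *)
Definition covers (e : seq L * B) (N : seq (seq L * B)) : Prop :=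
  forall w D, D != \bot%O -> (D <= wact w e.2)%O -> exists2 f, f \in N &
    invsg_mul S (idm (e.1 ++ w) D) (idm f.1 f.2) <> None.

Lemma pq0 be : pq (be, \bot%O) = 0.
Proof. by rewrite /pq /= tr0. Qed.

Lemma pq_diff be C D : widl be C -> pq (be, C) - pq (be, C `&` D)%O = pq (be, C `\` D)%O.
Proof.
move=> wC; have key E : (E <= C)%O -> pq (be, E) = sw be C ** p E ** cstar (sw be C).
  move=> EC; have eE : sw be E = sw be C ** p E by rewrite sw_p // (meet_idPr EC).
  by rewrite /pq /tr /= eE cstarM rep_pS cmulA -(cmulA (sw be C)) rep_pI meetxx.
by rewrite !key ?lexx ?leIl ?leBx // -cmulBl -cmulBr rep_pB.
Qed.

(** Relation (iv) for [C], conjugated by the partial isometry of [be]. *)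
Lemma pq_regular be C : widl be C -> regular_elt S C ->
  pq (be, C) = \sum_(a \in Delta S C) pq (be ++ [:: a], act S a C).
Proof.
move=> wC rC; have [_ _ _ _ h] := rep.
have [C0|C0] := eqVneq C \bot%O.
  rewrite C0 pq0 fsbig1 // => a _; by rewrite act0 pq0.
have [_ fin] := rC C C0 (lexx _).
have e1 : pq (be, C) = sw be C ** p C ** cstar (sw be C).
  by rewrite /pq /tr /= sw_p // meetxx.
rewrite e1 h //.
have fm (F : L -> A) (y z : A) : y ** (\sum_(a \in Delta S C) F a) ** z =
    \sum_(a \in Delta S C) (y ** F a ** z).
  rewrite !(fsbigTE, fsbig_finite) //=.
  elim: (fset_set _ : seq L) => [|a r IH]; first by rewrite !big_nil cmul0r cmul0l.
  by rewrite !big_cons cmulDr cmulDl IH.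
rewrite fm; apply: eq_fsbigr => a _.
have Ia : idl S a (act S a C) by exact: (act_idl (lexx _)).
by rewrite /pq /tr /= (sw_cat wC (lexx _)) sw1 // cstarM !cmulA.
Qed.

Lemma kill_cat z N N' : kill z (N ++ N') = kill (kill z N) N'.
Proof. exact: foldl_cat. Qed.

(** The projections commute, so those over short words can be treated first. *)
Lemma kill_filter (P : pred (seq L * B)) z N : (forall f, f \in N -> widl f.1 f.2) ->
  kill z N = kill z ([seq f <- N | P f] ++ [seq f <- N | ~~ P f]).
Proof.
elim: N z => [//|f N IH] z wN.
have wf : widl f.1 f.2 by apply: wN; rewrite mem_head.
have wN' g : g \in N -> widl g.1 g.2 by move=> gN; apply: wN; rewrite inE gN orbT.
rewrite -[LHS]/(kill (z - z ** pq f) N) IH //= .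
case: (P f) => //=.
rewrite !kill_cat -[RHS]/(kill (kill z _ - kill z _ ** pq f) _).
rewrite !killD !killN; congr (_ - _).
rewrite kill_pq //; last by move=> g; rewrite mem_filter => /andP[_ /wN'].
Qed.

Lemma covers_le be C C' N N' : covers (be, C) N -> (C' <= C)%O ->
  (forall f, f \in N -> f \in N' \/ forall w D, (D <= wact w C')%O ->
     invsg_mul S (idm (be ++ w) D) (idm f.1 f.2) = None) -> covers (be, C') N'.
Proof.
move=> cov C'C h w D D0 DC; have [|f fN ne] := cov w D D0.
  by apply: le_trans DC _; exact: wact_le.
by have [fN'|h'] := h f fN; [exists f|case: ne; exact: h'].
Qed.

Let long be (N : seq (seq L * B)) := forall f, f \in N -> (size be < size f.1)%N.

Let long_meets be w D N : covers (be, D) N -> long be N -> D != \bot%O ->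
  wact w D != \bot%O -> exists f u, [/\ f \in N, widl f.1 f.2 -> True, f.1 = be ++ u &
    (exists v, u = w ++ v /\ wact v (wact w D) != \bot%O) \/ (exists v, w = u ++ v)].
Proof.
move=> cov lN D0 wD; have [f fN ne] := cov w _ wD (lexx _).
have [[v e]|[v e]|//] := mul_id_cases S (be ++ w) f.1 (wact w D) f.2.
  exists f, (w ++ v); split=> //; first by rewrite e catA.
  left; exists v; split=> //; apply/eqP => e0; apply: ne.
  by rewrite e mul_idr e0 meet0x /mk_triple eqxx.
have := lN f fN; have [[u [e1 e2]]|[u [e1 e2]]] := cat_cases e.
  by move=> _; exists f, u; split=> //; right; exists v.
by rewrite e1 size_cat ltnNge leq_addr.
Qed.

(* A finite cover all of whose words properly extend [be] forces [C] to be
   regular: the words leaving [C] start with the letters used by the cover. *)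
Lemma covers_regular be C N : covers (be, C) N -> long be N -> regular_elt S C.
Proof.
move=> cov lN D D0 DC.
have covD : covers (be, D) N by apply: covers_le cov DC _ => f fN; left.
have D0' : wact [::] D != \bot%O by [].
split.
  have [f [u [fN _ e h]]] := long_meets covD lN D0 D0'.
  have := lN f fN; rewrite e size_cat; case: u h e => [|a u] h e.
    by rewrite addn0 ltnn.
  move=> _; exists a; case: h => [[v [/= <- /=]]|[v]//].
  by apply: contraNN => /eqP /= h; rewrite /wact /= h -/(wact u _) wact0.
apply: (@sub_finite_set _ _ [set` pmap (fun f => onth f.1 (size be)) N]); last exact: finite_seq.
move=> a /= aD; have [f [u [fN _ e h]]] := @long_meets be [:: a] D N covD lN D0 aD.
rewrite mem_pmap; apply/mapP; exists f => //; rewrite e onth_cat ltnn subnn.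
have := lN f fN; rewrite e; case: u h {e} => [|b u] h; first by rewrite cats0 ltnn.
move=> _ /=; congr Some.
by case: h => [[v [[-> _]]]|[v [->]]].
Qed.

(** An idempotent over a prefix of [be] can be subtracted inside [C], and one over an incomparable
    word acts as 0. The rest [C'] is covered by the long words alone. *)
Let kill_short be C N1 N2 : widl be C ->
  (forall f, f \in N1 -> widl f.1 f.2 /\ (size f.1 <= size be)%N) -> covers (be, C) (N1 ++ N2) ->
  exists C', [/\ (C' <= C)%O, kill (pq (be, C)) (N1 ++ N2) = kill (pq (be, C')) N2
    & covers (be, C') N2].
Proof.
elim: N1 C => [|f N1 IH] C wC wN1 cov; first by exists C.
have [wf sf] := wN1 f (mem_head _ _).
have wN1' g : g \in N1 -> widl g.1 g.2 /\ (size g.1 <= size be)%N.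
  by move=> gN; apply: wN1; rewrite inE gN orbT.
have kE : kill (pq (be, C)) ((f :: N1) ++ N2) =
  kill (pq (be, C) - pq (be, C) ** pq f) (N1 ++ N2) by [].
rewrite kE; have [/prefixP[w e]|np] := boolP (prefix f.1 be).
  have wC' : widl be (C `\` wact w f.2)%O by apply: widl_le wC; exact: leBx.
  have -> : pq (be, C) - pq (be, C) ** pq f = pq (be, C `\` wact w f.2)%O.
    rewrite -pq_diff //; congr (_ - _).
    by move: wC wf; rewrite e (surjective_pairing f) /= => wC wf; rewrite pq_meet'.
  have [|C' [C'C -> cov']] := IH _ wC' wN1'; last by exists C'; split=> //; exact: le_trans C'C (leBx _ _).
  apply: covers_le cov (leBx _ _) _ => g; rewrite inE => /orP[/eqP ->|gN]; last by left.
  right=> u D DC; rewrite e -catA mul_idl /mk_triple.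
  suff -> : (D `&` wact (w ++ u) f.2 = \bot)%O by rewrite eqxx.
  apply/eqP; rewrite -lex0; apply: le_trans (leI2 DC (lexx _)) _.
  by rewrite wact_cat -wactI meetC -[X in (wact u X)]meetC diffIK wact0.
have npb : ~~ prefix be f.1.
  apply: contraNN np => /prefixP[w e]; move: sf.
  rewrite e size_cat -{2}(addn0 (size be)) leq_add2l leqn0 size_eq0 => /eqP ->.
  by rewrite cats0 prefix_refl.
have -> : pq (be, C) ** pq f = 0 by rewrite /pq trM0.
rewrite subr0; apply: IH => //; apply: covers_le cov (lexx _) _ => g.
rewrite inE => /orP[/eqP ->|gN]; last by left.
right=> u D _; have [[v e]|[v e]|//] := mul_id_cases S (be ++ u) f.1 D f.2.
  by move: npb; rewrite e -catA prefix_prefix.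
have [[v' [e' _]]|[v' [e' _]]] := cat_cases e.
  by move: npb; rewrite e' prefix_prefix.
by move: np; rewrite e' prefix_prefix.
Qed.

(** After the short words are absorbed, the remaining element is regular by [covers_regular], and
    (iv) replaces it by its one-letter extensions. The excess [n] of the words of the cover over
    [be] thereby drops by one; at 0 nothing nonempty can still be covered. *)
Lemma tight_rep n e N : widl e.1 e.2 -> (forall f, f \in N -> widl f.1 f.2) ->
  (forall f, f \in N -> (size f.1 <= size e.1 + n)%N) -> covers e N -> kill (pq e) N = 0.
Proof.
elim: n e N => [|n IHn] [be C] N /= wC wN sN cov.
all: rewrite (kill_filter (fun f => size f.1 <= size be)%N) //.
all: have [||C' [C'C -> covC']] := @kill_short be C [seq f <- N | (size f.1 <= size be)%N]
  [seq f <- N | ~~ (size f.1 <= size be)%N] wC.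
1,4: by move=> f; rewrite mem_filter => /andP[h /wN].
1,3: apply: covers_le cov (lexx _) _ => f fN; left; rewrite mem_cat !mem_filter fN !andbT; exact: orbN.
all: set N2 := [seq f <- N | _] in covC' *.
all: have lN2 : long be N2 by move=> f; rewrite mem_filter -ltnNge => /andP[].
all: have s2 f : f \in N2 -> f \in N by rewrite mem_filter => /andP[_].
all: have rC := covers_regular covC' lN2.
all: have wC' := widl_le C'C wC.
  suff -> : C' = \bot%O by rewrite pq0 kill0.
  apply/eqP/negP => /negP C0; have [f fN _] := covC' [::] C' C0 (lexx _).
  by have := lN2 f fN; rewrite ltnNge -(addn0 (size be)) sN ?s2.
rewrite pq_regular //.
have [C0|C0] := eqVneq C' \bot%O.
  by rewrite fsbig1 ?kill0 // => a _; rewrite C0 act0 pq0.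
have [_ fin] := rC C' C0 (lexx _).
rewrite (fsbigTE, fsbig_finite) //= kill_sum big1_seq // => a _.
apply: IHn => /=.
- exact: widl_act wC' (lexx _).
- by move=> f /s2/wN.
- by move=> f /s2/sN; rewrite size_cat /=; lia.
- by move=> w D D0 DC; rewrite -catA; apply: covC'.
Qed.

End Representation.

(** On a fibre of [ga] the vector is constant and factors out, leaving a sum of coefficients that
    vanishes; fibres are removed one by one. *)
Lemma sum_by_fibre (K : nzRingType) (V : lmodType K) (T M : eqType) (l : seq T) (ga : T -> M)
    (c : T -> K) (v : T -> V) (Q : pred T) :
  (forall x y, x \in l -> y \in l -> Q x -> Q y -> ga x = ga y -> v x = v y) ->
  (forall x0, x0 \in l -> Q x0 -> \sum_(x <- l | Q x && (ga x == ga x0)) c x = 0) ->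
  \sum_(x <- l | Q x) c x *: v x = 0.
Proof.
have [n] := ubnP (count Q l); elim: n Q => [//|n IH] Q hn hv hc.
have [/hasP[x0 x0l Qx0]|/hasPn nQ] := boolP (has Q l); last first.
  by rewrite big1_seq // => x /andP[Qx xl]; have := nQ x xl; rewrite Qx.
rewrite (bigID (fun x => ga x == ga x0)) /=.
have -> : \sum_(x <- l | Q x && (ga x == ga x0)) c x *: v x = 0.
  rewrite -[RHS](scale0r (v x0)) -(hc x0 x0l Qx0) scaler_suml.
  rewrite big_seq_cond [RHS]big_seq_cond; apply: eq_bigr => x /and3P[xl Qx /eqP e].
  by rewrite (hv x x0).
rewrite add0r; apply: IH.
- have h := count_predUI (fun x => Q x && (ga x != ga x0)) (fun x => Q x && (ga x == ga x0)) l.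
  rewrite (eq_count (a2 := Q)) in h; last by move=> x /=; case: (Q x) => //=; case: (ga x == _).
  rewrite [X in (_ + X = _)%N](eq_count (a2 := pred0)) in h; last first.
    by move=> x /=; case: (Q x) => //=; case: (ga x == _).
  have h0 : (0 < count (fun x => Q x && (ga x == ga x0)) l)%N.
    by rewrite -has_count; apply/hasP; exists x0; rewrite ?Qx0 ?eqxx.
  rewrite count_pred0 addn0 in h; move: hn; rewrite h ltnS; apply: leq_trans.
  by rewrite -addn1 leq_add2l.
- by move=> x y xl yl /andP[Qx _] /andP[Qy _]; exact: hv.
- move=> x1 x1l /andP[Qx1 ne]; rewrite -[RHS](hc x1 x1l Qx1).
  apply: eq_bigl => x; rewrite -andbA; congr (_ && _).
  by have [->|] := eqVneq (ga x) (ga x1); rewrite ?ne ?andbF.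
Qed.

(** * Linear relations between bisections *)

Section Independence.
Context {R : realType} {d : Order.disp_t} {B : cbDistrLatticeType d} {L : choiceType}.
Variable S : gbds B L.
Implicit Types (C D E F : B) (al be ga u v w : seq L).
Local Notation widl := (Defs.widl S).
Local Notation wact := (Defs.wact S).
Local Notation G := (RD_groupoid (sigmaE_dom S) (sigmaE S)).
Local Notation T3 := (seq L * B * seq L)%type.

Definition zs (t : T3) : set G := zset t.1.1 t.1.2 t.2.
Definition valid (t : T3) : Prop := widl t.1.1 t.1.2 /\ widl t.2 t.1.2.
Definition ind (t : T3) : G -> R[i] := \1_(zs t).

Lemma cyl_le al C D (y : bpath S) : cyl al C y -> widl al D -> (C <= D)%O -> cyl al D y.
Proof. by move=> c; apply: (@cyl_shorten _ _ _ S al [::] C); rewrite cats0. Qed.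

Lemma cylI al w C D (y : bpath S) : widl al C -> widl (al ++ w) D ->
  cyl (al ++ w) (D `&` wact w C)%O y <-> cyl al C y /\ cyl (al ++ w) D y.
Proof.
move=> wC wD; split=> [h|[h1 h2]]; last by have [/(_ h1)[]] := cyl_cat C h2.
split; first by apply: cyl_shorten h wC _; exact: leIr.
exact: cyl_le h wD (leIl _ _).
Qed.

Lemma cyl_meets be C ga D (y : bpath S) : cyl be C y -> cyl ga D y ->
  invsg_mul S (idm be C) (idm ga D) <> None.
Proof.
move=> c1 c2; have w1 := cyl_widl c1; have w2 := cyl_widl c2.
have [[w e]|[w e]] := cyl_comparable c1 c2; subst.
  rewrite mul_idr; apply/mk_triple_neq0; rewrite meetC.
  by apply: (@cyl_neq0 _ _ _ S (be ++ w) _ y); apply/cylI.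
rewrite mul_idl; apply/mk_triple_neq0.
by apply: (@cyl_neq0 _ _ _ S (ga ++ w) _ y); apply/cylI.
Qed.

Variables (A : cstarAlg R) (p : B -> A) (s : L -> B -> A).
Hypothesis rep : gbds_rep S p s.
Local Notation pq := (pq S p s).
Local Notation tr al C be := (tr S p s al C be).
Local Notation kill := (kill S p s).
Local Notation wf l := (forall f, f \in l -> widl f.1 f.2).

Lemma pq_mul e f : widl e.1 e.2 -> widl f.1 f.2 -> exists m, [/\ widl m.1 m.2,
  pq e ** pq f = pq m & forall y : bpath S, cyl m.1 m.2 y <-> cyl e.1 e.2 y /\ cyl f.1 f.2 y].
Proof.
case: e f => [be C] [ga D] /= wC wD.
have [/prefixP[w ew]|n1] := boolP (prefix be ga).
  subst ga; exists (be ++ w, D `&` wact w C)%O; split.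
  - exact: widl_le (leIl _ _) wD.
  - exact: pq_meet.
  - by move=> y; exact: cylI.
have [/prefixP[w ew]|n2] := boolP (prefix ga be).
  subst be; exists (ga ++ w, C `&` wact w D)%O; split.
  - exact: widl_le (leIl _ _) wC.
  - exact: pq_meet'.
  - by move=> y; rewrite cylI //; split=> -[].
exists ([::], \bot%O); split=> //; first by rewrite (pq0 rep) /pq (trM0 rep).
move=> y; split=> [/cyl_neq0|[c1 c2]]; first by rewrite eqxx.
have [[w e]|[w e]] := cyl_comparable c1 c2; subst.
  by rewrite prefix_prefix in n1.
by rewrite prefix_prefix in n2.
Qed.

Implicit Types (N P ds : seq (seq L * B)).

Let mulp (z : A) P := foldl (fun z e => z ** pq e) z P.

Let mulp_pq z e P : widl e.1 e.2 -> wf P -> mulp (z ** pq e) P = mulp z P ** pq e.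
Proof.
move=> we; elim: P z => [//|f P IH] z wP /=.
rewrite -cmulA (pq_comm rep we (wP f (mem_head _ _))) cmulA IH // => g gP.
by apply: wP; rewrite inE gP orbT.
Qed.

Let mulp_mem z e P : e \in P -> wf P -> mulp z P = mulp (z ** pq e) P.
Proof.
move=> eP wP; have we := wP e eP; rewrite mulp_pq //.
elim: P z eP wP => [//|f P IH] z; rewrite inE => /orP[/eqP <-|eP] wP /=.
all: have wP' : wf P by move=> g gP; apply: wP; rewrite inE gP orbT.
  by rewrite mulp_pq // -cmulA (pq_idem rep).
exact: IH.
Qed.

Let mulpB x y P : mulp (x - y) P = mulp x P - mulp y P.
Proof. by elim: P x y => [//|f P IH] x y /=; rewrite cmulBl IH. Qed.

Let mulp_sum (T : Type) (l : seq T) (c : T -> R[i]) (F : T -> A) P :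
  mulp (\sum_(x <- l) c x *: F x) P = \sum_(x <- l) c x *: mulp (F x) P.
Proof.
elim: P F => [//|f P IH] F /=; rewrite -IH; congr (mulp _ P).
elim: l {IH} => [|x l IHl]; first by rewrite !big_nil cmul0l.
by rewrite !big_cons cmulDl cmulZl IHl.
Qed.

(** Splitting [z] into its product with [pq e] and the rest, for every [e], leaves the pieces over
    the atoms generated by [ds]. *)
Let atom_ind ds z : wf ds -> (forall P N, {subset P <= ds} -> {subset N <= ds} ->
  (forall e, e \in ds -> (e \in P) || (e \in N)) -> kill (mulp z P) N = 0) -> z = 0.
Proof.
elim: ds z => [|e ds IH] z wd h; first exact: (h [::] [::]).
have wd' : wf ds by move=> g gP; apply: wd; rewrite inE gP orbT.
have we : widl e.1 e.2 by apply: wd; exact: mem_head.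
have sub P : {subset P <= ds} -> {subset P <= e :: ds}.
  by move=> PS f fP; rewrite inE PS ?orbT.
have sub' P : {subset P <= ds} -> {subset e :: P <= e :: ds}.
  by move=> PS f; rewrite !inE => /orP[->//|/PS ->]; rewrite orbT.
have h1 : z ** pq e = 0.
  apply: IH => // P N Pd Nd PN; apply: (h (e :: P) N); [exact: sub'|exact: sub|].
  by move=> f; rewrite !inE => /orP[->//|/PN/orP[]->]; rewrite ?orbT.
have h2 : z - z ** pq e = 0.
  apply: IH => // P N Pd Nd PN.
  rewrite mulpB mulp_pq //; last by move=> f /Pd/wd'.
  apply: (h P (e :: N)); [exact: sub|exact: sub'|].
  by move=> f; rewrite !inE => /orP[->|/PN/orP[]->]; rewrite ?orbT.
by rewrite -(subrK (z ** pq e) z) h2 h1 addr0.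
Qed.

Let mulp_prod P : wf P -> P != [::] -> exists m, [/\ widl m.1 m.2,
  forall z, mulp z P = z ** pq m &
  forall y : bpath S, cyl m.1 m.2 y <-> forall e, e \in P -> cyl e.1 e.2 y].
Proof.
elim: P => [//|e P IH] wP _; have we : widl e.1 e.2 by apply: wP; exact: mem_head.
have [->|Pn] := eqVneq P [::].
  exists e; split=> // y; split=> [h f|]; first by rewrite inE => /eqP ->.
  by apply; exact: mem_head.
have [|m [wm mE mc]] := IH _ Pn; first by move=> g gP; apply: wP; rewrite inE gP orbT.
have [m' [wm' mE' mc']] := pq_mul we wm; exists m'; split=> //.
  by move=> z; rewrite /= -/(mulp _ P) mE -cmulA mE'.
move=> y; rewrite mc' mc; split=> [[h1 h2] f|h].
  by rewrite inE => /orP[/eqP ->|/h2].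
by split; [apply: h; exact: mem_head|move=> f fP; apply: h; rewrite inE fP orbT].
Qed.

(** By [cyl_nonempty], an empty set of paths means that [N] covers [m]; the sum of all word lengths
    serves as a bound for [tight_rep]. *)
Lemma kill_empty m N : widl m.1 m.2 -> wf N ->
  (forall y : bpath S, cyl m.1 m.2 y -> exists2 f, f \in N & cyl f.1 f.2 y) -> kill (pq m) N = 0.
Proof.
move=> wm wN h; apply: (tight_rep rep (n := sumn [seq size f.1 | f <- N])) => //.
  by move=> f fN; apply: leq_trans (leq_addl _ _); exact: seq_size_bound fN.
move=> w D D0 DC; have [y cy] := cyl_nonempty (widl_act wm DC) D0.
have [|f fN cf] := h y; first exact: cyl_shorten cy wm DC.
by exists f => //; exact: cyl_meets cy cf.
Qed.

Lemma ind_indep (l : seq (R[i] * T3)) : (forall x, x \in l -> valid x.2) ->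
  (forall g : G, \sum_(x <- l) x.1 * ind x.2 g = 0) ->
  \sum_(x <- l) x.1 *: tr x.2.1.1 x.2.1.2 x.2.2 = 0.
Proof.
move=> vl zl; pose dm (t : T3) := (t.2, t.1.2).
have wds : wf [seq dm x.2 | x <- l] by move=> _ /mapP[x /vl[_ w] ->].
apply: (atom_ind wds) => P N Pd Nd PN.
have wP : wf P by move=> e /Pd/wds.
have wN : wf N by move=> e /Nd/wds.
rewrite mulp_sum kill_sum; under eq_bigr do rewrite killZ.
have vN x : x \in l -> dm x.2 \in N -> kill (mulp (tr x.2.1.1 x.2.1.2 x.2.2) P) N = 0.
  move=> /[dup] xl /vl[w1 w2] xN; rewrite -(tr_pq rep w1 w2) mulp_pq //.
  exact: (kill_mem rep).
(* Over an empty atom every term vanishes by itself. With [P] empty there is no projection to cut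
   with, but then the source of each term lies in [N] and kills it. *)
have [[y [yP yN]]|ny] := pselect (exists y : bpath S, cbox P N y); last first.
  have [P0|Pn] := eqVneq P [::].
    rewrite big1_seq // => x xl; rewrite vN ?scaler0 //.
    by have := PN _ (map_f (fun x => dm x.2) xl); rewrite P0.
  have [m [wm mE mc]] := mulp_prod wP Pn.
  rewrite big1_seq // => x xl; rewrite mE kill_mull kill_empty ?cmul0r ?scaler0 //.
  move=> y /mc yP; apply: contrapT => h; apply: ny; exists y; split=> // f fN cf.
  by apply: h; exists f.
(* Over a nonempty atom a point [y] is fixed. A surviving term has its source in [P], so its
   bisection has exactly one arrow starting at [y]. *)
pose ga (x : R[i] * T3) : option G :=
  if pselect (exists g, zs x.2 g /\ src g = y) is left h then Some (projT1 (cid h)) else None.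
have gaP x g : ga x = Some g <-> zs x.2 g /\ src g = y.
  rewrite /ga; case: pselect => [h|h]; last by split=> // hg; case: h; exists g.
  case: cid => g' [z' s'] /=; split=> [[<-]//|[zg sg]]; congr Some.
  by apply: zset_src_inj z' zg _; rewrite s' sg.
rewrite (bigID (fun x => dm x.2 \in N)) /= big1_seq ?add0r; last first.
  by move=> x /andP[xN xl]; rewrite vN // scaler0.
have gaN x : x \in l -> dm x.2 \notin N -> exists2 g, ga x = Some g & dm x.2 \in P.
  move=> xl xN; have := PN _ (map_f (fun x => dm x.2) xl); rewrite (negbTE xN) orbF => xP.
  have [g hg] := zset_src_exists (vl x xl).1 (yP _ xP).
  by exists g => //; apply/gaP.
(* Terms with the same arrow become equal once both sources are multiplied in, and their
   coefficients are summed by evaluating the relation at that arrow. *)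
apply: (sum_by_fibre (ga := ga)) => [x x' xl xl' nx nx' e|x0 xl0 nx0].
  have [g hg xP] := gaN x xl nx; have [g' hg' xP'] := gaN x' xl' nx'.
  have {hg' e} hg' : ga x' = Some g by rewrite -e.
  have [[zg _] [zg' _]] := ((gaP _ _).1 hg, (gaP _ _).1 hg').
  rewrite (mulp_mem _ xP') // [in RHS](mulp_mem _ xP) //; congr (kill (mulp _ _) _).
  move: (vl x xl) (vl x' xl') zg zg'.
  case: (x) (x') => [c [[al C] be]] [c' [[al' C'] be']] [/= w1 w2] [/= w1' w2'] zg zg'.
  rewrite /zs /= in zg zg'; rewrite /pq /dm /=.
  have [[w [e1 e2]]|[w [e1 e2]]] := zset_compat zg zg'; subst.
    by rewrite (trM rep) // (trM' rep).
  by rewrite (trM rep) // (trM' rep).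
have [g hg _] := gaN _ xl0 nx0.
rewrite -[RHS](zl g) [RHS](bigID (fun x => (dm x.2 \notin N) && (ga x == ga x0))) /=.
rewrite [X in _ = _ + X]big1_seq ?addr0; last first.
  move=> x /andP[h xl]; rewrite /ind indicE; case: (boolP (_ \in _)); last by rewrite mulr0.
  move=> /set_mem zg; case/negP: h; have [_ sg] := (gaP _ _).1 hg.
  have gx : ga x = Some g by apply/gaP.
  rewrite gx hg eqxx andbT; apply/negP => xN; apply: (yN _ xN); rewrite -sg.
  by case: zg.
rewrite big_seq_cond [RHS]big_seq_cond; apply: eq_bigr => x /and3P[xl _ /eqP gx].
rewrite /ind indicE mem_set ?mulr1 //; rewrite hg in gx.
by case: ((gaP _ _).1 gx).
Qed.

End Independence.

(** * Products and intersections of bisections *)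

Section BisectionProducts.
Context {d : Order.disp_t} {B : cbDistrLatticeType d} {L : choiceType}.
Variable S : gbds B L.
Implicit Types (A C D E F : B) (al be ga de u v w : seq L) (x y z : bpath S).
Local Notation widl := (Defs.widl S).
Local Notation wact := (Defs.wact S).
Local Notation sh n := (iter n (sigmaE S)).
Local Notation G := (RD_groupoid (sigmaE_dom S) (sigmaE S)).
Implicit Types (g h k : G).
Local Notation T3 := (seq L * B * seq L)%type.
Implicit Types (t : T3).
Local Notation zs := (@zs _ _ _ S).

Lemma zset_inv al A be g : zset be A al (ginv g) <-> zset al A be g.
Proof.
have e1 : tgt (ginv g) = src g by [].
have e2 : src (ginv g) = tgt g by [].
have e3 : deg (ginv g) = - deg g by [].
rewrite /zset /= e1 e2 e3; split=> -[dg c1 c2 e]; split=> //; first by lia.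
by rewrite dg; lia.
Qed.

Lemma gmulE g h k : gmul g h k <->
  [/\ src g = tgt h, tgt k = tgt g, src k = src h & deg k = deg g + deg h].
Proof.
split=> [[e1 e2]|[e1 e2 e3 e4]].
  by rewrite /src /tgt /deg e2.
split=> //; rewrite [LHS]surjective_pairing [(set_val k).1]surjective_pairing.
by move: e2 e3 e4; rewrite /tgt /src /deg => -> -> ->.
Qed.

Lemma zset_ext al A be w C g : widl al A -> widl be A -> (C <= wact w A)%O ->
  zset (al ++ w) C (be ++ w) g <-> zset al A be g /\ cyl (be ++ w) C (src g).
Proof.
move=> wA wA' CA; split=> [[dg ca cb e]|[[dg ca cb e] cc]].
  split=> //; have [pa _] := (pre_cat _ _ _).1 (cyl_prex ca).
  have pa' := (prex_shift w pa).1 (cyl_prex ca).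
  have [pb _] := (pre_cat _ _ _).1 (cyl_prex cb).
  have pb' := (prex_shift w pb).1 (cyl_prex cb).
  split; first by rewrite dg !size_cat; lia.
  - exact: cyl_shorten ca wA CA.
  - exact: cyl_shorten cb wA' CA.
  apply: (shift_inj pa' pb'); rewrite -!iterD [(_ + size al)%N]addnC.
  by rewrite [(_ + size be)%N]addnC -!size_cat.
have pb := cyl_prex cb; have pa := cyl_prex ca.
have [h wC] := (cyl_shift w C pb).1 cc; split=> //.
- by rewrite dg !size_cat; lia.
- by apply/(cyl_shift w C pa); split; [rewrite e|exact: widl_act wA CA].
- by rewrite !size_cat ![(size _ + size w)%N]addnC !iterD e.
Qed.

Lemma zset_tgt_exists al A be x : widl be A -> cyl al A x ->
  exists g, zset al A be g /\ tgt g = x.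
Proof.
move=> wA cx; have [g [zg sg]] := zset_src_exists wA cx.
exists (ginv g); split; last by rewrite -sg.
exact/zset_inv.
Qed.

Lemma zset_le al A C be g : zset al A be g -> (C <= A)%O -> widl al C -> widl be C ->
  cyl al C (tgt g) \/ cyl be C (src g) -> zset al C be g.
Proof.
move=> zg CA w1 w2 h; have e := zset_tgt_cyl zg w1 w2.
case: (zg) => dg _ _ eq; split=> //; first by case: h => // /e.
by case: h => // /e.
Qed.

(** The product of the inverse semigroup, with 0 represented by a triple with bottom element, whose
    bisection is empty; products thus remain valid triples. *)
Definition tmul t t' : T3 :=
  let: (al, A, be) := t in let: (ga, C, de) := t' in
  if prefix be ga then (al ++ drop (size be) ga, C `&` wact (drop (size be) ga) A, de)%O
  else if prefix ga be then (al, A `&` wact (drop (size ga) be) C, de ++ drop (size ga) be)%O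
  else ([::], \bot, [::])%O.

Definition tinv t : T3 := (t.2, t.1.2, t.1.1).

Lemma tmul_valid t t' : valid S t -> valid S t' -> valid S (tmul t t').
Proof.
case: t t' => [[al A] be] [[ga C] de] [/= w1 w2] [/= w3 w4]; rewrite /tmul.
case: prefixP => [[w ->]|_].
  rewrite drop_size_cat //; split; first exact: widl_act w1 (leIr _ _).
  exact: widl_le (leIl _ _) w4.
case: prefixP => [[w e]|_]; last by split.
subst be; rewrite drop_size_cat //; split; first exact: widl_le (leIl _ _) w1.
exact: widl_act w4 (leIr _ _).
Qed.

Lemma tmul_tr (R : realType) (AA : cstarAlg R) p s t t' : gbds_rep (A := AA) S p s ->
  valid S t -> valid S t' -> let tr t := tr S p s t.1.1 t.1.2 t.2 in
  tr (tmul t t') = tr t ** tr t'.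
Proof.
case: t t' => [[al A] be] [[ga C] de] rep [/= w1 w2] [/= w3 w4].
have [/prefixP[w e]|n1] := boolP (prefix be ga).
  by subst ga; rewrite drop_size_cat // (trM rep).
have [/prefixP[w e]|n2] := boolP (prefix ga be); last by rewrite (trM0 rep) ?(tr0 rep).
by subst be; rewrite drop_size_cat // (trM' rep).
Qed.

(** To factor [g], [h] is the arrow of the first bisection with the target of [g], and [k] joins the
    source of [h] to that of [g]. *)
Let zmul al A be w C de g : valid S (al, A, be) -> valid S (be ++ w, C, de) ->
  zset (al ++ w) (C `&` wact w A)%O de g <->
  exists h k, [/\ gmul h k g, zset al A be h & zset (be ++ w) C de k].
Proof.
move=> [/= w1 w2] [/= w3 w4]; set X := (C `&` wact w A)%O.
have XA : (X <= wact w A)%O by exact: leIr.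
have XC : (X <= C)%O by exact: leIl.
split=> [zg|[h [k [/gmulE[e1 e2 e3 e4] zh zk]]]].
  have [dg ca cd e] := zg; have ca' := cyl_shorten ca w1 XA.
  have [h [zh th]] := zset_tgt_exists w2 ca'; have [dh c1 c2 eh] := zh.
  have p2 := cyl_prex c2.
  have cm : cyl (be ++ w) X (src h).
    apply/(cyl_shift w X p2); split; last exact: widl_act w2 XA.
    by rewrite -eh th; case/(cyl_shift w X (cyl_prex ca')): ca.
  have [k [zk tk sk]] : exists k, [/\ zset (be ++ w) X de k, tgt k = src h & src k = src g].
    apply: arrow_exists => //; rewrite -e -th !size_cat ![(size _ + size w)%N]addnC.
    by rewrite !iterD eh.
  exists h, k; split=> //.
    apply/gmulE; split=> //; rewrite dg; case: zk => -> _ _ _; case: zh => -> _ _ _.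
    by rewrite !size_cat; lia.
  case: zk => dk k1 k2 ek; split=> //; first exact: cyl_le k1 w3 XC.
  exact: cyl_le k2 w4 XC.
have cm : cyl (be ++ w) X (src h).
  by apply/cylI => //; split; [by case: zh|rewrite e1; case: zk].
have [dh h1 h2 eh] := (zset_ext h w1 w2 XA).2 (conj zh cm).
have [|dk k1 k2 ek] := zset_le zk XC (cyl_widl h2) (widl_le XC w4).
  by left; rewrite -e1.
split; [|by rewrite e2|by rewrite e3|by rewrite e2 e3 eh e1].
by rewrite e4 dh dk; lia.
Qed.

Lemma gmul_inv g h k : gmul g h k -> gmul (ginv h) (ginv g) (ginv k).
Proof.
move=> /gmulE[e1 e2 e3 e4]; apply/gmulE; split=> //.
by rewrite /deg /= -!/(deg _) e4 opprD addrC.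
Qed.

Lemma ginvK g : ginv (ginv g) = g.
Proof. by apply: arrow_ext => //; rewrite /deg /= opprK. Qed.

Lemma zs_mul t t' g : valid S t -> valid S t' ->
  zs (tmul t t') g <-> exists h k, [/\ gmul h k g, zs t h & zs t' k].
Proof.
case: t t' => [[al A] be] [[ga C] de] v v'; rewrite /zs /tmul.
have [/prefixP[w e]|n1] := boolP (prefix be ga).
  by subst ga; rewrite drop_size_cat //; exact: zmul.
have [/prefixP[w e]|n2] := boolP (prefix ga be).
  subst be; have [v1 v2] := v; have [v1' v2'] := v'.
  rewrite drop_size_cat //= -zset_inv (zmul _ (conj v2' v1') (conj v2 v1)).
  split=> -[h [k [m z1 z2]]]; exists (@ginv G k), (@ginv G h).
    split; [by rewrite -(ginvK g); exact: gmul_inv|exact/zset_inv|exact/zset_inv].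
  by split; [exact: gmul_inv|exact/zset_inv|exact/zset_inv].
split=> [[_ /cyl_neq0]|[h [k [/gmulE[e _ _ _] [_ _ c1 _] [_ c2 _ _]]]]].
  by rewrite eqxx.
rewrite /= e in c1; rewrite /= in c2; have [[w ew]|[w ew]] := cyl_comparable c1 c2; subst.
  by rewrite prefix_prefix in n1.
by rewrite prefix_prefix in n2.
Qed.

Lemma zs_src t ga C : valid S t -> widl ga C -> exists2 t', valid S t' &
  forall g, zs t' g <-> zs t g /\ cyl ga C (src g).
Proof.
case: t => [[al A] be] [/= w1 w2] wC.
have [/prefixP[w e]|n1] := boolP (prefix be ga).
  subst ga; have XA : (C `&` wact w A <= wact w A)%O by exact: leIr.
  exists (al ++ w, C `&` wact w A, be ++ w)%O.
    by split; [exact: widl_act w1 XA|exact: widl_act w2 XA].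
  move=> g; rewrite /zs /= (zset_ext _ w1 w2 XA) (cylI _ w2 wC).
  by split=> [[z [c1 c2]]|[z c]] //; split=> //; split=> //; case: z.
have [/prefixP[w e]|n2] := boolP (prefix ga be).
  subst be; have XA : (A `&` wact w C <= A)%O by exact: leIl.
  exists (al, A `&` wact w C, ga ++ w)%O.
    by split; [exact: widl_le XA w1|exact: widl_le XA w2].
  move=> g; rewrite /zs /=; split=> [[dg c1 c2 e]|[z c]].
    have [c3 c4] := (cylI _ wC w2).1 c2; split=> //; split=> //.
    exact: cyl_le c1 w1 XA.
  apply: (zset_le z XA (widl_le XA w1) (widl_le XA w2)); right.
  by apply/cylI => //; split=> //; case: z.
exists ([::], \bot, [::])%O; first by [].
move=> g; split=> [[_ /cyl_neq0]|[[_ _ c1 _] c2]]; first by rewrite eqxx.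
have [[w ew]|[w ew]] := cyl_comparable c1 c2; rewrite /= in ew; subst.
  by rewrite prefix_prefix in n1.
by rewrite prefix_prefix in n2.
Qed.

(** Bisections that meet agree over common sources, so their intersection is one of them cut down by
    the source condition of the other. *)
Lemma zsI t t' : valid S t -> valid S t' -> exists2 t'', valid S t'' &
  zs t'' = zs t `&` zs t'.
Proof.
move=> v v'; have [[g [z z']]|no] := pselect (exists g, zs t g /\ zs t' g).
  have [t'' v'' h] := zs_src v' v.2; exists t'' => //.
  apply/seteqP; split=> [k /h[k1 k2]|k [k1 k2]].
    by split=> //; exact: zset_restrict z z' k1 k2.
  by apply/h; split=> //; case: k1.
exists ([::], \bot, [::])%O; first by [].
apply/seteqP; split=> [k [_ /cyl_neq0]|k [k1 k2]]; first by rewrite eqxx.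
by case: no; exists k.
Qed.

End BisectionProducts.

(** * Convolution of compactly supported functions *)

Section Convolution.
Context {R : realType} {d : Order.disp_t} {B : cbDistrLatticeType d} {L : choiceType}.
Variable S : gbds B L.
Local Notation G := (RD_groupoid (sigmaE_dom S) (sigmaE S)).
Local Notation T3 := (seq L * B * seq L)%type.
Local Notation zs := (@zs _ _ _ S).
Local Notation ind := (@ind R _ _ _ S).
Local Notation valid := (valid S).
Implicit Types (g h k : G) (t : T3) (K : seq T3) (f e : G -> R[i]).

Definition union_of K : set G := [set g | exists2 t, t \in K & zs t g].
Definition supp_on K f : Prop := forall g, f g != 0 -> union_of K g.

Lemma ind1 t g : zs t g -> ind t g = 1.
Proof. by move=> h; rewrite /ind indicE mem_set. Qed.

Lemma ind0 t g : ~ zs t g -> ind t g = 0.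
Proof. by move=> h; rewrite /ind indicE memNset. Qed.

Lemma ind_neq0 t g : ind t g != 0 -> zs t g.
Proof. by move=> h; apply: contrapT => /ind0 e; rewrite e eqxx in h. Qed.

Lemma supp_sub K K' f : {subset K <= K'} -> supp_on K f -> supp_on K' f.
Proof. by move=> s h g /h[t tK z]; exists t => //; exact: s. Qed.

Lemma supp0 K : supp_on K (fun=> 0).
Proof. by move=> g; rewrite eqxx. Qed.

Lemma suppD K f e : supp_on K f -> supp_on K e -> supp_on K (fun g => f g + e g).
Proof.
move=> hf he g; have [f0|/hf//] := eqVneq (f g) 0.
by rewrite f0 add0r => /he.
Qed.

Lemma suppM K f e : supp_on K f -> supp_on K (fun g => e g * f g).
Proof. by move=> hf g; rewrite mulf_eq0 negb_or => /andP[_ /hf]. Qed.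

Lemma supp_ind K t : t \in K -> supp_on K (ind t).
Proof. by move=> tK g /ind_neq0; exists t. Qed.

Lemma supp_eq0 K f g : supp_on K f -> ~ union_of K g -> f g = 0.
Proof. by move=> h n; have [//|/h] := eqVneq (f g) 0. Qed.

(* A pair [p] of composable arrows with product [z] is determined by any
   bisection containing [p.1]. *)
Lemma conv_seq K z : exists r : seq (G * G), [/\ (size r <= size K)%N,
  forall p, p \in r -> gmul p.1 p.2 z &
  forall f e, supp_on K f -> convolution f e z = \sum_(p <- r) f p.1 * e p.2].
Proof.
pose q t : option (G * G) :=
  if pselect (exists p : G * G, gmul p.1 p.2 z /\ zs t p.1) is left h
  then Some (projT1 (cid h)) else None.
pose r := undup (pmap q K).
have rm (p : G * G) : p \in r -> gmul p.1 p.2 z.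
  rewrite mem_undup mem_pmap => /mapP[t _]; rewrite /q; case: pselect => // h.
  by case: cid => p' [? ?] /= [->].
exists r; split=> //.
  by apply: leq_trans (size_undup _) _; rewrite size_pmap count_size.
move=> f e hf.
have zero (p : G * G) : gmul p.1 p.2 z -> p \notin r -> f p.1 * e p.2 = 0.
  move=> hp pr; have [->|/hf[t tK zt]] := eqVneq (f p.1) 0; first by rewrite mul0r.
    case/negP: pr; rewrite mem_undup mem_pmap; apply/mapP; exists t => //.
    rewrite /q; case: pselect => [h|h]; last by case: h; exists p.
    case: cid => p' [m z'] /=; congr Some.
    move: hp => /gmulE[a1 a2 a3 a4]; have [b1 b2 b3 b4] := (gmulE _ _ _).1 m.
    have e1 : p.1 = p'.1 by apply: zset_tgt_inj zt z' _; rewrite -a2 -b2.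
    rewrite [LHS]surjective_pairing [RHS]surjective_pairing e1; congr pair.
    apply: arrow_ext; [by rewrite -a1 -b1 e1| |by rewrite -a3 -b3].
    by apply: (addrI (deg p.1)); rewrite -a4 e1 -b4.
rewrite /convolution (@fsbigE _ _ _ _ [set p : G * G | gmul p.1 p.2 z] r _ (undup_uniq _) rm zero).
rewrite big_seq_cond [RHS]big_seq; apply: eq_bigl => p.
by case: (boolP (p \in r)) => // /rm h; rewrite mem_set.
Qed.

Lemma convDl K f f' e : supp_on K f -> supp_on K f' ->
  convolution (fun g => f g + f' g) e = fun g => convolution f e g + convolution f' e g.
Proof.
move=> hf hf'; apply/funext => z; have [r [_ _ h]] := conv_seq K z.
rewrite !h //; last exact: suppD.
by rewrite -big_split; apply: eq_bigr => p _; rewrite mulrDl.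
Qed.

Lemma convDr K f e e' : supp_on K f ->
  convolution f (fun g => e g + e' g) = fun g => convolution f e g + convolution f e' g.
Proof.
move=> hf; apply/funext => z; have [r [_ _ h]] := conv_seq K z.
by rewrite !h // -big_split; apply: eq_bigr => p _; rewrite mulrDr.
Qed.

Lemma convZl K a f e : supp_on K f ->
  convolution (fun g => a * f g) e = fun g => a * convolution f e g.
Proof.
move=> hf; apply/funext => z; have [r [_ _ h]] := conv_seq K z.
rewrite !h //; last exact: suppM.
by rewrite mulr_sumr; apply: eq_bigr => p _; rewrite mulrA.
Qed.

Lemma convZr K a f e : supp_on K f ->
  convolution f (fun g => a * e g) = fun g => a * convolution f e g.
Proof.
move=> hf; apply/funext => z; have [r [_ _ h]] := conv_seq K z.
by rewrite !h // mulr_sumr; apply: eq_bigr => p _; rewrite mulrCA.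
Qed.

(** [conv_seq] leaves at most one summand for each bisection in [K]. *)
Lemma conv_bound K f e (M N : R[i]) z : supp_on K f -> (forall g, `|f g| <= M) ->
  (forall g, `|e g| <= N) -> `|convolution f e z| <= (M * N) *+ size K.
Proof.
move=> hf fM eN; have [r [sr _ h]] := conv_seq K z; rewrite h //.
have M0 : 0 <= M by apply: le_trans (fM z).
have N0 : 0 <= N by apply: le_trans (eN z).
apply: le_trans (ler_norm_sum _ _ _) _.
apply: (@le_trans _ _ ((M * N) *+ size r)); last by rewrite ler_wpMn2l ?mulr_ge0.
elim: (r) => [|p r' IH]; first by rewrite big_nil mulr0n.
by rewrite big_cons mulrS lerD // normrM ler_pM.
Qed.

Lemma conv_neq0 f e z : convolution f e z != 0 ->
  exists h k, [/\ gmul h k z, f h != 0 & e k != 0].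
Proof.
move=> h0; apply: contrapT => no; move/eqP: h0; apply; apply: fsbig1 => p /= m.
have [->|h1] := eqVneq (f p.1) 0; first by rewrite mul0r.
have [->|h2] := eqVneq (e p.2) 0; first by rewrite mulr0.
by case: no; exists p.1, p.2.
Qed.

Lemma conv_bisection t f e h k z : supp_on [:: t] f -> gmul h k z -> zs t h ->
  convolution f e z = f h * e k.
Proof.
move=> hf m zh; rewrite /convolution -(@fsbig_widen _ _ _ _ [set (h, k)]) ?fsbig_set1 //.
  by move=> _ ->.
move=> p [/= mp pn]; have [->|/hf[t' ]] := eqVneq (f p.1) 0; first by rewrite mul0r.
rewrite inE => /eqP -> zp; case: pn.
move: mp m => /gmulE[a1 a2 a3 a4] /gmulE[b1 b2 b3 b4].
have e1 : p.1 = h by apply: zset_tgt_inj zp zh _; rewrite -a2 -b2.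
rewrite [LHS]surjective_pairing e1; congr pair.
apply: arrow_ext; [by rewrite -a1 -b1 e1| |by rewrite -a3 -b3].
by apply: (addrI (deg p.1)); rewrite -a4 e1 -b4.
Qed.

Lemma conv_ind t t' : valid t -> valid t' -> convolution (ind t) (ind t') = ind (tmul S t t').
Proof.
move=> v v'; apply/funext => z.
have [zz|nz] := pselect (zs (tmul S t t') z); last first.
  rewrite (ind0 nz).
  have [//|/conv_neq0[h [k [m /ind_neq0 zh /ind_neq0 zk]]]] := eqVneq (convolution (ind t) (ind t') z) 0.
  by case: nz; apply/zs_mul => //; exists h, k.
rewrite ind1 //; have [h [k [m zh zk]]] := (zs_mul z v v').1 zz.
by rewrite (@conv_bisection t _ _ h k) ?ind1 ?mulr1 //; apply: supp_ind; rewrite inE.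
Qed.

Definition supp_mul K K' := [seq tmul S t t' | t <- K, t' <- K'].

Lemma conv_supp K K' f e : (forall t, t \in K -> valid t) -> (forall t, t \in K' -> valid t) ->
  supp_on K f -> supp_on K' e -> supp_on (supp_mul K K') (convolution f e).
Proof.
move=> vK vK' hf he z /conv_neq0[h [k [m /hf[t tK zt] /he[t' tK' zt']]]].
exists (tmul S t t'); first by apply/allpairsP; exists (t, t').
by apply/zs_mul; [exact: vK|exact: vK'|exists h, k].
Qed.

Lemma supp_mul_valid K K' : (forall t, t \in K -> valid t) -> (forall t, t \in K' -> valid t) ->
  forall t, t \in supp_mul K K' -> valid t.
Proof.
move=> vK vK' t /allpairsP[[t1 t2] [/= h1 h2 ->]]; apply: tmul_valid; [exact: vK|exact: vK'].
Qed.

Lemma zs_inv t g : zs (tinv t) (ginv g) <-> zs t g.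
Proof. exact: zset_inv. Qed.

Lemma inv_supp K f : supp_on K f -> supp_on [seq tinv t | t <- K] (involution f).
Proof.
move=> hf g; rewrite /involution fmorph_eq0 => /hf[t tK zt]; exists (tinv t).
  exact: map_f.
by rewrite -(ginvK g); apply/zs_inv.
Qed.

Lemma inv_ind t : involution (ind t) = ind (tinv t).
Proof.
apply/funext => g; rewrite /involution; have [zg|ng] := pselect (zs (tinv t) g).
  rewrite (ind1 zg) ind1 ?rmorph1 //; apply/zs_inv; by rewrite ginvK.
rewrite (ind0 ng) ind0 ?rmorph0 // => zg; apply: ng.
by rewrite -(ginvK g); apply/zs_inv.
Qed.

Definition lin (l : seq (R[i] * T3)) : G -> R[i] := fun g => \sum_(x <- l) x.1 * ind x.2 g.
Definition Alg f : Prop := exists2 l, (forall x, x \in l -> valid x.2) & f = lin l.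

Lemma Alg_rect (Q : (G -> R[i]) -> Prop) : Q (fun=> 0) ->
  (forall a t f, valid t -> Alg f -> Q f -> Q (fun g => a * ind t g + f g)) ->
  forall f, Alg f -> Q f.
Proof.
move=> Q0 QD _ [l vl ->]; elim: l vl => [|x l IH] vl.
  by rewrite (_ : lin [::] = fun=> 0) //; apply/funext => g; rewrite /lin big_nil.
have vl' y : y \in l -> valid y.2 by move=> yl; apply: vl; rewrite inE yl orbT.
rewrite (_ : lin (x :: l) = fun g => x.1 * ind x.2 g + lin l g); last first.
  by apply/funext => g; rewrite /lin big_cons.
by apply: QD; [apply: vl; exact: mem_head|exists l|exact: IH].
Qed.

Lemma AlgD f e : Alg f -> Alg e -> Alg (fun g => f g + e g).
Proof.
move=> [l vl ->] [l' vl' ->]; exists (l ++ l').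
  by move=> x; rewrite mem_cat => /orP[/vl|/vl'].
by apply/funext => g; rewrite /lin big_cat.
Qed.

Lemma AlgZ a f : Alg f -> Alg (fun g => a * f g).
Proof.
move=> [l vl ->]; exists [seq (a * x.1, x.2) | x <- l].
  by move=> _ /mapP[x /vl v ->].
by apply/funext => g; rewrite /lin big_map mulr_sumr; apply: eq_bigr => x _; rewrite mulrA.
Qed.

Lemma Alg_ind t : valid t -> Alg (ind t).
Proof.
move=> v; exists [:: (1, t)]; first by move=> x; rewrite inE => /eqP ->.
by apply/funext => g; rewrite /lin big_seq1 mul1r.
Qed.

Lemma Alg0 : Alg (fun=> 0).
Proof. by exists [::] => //; apply/funext => g; rewrite /lin big_nil. Qed.

Lemma AlgB f e : Alg f -> Alg e -> Alg (fun g => f g - e g).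
Proof.
move=> hf he; have := AlgD hf (AlgZ (-1) he); congr Alg.
by apply/funext => g; rewrite mulN1r.
Qed.

Lemma Alg_supp f : Alg f -> exists2 K, (forall t, t \in K -> valid t) & supp_on K f.
Proof.
elim/Alg_rect => [|a t f' v _ [K vK hK]]; first by exists [::] => //; exact: supp0.
exists (t :: K); first by move=> t'; rewrite inE => /orP[/eqP ->|/vK].
apply: suppD; first by apply: suppM; apply: supp_ind; exact: mem_head.
by apply: supp_sub hK => t'; rewrite inE orbC => ->.
Qed.

Lemma Alg_M f e : Alg f -> Alg e -> Alg (fun g => f g * e g).
Proof.
move=> hf he; elim/Alg_rect: f / hf => [|a t f v _ IH].
  by rewrite (_ : (fun g => 0 * e g) = fun=> 0) ?funeqE; [exact: Alg0|move=> g; rewrite mul0r].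
rewrite (_ : (fun g => _ * e g) = fun g => a * (ind t g * e g) + f g * e g); last first.
  by apply/funext => g; rewrite mulrDl mulrA.
apply: AlgD => //; apply: AlgZ; elim/Alg_rect: e / he {IH} => [|b t' e v' _ IH].
  by rewrite (_ : (fun g => ind t g * 0) = fun=> 0) ?funeqE; [exact: Alg0|move=> g; rewrite mulr0].
rewrite (_ : (fun g => ind t g * _) = fun g => b * (ind t g * ind t' g) + ind t g * e g); last first.
  by apply/funext => g; rewrite mulrDr mulrCA.
apply: AlgD => //; apply: AlgZ; have [t'' v'' e''] := zsI v v'.
rewrite (_ : (fun g => _ * _) = ind t''); first exact: Alg_ind.
by apply/funext => g; rewrite /ind e'' indicI.
Qed.

(** On the bisection [t] the function equals [a + f], so [phi] of it is [psi] of [f] plus [phi a];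
    as [psi 0 = 0], the induction must range over all [phi]. *)
Lemma Alg_comp (phi : R[i] -> R[i]) f : phi 0 = 0 -> Alg f -> Alg (phi \o f).
Proof.
move=> p0 hf; elim/Alg_rect: f / hf phi p0 => [|a t f v hf IH] phi p0.
  by rewrite (_ : _ \o _ = fun=> 0) ?funeqE; [exact: Alg0|move=> g /=; rewrite p0].
pose psi y := phi (a + y) - phi a.
have -> : phi \o (fun g => a * ind t g + f g) = fun g =>
    ind t g * (psi \o f) g + (phi a * ind t g + ((phi \o f) g - ind t g * (phi \o f) g)).
  apply/funext => g; rewrite /psi /=; have [z|z] := pselect (zs t g).
    by rewrite (ind1 z) !mul1r !mulr1 subrr addr0 subrK.
  by rewrite (ind0 z) !mul0r !mulr0 subr0 !add0r.
have hp : Alg (phi \o f) by exact: IH.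
apply: AlgD; first by apply: Alg_M; [exact: Alg_ind|apply: IH; rewrite /psi addr0 subrr].
apply: AlgD; first exact/AlgZ/Alg_ind.
apply: AlgB => //; apply: Alg_M => //; exact: Alg_ind.
Qed.

Lemma conv0l e : convolution (fun=> 0 : R[i]) e = fun=> 0.
Proof. by apply/funext => z; apply: fsbig1 => p _; rewrite mul0r. Qed.

Lemma conv0r f : convolution f (fun=> 0 : R[i]) = fun=> 0.
Proof. by apply/funext => z; apply: fsbig1 => p _; rewrite mulr0. Qed.

Lemma conv_cons a t f e : valid t -> Alg f -> convolution (fun g => a * ind t g + f g) e =
  fun g => a * convolution (ind t) e g + convolution f e g.
Proof.
move=> v /Alg_supp[K _ hK]; have st : supp_on (t :: K) (ind t) by exact/supp_ind/mem_head.
rewrite (@convDl (t :: K)).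
- by rewrite (convZl a e st).
- exact: suppM.
- by apply: supp_sub hK => t'; rewrite inE orbC => ->.
Qed.

Lemma conv_cons_ind t b t' e : valid t -> valid t' ->
  convolution (ind t) (fun g => b * ind t' g + e g) =
  fun g => b * ind (tmul S t t') g + convolution (ind t) e g.
Proof.
move=> v v'; have st : supp_on [:: t] (ind t) by exact/supp_ind/mem_head.
by rewrite (convDr _ _ st) (convZr _ _ st) conv_ind.
Qed.

Lemma Alg_conv f e : Alg f -> Alg e -> Alg (convolution f e).
Proof.
move=> hf he; elim/Alg_rect: f / hf => [|a t f v hf IH]; first by rewrite conv0l; exact: Alg0.
rewrite conv_cons //; apply: AlgD => //; apply: AlgZ.
elim/Alg_rect: e / he {IH} => [|b t' e v' _ IH]; first by rewrite conv0r; exact: Alg0.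
rewrite conv_cons_ind //; apply: AlgD => //; apply: AlgZ; apply: Alg_ind; exact: tmul_valid.
Qed.

Lemma inv_cons a t f : involution (fun g => a * ind t g + f g) =
  fun g => Num.conj a * ind (tinv t) g + involution f g.
Proof. by rewrite -inv_ind; apply/funext => g; rewrite /involution rmorphD rmorphM. Qed.

Lemma Alg_inv f : Alg f -> Alg (involution f).
Proof.
elim/Alg_rect => [|a t f' v _ IH].
  rewrite (_ : involution _ = fun=> 0); first exact: Alg0.
  by apply/funext => g; rewrite /involution rmorph0.
rewrite inv_cons; apply: AlgD => //; apply: AlgZ; apply: Alg_ind.
by case: v.
Qed.

End Convolution.

(** * Uniform limits of indicator combinations *)

Section UniformClosure.
Context {R : realType} {d : Order.disp_t} {B : cbDistrLatticeType d} {L : choiceType}.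
Variable S : gbds B L.
Local Notation G := (RD_groupoid (sigmaE_dom S) (sigmaE S)).
Local Notation T3 := (seq L * B * seq L)%type.
Local Notation zs := (@zs _ _ _ S).
Local Notation ind := (@ind R _ _ _ S).
Local Notation valid := (valid S).
Local Notation union_of := (@union_of _ _ _ S).
Local Notation Alg := (@Alg R _ _ _ S).
Local Notation src := (@src _ _ _ S).
Implicit Types (g h k : G) (t : T3) (K : seq T3) (f e u v : G -> R[i]).

Definition valids K : Prop := forall t, t \in K -> valid t.

Lemma valids_cat K K' : valids K -> valids K' -> valids (K ++ K').
Proof. by move=> v v' t; rewrite mem_cat => /orP[/v|/v']. Qed.

Lemma union_compact K : compact (union_of K).
Proof.
elim: K => [|t K IH].
  by rewrite (_ : union_of _ = set0); [exact: compact0|apply/seteqP; split=> // g [t]].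
rewrite (_ : union_of _ = zs t `|` union_of K).
  by apply: compactU => //; exact: zset_compact.
apply/seteqP; split=> [g [t']|g [z|[t' tK z]]].
- by rewrite inE => /orP[/eqP -> z|tK z]; [left|right; exists t'].
- by exists t => //; exact: mem_head.
- by exists t' => //; rewrite inE tK orbT.
Qed.

Lemma union_closed K : closed (union_of K).
Proof.
elim: K => [|t K IH].
  by rewrite (_ : union_of _ = set0); [exact: closed0|apply/seteqP; split=> // g [t]].
rewrite (_ : union_of _ = zs t `|` union_of K).
  by apply: closedU => //; exact: zset_closed.
apply/seteqP; split=> [g [t']|g [z|[t' tK z]]].
- by rewrite inE => /orP[/eqP -> z|tK z]; [left|right; exists t'].
- by exists t => //; exact: mem_head.
- by exists t' => //; rewrite inE tK orbT.
Qed.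

Lemma arrow_valid g : exists2 t, valid t & zs t g.
Proof.
have [al [A [be z]]] := arrow_zset g; exists (al, A, be) => //.
by case: z => _ c1 c2 _; split; [exact: cyl_widl c1|exact: cyl_widl c2].
Qed.

Lemma compact_union (C : set G) : compact C -> exists2 K, valids K & C `<=` union_of K.
Proof.
move=> cC; have [||s hs] := compact_subcover (f := fun t => zs t) cC.
- by move=> t; exact: zset_open.
- by move=> g _; have [t _ z] := arrow_valid g; exists t.
exists [seq t <- s | `[< valid t >]].
  by move=> t; rewrite mem_filter => /andP[/asboolP].
move=> g /hs[t ts z]; exists t => //; rewrite mem_filter ts andbT; apply/asboolP.
by case: z => _ c1 c2 _; split; [exact: cyl_widl c1|exact: cyl_widl c2].
Qed.

Lemma Alg_locally_constant f g : Alg f -> \forall h \near g, f h = f g.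
Proof.
move: f; apply: (@Alg_rect R _ _ _ S) => [|a t f' v _ IH]; first exact: (@filterE _ (nbhs g)).
have st : \forall h \near g, ind t h = ind t g.
  have [z|z] := pselect (zs t g).
    apply: (@filterS _ _ _ (zs t)); first by move=> h zh; rewrite !ind1.
    by apply: open_nbhs_nbhs; split=> //; exact: zset_open.
  apply: (@filterS _ _ _ (~` zs t)); first by move=> h zh; rewrite !ind0.
  by apply: open_nbhs_nbhs; split=> //; apply: closed_openC; exact: zset_closed.
by apply: filterS2 st IH => h -> ->.
Qed.

Lemma Alg_bounded f : Alg f -> exists2 M : R[i], 0 <= M & forall g, `|f g| <= M.
Proof.
elim/(@Alg_rect R _ _ _ S) => [|a t f' v _ [M M0 fM]]; first by exists 0 => // g; rewrite normr0.
exists (`|a| + M) => [|g]; first exact: addr_ge0.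
apply: le_trans (ler_normD _ _) _; apply: lerD => //; rewrite normrM.
have [z|z] := pselect (zs t g); first by rewrite ind1 // normr1 mulr1.
by rewrite ind0 // normr0 mulr0.
Qed.

(** The approximants must share one list [K]: the norm bounds for representations grow with the
    number of bisections, so uniform closeness alone would not control them. *)
Definition Unif f : Prop := exists K, [/\ valids K, supp_on K f &
  forall r : R[i], 0 < r -> exists u, [/\ Alg u, supp_on K u & forall g, `|f g - u g| <= r]].

Lemma Alg_Unif f : Alg f -> Unif f.
Proof.
move=> hf; have [K vK hK] := Alg_supp hf; exists K; split=> // r r0.
by exists f; split=> // g; rewrite subrr normr0 ltW.
Qed.

Lemma Alg_union K : valids K -> exists u, [/\ Alg u, supp_on K u & forall g, union_of K g -> u g = 1].
Proof.
elim: K => [|t K IH] vK.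
  exists (fun=> 0); split; [exact: Alg0|exact: supp0|by move=> g []].
have vt : valid t by apply: vK; exact: mem_head.
have [|u [hu su u1]] := IH; first by move=> t' tK; apply: vK; rewrite inE tK orbT.
exists (fun g => ind t g + (u g - ind t g * u g)); split.
- by apply: AlgD; [exact: Alg_ind|apply: AlgB => //; apply: Alg_M => //; exact: Alg_ind].
- move=> g; have [z|z] := pselect (zs t g); first by exists t => //; exact: mem_head.
  rewrite ind0 // mul0r subr0 add0r => /su[t' tK z']; exists t' => //.
  by rewrite inE tK orbT.
- move=> g [t']; have [z|z] := pselect (zs t g); first by rewrite ind1 // mul1r subrr addr0.
  rewrite inE => /orP[/eqP -> //|tK z']; rewrite ind0 // mul0r subr0 add0r u1 //.
  by exists t'.
Qed.

Lemma Alg_cbox t P N : valid t ->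
  exists2 u, Alg u & forall g, u g = (asbool ((zs t `&` src @^-1` cbox P N) g))%:R.
Proof.
move=> vt; have cyl1 p : exists2 u, Alg u & forall g, u g = (asbool (zs t g /\ cyl p.1 p.2 (src g)))%:R.
  have [w|w] := pselect (widl S p.1 p.2); last first.
    exists (fun=> 0); first exact: Alg0.
    by move=> g; case: asboolP => // -[_ /cyl_widl].
  have [t' v' ht'] := zs_src vt w; exists (ind t'); first exact: Alg_ind.
  move=> g; case: asboolP => [/ht' z|n]; first by rewrite ind1.
  by rewrite ind0 // => /ht'.
elim: P => [|p P [u hu uE]]; last first.
  have [u' hu' u'E] := cyl1 p; exists (fun g => u g * u' g); first exact: Alg_M.
  move=> g; rewrite uE u'E -natrM mulnb; congr (_ %:R); congr nat_of_bool.
  rewrite -asbool_and; apply: asbool_equiv_eq; split=> [[[z [hP hN]] [_ c]]|[z [hP hN]]].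
    by split=> //; split=> // q; rewrite inE => /orP[/eqP ->|/hP].
  split; last by split=> //; apply: hP; exact: mem_head.
  by split=> //; split=> // q qP; apply: hP; rewrite inE qP orbT.
elim: N => [|p N [u hu uE]].
  exists (ind t); first exact: Alg_ind.
  move=> g; case: asboolP => [[z _]|n]; first by rewrite ind1.
  by rewrite ind0 // => z; apply: n; split.
have [u' hu' u'E] := cyl1 p; exists (fun g => u g - u g * u' g).
  by apply: AlgB => //; exact: Alg_M.
move=> g; rewrite uE u'E; case: asboolP => [[z [hP hN]]|n1]; last first.
  rewrite mul0r subr0; case: asboolP => // -[z [hP hN]]; case: n1; split=> //; split=> // q qN.
  by apply: hN; rewrite inE qN orbT.
rewrite mul1r; case: asboolP => [[_ c]|n2].
  rewrite subrr; case: asboolP => // -[_ [_ hN']]; case: (hN' p _ c); exact: mem_head.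
rewrite subr0; case: asboolP => // n3; case: n3; split=> //; split=> // q.
by rewrite inE => /orP[/eqP -> c|/hN//]; apply: n2.
Qed.

Lemma Unif_continuous f : Unif f -> continuous (f : G -> R[i]^o).
Proof.
move=> [K [_ _ hf]] g; apply/(@cvgrPdist_le R[i] R[i]^o G (nbhs g) (nbhs_filter g) f (f g)) => r r0.
have r2 : 0 < r / 2 by rewrite divr_gt0.
have [u [hu _ fu]] := hf _ r2.
have := Alg_locally_constant g hu; apply: filterS => h hg.
rewrite -(subrK (u g) (f g)) -addrA -[X in _ + (X - _)]hg [r]splitr.
apply: le_trans (ler_normD _ _) (lerD (fu g) _).
by rewrite distrC; exact: fu.
Qed.

Lemma compact_approx K f r : valids K -> supp_on K f -> continuous (f : G -> R[i]^o) ->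
  0 < r -> exists u, [/\ Alg u, supp_on K u & forall g, `|f g - u g| <= r].
Proof.
move=> vK sf cf r0.
pose V (i : T3 * seq (seq L * B) * seq (seq L * B)) := zs i.1.1 `&` src @^-1` cbox i.1.2 i.2.
pose good i := valid i.1.1 /\ exists c, forall g, V i g -> `|f g - c| <= r.
pose F i := if `[< good i >] then V i else set0.
have [||s hs] := compact_subcover (f := F) (@union_compact K).
- move=> i; rewrite /F; case: asboolP => _; last exact: open0.
  by apply: zset_src_open; exact: cbox_open.
- move=> g _; have [t v z] := arrow_valid g.
  have nr := (@cvgrPdist_le R[i] R[i]^o G (nbhs g) (nbhs_filter g) f (f g)).1 (cf g) r r0.
  have [P [N [gPN sub]]] := arrow_nbhs z nr.
  exists (t, P, N); rewrite /F; case: asboolP => [_|[]]; first by split.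
  by split=> //; exists (f g) => h /sub; rewrite /= distrC.
(* The function is nearly constant on each piece of the cover; pieces are added one at a time, each
   new constant overriding the previous values there. *)
have [u hu uE] : exists2 u, Alg u & forall g, (exists2 i, i \in s & F i g) -> `|f g - u g| <= r.
  elim: (s) => [|i s' [u hu uE]]; first by exists (fun=> 0); [exact: Alg0|move=> g []].
  have [[v [c hc]]|bad] := pselect (good i); last first.
    exists u => // g [j]; rewrite inE => /orP[/eqP ->|js Fj]; last by apply: uE; exists j.
    by rewrite /F; case: asboolP.
  have [w hw wE] := Alg_cbox i.1.2 i.2 v.
  exists (fun g => c * w g + (u g - u g * w g)).
    by apply: AlgD; [exact: AlgZ|apply: AlgB => //; exact: Alg_M].
  move=> g [j js Fj]; rewrite wE; case: asboolP => [Vg|nV].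
    by rewrite !mulr1 subrr addr0; exact: hc.
  rewrite !mulr0 add0r subr0; apply: uE; exists j => //.
  move: js; rewrite inE => /orP[/eqP e|//]; case: nV; move: Fj; rewrite e /F.
  by case: asboolP.
(* Multiplying by the indicator of the union restores the support. *)
have [w [hw sw w1]] := Alg_union vK.
exists (fun g => u g * w g); split; [exact: Alg_M|exact: suppM|].
move=> g; have [gK|gK] := pselect (union_of K g).
  by rewrite w1 // mulr1; apply: uE; exact: hs.
by rewrite (supp_eq0 sf gK) (supp_eq0 sw gK) mulr0 subrr normr0 ltW.
Qed.

(** A compact support is covered by finitely many bisections; conversely, such a union is compact
    and closed, so it contains the closure of the support. *)
Lemma CcP f : Cc (f : G -> R[i]) <-> Unif f.
Proof.
split=> [[cf cs]|uf].
  have [K vK sK] := compact_union cs.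
  have sf : supp_on K f by move=> g h; apply: sK; exact: subset_closure.
  by exists K; split=> // r r0; exact: compact_approx.
split; first exact: Unif_continuous.
have [K [_ sf _]] := uf; apply: (subclosed_compact _ (@union_compact K)).
  exact: closed_closure.
rewrite [X in _ `<=` X](closure_id _).1; last exact: union_closed.
by apply: closure_subset => g /= /sf.
Qed.

Lemma Unif0 : Unif (fun=> 0).
Proof. by apply: Alg_Unif; exact: Alg0. Qed.

Lemma UnifD f e : Unif f -> Unif e -> Unif (fun g => f g + e g).
Proof.
have sl K K' u : supp_on K u -> supp_on (K ++ K') u by apply: supp_sub => t; rewrite mem_cat => ->.
have sr K K' u : supp_on K' u -> supp_on (K ++ K') u.
  by apply: supp_sub => t; rewrite mem_cat orbC => ->.
move=> [K [vK sf hf]] [K' [vK' se he]]; exists (K ++ K'); split.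
- exact: valids_cat.
- by apply: suppD; [exact: sl|exact: sr].
- move=> r r0; have r2 : 0 < r / 2 by rewrite divr_gt0.
  have [u [hu su fu]] := hf _ r2; have [v [hv sv ev]] := he _ r2.
  exists (fun g => u g + v g); split; first exact: AlgD.
    by apply: suppD; [exact: sl|exact: sr].
  move=> g; rewrite opprD addrACA [r]splitr.
  exact: le_trans (ler_normD _ _) (lerD (fu g) (ev g)).
Qed.

Lemma UnifZ a f : Unif f -> Unif (fun g => a * f g).
Proof.
move=> [K [vK sf hf]]; exists K; split=> //; first exact: suppM.
move=> r r0; have a0 : 0 < `|a| + 1 by rewrite ltr_wpDl.
have [u [hu su fu]] := hf (r / (`|a| + 1)) (divr_gt0 r0 a0).
exists (fun g => a * u g); split; [exact: AlgZ|exact: suppM|].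
move=> g; rewrite -mulrBr normrM -(divfK (lt0r_neq0 a0) r) mulrC.
by apply: ler_pM => //; rewrite lerDl.
Qed.

Lemma Unif_inv f : Unif f -> Unif (involution f).
Proof.
move=> [K [vK sf hf]]; exists [seq tinv t | t <- K]; split.
- by move=> _ /mapP[t /vK[v1 v2] ->].
- exact: inv_supp.
- move=> r /hf[u [hu su fu]]; exists (involution u); split; [exact: Alg_inv|exact: inv_supp|].
  by move=> g; rewrite /involution -rmorphB norm_conjC.
Qed.

Lemma Unif_bounded f : Unif f -> exists2 M : R[i], 0 <= M & forall g, `|f g| <= M.
Proof.
move=> [K [_ _ hf]]; have [u [hu _ fu]] := hf 1 ltr01; have [M M0 uM] := Alg_bounded hu.
exists (1 + M) => [|g]; first exact: addr_ge0.
by rewrite -(subrK (u g) (f g)); apply: le_trans (ler_normD _ _) (lerD (fu g) (uM g)).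
Qed.

(** An accuracy that is at most 1 and absorbs the constant [C], without a separate case for
    [C = 0]. *)
Lemma small_factor (c C : R[i]) : 0 < c -> 0 <= C ->
  [/\ 0 < c / (c + C), c / (c + C) <= 1 & C * (c / (c + C)) <= c].
Proof.
move=> c0 C0; have p : 0 < c + C by rewrite ltr_wpDr.
split; first exact: divr_gt0.
  by rewrite ler_pdivrMr // mul1r lerDl.
by rewrite mulrA ler_pdivrMr // mulrC ler_wpM2l ?(ltW c0) // lerDr ltW.
Qed.

Lemma conv_approx K f f' e e' (M N r : R[i]) : supp_on K f -> supp_on K f' ->
  (forall g, `|f' g| <= M) -> (forall g, `|e g| <= N) ->
  (forall g, `|f g - f' g| <= r) -> (forall g, `|e g - e' g| <= r) ->
  forall g, `|convolution f e g - convolution f' e' g| <= (N + M) *+ size K * r.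
Proof.
move=> sf sf' f'M eN fr er g.
have s1 : supp_on K (fun g => f g - f' g).
  have := suppD sf (suppM (e := fun=> -1) sf'); congr supp_on.
  by apply/funext => h; rewrite mulN1r.
have e1 : convolution f e = fun g => convolution (fun g => f g - f' g) e g + convolution f' e g.
  rewrite -(convDl _ s1 sf'); congr convolution; by apply/funext => h; rewrite subrK.
have e2 : convolution f' e = fun g => convolution f' (fun g => e g - e' g) g + convolution f' e' g.
  rewrite -(convDr _ _ sf'); congr convolution; by apply/funext => h; rewrite subrK.
rewrite e1 e2 /= addrA addrK; apply: le_trans (ler_normD _ _) _.
rewrite mulrnDl mulrDl; apply: lerD.
  by apply: le_trans (conv_bound g s1 fr eN) _; rewrite -mulrnAr mulrC.
by apply: le_trans (conv_bound g sf' f'M er) _; rewrite mulrnAl.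
Qed.

Lemma Unif_conv f e : Unif f -> Unif e -> Unif (convolution f e).
Proof.
move=> uf ue; have [M M0 fM] := Unif_bounded uf; have [N N0 eN] := Unif_bounded ue.
move: uf ue => [K [vK sf hf]] [K' [vK' se he]]; exists (supp_mul S K K'); split.
- exact: supp_mul_valid.
- exact: conv_supp.
move=> r r0; have C0 : 0 <= (N + (1 + M)) *+ size K by rewrite mulrn_wge0 // !addr_ge0.
have [q0 q1 qr] := small_factor r0 C0; set q := r / _ in q0 q1 qr.
have [u [hu su fu]] := hf _ q0; have [v [hv sv ev]] := he _ q0.
exists (convolution u v); split; [exact: Alg_conv|exact: conv_supp|].
move=> g; apply: le_trans qr; apply: (conv_approx sf su _ eN fu ev) => h.
rewrite -(subrK (f h) (u h)); apply: le_trans (ler_normD _ _) (lerD _ (fM h)).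
by rewrite distrC; exact: le_trans (fu h) q1.
Qed.

End UniformClosure.

(** * Norm bounds *)

Section Bound.
Context {R : realType} {d : Order.disp_t} {B : cbDistrLatticeType d} {L : choiceType}.
Variable S : gbds B L.
Local Notation G := (RD_groupoid (sigmaE_dom S) (sigmaE S)).
Local Notation T3 := (seq L * B * seq L)%type.
Local Notation zs := (@zs _ _ _ S).
Local Notation ind := (@ind R _ _ _ S).
Local Notation valid := (valid S).
Local Notation src := (@src _ _ _ S).
Local Notation tgt := (@tgt _ _ _ S).
Implicit Types (g h k : G) (t : T3) (K : seq T3) (f e u v : G -> R[i]).

Definition is_unit g : Prop := deg g = 0 /\ tgt g = src g.

Definition on_units f : Prop := forall g, f g != 0 -> is_unit g.

Lemma gmul_unit h k z : gmul h k z -> is_unit h -> is_unit k -> [/\ h = z, k = z & is_unit z].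
Proof.
move=> /gmulE[a1 a2 a3 a4] [h1 h2] [k1 k2].
have e : tgt h = tgt k by rewrite h2.
split.
- by apply: arrow_ext; [rewrite a2|rewrite a4 k1 addr0|rewrite a3 -k2 -e].
- by apply: arrow_ext; [rewrite a2|rewrite a4 h1 add0r|rewrite a3].
- by split; [rewrite a4 h1 k1 addr0|rewrite a2 a3 -k2].
Qed.

Lemma conv_units u v : on_units u -> on_units v ->
  convolution u v = fun z => u z * v z.
Proof.
move=> hu hv; apply/funext => z; rewrite /convolution.
have [uz|uz] := pselect (is_unit z); last first.
  rewrite fsbig1 => [|p /= m].
    by have [->|/hu//] := eqVneq (u z) 0; rewrite mul0r.
  have [->|/hu h1] := eqVneq (u p.1) 0; first by rewrite mul0r.
  have [->|/hv h2] := eqVneq (v p.2) 0; first by rewrite mulr0.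
  by have [_ _] := gmul_unit m h1 h2.
rewrite -(@fsbig_widen _ _ _ _ [set (z, z)]) ?fsbig_set1 //.
  by case: uz => d0 e _ ->; apply/gmulE; split; rewrite //= d0.
move=> p [/= m pn]; have [->|/hu h1] := eqVneq (u p.1) 0; first by rewrite mul0r.
have [->|/hv h2] := eqVneq (v p.2) 0; first by rewrite mulr0.
have [e1 e2 _] := gmul_unit m h1 h2; case: pn.
by rewrite [LHS]surjective_pairing e1 e2.
Qed.

Lemma inv_units u : on_units u -> (forall g, Num.conj (u g) = u g) -> involution u = u.
Proof.
move=> hu ru; apply/funext => g; rewrite /involution ru.
have inv1 g' : is_unit g' -> ginv g' = g'.
  move=> [d0 e]; apply: arrow_ext => //.
  by rewrite -[LHS]/(- deg g') d0 oppr0.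
have [e0|/hu ug] := eqVneq (u g) 0; last by rewrite inv1.
have [->|/hu ug] := eqVneq (u (ginv g)) 0; first by rewrite e0.
have eg : ginv g = g by rewrite -[RHS](ginvK g) (inv1 _ ug).
by rewrite eg.
Qed.

(** A contributing pair [(h, k)] has the inverse of [h] and [k] in one bisection with the same
    target, so they coincide and the product is a unit. *)
Lemma star_square t f z : supp_on [:: t] f ->
  convolution (involution f) f z != 0 ->
  is_unit z /\ exists g, convolution (involution f) f z = `|f g| ^+ 2.
Proof.
move=> sf /conv_neq0[h [k [m]]]; rewrite /involution fmorph_eq0 => fh fk.
have [t1 ] := sf _ fh; rewrite inE => /eqP -> zh.
have [t2 ] := sf _ fk; rewrite inE => /eqP -> zk.
have [a1 a2 a3 a4] := (gmulE _ _ _).1 m.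
have e : ginv h = k by apply: zset_tgt_inj zh zk _; rewrite -a1.
split.
  split; first by rewrite a4 -e; exact: subrr.
  by rewrite a2 a3 -e.
exists k; rewrite (@conv_bisection _ _ _ _ S (tinv t) _ _ h k) //.
- by rewrite /involution e normCK mulrC.
- by have := inv_supp sf.
- by rewrite -(ginvK h); apply/zs_inv.
Qed.

(** Solves [r^2 = 2w - w^2] for real [r] between 0 and 1, which gives the certificate of
    [selfadjoint_contractive] pointwise; the real part makes it defined on all of [R[i]]. *)
Definition sqrt_fun (z : R[i]) : R[i] := (1 - Num.sqrt (1 - complex.Re z ^+ 2))%:C%C.

Lemma sqrt_fun0 : sqrt_fun 0 = 0.
Proof. by rewrite /sqrt_fun /= expr0n subr0 sqrtr1 subrr. Qed.

Lemma sqrt_funE (r : R) : 0 <= r <= 1 -> let w := sqrt_fun r%:C%C in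
  r%:C%C * r%:C%C = w + w - w * w.
Proof.
move=> /andP[r0 r1] /=; rewrite /sqrt_fun /= -!rmorphM -rmorphD -rmorphB; congr (_ %:C)%C.
have h : 0 <= 1 - r ^+ 2 by rewrite subr_ge0 expr_le1.
have := sqr_sqrtr h; set s := Num.sqrt _ => e; ring: e.
Qed.

(** [F] will be [Alg] for the representation built from the relations, and [Unif] for an arbitrary
    representation of [Cc]. *)
Variables (F : set (G -> R[i])) (A : cstarAlg R) (pi : (G -> R[i]) -> A).
Hypothesis FD : forall f e, F f -> F e -> F (fun g => f g + e g).
Hypothesis FZ : forall a f, F f -> F (fun g => a * f g).
Hypothesis F_conv : forall f e, F f -> F e -> F (convolution f e).
Hypothesis F_inv : forall f, F f -> F (involution f).
Hypothesis F_ind : forall t f, valid t -> F f -> F (fun g => ind t g * f g).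
Hypothesis F_sqrt : forall f, F f -> F (sqrt_fun \o f).
Hypothesis piD : forall f e, F f -> F e -> pi (fun g => f g + e g) = pi f + pi e.
Hypothesis piZ : forall a f, F f -> pi (fun g => a * f g) = a *: pi f.
Hypothesis pi_conv : forall f e, F f -> F e -> pi (convolution f e) = pi f ** pi e.
Hypothesis pi_inv : forall f, F f -> pi (involution f) = cstar (pi f).

Lemma rep_zero f : F f -> (forall g, f g = 0) -> pi f = 0.
Proof.
move=> hf f0; rewrite (_ : f = fun g => 0 * f g) ?piZ ?scale0r //.
by apply/funext => g; rewrite mul0r.
Qed.

(* The C*-identity reduces to the positive function [f^* f] on units; with [h]
   its normalization and [w = 1 - sqrt (1 - h^2)], [h^2 = 2 w - w^2]. *)
Lemma bisection_bound t f (M : R[i]) : valid t -> F f -> supp_on [:: t] f -> 0 < M ->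
  (forall g, `|f g| <= M) -> `|pi f| <= M.
Proof.
move=> vt hf sf M0 fM; set q := convolution (involution f) f.
have Fq : F q by apply: F_conv => //; exact: F_inv.
pose h g := (M ^- 2) * q g; have Fh : F h by exact: FZ.
have M2 : 0 < M ^+ 2 by rewrite exprn_gt0.
have hr g : exists r : R, [/\ h g = r%:C%C, 0 <= r <= 1 & q g = 0 -> r = 0].
  have [q0|/(star_square sf)[_ [k ek]]] := eqVneq (q g) 0.
    by exists 0; rewrite /h q0 mulr0 lexx ler01.
  have h0 : 0 <= h g by rewrite /h /q ek mulr_ge0 ?invr_ge0 ?exprn_ge0 // ltW.
  exists (complex.Re (h g)); split; first exact: complex_ge0.
    rewrite -!lecR -(complex_ge0 h0) h0 /=.
    by rewrite /h /q ek mulrC ler_pdivrMr // mul1r lerXn2r // nnegrE ltW.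
  by rewrite /h => ->; rewrite mulr0.
have hU : on_units h.
  move=> g; rewrite /h mulf_eq0 negb_or => /andP[_ /(star_square sf)[]//].
pose w := sqrt_fun \o h; have Fw : F w by exact: F_sqrt.
have wU : on_units w.
  move=> g; have [h0|/hU//] := eqVneq (h g) 0.
  by rewrite /w /= h0 sqrt_fun0 eqxx.
have ihh : involution h = h.
  by apply: inv_units => // g; have [r [-> _ _]] := hr g; exact: conjc_real.
have iww : involution w = w by apply: inv_units => // g; exact: conjc_real.
have comm : pi h ** pi w = pi w ** pi h.
  rewrite -!pi_conv // !conv_units //; congr pi; apply/funext => g; exact: mulrC.
have sq : pi h ** pi h = pi w + pi w - pi w ** pi w.
  rewrite -!pi_conv // -piD // -scaleN1r -piZ; last exact: F_conv.
  rewrite -piD; [|exact: FD|by apply: FZ; exact: F_conv].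
  rewrite !conv_units //; congr pi; apply/funext => g; rewrite mulN1r /w /=.
  by have [r [-> r01 _]] := hr g; exact: sqrt_funE.
have n1 : nrm (pi h) <= 1.
  apply: (@selfadjoint_contractive _ _ (pi h) (pi w)) => //.
    by rewrite -pi_inv // ihh.
  by rewrite -pi_inv // iww.
have eq : pi q = M ^+ 2 *: pi h.
  rewrite -piZ //; congr pi; apply/funext => g.
  by rewrite /h mulrA divff ?mul1r // lt0r_neq0.
rewrite -(@ler_pXn2r _ 2) ?nnegrE ?(ltW M0) //.
rewrite -cnorm_star -pi_inv // -pi_conv //; last exact: F_inv.
rewrite -/q eq normrZ ger0_norm ?(ltW M2) // ler_piMr ?(ltW M2) //.
by rewrite nrmE -[1]/(1%:C%C) lecR.
Qed.

(** The part of [f] on one bisection is split off by its indicator and bounded. The factor [size K]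
    is crude, but it does not depend on the accuracy of an approximation. *)
Lemma rep_bound K f (M : R[i]) : valids S K -> F f -> supp_on K f -> 0 <= M ->
  (forall g, `|f g| <= M) -> `|pi f| <= M *+ size K.
Proof.
move=> vK hf sf; rewrite le0r => /orP[/eqP ->|M0] fM.
  rewrite rep_zero ?normr0 ?mul0rn // => g; apply/eqP; rewrite -normr_eq0 eq_le.
  by rewrite fM normr_ge0.
elim: K f vK hf sf fM => [|t K IH] f vK hf sf fM.
  rewrite mulr0n rep_zero ?normr0 // => g; apply: supp_eq0 sf _.
  by move=> [].
have vt : valid t by apply: vK; exact: mem_head.
have vK' : valids S K by move=> t' tK; apply: vK; rewrite inE tK orbT.
pose f1 g := ind t g * f g; pose f2 g := f g + -1 * f1 g.
have F1 : F f1 by exact: F_ind.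
have F2 : F f2 by apply: FD => //; exact: FZ.
have -> : pi f = pi f1 + pi f2.
  by rewrite -piD //; congr pi; apply/funext => g; rewrite /f2 mulN1r addrC subrK.
have f12 g : (zs t g /\ f1 g = f g /\ f2 g = 0) \/ (~ zs t g /\ f1 g = 0 /\ f2 g = f g).
  rewrite /f2 /f1; have [z|z] := pselect (zs t g); [left|right].
    by rewrite ind1 // mul1r mulN1r subrr.
  by rewrite ind0 // mul0r mulr0 addr0.
rewrite mulrS; apply: le_trans (ler_normD _ _) (lerD _ _).
  apply: (bisection_bound vt F1 _ M0) => [g|g].
    by have [[z _]|[_ [-> _]]] := f12 g; [exists t; rewrite ?inE|rewrite eqxx].
  by have [[_ [-> _]]|[_ [-> _]]] := f12 g; rewrite ?normr0 // ltW.
apply: IH => // g.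
  have [[_ [_ ->]]|[nz [_ ->]]] := f12 g; first by rewrite eqxx.
  by move=> /sf[t']; rewrite inE => /orP[/eqP ->|tK z] //; exists t'.
by have [[_ [_ ->]]|[_ [_ ->]]] := f12 g; rewrite ?normr0 // ltW.
Qed.

End Bound.

(** A modulus of continuity that holds up to 0; it lets [sqrt_fun] act on uniform limits. *)
Lemma sqrt_dist (R : rcfType) (a b : R) : `|Num.sqrt a - Num.sqrt b| <= Num.sqrt `|a - b|.
Proof.
wlog ab : a b / b <= a.
  by move=> h; have [/h//|/ltW/h] := leP b a; rewrite (distrC (Num.sqrt b)) (distrC b).
rewrite !ger0_norm ?subr_ge0 ?ler_wsqrtr //.
have [b0|b0] := leP b 0.
  by rewrite (ler0_sqrtr b0) subr0 ler_wsqrtr // lerDl oppr_ge0.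
have a0 : 0 <= a by apply: le_trans ab; exact: ltW.
rewrite lerBlDr -ler_sqr ?nnegrE ?addr_ge0 ?sqrtr_ge0 // sqrrD !sqr_sqrtr ?subr_ge0 ?(ltW b0) //.
have : 0 <= Num.sqrt (a - b) * Num.sqrt b by rewrite mulr_ge0 ?sqrtr_ge0.
by move=> h; rewrite addrAC subrK lerDl mulrn_wge0.
Qed.

Lemma nrm_small (R : realType) (V : normedModType R[i]) (x : V) (C : R) :
  (forall r, 0 < r -> r <= 1 -> nrm x <= C * r) -> x = 0.
Proof.
move=> h; apply: (@nrm_eps0 _ _ _ C) => e e0; have [e1|/ltW e1] := leP e 1; first exact: h.
have C0 : 0 <= C by have := h 1 ltr01 (lexx _); rewrite mulr1; apply: le_trans; exact: nrm_ge0.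
by apply: le_trans (h 1 ltr01 (lexx _)) _; rewrite ler_wpM2l.
Qed.

(** [near r i] says that [i] approximates a fixed object up to [r]. It serves to extend maps from
    [Alg] to [Unif] and from a dense image to the whole algebra. *)
Lemma limit_exists (R : realType) (V : completeNormedModType R[i]) (I : Type)
    (near : R -> I -> Prop) (rho : I -> V) (C : R) :
  (forall r, 0 < r -> exists i, near r i) ->
  (forall r r' i, r <= r' -> near r i -> near r' i) ->
  (forall r i j, 0 < r -> near r i -> near r j -> nrm (rho i - rho j) <= C * r) ->
  exists T, forall r i, 0 < r -> near r i -> nrm (T - rho i) <= C * r.
Proof.
move=> ex mono dist; pose q n : R := n.+1%:R^-1.
have q0 n : 0 < q n by rewrite invr_gt0.
have qm m n : (m <= n)%N -> q n <= q m by move=> mn; rewrite lef_pV2 ?posrE // ler_nat ltnS.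
have [i hi] := choice (fun n => ex (q n) (q0 n)).
have C0 : 0 <= C.
  have := dist _ _ _ (q0 0%N) (hi 0%N) (hi 0%N); rewrite subrr nrm0 /q invr1.
  by rewrite pmulr_lge0.
have ar (e : R) : 0 < e -> exists N, q N < e.
  move=> e0; exists (Num.truncn e^-1); rewrite /q -[ltRHS]invrK ltf_pV2 ?posrE ?invr_gt0 //.
  exact: truncnS_gt.
have [|T hT] := @complete_seq _ _ (fun n => rho (i n)).
  move=> e e0; have [N qN] := ar (e / (C + 1)) (divr_gt0 e0 (ltr_wpDl C0 ltr01)).
  exists N => m n Nm Nn; have hm : near (q N) (i m) by apply: mono (hi m); exact: qm.
  have hn : near (q N) (i n) by apply: mono (hi n); exact: qm.
  apply: le_lt_trans (dist _ _ _ (q0 N) hm hn) _.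
  move: qN; rewrite ltr_pdivlMr ?ltr_wpDl // mulrDr mulr1 mulrC; apply: le_lt_trans.
  by rewrite lerDl ltW.
exists T => r j r0 nj; rewrite -subr_le0; apply: (@le_eps0 _ _ 1) => e e0; rewrite mul1r.
have [N hN] := hT e e0; have [N' qN'] := ar r r0.
have hn : near r (i (maxn N N')).
  apply: mono (hi _); apply: le_trans (ltW qN'); apply: qm; exact: leq_maxr.
rewrite lerBlDr; apply: le_trans (nrm_tri (rho (i (maxn N N'))) _ _) _; apply: lerD.
  by rewrite nrmBC ltW // hN // leq_maxl.
exact: dist.
Qed.

Section Bounds.
Context {R : realType} {d : Order.disp_t} {B : cbDistrLatticeType d} {L : choiceType}.
Variable S : gbds B L.
Local Notation G := (RD_groupoid (sigmaE_dom S) (sigmaE S)).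
Local Notation T3 := (seq L * B * seq L)%type.
Local Notation zs := (@zs _ _ _ S).
Local Notation ind := (@ind R _ _ _ S).
Local Notation valid := (valid S).
Local Notation Alg := (@Alg R _ _ _ S).
Local Notation Unif := (@Unif R _ _ _ S).
Implicit Types (g h k : G) (t : T3) (K : seq T3) (f e u v : G -> R[i]).

Lemma Unif_ind t f : valid t -> Unif f -> Unif (fun g => ind t g * f g).
Proof.
move=> vt [K [vK sf hf]]; exists K; split=> //; first exact: suppM.
move=> r /hf[u [hu su fu]]; exists (fun g => ind t g * u g); split.
- by apply: Alg_M => //; exact: Alg_ind.
- exact: suppM.
- move=> g; rewrite -mulrBr normrM; apply: le_trans (fu g).
  have [z|z] := pselect (zs t g); first by rewrite ind1 // normr1 mul1r.
  by rewrite ind0 // normr0 mul0r.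
Qed.

Lemma sqrt_fun_dist (x y q M : R[i]) : `|x - y| <= q -> `|x| <= M -> `|y| <= M ->
  `|sqrt_fun x - sqrt_fun y| ^+ 2 <= q * (M + M).
Proof.
move=> xy xM yM; rewrite /sqrt_fun -rmorphB normcR opprB addrC subrKA.
set a := complex.Re x; set b := complex.Re y.
have h : `|Num.sqrt (1 - b ^+ 2) - Num.sqrt (1 - a ^+ 2)| ^+ 2 <= `|a - b| * (`|a| + `|b|).
  apply: (@le_trans _ _ (Num.sqrt `|(1 - b ^+ 2) - (1 - a ^+ 2)| ^+ 2)).
    by rewrite ler_sqr ?nnegrE ?sqrtr_ge0 // sqrt_dist.
  rewrite sqr_sqrtr // (_ : _ - _ = (a - b) * (a + b)); last by ring.
  by rewrite normrM ler_wpM2l // ler_normD.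
have h' : `|a - b| * (`|a| + `|b|) <= complex.Re q * (complex.Re M + complex.Re M).
  have q0 : 0 <= q by apply: le_trans xy.
  have M0 : 0 <= M by apply: le_trans xM.
  have le (z : R[i]) m : `|z| <= m -> `|complex.Re z| <= complex.Re m.
    move=> zm; have m0 : 0 <= m by apply: le_trans zm.
    by rewrite -lecR -(complex_ge0 m0); apply: le_trans zm; exact: normc_ge_Re.
  apply: ler_pM; rewrite ?addr_ge0 //.
    by have := le _ _ xy; rewrite raddfB.
  by apply: lerD; exact: le.
have q0 : 0 <= q by apply: le_trans xy.
have M0 : 0 <= M by apply: le_trans xM.
rewrite (complex_ge0 q0) (complex_ge0 M0) -rmorphXn -rmorphD -rmorphM lecR.
exact: le_trans h h'.
Qed.

Lemma Unif_sqrt f : Unif f -> Unif (@sqrt_fun R \o f).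
Proof.
move=> uf; have [M M0 fM] := Unif_bounded uf; move: uf => [K [vK sf hf]].
have sc u : supp_on K u -> supp_on K (@sqrt_fun R \o u).
  move=> su g /=; have [->|/su//] := eqVneq (u g) 0; by rewrite sqrt_fun0 eqxx.
exists K; split=> //; first exact: sc.
(* [sqrt_fun] loses a square root in accuracy, so [f] is approximated to the order of [r^2]. *)
move=> r r0; have r2 : 0 < r ^+ 2 by rewrite exprn_gt0.
have C0 : 0 <= (1 + M) + (1 + M) by rewrite !addr_ge0.
have [q0 q1 qC] := small_factor r2 C0; set q := _ / _ in q0 q1 qC.
have [u [hu su fu]] := hf q q0; exists (@sqrt_fun R \o u); split.
- by apply: Alg_comp => //; exact: sqrt_fun0.
- exact: sc.
move=> g; rewrite -(@ler_pXn2r _ 2) ?nnegrE ?(ltW r0) //.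
apply: le_trans (sqrt_fun_dist (fu g) (M := 1 + M) _ _) _.
- by apply: le_trans (fM g) _; rewrite lerDr.
- rewrite -(subrK (f g) (u g)); apply: le_trans (ler_normD _ _) (lerD _ (fM g)).
  by rewrite distrC; exact: le_trans (fu g) q1.
- by rewrite mulrC.
Qed.

Section Alg.
Variables (A : cstarAlg R) (pi : (G -> R[i]) -> A).
Hypothesis piD : forall f e, Alg f -> Alg e -> pi (fun g => f g + e g) = pi f + pi e.
Hypothesis piZ : forall a f, Alg f -> pi (fun g => a * f g) = a *: pi f.
Hypothesis pi_conv : forall f e, Alg f -> Alg e -> pi (convolution f e) = pi f ** pi e.
Hypothesis pi_inv : forall f, Alg f -> pi (involution f) = cstar (pi f).

Lemma Alg_rep_bound K f (r : R) : valids S K -> Alg f -> supp_on K f -> 0 <= r ->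
  (forall g, `|f g| <= r%:C%C) -> nrm (pi f) <= (size K)%:R * r.
Proof.
move=> vK hf sf r0 fr; rewrite -lecR -nrmE mulr_natl rmorphMn /=.
apply: (rep_bound (F := Alg)) vK hf sf _ fr => //.
- exact: AlgD.
- exact: AlgZ.
- exact: Alg_conv.
- exact: Alg_inv.
- by move=> t u vt hu; apply: Alg_M => //; exact: Alg_ind.
- by move=> u hu; apply: Alg_comp => //; exact: sqrt_fun0.
- by rewrite lecR.
Qed.

End Alg.

Lemma Cc_rep_bound (A : cstarAlg R) (pi : (G -> R[i]) -> A) K f (r : R) : Cc_rep pi ->
  valids S K -> Unif f -> supp_on K f -> 0 <= r ->
  (forall g, `|f g| <= r%:C%C) -> nrm (pi f) <= (size K)%:R * r.
Proof.
move=> [pD pZ pM pV] vK hf sf r0 fr; rewrite -lecR -nrmE mulr_natl rmorphMn /=.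
apply: (rep_bound (F := Unif)) vK hf sf _ fr => //.
- exact: UnifD.
- exact: UnifZ.
- exact: Unif_conv.
- exact: Unif_inv.
- exact: Unif_ind.
- exact: Unif_sqrt.
- by move=> u v /CcP hu /CcP hv; exact: pD.
- by move=> a u /CcP hu; exact: pZ.
- by move=> u v /CcP hu /CcP hv; exact: pM.
- by move=> u /CcP hu; exact: pV.
- by rewrite lecR.
Qed.

Lemma groupoid_cstar_RD : exists D : cstarAlg R, is_groupoid_cstar G D.
Proof.
apply: groupoid_cstar_exists.
- by apply/CcP; exact: Unif0.
- by move=> f e /CcP hf /CcP he; apply/CcP; exact: UnifD.
- by move=> a f /CcP hf; apply/CcP; exact: UnifZ.
- by move=> f e /CcP hf /CcP he; apply/CcP; exact: Unif_conv.
- by move=> f /CcP hf; apply/CcP; exact: Unif_inv.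
move=> f /CcP uf; have [M M0 fM] := Unif_bounded uf; have [K [vK sf _]] := uf.
have Mr := complex_ge0 M0.
exists ((size K)%:R * complex.Re M) => D pi hpi; apply: Cc_rep_bound => //.
  by rewrite -lecR -Mr.
by move=> g; rewrite -Mr.
Qed.

End Bounds.

(** * The universal property *)

Section Extension.
Context {R : realType} {d : Order.disp_t} {B : cbDistrLatticeType d} {L : choiceType}.
Variable S : gbds B L.
Local Notation G := (RD_groupoid (sigmaE_dom S) (sigmaE S)).
Local Notation T3 := (seq L * B * seq L)%type.
Local Notation ind := (@ind R _ _ _ S).
Local Notation valid := (valid S).
Local Notation valids := (valids S).
Local Notation Alg := (@Alg R _ _ _ S).
Local Notation lin := (@lin R _ _ _ S).
Local Notation Unif := (@Unif R _ _ _ S).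
Implicit Types (g h k : G) (t : T3) (K : seq T3) (f e u v : G -> R[i]).

(** [r <= 1] bounds [x'] by [nrm x + c], which keeps the error linear in [r]. *)
Lemma nrm_mul_dist (A : cstarAlg R) (x y x' y' : A) (c r : R) :
  nrm (x - x') <= c * r -> nrm (y - y') <= c * r -> 0 <= c -> 0 < r -> r <= 1 ->
  nrm (x ** y - x' ** y') <= (c * (nrm x + nrm y + c)) * r.
Proof.
move=> hx hy c0 r0 r1.
have -> : x ** y - x' ** y' = (x - x') ** y + x' ** (y - y').
  by rewrite cmulBl cmulBr addrA subrK.
apply: le_trans (nrmD _ _) _.
have h1 : nrm ((x - x') ** y) <= c * r * nrm y.
  by apply: le_trans (nrmM _ _) _; rewrite ler_wpM2r ?nrm_ge0.
have nx : nrm x' <= nrm x + c.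
  rewrite -[x'](subrK x) addrC; apply: le_trans (nrmD _ _) _; rewrite lerD2l nrmBC.
  by apply: le_trans hx _; rewrite ler_piMr.
have h2 : nrm (x' ** (y - y')) <= (nrm x + c) * (c * r).
  by apply: le_trans (nrmM _ _) _; apply: ler_pM; rewrite ?nrm_ge0.
apply: le_trans (lerD h1 h2) _; rewrite le_eqVlt; apply/orP; left; apply/eqP; ring.
Qed.

Variables (A : cstarAlg R) (p : B -> A) (s : L -> B -> A).
Hypothesis rep : gbds_rep S p s.
Local Notation tr t := (tr S p s t.1.1 t.1.2 t.2).

Definition pi0 f : A :=
  if pselect (Alg f) is left h then \sum_(x <- s2val (cid2 h)) x.1 *: tr x.2 else 0.

(** The value does not depend on the chosen decomposition: the difference of two decompositions is a
    vanishing combination of indicators, to which [ind_indep] applies. *)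
Lemma pi0_lin l : (forall x, x \in l -> valid x.2) -> pi0 (lin l) = \sum_(x <- l) x.1 *: tr x.2.
Proof.
move=> vl; rewrite /pi0; case: pselect => [h|]; last by case; exists l.
case: cid2 => l' vl' e /=; apply/eqP; rewrite -subr_eq0; apply/eqP.
have := @ind_indep R _ _ _ S A p s rep (l' ++ [seq (- x.1, x.2) | x <- l]).
rewrite big_cat big_map /=; under [X in _ + X]eq_bigr do rewrite scaleNr.
rewrite sumrN; apply.
  by move=> x; rewrite mem_cat => /orP[/vl'//|/mapP[y /vl v ->]].
move=> g; rewrite big_cat big_map /=; under [X in _ + X]eq_bigr do rewrite mulNr.
by rewrite sumrN; have := congr1 (fun f => f g) e; rewrite /lin => ->; rewrite subrr.
Qed.

Lemma pi0D u v : Alg u -> Alg v -> pi0 (fun g => u g + v g) = pi0 u + pi0 v.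
Proof.
move=> [l vl ->] [l' vl' ->]; rewrite !pi0_lin // -big_cat -pi0_lin /=.
  by congr pi0; apply/funext => g; rewrite /lin big_cat.
by move=> x; rewrite mem_cat => /orP[/vl|/vl'].
Qed.

Lemma pi0Z a u : Alg u -> pi0 (fun g => a * u g) = a *: pi0 u.
Proof.
move=> [l vl ->]; have vl' x : x \in [seq (a * x.1, x.2) | x <- l] -> valid x.2.
  by move=> /mapP[y /vl v ->].
transitivity (pi0 (lin [seq (a * x.1, x.2) | x <- l])).
  congr pi0; apply/funext => g; rewrite /lin big_map mulr_sumr.
  by apply: eq_bigr => x _; rewrite mulrA.
rewrite !pi0_lin // big_map scaler_sumr; apply: eq_bigr => x _.
by rewrite scalerA.
Qed.

Lemma pi0_ind t : valid t -> pi0 (ind t) = tr t.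
Proof.
move=> v; rewrite (_ : ind t = lin [:: (1, t)]).
  by rewrite pi0_lin ?big_seq1 ?scale1r // => x; rewrite inE => /eqP ->.
by apply/funext => g; rewrite /lin big_seq1 mul1r.
Qed.

Lemma pi0_0 : pi0 (fun=> 0) = 0.
Proof.
rewrite (_ : (fun=> 0) = lin [::]) ?pi0_lin ?big_nil //.
by apply/funext => g; rewrite /lin big_nil.
Qed.

Lemma pi0_cons a t u : valid t -> Alg u -> pi0 (fun g => a * ind t g + u g) = a *: tr t + pi0 u.
Proof.
move=> v hu; rewrite (pi0D (u := fun g => a * ind t g)) //; last exact/AlgZ/Alg_ind.
by rewrite pi0Z ?pi0_ind //; exact: Alg_ind.
Qed.

Lemma pi0_conv u v : Alg u -> Alg v -> pi0 (convolution u v) = pi0 u ** pi0 v.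
Proof.
move=> hu hv; move: u hu; apply: (@Alg_rect R _ _ _ S) => [|a t u vt hu IH].
  by rewrite conv0l pi0_0 cmul0l.
rewrite conv_cons // pi0_cons // (pi0D (u := fun g => a * convolution (ind t) v g)); last 2 first.
- by apply: AlgZ; apply: Alg_conv => //; exact: Alg_ind.
- exact: Alg_conv.
rewrite IH cmulDl cmulZl pi0Z; last by apply: Alg_conv => //; exact: Alg_ind.
congr (_ *: _ + _); move: v hv {IH}; apply: (@Alg_rect R _ _ _ S) => [|b t' v vt' hv IH].
  by rewrite conv0r pi0_0 cmul0r.
have vtt : valid (tmul S t t') by exact: tmul_valid.
rewrite conv_cons_ind // !pi0_cons //; last by apply: Alg_conv => //; exact: Alg_ind.
by rewrite IH cmulDr cmulZr (tmul_tr rep).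
Qed.

Lemma pi0_inv u : Alg u -> pi0 (involution u) = cstar (pi0 u).
Proof.
move: u; apply: (@Alg_rect R _ _ _ S) => [|a t u vt hu IH].
  rewrite (_ : involution _ = fun=> 0) ?pi0_0 ?cstar0 //.
  by apply/funext => g; rewrite /involution rmorph0.
have vt' : valid (tinv t) by case: vt.
rewrite inv_cons !pi0_cons //; last exact: Alg_inv.
by rewrite IH cstarD cstarZ (trS S).
Qed.

Lemma pi0_dist K f u v (r r' : R) : valids K -> Alg u -> Alg v -> supp_on K u -> supp_on K v ->
  (forall g, `|f g - u g| <= r%:C%C) -> (forall g, `|f g - v g| <= r'%:C%C) -> 0 <= r -> 0 <= r' ->
  nrm (pi0 u - pi0 v) <= (size K)%:R * (r + r').
Proof.
move=> vK hu hv su sv fu fv r0 r0'.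
have -> : pi0 u - pi0 v = pi0 (fun g => u g + -1 * v g).
  by rewrite pi0D //; [rewrite pi0Z // scaleN1r|exact: AlgZ].
apply: (Alg_rep_bound pi0D pi0Z pi0_conv pi0_inv) => //.
- by apply: AlgD => //; exact: AlgZ.
- by apply: suppD => //; exact: suppM.
- exact: addr_ge0.
- move=> g; rewrite mulN1r -(subrK (f g) (u g)) -addrA rmorphD.
  by apply: le_trans (ler_normD _ _) (lerD _ (fv g)); rewrite distrC; exact: fu.
Qed.

Let near K f (r : R) u := [/\ Alg u, supp_on K u & forall g, `|f g - u g| <= r%:C%C].

Let Ext f T := exists K, [/\ valids K, supp_on K f &
  forall r u, 0 < r -> near K f r u -> nrm (T - pi0 u) <= (size K)%:R * 2 * r].

Let near_exists K f r : valids K -> supp_on K f -> Unif f -> 0 < r -> exists u, near K f r u.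
Proof.
move=> vK sf uf r0; apply: compact_approx => //; first exact: Unif_continuous.
by rewrite ltcR.
Qed.

Let Ext_exists f : Unif f -> exists T, Ext f T.
Proof.
move=> uf; have [K [vK sf _]] := uf.
have [|||T hT] := @limit_exists R A _ (near K f) pi0 ((size K)%:R * 2).
- by move=> r; exact: near_exists.
- by move=> r r' u rr [hu su fu]; split=> // g; apply: le_trans (fu g) _; rewrite lecR.
- move=> r u v r0 [hu su fu] [hv sv fv]; rewrite -mulrA [2 * r]mulr_natl mulr2n.
  by apply: (pi0_dist vK hu hv su sv fu fv); exact: ltW.
by exists T, K.
Qed.

Definition ext f : A := if pselect (exists T, Ext f T) is left h then projT1 (cid h) else 0.

Let extP f : Unif f -> Ext f (ext f).
Proof. by move=> /Ext_exists h; rewrite /ext; case: pselect => // h'; case: cid. Qed.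

Let ext_approx f : Unif f -> exists K (C : R), [/\ valids K, 0 <= C &
  forall r, 0 < r -> exists2 u, near K f r u & nrm (ext f - pi0 u) <= C * r].
Proof.
move=> uf; have [K [vK sf h]] := extP uf; exists K, ((size K)%:R * 2); split=> //.
by move=> r r0; have [u hu] := near_exists vK sf uf r0; exists u => //; exact: h.
Qed.

(** Recognises the extension from approximants over any list of bisections, by comparing over the
    concatenated lists; each algebraic identity of [ext] reduces to an error constant. *)
Let ext_unique f T K (C : R) : Unif f -> valids K -> 0 <= C ->
  (forall r, 0 < r -> r <= 1 -> exists2 u, near K f (C * r) u & nrm (T - pi0 u) <= C * r) ->
  ext f = T.
Proof.
move=> uf vK C0 h; have [K0 [C' [vK0 C0' h0]]] := ext_approx uf.
apply: subr0_eq; apply: (@nrm_small _ _ _ (C' + (size (K0 ++ K))%:R * (1 + C) + C)) => r r0 r1.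
have [u [hu su fu] Tu] := h r r0 r1; have [v [hv sv fv] ev] := h0 r r0.
have dist : nrm (pi0 v - pi0 u) <= (size (K0 ++ K))%:R * (r + C * r).
  apply: (pi0_dist _ hv hu _ _ fv fu); first exact: valids_cat.
  - by apply: supp_sub sv => t; rewrite mem_cat => ->.
  - by apply: supp_sub su => t; rewrite mem_cat orbC => ->.
  - exact: ltW.
  - by rewrite mulr_ge0 // ltW.
apply: le_trans (nrm_tri (pi0 v) _ _) _; rewrite !mulrDl -addrA; apply: lerD => //.
apply: le_trans (nrm_tri (pi0 u) _ _) _; apply: lerD; last by rewrite nrmBC.
by rewrite -mulrA mulrDl mul1r.
Qed.

Lemma ext_Alg u : Alg u -> ext u = pi0 u.
Proof.
move=> hu; have [K vK sK] := Alg_supp hu.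
apply: (@ext_unique _ _ K 0) => //; first exact: Alg_Unif.
by move=> r r0 r1; exists u; [split=> // g|]; rewrite mul0r subrr ?normr0 ?nrm0.
Qed.

Let nearW K f r r' u : near K f r u -> r <= r' -> near K f r' u.
Proof. by move=> [hu su fu] rr; split=> // g; apply: le_trans (fu g) _; rewrite lecR. Qed.

Lemma extD f e : Unif f -> Unif e -> ext (fun g => f g + e g) = ext f + ext e.
Proof.
move=> uf ue; have [K [C [vK C0 hf]]] := ext_approx uf.
have [K' [C' [vK' C0' he]]] := ext_approx ue.
apply: (@ext_unique _ _ (K ++ K') (2 + (C + C'))).
- exact: UnifD.
- exact: valids_cat.
- by rewrite !addr_ge0.
move=> r r0 r1; have [u [hu su fu] du] := hf r r0; have [v [hv sv ev] dv] := he r r0.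
exists (fun g => u g + v g).
  apply: (@nearW _ _ (r + r)).
    split; first exact: AlgD.
      apply: suppD; first by apply: supp_sub su => t; rewrite mem_cat => ->.
      by apply: supp_sub sv => t; rewrite mem_cat orbC => ->.
    move=> g; rewrite opprD addrACA rmorphD.
    exact: le_trans (ler_normD _ _) (lerD (fu g) (ev g)).
  by rewrite mulrDl mulr_natl mulr2n lerDl mulr_ge0 ?addr_ge0 // ltW.
rewrite pi0D // opprD addrACA; apply: le_trans (nrmD _ _) _.
rewrite mulrDl [X in _ <= _ + X]mulrDl; apply: le_trans (lerD du dv) _.
by rewrite lerDr mulr_ge0 // ltW.
Qed.

Lemma extZ a f : Unif f -> ext (fun g => a * f g) = a *: ext f.
Proof.
move=> uf; have [K [C [vK C0 hf]]] := ext_approx uf.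
set c := complex.Re `|a|; have c0 : 0 <= c by exact: Re_norm_ge0.
apply: (@ext_unique _ _ K (c * (1 + C))) => //.
- exact: UnifZ.
- by rewrite mulr_ge0 // addr_ge0.
move=> r r0 r1; have [u [hu su fu] du] := hf r r0; exists (fun g => a * u g).
  apply: (@nearW _ _ (c * r)).
    split; [exact: AlgZ|exact: suppM|].
    move=> g; rewrite -mulrBr normrM rmorphM /= -(complex_ge0 (normr_ge0 a)).
    by rewrite ler_wpM2l.
  by rewrite -mulrA ler_wpM2l // mulrDl mul1r lerDl mulr_ge0 // ltW.
rewrite pi0Z // -scalerBr nrmZ -/c -mulrA ler_wpM2l //; apply: le_trans du _.
by rewrite ler_wpM2r ?lerDr // ltW.
Qed.

Lemma ext_inv f : Unif f -> ext (involution f) = cstar (ext f).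
Proof.
move=> uf; have [K [C [vK C0 hf]]] := ext_approx uf.
apply: (@ext_unique _ _ [seq tinv t | t <- K] (1 + C)).
- exact: Unif_inv.
- by move=> _ /mapP[t /vK[v1 v2] ->].
- by rewrite addr_ge0.
move=> r r0 r1; have [u [hu su fu] du] := hf r r0; exists (involution u).
  apply: (@nearW _ _ r); last by rewrite mulrDl mul1r lerDl mulr_ge0 // ltW.
  split; [exact: Alg_inv|exact: inv_supp|].
  by move=> g; rewrite /involution -rmorphB norm_conjC.
rewrite pi0_inv // -cstarB nrm_cstar; apply: le_trans du _.
by rewrite ler_wpM2r ?lerDr // ltW.
Qed.

Lemma ext_conv f e : Unif f -> Unif e -> ext (convolution f e) = ext f ** ext e.
Proof.
move=> uf ue; have [K [C [vK C0 hf]]] := ext_approx uf.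
have [K' [C' [vK' C0' he]]] := ext_approx ue.
have [M M0 fM] := Unif_bounded uf; have [N N0 eN] := Unif_bounded ue.
have [K1 [vK1 sf1 _]] := uf.
pose m := complex.Re M; pose n := complex.Re N.
have Mm : M = m%:C%C by exact: complex_ge0. have Nn : N = n%:C%C by exact: complex_ge0.
have m0 : 0 <= m by rewrite -lecR -Mm.
have n0 : 0 <= n by rewrite -lecR -Nn.
pose c1 := (n + (1 + m)) *+ size (K ++ K1); pose c2 := (C + C') * (nrm (ext f) + nrm (ext e) + (C + C')).
have c10 : 0 <= c1 by rewrite mulrn_wge0 // !addr_ge0.
have c20 : 0 <= c2 by rewrite mulr_ge0 ?addr_ge0 ?nrm_ge0.
apply: (@ext_unique _ _ (supp_mul S K K') (c1 + c2)).
- exact: Unif_conv.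
- exact: supp_mul_valid.
- exact: addr_ge0.
move=> r r0 r1; have [u [hu su fu] du] := hf r r0; have [v [hv sv ev] dv] := he r r0.
exists (convolution u v).
  apply: (@nearW _ _ (c1 * r)); last by rewrite mulrDl lerDl mulr_ge0 // ltW.
  split; [exact: Alg_conv|exact: conv_supp|].
  have su' : supp_on (K ++ K1) u by apply: supp_sub su => t; rewrite mem_cat => ->.
  have sf' : supp_on (K ++ K1) f by apply: supp_sub sf1 => t; rewrite mem_cat orbC => ->.
  have uM h : `|u h| <= 1 + M.
    rewrite -(subrK (f h) (u h)); apply: le_trans (ler_normD _ _) (lerD _ (fM h)).
    by rewrite distrC; apply: le_trans (fu h) _; rewrite -[1]/(1%:C)%C lecR.
  move=> g; apply: le_trans (conv_approx sf' su' uM eN fu ev g) _.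
  by rewrite /c1 Mm Nn -[1]/(1%:C)%C -!rmorphD -rmorphMn -rmorphM.
rewrite pi0_conv // mulrDl; apply: (@le_trans _ _ (c2 * r)); last first.
  by rewrite lerDr mulr_ge0 // ltW.
apply: nrm_mul_dist => //; last exact: addr_ge0.
  by apply: le_trans du _; rewrite ler_wpM2r ?lerDl // ltW.
by apply: le_trans dv _; rewrite ler_wpM2r ?lerDr // ltW.
Qed.

Lemma ext_Cc_rep : Cc_rep (ext : (G -> R[i]) -> A).
Proof.
split.
- by move=> f e /CcP hf /CcP he; exact: extD.
- by move=> a f /CcP hf; exact: extZ.
- by move=> f e /CcP hf /CcP he; exact: ext_conv.
- by move=> f /CcP hf; exact: ext_inv.
Qed.

End Extension.

(** * Homomorphisms out of a dense image *)

Section Dominated.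
Context {R : realType} {G : topGroupoid}.
Implicit Types (f e : G -> R[i]) (A D : cstarAlg R).
Hypothesis CcD : forall f g, Cc f -> Cc g -> Cc (fun x : G => f x + g x : R[i]).
Hypothesis CcZ : forall (a : R[i]) f, Cc f -> Cc (fun x => a * f x).
Hypothesis CcM : forall f g, Cc f -> Cc g -> Cc (convolution f g).
Hypothesis CcV : forall f, Cc f -> Cc (involution f).

(** Domination makes the assignment of [pi f] to [iota f] well defined and contractive on a dense
    set, so it extends by completeness. *)
Lemma dominated_hom A D (iota : (G -> R[i]) -> D) (pi : (G -> R[i]) -> A) :
  Cc_rep iota -> Cc_rep pi -> closure (iota @` @Cc R G) = setT ->
  (forall f, Cc f -> `|pi f| <= `|iota f|) ->
  exists psi : D -> A, star_hom psi /\ forall f, Cc f -> psi (iota f) = pi f.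
Proof.
move=> [iD iZ iM iV] [pD pZ pM pV] dense dom.
have dist f e : Cc f -> Cc e -> nrm (pi f - pi e) <= nrm (iota f - iota e).
  move=> hf he; have := dom _ (CcD hf (CcZ (-1) he)).
  by rewrite pD ?iD ?pZ ?iZ ?scaleN1r ?nrmE ?lecR //; exact: CcZ.
pose near x (r : R) f := Cc f /\ nrm (x - iota f) <= r.
have ex x r : 0 < r -> exists f, near x r f.
  move=> r0; have /closureP/(_ r r0)[_ [f hf <-] h] : closure (iota @` @Cc R G) x by rewrite dense.
  by exists f; split=> //; exact: ltW.
have key x : exists T, forall r f, 0 < r -> near x r f -> nrm (T - pi f) <= 2 * r.
  apply: limit_exists => //.
  - by move=> r r0; exact: ex.
  - by move=> r r' f rr [hf h]; split=> //; exact: le_trans h rr.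
  - move=> r f e r0 [hf h] [he h']; apply: le_trans (dist _ _ hf he) _.
    apply: le_trans (nrm_tri x _ _) _; rewrite mulr_natl mulr2n; apply: lerD => //.
    by rewrite nrmBC.
have [psi hpsi] := choice key.
(* Each identity below supplies approximants with errors linear in [r]; [C] collects its
   constants. *)
have uniq x T (C : R) : (forall r, 0 < r -> r <= 1 -> exists2 f, near x (C * r) f & nrm (T - pi f) <= C * r) ->
    psi x = T.
  move=> h; have C0 : 0 <= C.
    have [f _] := h 1 ltr01 (lexx _); rewrite mulr1; apply: le_trans; exact: nrm_ge0.
  apply: subr0_eq; apply: (@nrm_small _ _ _ (2 * (C + 1) + C)) => r r0 r1.
  have [f [hf xf] Tf] := h r r0 r1.
  have q0 : 0 < (C + 1) * r by rewrite mulr_gt0 // ltr_wpDl.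
  have nf : near x ((C + 1) * r) f.
    by split=> //; apply: le_trans xf _; rewrite ler_wpM2r ?lerDl // ltW.
  have := hpsi x _ f q0 nf; rewrite mulrA => h1.
  apply: le_trans (nrm_tri (pi f) _ _) _; rewrite [leRHS]mulrDl; apply: lerD => //.
  by rewrite nrmBC.
have approx x r : 0 < r -> exists2 f, near x r f & nrm (psi x - pi f) <= 2 * r.
  by move=> r0; have [f nf] := ex x r r0; exists f => //; exact: hpsi.
exists psi; split; last first.
  move=> f hf; apply: (@uniq _ _ 0) => r r0 r1.
  by exists f; [split=> //|]; rewrite subrr nrm0 mul0r.
split.
- move=> x y; apply: (@uniq _ _ 4) => r r0 r1.
  have [f [hf xf] pf] := approx x r r0; have [e [he ye] pe] := approx y r r0.
  exists (fun g => f g + e g); first split.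
  + exact: CcD.
  + rewrite iD // opprD addrACA; apply: le_trans (nrmD _ _) _.
    apply: le_trans (lerD xf ye) _; lra.
  + rewrite pD // opprD addrACA; apply: le_trans (nrmD _ _) _.
    apply: le_trans (lerD pf pe) _; lra.
- move=> a x; set c := complex.Re `|a|; have c0 : 0 <= c by exact: Re_norm_ge0.
  apply: (@uniq _ _ (c * 2)) => r r0 r1; have [f [hf xf] pf] := approx x r r0.
  exists (fun g => a * f g); first split.
  + exact: CcZ.
  + rewrite iZ // -scalerBr nrmZ -/c -mulrA ler_wpM2l //; lra.
  + by rewrite pZ // -scalerBr nrmZ -/c -mulrA ler_wpM2l.
- move=> x y; pose c := (2 * (nrm x + nrm y + 2)) + (2 * (nrm (psi x) + nrm (psi y) + 2)).
  have p1 : 0 <= 2 * (nrm x + nrm y + 2) by rewrite mulr_ge0 ?addr_ge0 ?nrm_ge0.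
  have p2 : 0 <= 2 * (nrm (psi x) + nrm (psi y) + 2) by rewrite mulr_ge0 ?addr_ge0 ?nrm_ge0.
  apply: (@uniq _ _ c) => r r0 r1.
  have [f [hf xf] pf] := approx x r r0; have [e [he ye] pe] := approx y r r0.
  exists (convolution f e); first split.
  + exact: CcM.
  + rewrite iM //; apply: (@le_trans _ _ (2 * (nrm x + nrm y + 2) * r)).
      apply: nrm_mul_dist => //; lra.
    by rewrite /c [leRHS]mulrDl lerDl mulr_ge0 // ltW.
  + rewrite pM //; apply: (@le_trans _ _ (2 * (nrm (psi x) + nrm (psi y) + 2) * r)).
      by apply: nrm_mul_dist.
    by rewrite /c [leRHS]mulrDl lerDr mulr_ge0 // ltW.
- move=> x; apply: (@uniq _ _ 2) => r r0 r1; have [f [hf xf] pf] := approx x r r0.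
  exists (involution f); first split.
  + exact: CcV.
  + rewrite iV // -cstarB nrm_cstar; lra.
  + by rewrite pV // -cstarB nrm_cstar.
Qed.

End Dominated.

(** * The groupoid algebra satisfies the relations *)

Section Universal.
Context {R : realType} {d : Order.disp_t} {B : cbDistrLatticeType d} {L : choiceType}.
Variable S : gbds B L.
Local Notation G := (RD_groupoid (sigmaE_dom S) (sigmaE S)).
Local Notation T3 := (seq L * B * seq L)%type.
Local Notation ind := (@ind R _ _ _ S).
Local Notation zs := (@zs _ _ _ S).
Local Notation valid := (valid S).
Local Notation Alg := (@Alg R _ _ _ S).
Local Notation Unif := (@Unif R _ _ _ S).
Local Notation widl := (Defs.widl S).
Local Notation wact := (Defs.wact S).
Implicit Types (g h k : G) (t : T3) (K : seq T3) (f e u v : G -> R[i]) (C E : B).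

Lemma cyl_join C C' (x : bpath S) : cyl [::] (C `|` C')%O x -> cyl [::] C x \/ cyl [::] C' x.
Proof.
move=> /rcyl_cut - /(_ C)[h|h]; [left|right]; apply: (cyl_le h) => //; first exact: leIr.
by rewrite leBLR.
Qed.

(** A boundary path cannot stop at a vertex that contains a regular element, by [bpath_singular]. *)
Lemma cyl_letter C (x : bpath S) : regular_elt S C -> cyl [::] C x ->
  exists2 a, act S a C != \bot%O & cyl [:: a] (act S a C) x.
Proof.
move=> rC cx; have e0 : bpath_edge x 0 <> None.
  by move=> /bpath_singular h; apply: (h C (cyl_lev cx)).
have [[|a [|//]] // pu _] := @cyl_pre_exists _ _ _ S x 1 e0.
have [|A' cA] := @prex_cyl _ _ _ S [:: a] x _ pu; first by [].
have [/(_ cx)[c _] _] := @cyl_cat _ _ _ S [::] [:: a] A' C x cA.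
have c' : cyl [:: a] (act S a C) x by apply: (cyl_le c) (leIr _ _); exact: widl1_act.
by exists a => //; exact: cyl_neq0 c'.
Qed.

Section GroupoidAlgebra.
Variables (D : cstarAlg R) (iota : (G -> R[i]) -> D).
Hypothesis iota_rep : Cc_rep iota.
Let ii t := iota (ind t).

Let AlgCc f : Alg f -> Cc (f : G -> R[i]).
Proof. by move=> /Alg_Unif/CcP. Qed.

Let iotaD f e : Alg f -> Alg e -> iota (fun g => f g + e g) = iota f + iota e.
Proof. by move=> /AlgCc hf /AlgCc he; have [h _ _ _] := iota_rep; exact: h. Qed.

Let iotaZ a f : Alg f -> iota (fun g => a * f g) = a *: iota f.
Proof. by move=> /AlgCc hf; have [_ h _ _] := iota_rep; exact: h. Qed.

Let iota0 : iota (fun=> 0) = 0.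
Proof.
have := iotaZ 0 (Alg0 (R := R) S); rewrite scale0r => <-; congr iota.
by apply/funext => g; rewrite mul0r.
Qed.

Let iiM t t' : valid t -> valid t' -> ii t ** ii t' = ii (tmul S t t').
Proof.
move=> v v'; have [_ _ h _] := iota_rep.
by rewrite /ii -h ?conv_ind //; apply: AlgCc; exact: Alg_ind.
Qed.

Let iiV t : valid t -> cstar (ii t) = ii (tinv t).
Proof.
move=> v; have [_ _ _ h] := iota_rep.
by rewrite /ii -h ?inv_ind //; apply: AlgCc; exact: Alg_ind.
Qed.

Let iota_sum (I : eqType) (r : seq I) (F : I -> T3) : (forall i, i \in r -> valid (F i)) ->
  Alg (fun g => \sum_(i <- r) ind (F i) g) /\
  iota (fun g => \sum_(i <- r) ind (F i) g) = \sum_(i <- r) ii (F i).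
Proof.
elim: r => [|i r IH] vF.
  rewrite big_nil (_ : (fun g => _) = fun=> 0); first by split=> //; exact: Alg0.
  by apply/funext => g; rewrite big_nil.
have [|hA e] := IH; first by move=> j jr; apply: vF; rewrite inE jr orbT.
have hi : Alg (ind (F i)) by apply: Alg_ind; apply: vF; exact: mem_head.
rewrite big_cons -e -iotaD // (_ : (fun g => _) = fun g => ind (F i) g + \sum_(j <- r) ind (F j) g).
  by split=> //; exact: AlgD.
by apply/funext => g; rewrite big_cons.
Qed.

Definition gen_p C : D := ii ([::], C, [::]).
Definition gen_s (a : L) C : D := ii ([:: a], C, [::]).

Let v1 a C : idl S a C -> valid ([:: a], C, [::]). Proof. by move=> /widl1. Qed.
Let v1' a C : idl S a C -> valid ([::], C, [:: a]). Proof. by move=> /widl1. Qed.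

Let gen_p0 : gen_p \bot%O = 0.
Proof.
rewrite /gen_p /ii (_ : ind _ = fun=> 0) //; apply/funext => g; apply: ind0.
by move=> [_ /cyl_neq0]; rewrite eqxx.
Qed.

Let gen_pI C C' : gen_p (C `&` C')%O = gen_p C ** gen_p C'.
Proof. by rewrite iiM //= meetC. Qed.

Let gen_pU C C' : gen_p (C `|` C')%O = gen_p C + gen_p C' - gen_p (C `&` C')%O.
Proof.
rewrite /gen_p /ii -scaleN1r -iotaD -?iotaZ; try exact: Alg_ind.
rewrite -iotaD; [|by apply: AlgD; exact: Alg_ind|by apply: AlgZ; exact: Alg_ind].
congr iota; apply/funext => g; rewrite mulN1r.
have zE A' : zs ([::], A', [::]) g <-> is_unit g /\ cyl [::] A' (src g).
  split=> [[dg c1 c2 e]|[[dg e] c]].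
    by split=> //; split=> //; rewrite dg.
  by split; [rewrite dg|rewrite /= e|exact: c|exact: e].
have zI : zs ([::], C `&` C', [::])%O g <-> zs ([::], C, [::]) g /\ zs ([::], C', [::]) g.
  have cI := @cylI _ _ _ S [::] [::] C' C (src g) I I.
  rewrite !zE; split=> [[ug /cI[c' c]]|[[ug c] [_ c']]] //.
  by split=> //; apply/cI.
have zU : zs ([::], C `|` C', [::])%O g <-> zs ([::], C, [::]) g \/ zs ([::], C', [::]) g.
  rewrite !zE; split=> [[ug /cyl_join[]]|[[ug c]|[ug c]]].
  - by left.
  - by right.
  - by split=> //; apply: (cyl_le c) => //; exact: leUl.
  - by split=> //; apply: (cyl_le c) => //; exact: leUr.
have [z|z] := pselect (zs ([::], C, [::]) g); have [z'|z'] := pselect (zs ([::], C', [::]) g).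
- by rewrite (ind1 z) (ind1 z') (ind1 (zI.2 (conj z z'))) (ind1 (zU.2 (or_introl z))) addrK.
- have nI : ~ zs ([::], C `&` C', [::])%O g by move=> /zI[].
  by rewrite (ind1 z) (ind0 z') (ind0 nI) (ind1 (zU.2 (or_introl z))) subr0 addr0.
- have nI : ~ zs ([::], C `&` C', [::])%O g by move=> /zI[].
  by rewrite (ind0 z) (ind1 z') (ind0 nI) (ind1 (zU.2 (or_intror z'))) subr0 add0r.
- have nI : ~ zs ([::], C `&` C', [::])%O g by move=> /zI[].
  have nU : ~ zs ([::], C `|` C', [::])%O g by move=> /zU[].
  by rewrite (ind0 z) (ind0 z') (ind0 nI) (ind0 nU) subr0 addr0.
Qed.

(** By [cyl_letter], the paths through a regular [C] split according to their first letter, so the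
    indicator of its units is a finite sum. *)
Let gen_regular C : regular_elt S C -> gen_p C =
  \sum_(a \in Delta S C) gen_s a (act S a C) ** cstar (gen_s a (act S a C)).
Proof.
move=> rC; have Ia a : idl S a (act S a C) by exact: (act_idl (lexx _)).
have sE a : gen_s a (act S a C) ** cstar (gen_s a (act S a C)) = ii ([:: a], act S a C, [:: a]).
  rewrite /gen_s iiV; last exact: v1.
  by rewrite iiM /= ?meetxx //; [exact: v1|exact: v1'].
under eq_fsbigr do rewrite sE.
have [C0|C0] := eqVneq C \bot%O.
  rewrite C0 gen_p0 fsbig1 // => a; by rewrite /Delta /= act0 eqxx.
have [_ fin] := rC C C0 (lexx _).
rewrite fsbig_finite //.
have [|_ <-] := @iota_sum _ (fset_set (Delta S C)) (fun a => ([:: a], act S a C, [:: a])).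
  by move=> a _; split; exact/widl1.
congr iota; apply/funext => g.
have zE a : zs ([:: a], act S a C, [:: a]) g <->
    zs ([::], C, [::]) g /\ cyl [:: a] (act S a C) (src g).
  by apply: (@zset_ext _ _ _ S [::] C [::] [:: a]) => //; exact: lexx.
have [[a za]|no] := pselect (exists a, zs ([:: a], act S a C, [:: a]) g).
  have [z0 ca] := (zE a).1 za.
  have aD : a \in fset_set (Delta S C) by rewrite in_fset_set // mem_set //; exact: cyl_neq0 ca.
  rewrite (bigD1_seq a) ?fset_uniq //= big1 ?addr0; last first.
    move=> b ba; apply: ind0 => /zE[_ cb]; case/eqP: ba.
    by have [[w []]|[w []]] := cyl_comparable ca cb.
  by rewrite !ind1.
rewrite big1 => [|a _]; last by apply: ind0 => za; apply: no; exists a.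
apply: ind0 => z; have [|a _ ca] := cyl_letter rC (x := src g); first by case: z.
by apply: no; exists a; apply/zE.
Qed.

Lemma gen_rep : gbds_rep S gen_p gen_s.
Proof.
split.
- split=> [C|a C IC]; first by split; rewrite -?gen_pI ?meetxx // /gen_p iiV.
  have va : valid ([:: a], C, [:: a]) by split; exact/widl1.
  rewrite /is_partial_isometry /gen_s (iiV (v1 IC)) (iiM (v1 IC) (v1' IC)) /= meetxx.
  by rewrite (iiM va (v1 IC)) /= eqxx meetxx.
- by split; [exact: gen_p0|exact: gen_pI|exact: gen_pU].
- move=> C a C' IC'; rewrite /gen_p /gen_s !iiM //; try exact: v1.
  by rewrite /= meetC.
- move=> a a' C C' IC IC'; rewrite /gen_s iiV ?iiM; try exact: v1; try exact: v1'.
  rewrite /tmul /= [a' == a]eq_sym; case: (a == a') => /=.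
    by rewrite ?drop0 /= meetC.
  exact: gen_p0.
- exact: gen_regular.
Qed.

Lemma sw_gen al C : widl al C -> sw S gen_p gen_s al C = ii (al, C, [::]).
Proof.
elim: al => [//|a al IH] wC; have [E0 IE CE] := wC.
have wC' := widl_suffix (u := [:: a]) wC.
rewrite (sw_cons gen_rep wC IE CE) IH // /gen_s iiM //=; last exact: v1.
by rewrite prefix0s drop0 (meet_idPl CE).
Qed.

Lemma tr_gen t : valid t -> tr S gen_p gen_s t.1.1 t.1.2 t.2 = ii t.
Proof.
case: t => [[al C] be] [/= w1 w2]; rewrite /tr !sw_gen // iiV; last by split.
by rewrite iiM /= ?drop0 ?cats0 ?meetxx //; split.
Qed.

Lemma subalg_Alg (N : set D) : is_cstar_subalg N -> range gen_p `|`
    [set x | exists a, exists2 C, idl S a C & x = gen_s a C] `<=` N ->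
  forall f, Alg f -> N (iota f).
Proof.
move=> [_ N0 ND NZ [NM NV]] sub; apply: (@Alg_rect R _ _ _ S); first by rewrite iota0.
have Nsw al C : widl al C -> N (sw S gen_p gen_s al C).
  elim: al => [_|a al IH wC]; first by apply: sub; left; exists C.
  have [E0 IE CE] := wC; rewrite (sw_cons gen_rep wC IE CE); apply: NM.
    by apply: sub; right; exists a, E0.
  exact: IH (widl_suffix (u := [:: a]) wC).
move=> a t f vt hf Nf; rewrite (iotaD (f := fun g => a * ind t g)) //; last exact/AlgZ/Alg_ind.
apply: ND => //; rewrite iotaZ; last exact: Alg_ind.
apply: NZ; rewrite -/(ii t) -tr_gen //; case: vt => w1 w2.
by apply: NM; [exact: Nsw|apply: NV; exact: Nsw].
Qed.

(** [iota] is not assumed continuous; the estimate comes from [Cc_rep_bound], with the bisections of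
    [f] fixed. *)
Lemma Alg_dense f (r : R) : Unif f -> 0 < r -> exists2 u, Alg u & nrm (iota f - iota u) < r.
Proof.
move=> uf r0; have [K [vK sf _]] := uf; pose q : R := r / ((size K)%:R + 1).
have n0 : 0 < (size K)%:R + 1 :> R by rewrite ltr_wpDl.
have q0 : 0 < q by rewrite divr_gt0.
have [|u [hu su fu]] := compact_approx (r := q%:C%C) vK sf (Unif_continuous uf).
  by rewrite ltcR.
exists u => //; have Uu := Alg_Unif hu; have Ud := UnifD uf (UnifZ (-1) Uu).
have -> : iota f - iota u = iota (fun g => f g + -1 * u g).
  have [hD hZ _ _] := iota_rep.
  by rewrite hD ?hZ ?scaleN1r //; apply/CcP => //; exact: UnifZ.
apply: (@le_lt_trans _ _ ((size K)%:R * q)).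
  apply: (Cc_rep_bound iota_rep vK Ud); first by apply: suppD => //; exact: suppM.
    exact: ltW.
  by move=> g; rewrite mulN1r.
rewrite -[ltRHS](divfK (lt0r_neq0 n0)) -/q mulrC ltr_pM2l //.
by rewrite ltrDl.
Qed.

End GroupoidAlgebra.

(** A representation of the relations extends to [Cc] by [ext]; as [iota] dominates every
    representation, it factors through [D]. Generation follows because words in the generators give
    all indicators. *)
Lemma groupoid_gbds_cstar (D : cstarAlg R) : is_groupoid_cstar G D -> is_gbds_cstar S D.
Proof.
move=> [iota [hi dense dom]]; exists (gen_p iota), (gen_s iota); split.
- exact: gen_rep.
- move=> N hN sub; have [clN _ _ _ _] := hN; apply/seteqP; split=> // x _.
  suff cN : iota @` @Cc R G `<=` N.
    rewrite (closure_id N).1 //; apply: (closure_subset cN); by rewrite dense.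
  move=> _ [f /CcP uf <-]; rewrite (closure_id N).1 //; apply/closureP => r r0.
  have [u hu fu] := Alg_dense hi uf r0; exists (iota u) => //.
  exact: (subalg_Alg hi hN sub).
move=> A q t rep; have he := ext_Cc_rep rep.
have [||||psi [hpsi psiE]] := dominated_hom _ _ _ _ hi he dense (dom _ _ he).
- by move=> f e /CcP hf /CcP he'; apply/CcP; exact: UnifD.
- by move=> a f /CcP hf; apply/CcP; exact: UnifZ.
- by move=> f e /CcP hf /CcP he'; apply/CcP; exact: Unif_conv.
- by move=> f /CcP hf; apply/CcP; exact: Unif_inv.
have psii t0 : valid t0 -> psi (iota (ind t0)) = tr S q t t0.1.1 t0.1.2 t0.2.
  move=> v; have hA := Alg_ind (R := R) v; rewrite psiE; last exact/CcP/Alg_Unif.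
  by rewrite (ext_Alg rep) // (pi0_ind rep).
exists psi; split=> // [C|a C IC].
  by rewrite psii // /tr /= (rep_pS rep) (rep_pI rep) meetxx.
rewrite psii; last by split=> //; exact/widl1.
by rewrite /tr (sw1 rep) //= (rep_pS rep) (rep_sp rep) // meetxx.
Qed.

End Universal.

Theorem corollary7p11 (R : realType) (d : Order.disp_t)
    (B : cbDistrLatticeType d) (L : choiceType) (S : gbds B L) :
  [/\ local_homeomorphism (sigmaE_dom S) (sigmaE S),
      groupoid_iso (RD_groupoid (sigmaE_dom S) (sigmaE S))
        (Gamma_groupoid S),
      (exists A : cstarAlg R, is_gbds_cstar S A),
      (exists D : cstarAlg R, is_groupoid_cstar
         (RD_groupoid (sigmaE_dom S) (sigmaE S)) D)
    & forall A D : cstarAlg R, is_gbds_cstar S A ->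
        is_groupoid_cstar (RD_groupoid (sigmaE_dom S) (sigmaE S)) D ->
        cstar_iso D A].
Proof.
(* The groupoid algebra witnesses both existence claims, and uniqueness for the relations gives the
   isomorphism. *)
have [D hD] := @groupoid_cstar_RD R _ _ _ S; split.
- exact: sigmaE_local_homeo.
- exact: RD_Gamma_iso.
- by exists D; exact: groupoid_gbds_cstar.
- by exists D.
- by move=> A D' hA hD'; apply: gbds_cstar_unique hA (groupoid_gbds_cstar hD').
Qed.
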